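(* Let $D_B\supseteq D_A=D$, $\dim\ker A=n<\infty$, let $\lambda A+B$ be a regular pencil of index $\nu$, and let $f\in C(\mathbb R_+\times D,Y)$ have the structure $$f(t,x)=(Q_1+Q_{20})f(t,x)+\sum_{s=1}^{\nu-2}Q_{2\Sigma,s}f\Big(t,\sum_{j=1}^{\nu-1}x_{2j}^{(j+1)}+\sum_{j=s}^{\nu-2}x_{2\wedge,j}\Big)+\sum_{s=1}^{\nu-1}Q_{2s}^{(s+1)}f\Big(t,\sum_{j=s}^{\nu-1}x_{2j}^{(j+1)}\Big).$$ Assume that there exist open sets $\widetilde M_1\subseteq Y_1$, $M_{20}\subseteq D_{20}$, $M_{2j}^{(j+1)}\subseteq D_{2j}^{(j+1)}$ and $M_{2\wedge,j}\subseteq D_{2\wedge,j}$ ($j=1,\dots,\nu-2$), $M_{2(\nu-1)}=M_{2(\nu-1)}^{(\nu)}\subseteq D_{2(\nu-1)}$ such that, for $s=1,\dots,\nu-2$, $$Q_{2s}^{(s+1)}f\in C^{\nu-2}\Big(\mathbb R_+\times\big(\dot{+}_{i=s}^{\nu-1}M_{2i}^{(i+1)}\big),Y_{2s}^{(s+1)}\Big),\quad Q_{2\Sigma,s}f\in C^s\Big(\mathbb R_+\times\big(\dot{+}_{i=1}^{\nu-1}M_{2i}^{(i+1)}\,\dot{+}\,\dot{+}_{i=s}^{\nu-2}M_{2\wedge,i}\big),Y_{2\Sigma,s}\Big),$$ and $Q_{2(\nu-1)}f\in C^{\nu-1}(\mathbb R_+\times M_{2(\nu-1)},Y_{2(\nu-1)})$,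 and such that, with $M_1=\widetilde A^{-1}\widetilde M_1\subseteq D_1$, $M_{2\Sigma}=\dot{+}_{i=1}^{\nu-1}M_{2i}^{(i+1)}\,\dot{+}\,\dot{+}_{i=1}^{\nu-2}M_{2\wedge,i}$ and $M=M_1\dot{+}M_{20}\dot{+}M_{2\Sigma}$, the following conditions hold. 1.a. For each $t\in\mathbb R_+$ there exists a unique $x_{2(\nu-1)}\in M_{2(\nu-1)}$ such that $F_{2(\nu-1)}(t,x_{2(\nu-1)})=0$. 1.b. For each $s=1,\dots,\nu-2$: for each $t\in\mathbb R_+$, $x_{2j}^{(j+1)}\in M_{2j}^{(j+1)}$, $j=s+1,\dots,\nu-1$, there exists a unique $x_{2s}^{(s+1)}\in M_{2s}^{(s+1)}$ such that $F_{2s}^{(s+1)}=0$ at $(t,x_{2j}^{(j+1)},j=s,\dots,\nu-1)$. 1.c. For each $t\in\mathbb R_+$, $x_{2j}^{(j+1)}\in M_{2j}^{(j+1)}$, $j=1,\dots,\nu-1$, $d_{2(\nu-1)}\in D_{2(\nu-1)}$ there exists a unique $x_{2\wedge,\nu-2}\in M_{2\wedge,\nu-2}$ such that $F_{2\Sigma,\nu-2}=0$ at these values. 1.d. For each $s=1,\dots,\nu-3$: for each $t\in\mathbb R_+$, $x_{2j}^{(j+1)}\in M_{2j}^{(j+1)}$, $j=1,\dots,\nu-1$, $x_{2\wedge,i}\in M_{2\wedge,i}$, $i=s+1,\dots,\nu-2$, $d_{2\wedge,s+1}\in D_{2\wedge,s+1}$, $d_{2(s+1)}^{(s+2)}\in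 D_{2(s+1)}^{(s+2)}$ there exists a unique $x_{2\wedge,s}\in M_{2\wedge,s}$ such that $F_{2\Sigma,s}=0$ at these values. 1.e. For each $t\in\mathbb R_+$, $x_1\in M_1$, $x_{2\Sigma}\in M_{2\Sigma}$, $d_{2\wedge,1}\in D_{2\wedge,1}$, $d_{21}^{(2)}\in D_{21}^{(2)}$ there exists a unique $x_{20}\in M_{20}$ such that $F_{20}=0$ at these values. 2.a. For any fixed $\hat t\in\mathbb R_+$, $\hat x_{2(\nu-1)}\in M_{2(\nu-1)}$ satisfying $F_{2(\nu-1)}=0$, the operator $[\partial_x(Q_{2(\nu-1)}f)(\hat t,\hat x_{2(\nu-1)})-Q_{2(\nu-1)}B]P_{2(\nu-1)}|_{D_{2(\nu-1)}}:D_{2(\nu-1)}\to Y_{2(\nu-1)}$ has an inverse in $\mathrm L(Y_{2(\nu-1)},D_{2(\nu-1)})$. 2.b. For each $s=1,\dots,\nu-2$: for any fixed $\hat t\in\mathbb R_+$, $\hat x_{2i}^{(i+1)}\in M_{2i}^{(i+1)}$, $i=s,\dots,\nu-1$, satisfying $F_{2s}^{(s+1)}=0$, the operator $[\partial_x(Q_{2s}^{(s+1)}f)(\hat t,\sum_{i=s}^{\nu-1}\hat x_{2i}^{(i+1)})-Q_{2s}^{(s+1)}B]P_{2s}^{(s+1)}|_{D_{2s}^{(s+1)}}:D_{2s}^{(s+1)}\to Y_{2s}^{(s+1)}$ has an inverse in $\mathrm L(Y_{2s}^{(s+1)},D_{2s}^{(s+1)})$. 2.c. For any fixed $\hat t\in\mathbb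 R_+$, $\hat x_{2j}^{(j+1)}\in M_{2j}^{(j+1)}$, $j=1,\dots,\nu-1$, $\hat x_{2\wedge,\nu-2}\in M_{2\wedge,\nu-2}$, $\hat d_{2(\nu-1)}\in D_{2(\nu-1)}$ satisfying $F_{2\Sigma,\nu-2}=0$, the operator $[\partial_x(Q_{2\Sigma,\nu-2}f)(\hat t,\sum_{j=1}^{\nu-1}\hat x_{2j}^{(j+1)}+\hat x_{2\wedge,\nu-2})-Q_{2\Sigma,\nu-2}B]P_{2\wedge,\nu-2}|_{D_{2\wedge,\nu-2}}:D_{2\wedge,\nu-2}\to Y_{2\Sigma,\nu-2}$ has an inverse in $\mathrm L(Y_{2\Sigma,\nu-2},D_{2\wedge,\nu-2})$. 2.d. For each $s=1,\dots,\nu-3$: for any fixed $\hat t\in\mathbb R_+$, $\hat x_{2j}^{(j+1)}\in M_{2j}^{(j+1)}$, $j=1,\dots,\nu-1$, $\hat x_{2\wedge,i}\in M_{2\wedge,i}$, $i=s,\dots,\nu-2$, $\hat d_{2\wedge,s+1}\in D_{2\wedge,s+1}$, $\hat d_{2(s+1)}^{(s+2)}\in D_{2(s+1)}^{(s+2)}$ satisfying $F_{2\Sigma,s}=0$, the operator $[\partial_x(Q_{2\Sigma,s}f)(\hat t,\sum_{j=1}^{\nu-1}\hat x_{2j}^{(j+1)}+\sum_{i=s}^{\nu-2}\hat x_{2\wedge,i})-Q_{2\Sigma,s}B]P_{2\wedge,s}|_{D_{2\wedge,s}}:D_{2\wedge,s}\to Y_{2\Sigma,s}$ has an inverse in $\mathrm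 L(Y_{2\Sigma,s},D_{2\wedge,s})$. 2.e. The components $Q_1f(t,x_1+x_{20}+x_{2\Sigma})$ and $Q_{20}f(t,x_1+x_{20}+x_{2\Sigma})$ satisfy locally a Lipschitz condition with respect to $x_1+x_{20}$ on $\mathbb R_+\times M$. For any fixed $\hat t\in\mathbb R_+$, $\hat x_1\in M_1$, $\hat x_{20}\in M_{20}$, $\hat x_{2\Sigma}\in M_{2\Sigma}$ (put $\hat x=\hat x_1+\hat x_{20}+\hat x_{2\Sigma}\in M$), $\hat d_{21}^{(2)}\in D_{21}^{(2)}$, $\hat d_{2\wedge,1}\in D_{2\wedge,1}$ satisfying $F_{20}=0$ there exist open neighborhoods $U_\delta(\hat t,\hat x_1,\hat x_{2\Sigma},\hat d_{21}^{(2)},\hat d_{2\wedge,1})=U_{\delta_1}(\hat t)\times U_{\delta_2}(\hat x_1)\times U_{\delta_3}(\hat x_{2\Sigma})\times U_{\delta_4}(\hat d_{21}^{(2)})\times U_{\delta_5}(\hat d_{2\wedge,1})\subset\mathbb R_+\times D_1\times D_{2\Sigma}\times D_{21}^{(2)}\times D_{2\wedge,1}$ and $U_\varepsilon(\hat x_{20})\subset D_{20}$ and an operator $\mathrm Z=\mathrm Z_{\hat t,\hat x,\hat d_{21}^{(2)},\hat d_{2\wedge,1}}\in\mathrm L(D_{20},Y_{20})$ having an inverse $\mathrm Z^{-1}\in\mathrm L(Y_{20},D_{20})$ such that for each $(t,x_1,x_{2\Sigma},d_{21}^{(2)},d_{2\wedge,1})$ in the former neighborhood and each $x_{20}',x_{20}''\in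 U_\varepsilon(\hat x_{20})$ $$\big\|F_{20}(t,x_1,x_{20}',x_{2\Sigma},d_{21}^{(2)},d_{2\wedge,1})-F_{20}(t,x_1,x_{20}'',x_{2\Sigma},d_{21}^{(2)},d_{2\wedge,1})-\mathrm Z[x_{20}'-x_{20}'']\big\|\le k(\delta,\varepsilon)\|x_{20}'-x_{20}''\|,$$ where $k(\delta,\varepsilon)$ is such that $\lim_{\delta,\varepsilon\to0}k(\delta,\varepsilon)<\|\mathrm Z^{-1}\|^{-1}$ (the numbers $\delta,\varepsilon>0$ depend on the choice of $\hat t,\hat x,\hat d_{21}^{(2)},\hat d_{2\wedge,1}$). Then for each initial value $t_0\in\mathbb R_+$ and $x_{0,1}\in M_1$ there exists $t_{max}\le\infty$ such that the initial value problem $\frac{d}{dt}[Ax]+Bx=f(t,x)$, $P_1x(t_0)=x_{0,1}$, has a unique solution $x(t)$ in $M$ on the maximal interval of existence $[t_0,t_{max})$.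
   Context: Notation: $\mathbb R_+=[0,\infty)$; $\mathrm L(E,F)$ is the space of bounded linear operators; $\dot{+}$ is direct sum (for subsets of the summands, the set of sums). Setting: $X,Y$ are Banach spaces; $A:D_A\to Y$, $B:D_B\to Y$ are closed linear operators with domains dense in $X$; $\operatorname{range}(A)$ is closed; $D=D_A\cap D_B\neq\{0\}$. The abstract differential-algebraic equation (ADAE) is $\frac{d}{dt}[Ax]+Bx=f(t,x)$, $t>0$. A solution on an interval $J\subseteq\mathbb R_+$ is $x\in C(J,X)$ with $Ax\in C^1(J,Y)$ (if $J=\mathbb R_+$: $Ax\in C^1((0,\infty),Y)$), $x(t)\in D$, satisfying the equation for every $t\in J$. An interval $J$ is the maximal interval of existence of $x(t)$ (in a set $S$) if $x$ cannot be extended (to the right) to a strictly larger interval so that it remains a solution (with values in $S$). Regular pencil of index $\nu\in\mathbb N$: there is $R>0$ such that for every complex $\lambda$ with $|\lambda|>R$ the operator $\lambda A+B:D\to Y$ has an inverse in $\mathrm L(Y,X)$, and $(A+\mu B)^{-1}$ has a pole of order $\nu$ at $\mu=0$ (equivalently, $(\lambda A+B)^{-1}$ has at $\lambda=\infty$ a pole of order $\nu-1$, or a removable singularity if $\nu=1$). For real spaces this is understood via complexification. Projectors: let $\{\varphi_i^1\}_{i=1}^n$ be a basis of $\ker A\cap D$, and $\{\varphi_i^j\}_{i=1,\dots,n}^{j=1,\dots,m_i}\subset D$ a canonical system of root vectors of $A+\mu B$ at $\mu=0$: $A\varphi_i^1=0$, $A\varphi_i^j=-B\varphi_i^{j-1}$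 ($j=2,\dots,m_i$), $1\le m_i\le\nu$, $\max_i m_i=\nu$; let $q_i^j\in D_{A^*}\cap D_{B^*}$ satisfy $A^*q_i^{m_i}=0$, $A^*q_i^j=-B^*q_i^{j+1}$ ($j<m_i$), $\langle B\varphi_i^j,q_k^l\rangle=\delta_{ik}\delta_{jl}$. Such systems exist and are fixed. For $s=0,\dots,\nu-1$, $j=s+1,\dots,\nu$: $P_{2s}^{(j)}=\sum_{i:m_i=j}\langle\cdot,B^*q_i^{s+1}\rangle\varphi_i^{s+1}$, $Q_{2s}^{(j)}=\sum_{i:m_i=j}\langle\cdot,q_i^{s+1}\rangle B\varphi_i^{s+1}$, $P_{2s}=\sum_{j=s+1}^\nu P_{2s}^{(j)}$, $Q_{2s}=\sum_{j=s+1}^\nu Q_{2s}^{(j)}$; $P_2=\sum_{s=0}^{\nu-1}P_{2s}$, $Q_2=\sum_{s=0}^{\nu-1}Q_{2s}$, $P_1=I-P_2$, $Q_1=I-Q_2$, $P_{2\Sigma}=\sum_{s=1}^{\nu-1}P_{2s}$; $P_{2\wedge,s}=P_{2s}-P_{2s}^{(s+1)}$, $Q_{2\Sigma,s}=Q_{2s}-Q_{2s}^{(s+1)}$ ($s=0,\dots,\nu-2$). These are bounded projectors on $X$ (the $P$'s) and $Y$ (the $Q$'s). $D$ and $Y$ with an index denote the images of $D$ and $Y$ under the projector with the same index: $D_1=P_1D$, $D_{2s}=P_{2s}D$, $D_{2s}^{(j)}=P_{2s}^{(j)}D$, $D_{2\wedge,s}=P_{2\wedge,s}D$, $D_{2\Sigma}=P_{2\Sigma}D$,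 $Y_1=Q_1Y$, $Y_{2s}=Q_{2s}Y$, $Y_{2s}^{(j)}=Q_{2s}^{(j)}Y$, $Y_{2\Sigma,s}=Q_{2\Sigma,s}Y$; similarly $x_1=P_1x$, $x_{2s}=P_{2s}x$, $x_{2s}^{(j)}=P_{2s}^{(j)}x$, $x_{2\wedge,s}=P_{2\wedge,s}x$, $x_{2\Sigma}=P_{2\Sigma}x$. Thus $x=x_1+x_{20}+x_{2\Sigma}$, $x_{2\Sigma}=\sum_{j=1}^{\nu-1}x_{2j}^{(j+1)}+\sum_{j=1}^{\nu-2}x_{2\wedge,j}$, $x_{2(\nu-1)}=x_{2(\nu-1)}^{(\nu)}$, $Q_{2(\nu-1)}=Q_{2(\nu-1)}^{(\nu)}$. Norms on direct sums are sums of the norms of components. $\widetilde A=A+\sum_{i=1}^n\langle\cdot,B^*q_i^1\rangle B\varphi_i^{m_i}:D\to Y$ has an inverse $\widetilde A^{-1}\in\mathrm L(Y,X)$; it coincides with $A$ on $D_1$ and maps $D_1$ onto $Y_1$. Functions: $F_{2(\nu-1)}(t,x_{2(\nu-1)})=Q_{2(\nu-1)}f(t,x_{2(\nu-1)})-Bx_{2(\nu-1)}$ (used for $\nu\ge2$); $F_{2s}^{(s+1)}(t,x_{2j}^{(j+1)},j=s,\dots,\nu-1)=Q_{2s}^{(s+1)}f(t,\sum_{j=s}^{\nu-1}x_{2j}^{(j+1)})-Bx_{2s}^{(s+1)}$, $s=1,\dots,\nu-2$ ($\nu\ge3$); $F_{2\Sigma,\nu-2}(t,x_{2j}^{(j+1)},j=1,\dots,\nu-1,x_{2\wedge,\nu-2},d_{2(\nu-1)})=Q_{2\Sigma,\nu-2}f(t,\sum_{j=1}^{\nu-1}x_{2j}^{(j+1)}+x_{2\wedge,\nu-2})-Bx_{2\wedge,\nu-2}-Ad_{2(\nu-1)}$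 ($\nu\ge3$); $F_{2\Sigma,s}(t,x_{2j}^{(j+1)},j=1,\dots,\nu-1,x_{2\wedge,i},i=s,\dots,\nu-2,d_{2(s+1)}^{(s+2)},d_{2\wedge,s+1})=Q_{2\Sigma,s}f(t,\sum_{j=1}^{\nu-1}x_{2j}^{(j+1)}+\sum_{i=s}^{\nu-2}x_{2\wedge,i})-Bx_{2\wedge,s}-A[d_{2(s+1)}^{(s+2)}+d_{2\wedge,s+1}]$, $s=1,\dots,\nu-3$ ($\nu\ge4$); $F_{20}(t,x_1,x_{20},x_{2\Sigma},d_{21}^{(2)},d_{2\wedge,1})=Q_{20}f(t,x_1+x_{20}+x_{2\Sigma})-Bx_{20}-Q_{20}A[d_{21}^{(2)}+d_{2\wedge,1}]$. Sums, objects and conditions with index ranges that are empty for the given $\nu$ are absent: for $\nu=2$, $x_{2\wedge,1}=d_{2\wedge,1}=0$; for $\nu=1$, $x_{2\Sigma}=0$, $d_{21}^{(2)}=d_{2\wedge,1}=0$ and only $M_1$, $M_{20}$ and the conditions involving $F_{20}$ remain. Locally Lipschitz with respect to $x$ on $J\times M$: for each $(t',x')\in J\times M$ there are open neighborhoods of $t'$, $x'$ and $L\ge0$ with $\|g(t,x^1)-g(t,x^2)\|\le L\|x^1-x^2\|$ for $t$, $x^1,x^2$ in them; ''with respect to $x_1+x_{20}$'' means this for $x^1,x^2$ having the same component $x_{2\Sigma}$. Neighborhoods of an endpoint of a time interval are semi-open intervals. *)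

(* Defs.v *)
From HB Require Import structures.
From mathcomp Require Import all_boot all_order all_algebra.
From mathcomp Require Import complex.
From mathcomp Require Import all_classical all_reals all_analysis.

Set Implicit Arguments.
Unset Strict Implicit.
Unset Printing Implicit Defensive.

Import Order.TTheory GRing.Theory Num.Theory.
Import numFieldNormedType.Exports.

Local Open Scope classical_set_scope.
Local Open Scope ring_scope.
Local Open Scope complex_scope.

(* The Banach spaces are either both real or both complex, while time is always
   real. *)

Inductive scalars := RealScalars | ComplexScalars.

Definition scalar_field (R : realType) (k : scalars) : numFieldType :=
  match k with RealScalars => R | ComplexScalars => R[i] end.

Definition of_real (R : realType) (k : scalars) : R -> scalar_field R k :=
  match k with RealScalars => id | ComplexScalars => real_complex R end.

Definition to_real (R : realType) (k : scalars) : scalar_field R k -> R :=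
  match k with RealScalars => id | ComplexScalars => @complex.Re R end.
Arguments of_real {R} k.
Arguments to_real {R} k.

(* `|x| lives in the field of scalars; nrm x is the same number seen in R *)
Definition nrm (R : realType) (k : scalars)
  (V : normedZmodType (scalar_field R k)) (x : V) : R := to_real k `|x|.
Arguments nrm {R k V} x.

Section operators.
Context {R : realType} {k : scalars}.
Local Notation K := (scalar_field R k).
Implicit Types X Y : normedModType K.

Definition klinear_on X Y (E : set X) (T : X -> Y) :=
  forall (a : K) x y, E x -> E y -> T (a *: x + y) = a *: T x + T y.

Definition rlinear_on X Y (E : set X) (T : X -> Y) :=
  forall (a : R) x y, E x -> E y ->
    T (of_real k a *: x + y) = of_real k a *: T x + T y.

Definition bounded_on X Y (E : set X) (T : X -> Y) :=
  exists L : R, forall x, E x -> nrm (T x) <= L * nrm x.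

Definition opnorm X Y (E : set X) (T : X -> Y) : R :=
  inf [set L : R | 0 <= L /\ forall x, E x -> nrm (T x) <= L * nrm x].

(* T : E -> F is bijective and S : F -> E is its inverse, S being bounded; the
   linearity of S is inherited from that of T *)
Definition bounded_inverse X Y (E : set X) (F : set Y)
    (T : X -> Y) (S : Y -> X) :=
  [/\ forall x, E x -> F (T x), forall y, F y -> E (S y),
      forall x, E x -> S (T x) = x, forall y, F y -> T (S y) = y
    & bounded_on F S].

(* the values of app outside of dom are irrelevant *)
Record linop X Y := Linop {
  dom : set X;
  app :> X -> Y;
  dom0 : dom 0;
  dom_comb : forall (a : K) x y, dom x -> dom y -> dom (a *: x + y);
  app_linear : klinear_on dom app }.

Definition closed_op X Y (T : linop X Y) :=
  closed [set p : X * Y | dom T p.1 /\ p.2 = T p.1].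

Definition functional Y (q : Y -> K) :=
  (forall (a : K) x y, q (a *: x + y) = a * q x + q y) /\
  exists L : R, forall y, nrm (q y) <= L * nrm y.

Definition is_adjoint X Y (T : linop X Y) (q : Y -> K) (r : X -> K) :=
  [/\ functional q, functional r & forall x, dom T x -> q (T x) = r x].

Definition adj_dom X Y (T : linop X Y) (q : Y -> K) :=
  exists r, is_adjoint T q r.

(* T^* q; well defined for q in adj_dom T when dom T is dense *)
Definition adj X Y (T : linop X Y) (q : Y -> K) : X -> K :=
  xget (fun=> 0) [set r | is_adjoint T q r].

Definition rel_open (V : topologicalType) (E U : set V) :=
  exists2 O, open O & U = O `&` E.

Definition msum (V : zmodType) (E F : set V) : set V :=
  [set x + y | x in E & y in F].

Definition dsum (V : zmodType) (a b : nat) (M : nat -> set V) : set V :=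
  [set x | exists2 u : nat -> V,
     forall j, (a <= j < b)%N -> M j (u j) & x = \sum_(a <= j < b) u j].

End operators.

(* The pencil of complex operators lives in the complexification of X and Y
   when the scalars are real.  The norm |x| + |y| used on X + iX is equivalent
   to the usual complexification norms. *)

Record cspace (R : realType) := CSpace {
  ccar :> zmodType;
  cscale : R[i] -> ccar -> ccar;
  cnorm : ccar -> R }.

Section pencils.
Context {R : realType}.

Definition cplx (k : scalars) : normedModType (scalar_field R k) -> cspace R :=
  match k with
  | RealScalars => fun X : normedModType R =>
      CSpace (fun (z : R[i]) (p : X * X) =>
        (complex.Re z *: p.1 - complex.Im z *: p.2,
         complex.Im z *: p.1 + complex.Re z *: p.2))
      (fun p => `|p.1| + `|p.2|)
  | ComplexScalars => fun X : normedModType R[i] =>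
      CSpace (fun (z : R[i]) (x : X) => z *: x) (fun x => complex.Re `|x|)
  end.

Definition cplx_set (k : scalars) :
    forall X : normedModType (scalar_field R k), set X -> set (cplx X) :=
  match k with
  | RealScalars => fun X D => [set p : X * X | D p.1 /\ D p.2]
  | ComplexScalars => fun X D => D
  end.

Definition cplx_fun (k : scalars) :
    forall X Y : normedModType (scalar_field R k), (X -> Y) -> cplx X -> cplx Y :=
  match k with
  | RealScalars => fun X Y T (p : X * X) => (T p.1, T p.2)
  | ComplexScalars => fun X Y T => T
  end.

Implicit Types V W : cspace R.

Definition cbounded_linear V W (T : V -> W) :=
  (forall z x y, T (cscale z x + y) = cscale z (T x) + T y) /\
  exists L : R, forall x, cnorm (T x) <= L * cnorm x.

(* G in L(W, V) is the inverse of T : D -> W *)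
Definition cinverse V W (D : set V) (T : V -> W) (G : W -> V) :=
  [/\ cbounded_linear G, forall y, D (G y), forall y, T (G y) = y
    & forall x, D x -> G (T x) = x].

(* Laurent expansion mu^p G(mu) = sum_k mu^k H_k, 0 < |mu| < r, in operator
   norm, with H_0 <> 0 *)
Definition has_pole V W (G : R[i] -> W -> V) (p : nat) :=
  exists (H : nat -> W -> V) (r : R),
  [/\ 0 < r, forall j, cbounded_linear (H j), exists y, H 0%N y <> 0
    & forall mu : R[i], 0 < complex.Re `|mu| < r -> forall eta : R, 0 < eta ->
      exists N0 : nat, forall N : nat, (N0 <= N)%N -> forall y,
      cnorm (cscale (mu ^+ p) (G mu y) -
             \sum_(0 <= j < N) cscale (mu ^+ j) (H j y)) <= eta * cnorm y].

Definition cregular V W (D : set V) (A B : V -> W) (p : nat) :=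
  (exists2 r : R, 0 < r & forall la : R[i], r < complex.Re `|la| ->
     exists G, cinverse D (fun x => cscale la (A x) + B x) G) /\
  (exists (G : R[i] -> W -> V) (r : R), [/\ 0 < r,
     forall mu : R[i], 0 < complex.Re `|mu| < r ->
       cinverse D (fun x => A x + cscale mu (B x)) (G mu)
     & has_pole G p]).

Definition regular_pencil (k : scalars)
    (X Y : normedModType (scalar_field R k)) (D : set X) (A B : X -> Y) (p : nat) :=
  cregular (cplx_set D) (cplx_fun A) (cplx_fun B) p.

End pencils.

Section calculus.
Context {R : realType} {k : scalars}.
Local Notation K := (scalar_field R k).
Context {X Y : normedModType K}.

Definition has_tderiv (J : set R) (g : R -> Y) (t : R) (d : Y) :=
  (fun h : R => of_real k h^-1 *: (g (t + h) - g t))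
    @ within [set h | J (t + h)] 0^' --> d.

Definition C1_on (J : set R) (g : R -> Y) :=
  exists2 g' : R -> Y, forall t, J t -> has_tderiv J g t (g' t)
                     & {within J, continuous g'}.

Definition txnrm (p : R * X) : R := `|p.1| + nrm p.2.
Definition txscale (a : R) (p : R * X) : R * X := (a * p.1, of_real k a *: p.2).

(* g is of class C^m on R_+ x U, where U is relatively open in the subspace E.
   Dg p [:: v1; ..; vj] is the j-th Frechet derivative of g at p, a bounded
   (real) j-linear map on (R x E)^j.  It is the derivative in the operator norm
   of the (j-1)-st one, and the m-th derivative is continuous in that norm. *)
Definition class_C (m : nat) (U E : set X) (g : R -> X -> Y) :=
  let TU := [set p : R * X | 0 <= p.1 /\ U p.2] in
  let dirs := fun (j : nat) (vs : seq (R * X)) =>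
    size vs = j /\ forall v, v \in vs -> E v.2 in
  exists Dg : R * X -> seq (R * X) -> Y,
  [/\ forall p, TU p -> Dg p [::] = g p.1 p.2,
      forall p, TU p -> forall (j : nat), (j <= m)%N ->
        (forall us vs (a : R) v w, (size us + size vs).+1 = j ->
           (forall z, z \in us ++ v :: w :: vs -> E z.2) ->
           Dg p (us ++ (txscale a v + w) :: vs) =
           of_real k a *: Dg p (us ++ v :: vs) + Dg p (us ++ w :: vs)) /\
        (exists L : R, forall vs, dirs j vs ->
           nrm (Dg p vs) <= L * \prod_(v <- vs) txnrm v),
      forall p, TU p -> forall (j : nat), (j < m)%N ->
        forall eta : R, 0 < eta -> exists2 delta : R, 0 < delta &
        forall p', TU p' -> txnrm (p' - p) < delta -> forall vs, dirs j vs ->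
        nrm (Dg p' vs - Dg p vs - Dg p ((p' - p) :: vs)) <=
          eta * txnrm (p' - p) * \prod_(v <- vs) txnrm v
    & forall p, TU p ->
        forall eta : R, 0 < eta -> exists2 delta : R, 0 < delta &
        forall p', TU p' -> txnrm (p' - p) < delta -> forall vs, dirs m vs ->
        nrm (Dg p' vs - Dg p vs) <= eta * \prod_(v <- vs) txnrm v].

(* T is the partial Frechet derivative of g with respect to x at (t, x), x
   ranging over the relatively open subset U of the subspace E.  Since time is
   real, derivatives are real-linear also when the scalars are complex, which
   covers complex differentiability. *)
Definition has_dx (U E : set X) (g : R -> X -> Y) (t : R) (x : X)
    (T : X -> Y) :=
  [/\ rlinear_on E T, bounded_on E T &
      forall eta : R, 0 < eta -> exists2 delta : R, 0 < delta &
      forall x', U x' -> nrm (x' - x) < delta ->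
      nrm (g t x' - g t x - T (x' - x)) <= eta * nrm (x' - x)].

(* local Lipschitz condition on R_+ x M for pairs of points with the same
   component P x *)
Definition loc_lipschitz (M : set X) (P : X -> X) (g : R -> X -> Y) :=
  forall (t' : R) (x' : X), 0 <= t' -> M x' ->
  exists (I : set R) (V : set X) (L : R),
  [/\ open_nbhs t' I, open_nbhs x' V, 0 <= L
    & forall (t : R) x y, 0 <= t -> I t -> M x -> V x -> M y -> V y -> P x = P y ->
      nrm (g t x - g t y) <= L * nrm (x - y)].

End calculus.

(* phi i j and qf i j stand for phi_i^j and q_i^j, 1 <= j <= m_i = mult i; the
   other values are irrelevant. *)

Record root_data (R : realType) (k : scalars)
    (X Y : normedModType (scalar_field R k)) := RootData {
  opA : linop X Y;
  opB : linop X Y;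
  idx : nat;
  kdim : nat;
  mult : 'I_kdim -> nat;
  phi : 'I_kdim -> nat -> X;
  qf : 'I_kdim -> nat -> Y -> scalar_field R k }.

Section projectors.
Context {R : realType} {k : scalars} {X Y : normedModType (scalar_field R k)}.
Local Notation K := (scalar_field R k).
Variable S : root_data X Y.
Local Notation A := (opA S).
Local Notation B := (opB S).
Local Notation nu := (idx S).

Definition D : set X := dom A `&` dom B.

Definition root_basis :=
  [/\ forall i, D (phi i 1) /\ A (@phi _ _ _ _ S i 1) = 0,
      forall c : 'I_(kdim S) -> K, \sum_i c i *: phi i 1 = 0 ->
        forall i, c i = 0
    & forall x, D x -> A x = 0 ->
        exists c : 'I_(kdim S) -> K, x = \sum_i c i *: phi i 1].

(* the chains are automatically of maximal length: biorthogonality excludes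
   that B phi_i^{m_i} = - A x for some x *)
Definition root_vectors :=
  [/\ forall i : 'I_(kdim S), (1 <= mult i <= nu)%N,
      exists i : 'I_(kdim S), mult i = nu,
      forall (i : 'I_(kdim S)) j, (1 <= j <= mult i)%N -> D (phi i j)
    & forall (i : 'I_(kdim S)) j, (2 <= j <= mult i)%N ->
        A (phi i j) = - B (phi i j.-1)].

Definition dual_root_vectors :=
  [/\ forall (i : 'I_(kdim S)) j, (1 <= j <= mult i)%N ->
        adj_dom A (qf i j) /\ adj_dom B (qf i j),
      forall i : 'I_(kdim S), adj A (qf i (mult i)) = fun=> 0,
      forall (i : 'I_(kdim S)) j, (1 <= j < mult i)%N ->
        adj A (qf i j) = fun x => - adj B (qf i j.+1) x
    & forall (i i' : 'I_(kdim S)) j l,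
        (1 <= j <= mult i)%N -> (1 <= l <= mult i')%N ->
        qf i' l (B (phi i j)) = ((i == i') && (j == l))%:R].

Definition P2sj (s j : nat) (x : X) : X :=
  \sum_(i < kdim S | mult i == j) adj B (qf i s.+1) x *: phi i s.+1.
Definition Q2sj (s j : nat) (y : Y) : Y :=
  \sum_(i < kdim S | mult i == j) qf i s.+1 y *: B (phi i s.+1).

Definition P2s s x := \sum_(s.+1 <= j < nu.+1) P2sj s j x.
Definition Q2s s y := \sum_(s.+1 <= j < nu.+1) Q2sj s j y.
Definition P2 x := \sum_(0 <= s < nu) P2s s x.
Definition Q2 y := \sum_(0 <= s < nu) Q2s s y.
Definition P1 x := x - P2 x.
Definition Q1 y := y - Q2 y.
Definition P2Sig x := \sum_(1 <= s < nu) P2s s x.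
Definition P2w s x := P2s s x - P2sj s s.+1 x.
Definition Q2Sig s y := Q2s s y - Q2sj s s.+1 y.

Definition D1 := P1 @` D.
Definition D2s s := P2s s @` D.
Definition D2 s := P2sj s s.+1 @` D.
Definition Dw s := P2w s @` D.
Definition D2Sig := P2Sig @` D.
Definition Y1 := range Q1.
Definition Y2s s := range (Q2s s).
Definition Y2 s := range (Q2sj s s.+1).
Definition Y2Sig s := range (Q2Sig s).

Definition tildeA (x : X) : Y :=
  A x + \sum_(i < kdim S) adj B (qf i 1) x *: B (phi i (mult i)).

(* tildeA is a bijection of D onto Y: this is the image of MY under its
   inverse *)
Definition tildeA_inv_image (MY : set Y) : set X := D `&` tildeA @^-1` MY.

Variable f : R -> X -> Y.

Definition has_structure :=
  forall (t : R) x, 0 <= t -> D x ->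
  f t x = Q1 (f t x) + Q2s 0 (f t x)
   + \sum_(1 <= s < nu.-1)
       Q2Sig s (f t (\sum_(1 <= j < nu) P2sj j j.+1 x +
                     \sum_(s <= j < nu.-1) P2w j x))
   + \sum_(1 <= s < nu)
       Q2sj s s.+1 (f t (\sum_(s <= j < nu) P2sj j j.+1 x)).

(* Below u j stands for x_{2j}^{(j+1)} and w j for x_{2/\,j}. *)

Definition F2last (t : R) (x : X) : Y := Q2s nu.-1 (f t x) - B x.

Definition F2 s (t : R) (u : nat -> X) : Y :=
  Q2sj s s.+1 (f t (\sum_(s <= j < nu) u j)) - B (u s).

Definition F2Sig_last (t : R) (u : nat -> X) (x d : X) : Y :=
  Q2Sig (nu - 2) (f t (\sum_(1 <= j < nu) u j + x)) - B x - A d.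

Definition F2Sig s (t : R) (u w : nat -> X) (d dw : X) : Y :=
  Q2Sig s (f t (\sum_(1 <= j < nu) u j + \sum_(s <= j < nu.-1) w j))
  - B (w s) - A (d + dw).

Definition F20 (t : R) (x1 x20 x2S d dw : X) : Y :=
  Q2s 0 (f t (x1 + x20 + x2S)) - B x20 - Q2s 0 (A (d + dw)).

(* M2 j and Mw j are M_{2j}^{(j+1)} and M_{2/\,j}. *)
Variables (MY : set Y) (M20 : set X) (M2 Mw : nat -> set X).

Definition M1 := tildeA_inv_image MY.
Definition M2Sig := msum (dsum 1 nu M2) (dsum 1 nu.-1 Mw).
Definition M := msum (msum M1 M20) M2Sig.

Definition open_sets :=
  [/\ rel_open Y1 MY, rel_open (D2s 0) M20,
      forall j, (1 <= j < nu)%N -> rel_open (D2 j) (M2 j)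
    & forall j, (1 <= j < nu.-1)%N -> rel_open (Dw j) (Mw j)].

Definition smoothness :=
  [/\ forall s, (1 <= s <= nu - 2)%N ->
        class_C (nu - 2) (dsum s nu M2) (dsum s nu D2)
          (fun t x => Q2sj s s.+1 (f t x)),
      forall s, (1 <= s <= nu - 2)%N ->
        class_C s (msum (dsum 1 nu M2) (dsum s nu.-1 Mw))
          (msum (dsum 1 nu D2) (dsum s nu.-1 Dw))
          (fun t x => Q2Sig s (f t x))
    & (2 <= nu)%N ->
        class_C nu.-1 (M2 nu.-1) (D2 nu.-1) (fun t x => Q2s nu.-1 (f t x))].

Definition in_M2 a (u : nat -> X) := forall j, (a <= j < nu)%N -> M2 j (u j).
Definition in_Mw a (w : nat -> X) := forall j, (a <= j < nu.-1)%N -> Mw j (w j).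

Definition cond1a := (2 <= nu)%N ->
  forall (t : R), 0 <= t -> exists! x, M2 nu.-1 x /\ F2last t x = 0.

Definition cond1b := forall s, (1 <= s <= nu - 2)%N ->
  forall (t : R) u, 0 <= t -> in_M2 s.+1 u ->
  exists! x, M2 s x /\ F2 s t [eta u with s |-> x] = 0.

Definition cond1c := (3 <= nu)%N ->
  forall (t : R) u d, 0 <= t -> in_M2 1 u -> D2s nu.-1 d ->
  exists! x, Mw (nu - 2)%N x /\ F2Sig_last t u x d = 0.

Definition cond1d := forall s, (1 <= s <= nu - 3)%N ->
  forall (t : R) u w d dw, 0 <= t -> in_M2 1 u -> in_Mw s.+1 w ->
  D2 s.+1 d -> Dw s.+1 dw ->
  exists! x, Mw s x /\ F2Sig s t u [eta w with s |-> x] d dw = 0.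

(* P2sj 1 2 and P2w 1 vanish identically when nu = 1, and so does P2w 1 when
   nu = 2 *)
Definition cond1e :=
  forall (t : R) x1 x2S d dw, 0 <= t -> M1 x1 -> M2Sig x2S -> D2 1 d -> Dw 1 dw ->
  exists! x20, M20 x20 /\ F20 t x1 x20 x2S d dw = 0.

(* [d_x g (t, x) - Q B] P : E -> F has an inverse in L(F, E), where the
   derivative is taken on U, relatively open in V *)
Definition invertible_dx (U V : set X) (Q : Y -> Y) (P : X -> X)
    (E : set X) (F : set Y) (t : R) (x : X) :=
  exists T : X -> Y, has_dx U V (fun t x => Q (f t x)) t x T /\
  exists G, bounded_inverse E F (fun z => T (P z) - Q (B (P z))) G.

Definition cond2a := (2 <= nu)%N ->
  forall (t : R) x, 0 <= t -> M2 nu.-1 x -> F2last t x = 0 ->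
  invertible_dx (M2 nu.-1) (D2 nu.-1) (Q2s nu.-1) (P2s nu.-1)
    (D2s nu.-1) (Y2s nu.-1) t x.

Definition cond2b := forall s, (1 <= s <= nu - 2)%N ->
  forall (t : R) u, 0 <= t -> in_M2 s u -> F2 s t u = 0 ->
  invertible_dx (dsum s nu M2) (dsum s nu D2) (Q2sj s s.+1) (P2sj s s.+1)
    (D2 s) (Y2 s) t (\sum_(s <= j < nu) u j).

Definition cond2c := (3 <= nu)%N ->
  forall (t : R) u x d, 0 <= t -> in_M2 1 u -> Mw (nu - 2)%N x -> D2s nu.-1 d ->
  F2Sig_last t u x d = 0 ->
  invertible_dx (msum (dsum 1 nu M2) (Mw (nu - 2)%N))
    (msum (dsum 1 nu D2) (Dw (nu - 2)))
    (Q2Sig (nu - 2)) (P2w (nu - 2)) (Dw (nu - 2)) (Y2Sig (nu - 2))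
    t (\sum_(1 <= j < nu) u j + x).

Definition cond2d := forall s, (1 <= s <= nu - 3)%N ->
  forall (t : R) u w d dw, 0 <= t -> in_M2 1 u -> in_Mw s w ->
  D2 s.+1 d -> Dw s.+1 dw -> F2Sig s t u w d dw = 0 ->
  invertible_dx (msum (dsum 1 nu M2) (dsum s nu.-1 Mw))
    (msum (dsum 1 nu D2) (dsum s nu.-1 Dw))
    (Q2Sig s) (P2w s) (Dw s) (Y2Sig s)
    t (\sum_(1 <= j < nu) u j + \sum_(s <= j < nu.-1) w j).

Definition cond2e_lipschitz :=
  loc_lipschitz M P2Sig (fun t x => Q1 (f t x)) /\
  loc_lipschitz M P2Sig (fun t x => Q2s 0 (f t x)).

(* (t, x1, x2S, d, dw) is in the product of the open balls of radii
   delta 0, .., delta 4 around (t0, y1, y2S, e, ew) in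
   R_+ x D_1 x D_{2Sigma} x D_21^(2) x D_{2/\,1} *)
Definition in_Udelta (delta : 'I_5 -> R) (t0 : R) (y1 y2S e ew : X)
    (t : R) (x1 x2S d dw : X) :=
  [/\ 0 <= t /\ `|t - t0| < delta 0,
      D1 x1 /\ nrm (x1 - y1) < delta 1,
      D2Sig x2S /\ nrm (x2S - y2S) < delta 2,
      D2 1 d /\ nrm (d - e) < delta 3
    & Dw 1 dw /\ nrm (dw - ew) < delta 4].

(* l is the limit of kappa(delta, eps) as all the radii tend to 0+; the
   estimate holds with constant kappa(delta, eps) on the neighbourhoods of
   radii (delta, eps) as soon as these do not exceed (delta0, eps0) *)
Definition cond2e_F20 :=
  forall (t0 : R) y1 y20 y2S e ew, 0 <= t0 -> M1 y1 -> M20 y20 -> M2Sig y2S ->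
  D2 1 e -> Dw 1 ew -> F20 t0 y1 y20 y2S e ew = 0 ->
  exists (delta0 : 'I_5 -> R) (eps0 : R) (Z : X -> Y) (Zinv : Y -> X)
         (kappa : ('I_5 -> R) -> R -> R) (l : R),
  [/\ (forall i, 0 < delta0 i) /\ 0 < eps0,
      klinear_on (D2s 0) Z /\ bounded_on (D2s 0) Z,
      bounded_inverse (D2s 0) (Y2s 0) Z Zinv,
      forall (delta : 'I_5 -> R) (eps : R),
        (forall i, 0 < delta i <= delta0 i) -> 0 < eps <= eps0 ->
        forall t x1 x2S d dw, in_Udelta delta t0 y1 y2S e ew t x1 x2S d dw ->
        forall x x' : X, D2s 0 x -> nrm (x - y20) < eps ->
          D2s 0 x' -> nrm (x' - y20) < eps ->
        nrm (F20 t x1 x x2S d dw - F20 t x1 x' x2S d dw - Z (x - x'))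
          <= kappa delta eps * nrm (x - x')
    & (forall eta : R, 0 < eta -> exists2 rho : R, 0 < rho &
         forall (delta : 'I_5 -> R) (eps : R),
         (forall i, 0 < delta i < rho) -> 0 < eps < rho ->
         `|kappa delta eps - l| < eta) /\
      l < (opnorm (Y2s 0) Zinv)^-1].

(* Ax is required to be C^1, and the equation to hold, on J, except for J = R_+
   where 0 is excluded.  At an endpoint of J derivatives are one-sided. *)
Definition tdom (J : set R) : set R :=
  [set t | J t /\ (J = [set r | 0 <= r] -> 0 < t)].

Definition solution (J : set R) (x : R -> X) :=
  [/\ {within J, continuous x}, forall t, J t -> D (x t),
      C1_on (tdom J) (fun t => A (x t))
    & forall t, tdom J t ->
        has_tderiv (tdom J) (fun t => A (x t)) t (f t (x t) - B (x t))].

(* x is a solution with values in N on J that cannot be extended to the right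
   to a solution with values in N *)
Definition maximal_solution (N : set X) (J : set R) (x : R -> X) :=
  [/\ solution J x, forall t, J t -> N (x t)
    & ~ exists (J' : set R) (y : R -> X),
        [/\ is_interval J' /\ J' `<=` [set r | 0 <= r],
            J `<` J', forall t, J' t -> exists2 s, J s & s <= t,
            solution J' y /\ (forall t, J' t -> N (y t))
          & forall t, J t -> y t = x t]].

Definition ivp_solution (N : set X) (t0 : R) (x01 : X) (J : set R)
    (x : R -> X) :=
  [/\ solution J x, forall t, J t -> N (x t) & P1 (x t0) = x01].

End projectors.

Definition half_open (R : realType) (t0 : R) (T : \bar R) : set R :=
  [set t | t0 <= t /\ (t%:E < T)%E].

(* Main.v *)
From HB Require Import structures.
Require Import Defs.
From mathcomp Require Import all_boot all_order all_algebra.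
From mathcomp Require Import complex.
From mathcomp Require Import all_classical all_reals all_analysis.
From mathcomp Require Import ring lra zify.

(* On the root vectors A shifts the level s + 1 to the level s and kills the
   level 0.  Hence Q_{2s}^{(s+1)} removes the derivative from the equation, and,
   going down from s = nu - 1 to s = 1, conditions 1.a and 1.b determine
   x_{2s}^{(s+1)} as a curve on R_+; then Q_{2Sigma,s} leaves only the
   derivatives of the components of level s + 1, which are already known, and
   1.c and 1.d determine x_{2/\,s}.  The implicit function theorem (2.a-2.d)
   makes these curves smooth, every step down costing one derivative.
   In the same way F_20 = 0 gives x_20 as a continuous function of (t, x_1),
   locally Lipschitz in x_1.  By the closed graph theorem A : D_1 -> Y_1 has an
   inverse G such that G and B G are bounded (that A maps D_1 onto Y_1 follows
   from the surjectivity of A + mu B as mu tends to 0), so that z = A x_1 solves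
   the ordinary differential equation z' = Q_1 f - B G z, whose right-hand side
   is locally Lipschitz in z; its maximal solution yields that of the ADAE. *)

Set Implicit Arguments.
Unset Strict Implicit.
Unset Printing Implicit Defensive.

Import Order.TTheory GRing.Theory Num.Theory.
Import numFieldNormedType.Exports.

Local Open Scope classical_set_scope.
Local Open Scope ring_scope.

(** * Banach spaces as real normed spaces *)

(** Differentiability is real-linear in the definitions even over complex scalars, so all analysis
    is done once, in real normed spaces; the scalar field matters only in the algebra of the
    operators and root vectors. The orders of smoothness come from the chains: the equation at level
    s contains the derivative of level s + 1, so x_{2/\,s} is of class C^s as soon as those
    derivatives are. x_20 is merely continuous, which is harmless: A annihilates it, and only A x
    has to be differentiable. The reduced equation is posed on an open subset of the whole of Y, the
    preimage of [MY] under Q_1; Y_1 is recovered as an invariant subspace. Both ends of the interval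
    need care. A solution on R_+ need not satisfy the equation at 0, so z = A P_1 x is not even
    known to be continuous at t_0; a growth estimate to the right of t_0 provides a limit, which the
    bounded inverse G identifies. At a finite t_max an extension of x would give z a limit in the
    domain of the field, which the maximality of z excludes. *)

Section scalars.
Context {R : realType} (k : scalars).
Local Notation K := (scalar_field R k).

Lemma of_realD : {morph @of_real R k : a b / a + b}.
Proof. by case: k => a b //=; rewrite rmorphD. Qed.

Lemma of_realM : {morph @of_real R k : a b / a * b}.
Proof. by case: k => a b //=; rewrite rmorphM. Qed.

Lemma of_real0 : of_real k (0 : R) = 0.
Proof. by case: k. Qed.

Lemma of_real1 : of_real k (1 : R) = 1.
Proof. by case: k. Qed.

Lemma of_realK (a : R) : to_real k (of_real k a) = a.
Proof. by case: k. Qed.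

Lemma ge0_to_real (a : K) : 0 <= a -> of_real k (to_real k a) = a.
Proof. by case: k a => //= -[a b]; rewrite lecE /= => /andP[/eqP-> _]. Qed.

Lemma ler_of_real (a b : R) : (of_real k a <= of_real k b) = (a <= b).
Proof. by case: k => //=; rewrite lecR. Qed.

Lemma ltr_of_real (a b : R) : (of_real k a < of_real k b) = (a < b).
Proof. by case: k => //=; rewrite ltcR. Qed.

Lemma norm_of_real (a : R) : `|of_real k a| = of_real k `|a|.
Proof. by case: k => //=; rewrite normc_def /= expr0n addr0 sqrtr_sqr. Qed.

Lemma nrmE (V : normedZmodType K) (x : V) : `|x| = of_real k (nrm x).
Proof. by rewrite /nrm ge0_to_real. Qed.

Section nrm.
Variable X : normedModType K.

Lemma nrmD (x y : X) : nrm (x + y) <= nrm x + nrm y.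
Proof. by rewrite -ler_of_real of_realD -!nrmE ler_normD. Qed.

Lemma nrm_scale (a : K) (x : X) : nrm (a *: x) = nrm a * nrm x.
Proof.
by rewrite /nrm normrZ (nrmE a) (nrmE x) -of_realM !of_realK.
Qed.

Lemma nrm_of_real (a : R) (x : X) : nrm (of_real k a *: x) = `|a| * nrm x.
Proof. by rewrite nrm_scale {1}/nrm norm_of_real of_realK. Qed.

Lemma nrm_eq0 (x : X) : nrm x = 0 -> x = 0.
Proof.
move=> x0; apply/normr0_eq0; rewrite nrmE x0.
exact: of_real0.
Qed.

End nrm.
End scalars.

(* an alias carrying the structure of a real normed space, with norm nrm *)
Definition realify (R : realType) (k : scalars)
  (X : normedModType (scalar_field R k)) : Type := X.

Section realify.
Context {R : realType} {k : scalars}.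
Local Notation K := (scalar_field R k).
Variable X : normedModType K.

HB.instance Definition _ := GRing.Zmodule.copy (realify X) X.

Definition rscale (a : R) (x : realify X) : realify X := of_real k a *: (x : X).

Fact rscaleA a b v : rscale a (rscale b v) = rscale (a * b) v.
Proof. by rewrite /rscale scalerA of_realM. Qed.
Fact rscale1 : left_id 1 rscale.
Proof. by move=> v; rewrite /rscale of_real1 scale1r. Qed.
Fact rscaleDr : right_distributive rscale +%R.
Proof. by move=> a u v; rewrite /rscale scalerDr. Qed.
Fact rscaleDl v : {morph rscale^~ v : a b / a + b}.
Proof. by move=> a b; rewrite /rscale of_realD scalerDl. Qed.

HB.instance Definition _ :=
  GRing.Zmodule_isLmodule.Build R (realify X) rscaleA rscale1 rscaleDr rscaleDl.

Fact rnormZ (a : R) (x : realify X) :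
  nrm (a *: x : X) = `|a| * nrm (x : X).
Proof. exact: nrm_of_real. Qed.

HB.instance Definition _ :=
  Lmodule_isNormed.Build R (realify X) (@nrmD _ _ X) rnormZ (@nrm_eq0 _ _ X).

End realify.

(** * Identities between linear combinations, decided by reflection *)

Section linear_expressions.
Variables (K : fieldType) (V : lmodType K).

Inductive lexpr := LVar of nat | LZero | LAdd of lexpr & lexpr | LOpp of lexpr
  | LScale of K & lexpr.

Fixpoint lden (env : seq V) (e : lexpr) : V := match e with
  | LVar n => nth 0 env n
  | LZero => 0
  | LAdd e1 e2 => lden env e1 + lden env e2
  | LOpp e1 => - lden env e1
  | LScale a e1 => a *: lden env e1
  end.

(** The index test is [PeanoNat.Nat.eqb] so that [cbn] in [linear_over] evaluates it on concrete
    indices. *)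
Fixpoint lcoef (e : lexpr) (i : nat) : K := match e with
  | LVar n => if PeanoNat.Nat.eqb n i then 1 else 0
  | LZero => 0
  | LAdd e1 e2 => lcoef e1 i + lcoef e2 i
  | LOpp e1 => - lcoef e1 i
  | LScale a e1 => a * lcoef e1 i
  end.

Fixpoint lcoef_eq (n : nat) (e1 e2 : lexpr) : Prop := match n with
  | 0 => True
  | m.+1 => lcoef e1 m = lcoef e2 m /\ lcoef_eq m e1 e2
  end.

Lemma ldenE env e : lden env e = \sum_(i < size env) lcoef e i *: nth 0 env i.
Proof.
elim: e => [n||e1 IH1 e2 IH2|e1 IH1|a e1 IH1] /=.
- have [nlt|nge] := ltnP n (size env); last first.
    (* A variable outside the environment denotes the default vector 0 and has no coefficient at an
       index below [size env]. *)
    rewrite nth_default // big1 // => i _.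
    case: PeanoNat.Nat.eqb_spec => [ni|_]; last by rewrite scale0r.
    by have := ltn_ord i; rewrite -ni ltnNge nge.
  rewrite (bigD1 (Ordinal nlt)) //= PeanoNat.Nat.eqb_refl scale1r.
  rewrite big1 ?addr0 // => i ine.
  case: PeanoNat.Nat.eqb_spec => [ni|_]; last by rewrite scale0r.
  by move: ine; rewrite -val_eqE /= ni eqxx.
- by rewrite big1 // => i _; rewrite scale0r.
- by rewrite IH1 IH2 -big_split /=; apply: eq_bigr => i _; rewrite scalerDl.
- by rewrite IH1 -sumrN; apply: eq_bigr => i _; rewrite scaleNr.
- by rewrite IH1 scaler_sumr; apply: eq_bigr => i _; rewrite scalerA.
Qed.

Lemma lexpr_eq env e1 e2 : lcoef_eq (size env) e1 e2 ->
  lden env e1 = lden env e2.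
Proof.
rewrite !ldenE => h; apply: eq_bigr => i _; congr (_ *: _).
elim: (size env) i h => [[]//|n IH] i /= [hn h].
have := ltn_ord i; rewrite ltnS leq_eqVlt => /orP[/eqP->//|lin].
exact: (IH (Ordinal lin)).
Qed.
End linear_expressions.

(** The inner match on [constr:(Set)] runs the tactic [constr_eq] as a test while a term is being
    computed; its failure selects the next branch. *)
Ltac lmem x l := match l with
  | cons ?y ?l' => match constr:(Set) with
     | _ => let _ := match constr:(Set) with _ => constr_eq x y end in constr:(true)
     | _ => lmem x l' end
  | _ => constr:(false) end.

Ltac lindex x l := match l with
  | cons ?y ?l' => match constr:(Set) with
     | _ => let _ := match constr:(Set) with _ => constr_eq x y end in constr:(O)
     | _ => let n := lindex x l' in constr:(S n) end
  end.

Ltac latoms t l := match t with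
  | ?x + ?y => let l := latoms x l in latoms y l
  | - ?x => latoms x l
  | ?a *: ?x => latoms x l
  | 0 => l
  | _ => match lmem t l with true => l | false => constr:(cons t l) end
  end.

Ltac lreify K t l := match t with
  | ?x + ?y => let ex := lreify K x l in let ey := lreify K y l in
      constr:(@LAdd K ex ey)
  | - ?x => let ex := lreify K x l in constr:(@LOpp K ex)
  | ?a *: ?x => let ex := lreify K x l in constr:(@LScale K a ex)
  | 0 => constr:(@LZero K)
  | _ => let n := lindex t l in constr:(@LVar K n)
  end.

(* Decides identities between linear combinations of vectors, the equality of
   the coefficients being left to ring *)
Ltac linear_over K := match goal with |- @eq ?V ?x ?y =>
  let l := latoms x (@nil V) in let l := latoms y l in
  let ex := lreify K x l in let ey := lreify K y l in
  change (@lden K _ l ex = @lden K _ l ey);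
  apply: lexpr_eq; cbn [lcoef_eq lcoef PeanoNat.Nat.eqb size];
  repeat split; ring end.

(** * Calculus of curves *)

Section reals.
Variable R : realType.

(** The supremum of the c for which P holds on [a, c] satisfies P by the limit hypothesis, and would
    be exceeded by the step hypothesis if it were below b. This takes the place of compactness of
    [a, b] in the mean value inequality, the construction of antiderivatives and the uniqueness of
    solutions. *)
Lemma real_induction (a b : R) (P : R -> Prop) : a <= b -> P a ->
  (forall c, a <= c < b -> P c ->
    exists2 d, 0 < d & forall s, c <= s -> s <= c + d -> s <= b -> P s) ->
  (forall c, a < c <= b -> (forall s, a <= s < c -> P s) -> P c) ->
  P b.
Proof.
move=> ab Pa Pstep Plim.
pose S := [set c | a <= c <= b /\ forall s, a <= s <= c -> P s].
have Sa : S a.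
  split; first by rewrite lexx.
  by move=> s /andP[as_ sa]; have -> : s = a by apply/eqP; rewrite eq_le as_ sa.
have Sub : has_sup S by split; [exists a | exists b => c [/andP[]]].
set c := sup S.
have ac : a <= c by apply: ub_le_sup => //; case: Sub.
have cb : c <= b by apply: ge_sup; [exists a | move=> x [/andP[]]].
have Plt s : a <= s < c -> P s.
  move=> /andP[as_ sc]; have e0 : 0 < c - s by rewrite subr_gt0.
  have [x [/andP[ax xb] Px] sx] := sup_adherent e0 Sub.
  by apply: Px; rewrite as_ /=; move: sx; rewrite -/c; lra.
have Pc : P c.
  have [->//|ca] := eqVneq c a.
  by apply: Plim => //; rewrite cb lt_neqAle eq_sym ca ac.
have Ple s : a <= s <= c -> P s.
  move=> /andP[as_]; rewrite le_eqVlt => /orP[/eqP->//|sc].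
  by apply: Plt; rewrite as_.
have [<-//|cneb] := eqVneq c b.
have cltb : c < b by rewrite lt_neqAle cneb.
have [|d d0 Pd] := Pstep c _ Pc; first by rewrite ac.
have Sd : S (Num.min b (c + d)).
  split; first by rewrite le_min ab ge_min lexx /= andbT; lra.
  move=> s /andP[as_]; rewrite le_min => /andP[sb scd].
  have [sc|cs] := leP s c; first by apply: Ple; rewrite as_.
  by apply: Pd => //; exact: ltW.
have : Num.min b (c + d) <= c by apply: ub_le_sup => //; case: Sub.
by rewrite ge_min => /orP[|]; lra.
Qed.

Lemma le0_halving (x C : R) : (forall n, x <= C / 2 ^+ n) -> x <= 0.
Proof.
move=> xC; rewrite leNgt; apply/negP => x0.
have C0 : 0 < C by have := xC 0%N; rewrite expr0 divr1; lra.
have [n] : exists n, C / x < 2 ^+ n.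
  exists (Num.truncn (C / x)).+1.
  apply: lt_le_trans (truncnS_gt _) _.
  by rewrite -natrX ler_nat ltnW // ltn_expl.
rewrite ltr_pdivrMr // mulrC => Cx; have := xC n.
by rewrite ler_pdivlMr ?exprn_gt0 // leNgt Cx.
Qed.

Lemma small_halving (C e : R) : 0 < e -> exists N : nat, C / 2 ^+ N <= e.
Proof.
move=> e0; apply: contrapT => h.
suff : e <= 0 by lra.
apply: (@le0_halving _ C) => n; rewrite leNgt; apply/negP => ne.
by apply: h; exists n; exact: ltW.
Qed.

Lemma ler_halving (C : R) m n : 0 <= C -> (m <= n)%N ->
  C / 2 ^+ n <= C / 2 ^+ m.
Proof.
move=> C0 mn; rewrite ler_wpM2l // lef_pV2 ?posrE ?exprn_gt0 //.
by rewrite ler_weXn2l // ler1n.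
Qed.

Lemma halvingS (C : R) n : C / 2 ^+ n.+1 = C / 2 ^+ n / 2.
Proof. by rewrite exprSr invfM mulrA. Qed.

(** Completeness in terms of sequences and non-strict bounds, the form that the iterations below
    consume; [realify_complete] supplies it for Banach spaces. *)
Definition seq_complete (V : normedModType R) := forall u : nat -> V,
  (forall e : R, 0 < e -> exists N : nat, forall m n,
     (N <= m)%N -> (N <= n)%N -> `|u m - u n| <= e) ->
  exists l : V, forall e : R, 0 < e -> exists N : nat, forall n,
     (N <= n)%N -> `|u n - l| <= e.

Lemma halving_cauchy (V : normedModType R) (u : nat -> V) (C : R) :
  (forall n, `|u n.+1 - u n| <= C / 2 ^+ n) ->
  forall m n, (n <= m)%N -> `|u m - u n| <= 2 * C / 2 ^+ n.
Proof.
move=> uC m n nm.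
have C0 : 0 <= C by have := uC 0%N; rewrite expr0 divr1; apply: le_trans.
rewrite -(subnK nm); move: (m - n)%N => i {nm}; elim: i n => [|i IH] n.
  by rewrite add0n subrr normr0 !mulr_ge0 // invr_ge0 exprn_ge0.
have := IH n.+1; rewrite addnS addSn => h.
apply: le_trans (ler_distD (u n.+1) _ _) _.
have := uC n; have := h; rewrite halvingS; lra.
Qed.

(** The geometric rate is kept in the conclusion: when the sequence depends on a parameter and C
    does not, the convergence is uniform. *)
Lemma halving_limit (V : normedModType R) (u : nat -> V) (C : R) :
  seq_complete V -> (forall n, `|u n.+1 - u n| <= C / 2 ^+ n) ->
  exists l, forall n, `|u n - l| <= 2 * C / 2 ^+ n.
Proof.
move=> cV uC; have uD := halving_cauchy uC.
have C0 : 0 <= C by have := uC 0%N; rewrite expr0 divr1; apply: le_trans.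
have C20 : 0 <= 2 * C by rewrite mulr_ge0.
have [|l ul] := cV u.
  move=> e e0; have [N Ne] := small_halving (2 * C) e0; exists N => m n Nm Nn.
  have [mn|nm] := leqP m n; last first.
    by apply: le_trans (uD _ _ (ltnW nm)) (le_trans _ Ne); exact: ler_halving.
  by rewrite distrC; apply: le_trans (uD _ _ mn) (le_trans _ Ne); exact: ler_halving.
exists l => n; apply/ler_addgt0Pr => e e0; have [N HN] := ul _ e0.
apply: le_trans (ler_distD (u (maxn N n)) _ _) _.
rewrite distrC lerD ?uD ?leq_maxr //.
by apply: HN; rewrite leq_maxl.
Qed.
End reals.

Section curves.
Context {R : realType} {E : normedModType R}.
Implicit Types (J : set R) (g : R -> E).

(** Differentiability relative to J, hence one-sided at endpoints. Without quotients the inequality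
    is trivial at s = t, and no punctured neighbourhood is involved. *)
Definition deriv_on J g (t : R) (d : E) := forall e : R, 0 < e ->
  exists2 r : R, 0 < r & forall s, J s -> `|s - t| < r ->
    `|g s - g t - (s - t) *: d| <= e * `|s - t|.

Definition cont_on J g (t : R) := forall e : R, 0 < e ->
  exists2 r : R, 0 < r & forall s, J s -> `|s - t| < r -> `|g s - g t| <= e.

Definition seg (a b : R) : set R := [set t | a <= t <= b].

Lemma deriv_on_sub J J' g t d : J' `<=` J -> deriv_on J g t d ->
  deriv_on J' g t d.
Proof.
by move=> JJ h e /h[r r0 H]; exists r => // s /JJ; exact: H.
Qed.

Lemma cont_on_sub J J' g t : J' `<=` J -> cont_on J g t -> cont_on J' g t.
Proof.
by move=> JJ h e /h[r r0 H]; exists r => // s /JJ; exact: H.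
Qed.

Lemma deriv_on_local J g t d (r : R) : 0 < r ->
  deriv_on (J `&` [set s | `|s - t| < r]) g t d -> deriv_on J g t d.
Proof.
move=> r0 h e /h[q q0 H]; exists (Num.min q r); first by rewrite lt_min q0.
by move=> s Js; rewrite lt_min => /andP[sq sr]; exact: H.
Qed.

Lemma eq_deriv_on J g g' t d : J t -> (forall s, J s -> g s = g' s) ->
  deriv_on J g t d -> deriv_on J g' t d.
Proof.
move=> Jt gg h e /h[r r0 H]; exists r => // s Js; rewrite -!gg //; exact: H.
Qed.

Lemma eq_cont_on J g g' t : J t -> (forall s, J s -> g s = g' s) ->
  cont_on J g t -> cont_on J g' t.
Proof.
move=> Jt gg h e /h[r r0 H]; exists r => // s Js; rewrite -!gg //; exact: H.
Qed.

Lemma deriv_lip J g t d : deriv_on J g t d ->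
  exists2 r : R, 0 < r & forall s, J s -> `|s - t| < r ->
    `|g s - g t| <= (`|d| + 1) * `|s - t|.
Proof.
move=> /(_ 1 ltr01)[r r0 H]; exists r => // s Js st; have := H _ Js st.
have := ler_normD (g s - g t - (s - t) *: d) ((s - t) *: d).
rewrite subrK normrZ mul1r mulrDl mul1r (mulrC `|d|); lra.
Qed.

Lemma deriv_cont J g t d : deriv_on J g t d -> cont_on J g t.
Proof.
move=> /deriv_lip[r r0 H] e e0.
have p0 : 0 < `|d| + 1 by rewrite ltr_wpDl.
exists (Num.min r (e / (`|d| + 1))); first by rewrite lt_min r0 divr_gt0.
move=> s Js; rewrite lt_min ltr_pdivlMr // => /andP[/(H s Js)]; lra.
Qed.

Lemma deriv_onD J g h t d d' : deriv_on J g t d -> deriv_on J h t d' ->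
  deriv_on J (fun s => g s + h s) t (d + d').
Proof.
move=> hg hh e e0; have e20 : 0 < e / 2 by rewrite divr_gt0.
have [r r0 H] := hg _ e20; have [r' r'0 H'] := hh _ e20.
exists (Num.min r r'); first by rewrite lt_min r0.
move=> s Js; rewrite lt_min => /andP[/(H s Js) h1 /(H' s Js) h2].
have -> : g s + h s - (g t + h t) - (s - t) *: (d + d') =
  (g s - g t - (s - t) *: d) + (h s - h t - (s - t) *: d').
  by linear_over R.
apply: le_trans (ler_normD _ _) _; lra.
Qed.

Lemma deriv_onZ J g t d (a : R) : deriv_on J g t d ->
  deriv_on J (fun s => a *: g s) t (a *: d).
Proof.
move=> hg e e0; have a0 : 0 < `|a| + 1 by rewrite ltr_wpDl.
have [|r r0 H] := hg (e / (`|a| + 1)); first by rewrite divr_gt0.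
exists r => // s Js st.
rewrite scalerA (mulrC _ a) -scalerA -!scalerBr normrZ.
apply: (@le_trans _ _ (`|a| * (e / (`|a| + 1) * `|s - t|))).
  by rewrite ler_wpM2l //; exact: H.
rewrite mulrA ler_wpM2r // mulrCA ler_piMr ?(ltW e0) //.
by rewrite ler_pdivrMr // mul1r; lra.
Qed.

Lemma deriv_onN J g t d : deriv_on J g t d ->
  deriv_on J (fun s => - g s) t (- d).
Proof.
move=> /(deriv_onZ (-1)); rewrite scaleN1r => h e /h[r r0 H]; exists r => //.
by move=> s Js st; have := H s Js st; rewrite !scaleN1r.
Qed.

Lemma deriv_onB J g h t d d' : deriv_on J g t d -> deriv_on J h t d' ->
  deriv_on J (fun s => g s - h s) t (d - d').
Proof. by move=> hg /deriv_onN; exact: deriv_onD. Qed.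

Lemma deriv_on_cst J (c : E) t : deriv_on J (fun=> c) t 0.
Proof.
move=> e e0; exists 1 => // s _ _.
by rewrite subrr scaler0 subr0 normr0 mulr_ge0 // ltW.
Qed.

Lemma deriv_on_affine J (t0 : R) (c d : E) t :
  deriv_on J (fun s => c + (s - t0) *: d) t d.
Proof.
move=> e e0; exists 1 => // s _ _.
have -> : c + (s - t0) *: d - (c + (t - t0) *: d) - (s - t) *: d = 0.
  rewrite opprD addrACA subrr add0r -!scalerBl.
  by rewrite (_ : _ - _ = 0) ?scale0r //; ring.
by rewrite normr0 mulr_ge0 // ltW.
Qed.

Lemma cont_onD J g h t : cont_on J g t -> cont_on J h t ->
  cont_on J (fun s => g s + h s) t.
Proof.
move=> hg hh e e0; have e20 : 0 < e / 2 by rewrite divr_gt0.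
have [r r0 H] := hg _ e20; have [r' r'0 H'] := hh _ e20.
exists (Num.min r r'); first by rewrite lt_min r0.
move=> s Js; rewrite lt_min => /andP[/(H s Js) h1 /(H' s Js) h2].
rewrite opprD addrACA; apply: le_trans (ler_normD _ _) _; lra.
Qed.

Lemma cont_onN J g t : cont_on J g t -> cont_on J (fun s => - g s) t.
Proof.
move=> hg e /hg[r r0 H]; exists r => // s Js st.
by rewrite -opprD normrN; exact: H.
Qed.

Lemma cont_onB J g h t : cont_on J g t -> cont_on J h t ->
  cont_on J (fun s => g s - h s) t.
Proof. by move=> hg /cont_onN; exact: cont_onD. Qed.

Lemma cont_on_cst J (c : E) t : cont_on J (fun=> c) t.
Proof.
by move=> e e0; exists 1 => // s _ _; rewrite subrr normr0 ltW.
Qed.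

Lemma cont_on_bounded J g t : cont_on J g t -> exists2 r : R, 0 < r &
  forall s, J s -> `|s - t| < r -> `|g s| <= `|g t| + 1.
Proof.
move=> /(_ 1 ltr01)[r r0 H]; exists r => // s Js /(H s Js) h.
have := ler_normD (g s - g t) (g t); rewrite subrK; lra.
Qed.

(** Only increments starting from a point t and staying near t are controlled; real induction on the
    right end propagates the bound with C enlarged by e / (b - a), so that the total error is e. *)
Lemma mean_value (a b C : R) g : a <= b ->
  (forall t, seg a b t -> forall e, 0 < e -> exists2 r : R, 0 < r &
     forall s, seg a b s -> `|s - t| < r -> `|g s - g t| <= (C + e) * `|s - t|) ->
  `|g b - g a| <= C * (b - a).
Proof.
move=> ab H; have [<-|aneb] := eqVneq a b; first by rewrite !subrr normr0 mulr0.
have ba0 : 0 < b - a by rewrite subr_gt0 lt_neqAle aneb.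
apply/ler_addgt0Pr => e e0.
have e'0 : 0 < e / (b - a) by rewrite divr_gt0.
suff : `|g b - g a| <= (C + e / (b - a)) * (b - a).
  by rewrite mulrDl divfK ?gt_eqF.
pose P c := `|g c - g a| <= (C + e / (b - a)) * (c - a).
apply: (@real_induction _ a b P) => //.
- by rewrite /P !subrr normr0 mulr0.
- move=> c /andP[ac cb] Pc.
  have [|r r0 Hr] := H c _ _ e'0; first by rewrite /seg /= ac ltW.
  exists (r / 2) => [|s cs sr sb]; first by rewrite divr_gt0.
  have : `|g s - g c| <= (C + e / (b - a)) * (s - c).
    rewrite -(ger0_norm (x := s - c)) ?subr_ge0 //; apply: Hr.
      by rewrite /seg /= sb (le_trans ac).
    by rewrite ger0_norm ?subr_ge0 //; lra.
  have := ler_distD (g c) (g s) (g a); rewrite /P; move: Pc; rewrite /P; nra.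
- move=> c /andP[ac cb] Pc.
  have [|r r0 Hr] := H c _ _ e'0; first by rewrite /seg /= cb ltW.
  (* A point to the left of c, close enough for the local estimate at c, carries the bound already
     known at s over to c. *)
  have [s [as_ sc rs]] : exists s, [/\ a <= s, s < c & c - s < r].
    exists (Num.max a (c - r / 2)).
    rewrite le_max lexx gt_max ac /= ltrBlDr -ltrBlDl subrr divr_gt0 //.
    split => //; rewrite ltrBlDr -ltrBlDl lt_max; apply/orP; right; lra.
  have : `|g s - g c| <= (C + e / (b - a)) * (c - s).
    rewrite -(gtr0_norm (x := c - s)) ?subr_gt0 // (distrC c); apply: Hr.
      by rewrite /seg /= as_ (le_trans _ cb) // ltW.
    by rewrite distrC gtr0_norm ?subr_gt0.
  have := ler_distD (g s) (g c) (g a); rewrite (distrC (g c) (g s)) /P.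
  have := Pc s; rewrite as_ sc /P => /(_ isT); nra.
Qed.

Lemma deriv_bound (a b C : R) g (g' : R -> E) : a <= b ->
  (forall t, seg a b t -> deriv_on (seg a b) g t (g' t)) ->
  (forall t, seg a b t -> `|g' t| <= C) ->
  `|g b - g a| <= C * (b - a).
Proof.
move=> ab dg gC; apply: mean_value => // t abt e e0.
have [r r0 H] := dg t abt _ e0; exists r => // s abs st.
have := H s abs st.
have := ler_normD (g s - g t - (s - t) *: g' t) ((s - t) *: g' t).
rewrite subrK normrZ; have := gC t abt; have := normr_ge0 (s - t); nra.
Qed.

(** [deriv_bound] applies on [a + q, b - q]; continuity at the two endpoints absorbs the rest as q
    tends to 0. *)
Lemma deriv0_cst (a b : R) g : a <= b ->
  (forall t, seg a b t -> cont_on (seg a b) g t) ->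
  (forall t, a < t < b -> deriv_on (seg a b) g t 0) -> g b = g a.
Proof.
move=> ab gc dg; have [->//|aneb] := eqVneq a b.
have altb : a < b by rewrite lt_neqAle aneb.
apply/eqP; rewrite -subr_eq0 -normr_le0; apply/ler_addgt0Pr => e e0; rewrite add0r.
have e20 : 0 < e / 2 by rewrite divr_gt0.
have [|r r0 Ha] := gc a _ _ e20; first by rewrite /seg /= lexx.
have [|r' r'0 Hb] := gc b _ _ e20; first by rewrite /seg /= lexx andbT.
pose q := Num.min (Num.min (r / 2) (r' / 2)) ((b - a) / 2).
have q0 : 0 < q by rewrite !lt_min !divr_gt0 // subr_gt0.
have [qr qr' qab] : [/\ q <= r / 2, q <= r' / 2 & q <= (b - a) / 2].
  by rewrite !ge_min !lexx ?orbT.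
have : `|g (b - q) - g (a + q)| <= 0 * (b - q - (a + q)).
  apply: (@deriv_bound _ _ _ _ (fun=> 0)) => //; first lra.
    move=> t /andP[t1 t2]; apply: (@deriv_on_sub (seg a b)).
      by move=> s /andP[s1 s2]; apply/andP; split; lra.
    by apply: dg; apply/andP; split; lra.
  by move=> t _; rewrite normr0.
rewrite mul0r normr_le0 subr_eq0 => /eqP gg.
have h1 : `|g (a + q) - g a| <= e / 2.
  apply: Ha; first by apply/andP; split; lra.
  by rewrite addrAC subrr add0r gtr0_norm //; lra.
have h2 : `|g (b - q) - g b| <= e / 2.
  apply: Hb; first by apply/andP; split; lra.
  by rewrite addrAC subrr add0r normrN gtr0_norm //; lra.
have := ler_distD (g (b - q)) (g b) (g a).
move: h2; rewrite (distrC (g b) (g (b - q))) gg; lra.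
Qed.

(** * Antiderivatives of continuous curves *)

Section antiderivative.
Variables (a b : R) (w : R -> E).
Hypothesis wc : forall t, seg a b t -> cont_on (seg a b) w t.
Hypothesis cE : seq_complete E.

Definition approx_antideriv (e c : R) g := forall t, seg a c t ->
  exists2 r : R, 0 < r & forall s, seg a c s -> `|s - t| < r ->
    `|g s - g t - (s - t) *: w t| <= e * `|s - t|.

Lemma approx_antideriv_extend (e p c q : R) g : a <= p -> p <= q ->
  (forall t, p <= t <= q -> `|w t - w c| <= e) ->
  approx_antideriv e p g -> exists h, approx_antideriv e q h.
Proof.
move=> ap pq wpq hg.
exists (fun s => if s <= p then g s else g p + (s - p) *: w c).
move=> t /andP[at_ tq]; have [tp|pt|->] := ltgtP t p.
- have [|r r0 H] := hg t; first by rewrite /seg /= at_ ltW.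
  exists (Num.min r (p - t)); first by rewrite lt_min r0 subr_gt0.
  move=> s /andP[as_ sq]; rewrite lt_min => /andP[st /ltr_normlP[s1 s2]].
  have -> : s <= p by lra.
  by apply: H => //; apply/andP; split => //; lra.
- exists (t - p); first by rewrite subr_gt0.
  move=> s /andP[as_ sq]; rewrite ltr_norml => /andP[s1 s2].
  have /negbTE-> : ~~ (s <= p) by rewrite -ltNge; lra.
  have -> : g p + (s - p) *: w c - (g p + (t - p) *: w c) - (s - t) *: w t =
     (s - t) *: (w c - w t).
    rewrite opprD addrACA subrr add0r -scalerBl scalerBr.
    by congr (_ *: _ - _); ring.
  rewrite normrZ mulrC ler_wpM2r // distrC; apply: wpq; lra.
- have [|r r0 H] := hg p; first by rewrite /seg /= ap lexx.
  exists r => // s /andP[as_ sq] sp.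
  case: (leP s p) => [sp'|ps] /=; first by apply: H => //; apply/andP.
  have -> : g p + (s - p) *: w c - g p - (s - p) *: w p = (s - p) *: (w c - w p).
    by rewrite [g p + _]addrC addrK -scalerBr.
  by rewrite normrZ mulrC ler_wpM2r // distrC; apply: wpq; rewrite lexx.
Qed.

Lemma approx_antideriv_exists (e : R) : a <= b -> 0 < e ->
  exists g, approx_antideriv e b g.
Proof.
move=> ab e0.
pose P c := exists g, approx_antideriv e c g.
apply: (@real_induction _ a b P) => //.
- exists (fun=> 0) => t ta; exists 1 => // s /andP[s1 s2] _.
  move: ta => /andP[t1 t2]; have -> : s = t by lra.
  by rewrite !subrr scale0r subr0 !normr0 mulr0.
- move=> c /andP[ac cb] [g hg].
  have [|r r0 Hr] := wc (t := c) _ e0; first by rewrite /seg /= ac ltW.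
  exists (r / 2) => [|s cs sr sb]; first by rewrite divr_gt0.
  apply: (approx_antideriv_extend (p := c) (c := c)) hg => // t /andP[t1 t2].
  apply: Hr; first by apply/andP; split; lra.
  by rewrite ger0_norm ?subr_ge0 //; lra.
- move=> c /andP[ac cb] Pc.
  have [|r r0 Hr] := wc (t := c) _ e0; first by rewrite /seg /= cb ltW.
  have [s [as_ sc rs]] : exists s, [/\ a <= s, s < c & c - s < r].
    exists (Num.max a (c - r / 2)).
    rewrite le_max lexx gt_max ac /= ltrBlDr -ltrBlDl subrr divr_gt0 //.
    split => //; rewrite ltrBlDr -ltrBlDl lt_max; apply/orP; right; lra.
  have [|g hg] := Pc s; first by rewrite as_.
  apply: (approx_antideriv_extend (p := s) (c := c)) hg => //; first exact: ltW.
  move=> t /andP[t1 t2]; apply: Hr; first by apply/andP; split; lra.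
  by rewrite ler0_norm ?subr_le0 //; lra.
Qed.

(** In the difference of two approximate antiderivatives the terms (q - p) w p cancel, which leaves
    increments of at most e + e' per unit length for [mean_value]. *)
Lemma approx_antideriv_dist (e e' : R) g g' s t : seg a b s -> seg a b t ->
  approx_antideriv e b g -> approx_antideriv e' b g' ->
  `|(g t - g' t) - (g s - g' s)| <= (e + e') * `|t - s|.
Proof.
move=> abs abt hg hg'.
wlog st : s t abs abt / s <= t.
  move=> W; have [/W|/ltW ts] := leP s t; first exact.
  by rewrite distrC (distrC t); exact: W.
rewrite (ger0_norm (x := t - s)) ?subr_ge0 //.
apply: (@mean_value s t _ (fun t => g t - g' t)) => // p /andP[p1 p2] d d0.
have sub q : seg s t q -> seg a b q.
  move: abs abt => /andP[? ?] /andP[? ?] /andP[? ?]; apply/andP; split; lra.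
have [|r r0 H] := hg p; first by apply: sub; apply/andP.
have [|r' r'0 H'] := hg' p; first by apply: sub; apply/andP.
exists (Num.min r r'); first by rewrite lt_min r0.
move=> q /sub abq; rewrite lt_min => /andP[/(H _ abq) h /(H' _ abq) h'].
have -> : g q - g' q - (g p - g' p) =
  (g q - g p - (q - p) *: w p) - (g' q - g' p - (q - p) *: w p).
  by linear_over R.
have := ler_normB (g q - g p - (q - p) *: w p) (g' q - g' p - (q - p) *: w p).
have := normr_ge0 (q - p); nra.
Qed.

(** The limit of 2^-n-approximate antiderivatives normalised to vanish at a. Their increments
    converge uniformly relative to the length of the interval, and so the derivative passes to the
    limit. *)
Lemma antiderivative : a <= b -> exists W : R -> E,
  forall t, seg a b t -> deriv_on (seg a b) W t (w t).
Proof.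
move=> ab.
have /choice[g hg] : forall n : nat, exists g, approx_antideriv (2 ^- n) b g.
  by move=> n; apply: approx_antideriv_exists; rewrite // invr_gt0 exprn_gt0.
pose u n t := g n t - g n a.
have aba : seg a b a by rewrite /seg /= lexx.
have lim t : seg a b t -> exists l, forall n,
    `|u n t - l| <= 2 * (2 * (b - a)) / 2 ^+ n.
  move=> abt; apply: halving_limit => // n.
  have := approx_antideriv_dist aba abt (hg n.+1) (hg n).
  have -> : g n.+1 t - g n t - (g n.+1 a - g n a) = u n.+1 t - u n t.
    by rewrite /u; linear_over R.
  move/le_trans; apply.
  have p0 : 0 < 2 ^- n :> R by rewrite invr_gt0 exprn_gt0.
  have p2 : 0 < 2 ^- n.+1 :> R by rewrite invr_gt0 exprn_gt0.
  have p1 : 2 ^- n.+1 <= 2 ^- n :> R.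
    by rewrite lef_pV2 ?posrE ?exprn_gt0 // ler_weXn2l ?ler1n.
  move: abt => /andP[t1 t2]; rewrite ger0_norm ?subr_ge0 //.
  rewrite (_ : 2 * _ / _ = (2 * 2 ^- n) * (b - a)); last by ring.
  by apply: ler_pM; rewrite ?subr_ge0; lra.
have /choice[W hW] : forall t, exists l, seg a b t -> forall n,
    `|u n t - l| <= 2 * (2 * (b - a)) / 2 ^+ n.
  move=> t; have [/lim[l hl]|nt] := pselect (seg a b t); first by exists l.
  by exists 0.
exists W => t abt e e0.
(* The 3 pays twice 2^-N for replacing the increments of W by those of [u N] and once for the error
   of [g N] itself. *)
have [N HN] := small_halving (3 : R) e0.
have [r r0 H] := hg N t abt; exists r => // s abs st.
(* The increments of [u M] and [u N] differ by at most twice 2^-N per unit length for all M above N;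
   the distance from [u M] to W is made smaller than any d. *)
have close : `|(W s - W t) - (u N s - u N t)| <= 2 / 2 ^+ N * `|s - t|.
  apply/ler_addgt0Pr => d d0.
  have [m Hm] := small_halving (2 * (2 * (2 * (b - a)))) d0.
  pose M := maxn m N.
  have : `|(u M s - u M t) - (u N s - u N t)| <= 2 / 2 ^+ N * `|s - t|.
    have := approx_antideriv_dist abt abs (hg M) (hg N).
    have -> : g M s - g N s - (g M t - g N t) = (u M s - u M t) - (u N s - u N t).
      by rewrite /u; linear_over R.
    move/le_trans; apply; rewrite ler_wpM2r //.
    have : 2 ^- M <= 2 ^- N :> R.
      by rewrite lef_pV2 ?posrE ?exprn_gt0 // ler_weXn2l ?ler1n ?leq_maxr.
    lra.
  have := hW s abs M; have := hW t abt M.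
  have Mm : 2 * (2 * (2 * (b - a))) / 2 ^+ M <= d.
    apply: le_trans Hm; apply: ler_halving; last exact: leq_maxl.
    by rewrite !mulr_ge0 // subr_ge0.
  have -> : W s - W t - (u N s - u N t) =
     ((u M s - u M t) - (u N s - u N t)) + ((u M t - W t) - (u M s - W s)).
    by linear_over R.
  have := ler_normD ((u M s - u M t) - (u N s - u N t)) ((u M t - W t) - (u M s - W s)).
  have := ler_normB (u M t - W t) (u M s - W s).
  have : 2 * (2 * (2 * (b - a)) / 2 ^+ M) <= d by rewrite mulrA.
  set x := 2 * (2 * _) / 2 ^+ M; lra.
have := H s abs st.
have -> : g N s - g N t = u N s - u N t by rewrite /u; linear_over R.
have -> : W s - W t - (s - t) *: w t =
  (W s - W t - (u N s - u N t)) + (u N s - u N t - (s - t) *: w t).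
  by rewrite addrA subrK.
have := ler_normD (W s - W t - (u N s - u N t)) (u N s - u N t - (s - t) *: w t).
have : (2 / 2 ^+ N + 2 ^- N) * `|s - t| <= e * `|s - t|.
  by rewrite ler_wpM2r //; lra.
rewrite mulrDl; lra.
Qed.

End antiderivative.

(** Subtracting an antiderivative of w leaves a continuous curve with zero derivative inside, hence
    a constant. This extends a differential equation to an endpoint where only continuity is known:
    to a finite end of a maximal solution and to the initial time. *)
Lemma closing (a b : R) g (w : R -> E) : seq_complete E -> a <= b ->
  (forall t, seg a b t -> cont_on (seg a b) g t) ->
  (forall t, seg a b t -> cont_on (seg a b) w t) ->
  (forall t, a < t < b -> deriv_on (seg a b) g t (w t)) ->
  forall t, seg a b t -> deriv_on (seg a b) g t (w t).
Proof.
move=> cE ab gc wc dg; have [W hW] := antiderivative wc cE ab.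
have same t : seg a b t -> W t + (g a - W a) = g t.
  move=> /andP[at_ tb].
  have sub : seg a t `<=` seg a b.
    by move=> s /andP[s1 s2]; apply/andP; split => //; exact: le_trans tb.
  have h : g t - W t = g a - W a.
    apply: (@deriv0_cst a t (fun t => g t - W t)) => //.
      move=> s /sub abs; apply: (cont_on_sub sub).
      by apply: cont_onB; [exact: gc | apply: deriv_cont (hW _ abs)].
    move=> s /andP[as_ st]; apply: (deriv_on_sub sub).
    rewrite -(subrr (w s)); apply: deriv_onB.
      by apply: dg; rewrite as_ (lt_le_trans st).
    by apply: hW; apply/andP; split; [exact: ltW | apply: le_trans tb; exact: ltW].
  by rewrite -h addrC subrK.
move=> t abt; apply: (eq_deriv_on abt same).
rewrite -[w t]addr0; apply: deriv_onD; [exact: hW | exact: deriv_on_cst].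
Qed.

Lemma deriv_on_unique J g t d d' :
  (forall r, 0 < r -> exists s, [/\ J s, s != t & `|s - t| < r]) ->
  deriv_on J g t d -> deriv_on J g t d' -> d = d'.
Proof.
move=> acc hd hd'; apply/eqP; rewrite -subr_eq0 -normr_le0.
apply/ler_addgt0Pr => e e0; rewrite add0r; have e20 : 0 < e / 2 by rewrite divr_gt0.
have [r r0 H] := hd _ e20; have [r' r'0 H'] := hd' _ e20.
have [|s [Js st]] := acc (Num.min r r'); first by rewrite lt_min r0.
rewrite lt_min => /andP[/(H s Js) h /(H' s Js) h'].
have st0 : 0 < `|s - t| by rewrite normr_gt0 subr_eq0.
rewrite -(ler_pM2l st0) -normrZ.
have -> : (s - t) *: (d - d') = (g s - g t - (s - t) *: d') - (g s - g t - (s - t) *: d).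
  by linear_over R.
have := ler_normB (g s - g t - (s - t) *: d') (g s - g t - (s - t) *: d).
rewrite (mulrC `|s - t|); lra.
Qed.

Lemma deriv_on_glue (a b c : R) g h t d : g c = h c ->
  (seg a c t -> deriv_on (seg a c) g t d) ->
  (seg c b t -> deriv_on (seg c b) h t d) -> seg a b t ->
  deriv_on (seg a b) (fun s => if s <= c then g s else h s) t d.
Proof.
move=> gh dg dh /andP[at_ tb]; have [tc|ct|tc] := ltgtP t c.
- apply: (@deriv_on_local _ _ _ _ (c - t)); first by rewrite subr_gt0.
  apply: (@eq_deriv_on _ g).
  + by split => /=; [apply/andP | rewrite subrr normr0 subr_gt0].
  + by move=> s /= [_]; rewrite ltr_norml => /andP[_ s2]; have -> : s <= c by lra.
  apply: (@deriv_on_sub (seg a c)).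
    move=> s /= [/andP[s1 s2]]; rewrite ltr_norml => /andP[_ s3].
    by apply/andP; split => //; lra.
  by apply: dg; rewrite /seg /= at_ ltW.
- apply: (@deriv_on_local _ _ _ _ (t - c)); first by rewrite subr_gt0.
  apply: (@eq_deriv_on _ h).
  + by split => /=; [apply/andP | rewrite subrr normr0 subr_gt0].
  + move=> s /= [_]; rewrite ltr_norml => /andP[s2 _].
    by have /negbTE-> : ~~ (s <= c) by rewrite -ltNge; lra.
  apply: (@deriv_on_sub (seg c b)).
    move=> s /= [/andP[s1 s2]]; rewrite ltr_norml => /andP[s3 _].
    by apply/andP; split => //; lra.
  by apply: dh; rewrite /seg /= tb ltW.
- move=> e e0; subst t.
  have [|r r0 H] := dg _ _ e0; first by rewrite /seg /= at_ lexx.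
  have [|r' r'0 H'] := dh _ _ e0; first by rewrite /seg /= tb lexx.
  rewrite lexx; exists (Num.min r r'); first by rewrite lt_min r0.
  move=> s /andP[s1 s2]; rewrite lt_min => /andP[s3 s4].
  case: (leP s c) => sc /=; first by apply: H => //; apply/andP.
  by rewrite gh; apply: H' => //; apply/andP; split => //; exact: ltW.
Qed.

End curves.

(** * Ordinary differential equations *)

Section ode.
Context {R : realType} {E : normedModType R}.
Variables (Om : set E) (v : R -> E -> E).
Hypothesis cE : seq_complete E.
Hypothesis v_lip : forall (t : R) y, 0 <= t -> Om y -> exists d L : R,
  [/\ 0 < d, 0 <= L, forall y', `|y' - y| <= d -> Om y' &
      forall (s : R) y1 y2, 0 <= s -> `|s - t| <= d ->
        `|y1 - y| <= d -> `|y2 - y| <= d ->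
        `|v s y1 - v s y2| <= L * `|y1 - y2|].
Hypothesis v_cont : forall (t : R) y, 0 <= t -> Om y -> forall e : R, 0 < e ->
  exists2 d : R, 0 < d & forall (s : R) y', 0 <= s -> `|s - t| <= d ->
    `|y' - y| <= d -> `|v s y' - v t y| <= e.

Definition ode_on (a b : R) (z : R -> E) := forall t, seg a b t ->
  Om (z t) /\ deriv_on (seg a b) z t (v t (z t)).

Lemma field_along_cont J (g : R -> E) t : (forall s, J s -> 0 <= s) -> J t ->
  Om (g t) -> cont_on J g t -> cont_on J (fun s => v s (g s)) t.
Proof.
move=> J0 Jt gt gc e e0; have [d d0 H] := v_cont (J0 t Jt) gt e0.
have [r r0 Hr] := gc _ d0.
exists (Num.min d r); first by rewrite lt_min d0.
move=> s Js; rewrite lt_min => /andP[sd sr].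
by apply: H; [exact: J0 | exact: ltW | exact: Hr].
Qed.

Section picard.
Variables (a h d C L : R) (y0 : E).
Hypotheses (a0 : 0 <= a) (h0 : 0 < h) (d0 : 0 < d) (C0 : 0 <= C) (L0 : 0 <= L).
Hypothesis ball_Om : forall y', `|y' - y0| <= d -> Om y'.
Hypothesis lip : forall s y1 y2, seg a (a + h) s ->
  `|y1 - y0| <= d -> `|y2 - y0| <= d -> `|v s y1 - v s y2| <= L * `|y1 - y2|.
Hypothesis bnd : forall s y, seg a (a + h) s -> `|y - y0| <= d -> `|v s y| <= C.
Hypotheses (hC : C * h <= d) (hL : L * h <= 1 / 2).

Let good (z : R -> E) := forall t, seg a (a + h) t ->
  `|z t - y0| <= d /\ cont_on (seg a (a + h)) z t.

(** The Picard iterate is a relation because antiderivatives are only known to exist. *)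
Let next (z z' : R -> E) := [/\ good z', z' a = y0 &
  forall t, seg a (a + h) t -> deriv_on (seg a (a + h)) z' t (v t (z t))].

Let aah : a <= a + h. Proof. by rewrite lerDl ltW. Qed.
Let aa : seg a (a + h) a. Proof. by rewrite /seg /= lexx. Qed.
Let sub t : seg a (a + h) t -> seg a t `<=` seg a (a + h).
Proof.
move=> /andP[_ th] s /andP[s1 s2]; rewrite /seg /= s1.
exact: le_trans th.
Qed.

Let nextP z : good z -> exists z', next z z'.
Proof.
move=> gz.
have wc t : seg a (a + h) t -> cont_on (seg a (a + h)) (fun s => v s (z s)) t.
  move=> at_; apply: field_along_cont => //.
  - by move=> s /andP[/(le_trans a0)].
  - by apply: ball_Om; case: (gz t at_).
  - by case: (gz t at_).
have [W hW] := antiderivative wc cE aah.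
have dz t : seg a (a + h) t ->
    deriv_on (seg a (a + h)) (fun t => W t + (y0 - W a)) t (v t (z t)).
  move=> at_; rewrite -[v t _]addr0; apply: deriv_onD; first exact: hW.
  exact: deriv_on_cst.
exists (fun t => W t + (y0 - W a)); split => //; last by rewrite addrC subrK.
move=> t at_; split; last exact: deriv_cont (dz t at_).
have -> : W t + (y0 - W a) - y0 = W t - W a by linear_over R.
apply: (@le_trans _ _ (C * (t - a))); last first.
  apply: le_trans hC; apply: ler_wpM2l => //.
  by move: at_ => /andP[_]; lra.
apply: (@deriv_bound _ _ _ _ _ _ (fun t => v t (z t))).
- by case/andP: at_.
- by move=> s /(sub at_) /hW; apply: deriv_on_sub; exact: sub.
- by move=> s /(sub at_) asb; apply: bnd => //; case: (gz s asb).
Qed.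

(** The difference of the iterates vanishes at a and its derivative is at most L D; over a length h
    with L h <= 1/2 this halves the distance. *)
Let next_dist z1 z2 z1' z2' (D : R) : good z1 -> good z2 ->
  next z1 z1' -> next z2 z2' ->
  (forall t, seg a (a + h) t -> `|z1 t - z2 t| <= D) ->
  forall t, seg a (a + h) t -> `|z1' t - z2' t| <= D / 2.
Proof.
move=> g1 g2 [_ e1 d1] [_ e2 d2] hD t at_.
have D0 : 0 <= D by apply: le_trans (hD a aa); exact: normr_ge0.
apply: (@le_trans _ _ (L * D * (t - a))); last first.
  rewrite mulrAC (mulrC D); apply: le_trans (_ : 1 / 2 * D <= _); last lra.
  apply: ler_wpM2r => //; apply: le_trans hL; apply: ler_wpM2l => //.
  by move: at_ => /andP[_]; lra.
have -> : z1' t - z2' t = (z1' t - z2' t) - (z1' a - z2' a).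
  by rewrite e1 e2 subrr subr0.
apply: (@deriv_bound _ _ _ _ _ (fun t => z1' t - z2' t)
  (fun t => v t (z1 t) - v t (z2 t))).
- by case/andP: at_.
- move=> s /(sub at_) asb; apply: (deriv_on_sub (sub at_)).
  by apply: deriv_onB; [exact: d1 | exact: d2].
- move=> s /(sub at_) asb.
  apply: le_trans (lip asb _ _) _; [by case: (g1 s asb)|by case: (g2 s asb)|].
  by apply: ler_wpM2l => //; exact: hD.
Qed.

(** Iteration from the constant curve y0: the differences halve, so the iterates converge uniformly
    and the limit stays in the ball and is continuous. *)
Lemma picard : exists2 z, z a = y0 & ode_on a (a + h) z.
Proof.
have /choice[nx hnx] : forall z, exists z', good z -> next z z'.
  move=> z; have [/nextP[z' ?]|nz] := pselect (good z); first by exists z'.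
  by exists z.
pose zn n := iter n nx (fun=> y0).
have zn_good n : good (zn n).
  elim: n => [t _|n IH] /=; last by case: (hnx _ IH).
  by rewrite subrr normr0 ltW //; split => //; exact: cont_on_cst.
have zn_next n : next (zn n) (zn n.+1) by exact: hnx.
have zn_dist n : forall t, seg a (a + h) t -> `|zn n.+1 t - zn n t| <= d / 2 ^+ n.
  elim: n => [t at_|n IH t at_].
    by rewrite expr0 divr1; case: (zn_good 1%N t at_).
  by rewrite halvingS; apply: (next_dist (zn_good n.+1) (zn_good n)).
have /choice[z hz] : forall t, exists l, seg a (a + h) t ->
    forall n, `|zn n t - l| <= 2 * d / 2 ^+ n.
  move=> t; have [at_|nt] := pselect (seg a (a + h) t); last by exists 0.
  have [l hl] := halving_limit cE (fun n => zn_dist n t at_).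
  by exists l.
have gz : good z.
  move=> t at_; split.
    apply/ler_addgt0Pr => e e0; have [n hn] := small_halving (2 * d) e0.
    have := ler_distD (zn n t) (z t) y0; rewrite (distrC (z t) (zn n t)).
    have := hz t at_ n; have [] := zn_good n t at_; lra.
  move=> e e0; have e30 : 0 < e / 3 by rewrite divr_gt0.
  have [n hn] := small_halving (2 * d) e30.
  have [_ /(_ _ e30)[r r0 H]] := zn_good n t at_.
  exists r => // s as_ st; have := H s as_ st.
  have := ler_distD (zn n s) (z s) (z t).
  have := ler_distD (zn n t) (zn n s) (z t).
  have := hz t at_ n; have := hz s as_ n; rewrite (distrC (z s) (zn n s)); lra.
have nz := hnx _ gz; have [gz' z'a dz'] := nz.
(* The limit and its own iterate are both approached by the sequence [zn], since one iteration
   halves the distance; hence the limit is a fixed point. *)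
have same t : seg a (a + h) t -> nx z t = z t.
  move=> at_; apply/eqP; rewrite -subr_eq0 -normr_le0.
  apply: (@le0_halving _ _ (2 * d)) => n.
  have h1 : `|nx z t - zn n.+1 t| <= 2 * d / 2 ^+ n / 2.
    apply: (next_dist gz (zn_good n) nz (zn_next n)) => // s as_.
    by rewrite distrC; exact: hz.
  have := ler_distD (zn n.+1 t) (nx z t) (z t).
  have := hz t at_ n.+1; rewrite halvingS; lra.
exists (nx z) => // t at_; rewrite same //; split; last exact: dz'.
by apply: ball_Om; case: (gz t at_).
Qed.

End picard.

Lemma ode_local (a : R) y0 : 0 <= a -> Om y0 ->
  exists2 h : R, 0 < h & exists2 z, z a = y0 & ode_on a (a + h) z.
Proof.
move=> a0 y0Om; have [d [L [d0 L0 bO lip]]] := v_lip a0 y0Om.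
have [r r0 H] := v_cont a0 y0Om ltr01.
pose d' := Num.min d r.
have [d'd d'r] : d' <= d /\ d' <= r by rewrite !ge_min !lexx orbT.
have d'0 : 0 < d' by rewrite lt_min d0.
pose C := `|v a y0| + 1.
have C0 : 0 < C by rewrite ltr_wpDl.
have L20 : 0 < 2 * L + 1 by rewrite ltr_wpDl ?mulr_ge0.
(* The three bounds keep the time in the ball, give C h <= d' so that iterates stay in it, and give
   L h <= 1/2; the summand 1 avoids dividing by L = 0. *)
pose h := Num.min d' (Num.min (d' / C) ((2 * L + 1)^-1)).
have h0 : 0 < h by rewrite lt_min d'0 lt_min divr_gt0 // invr_gt0.
have [hd' hC hL] : [/\ h <= d', h <= d' / C & h <= (2 * L + 1)^-1].
  have := lexx h; rewrite {2}/h le_min => /andP[-> ].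
  by rewrite le_min => /andP[-> ->].
exists h => //; apply: (@picard a h d' C L) => //.
- exact: ltW.
- by move=> y' y'd; apply: bO; exact: le_trans d'd.
- move=> s y1 y2 /andP[s1 s2] h1 h2; apply: lip; first exact: le_trans s1.
  + by rewrite ger0_norm ?subr_ge0 //; lra.
  + exact: le_trans d'd.
  + exact: le_trans d'd.
- move=> s y /andP[s1 s2] yd.
  have := H s y (le_trans a0 s1); rewrite ger0_norm ?subr_ge0 // => /(_ _ _).
  have := ler_normD (v s y - v a y0) (v a y0); rewrite subrK /C => h1 h2.
  have : `|v s y - v a y0| <= 1 by apply: h2; lra.
  lra.
- by rewrite mulrC -ler_pdivlMr.
- move: hL; rewrite -(ler_pM2r L20) mulVf ?gt_eqF //.
  have := ltW h0; nra.
Qed.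

Lemma ode_sub a b c z : c <= b -> ode_on a b z -> ode_on a c z.
Proof.
move=> cb hz t /andP[at_ tc].
have sub : seg a c `<=` seg a b.
  by move=> s /andP[s1 s2]; rewrite /seg /= s1 (le_trans s2).
have [|Oz dz] := hz t; first by apply: sub; rewrite /seg /= at_.
by split => //; exact: deriv_on_sub dz.
Qed.

(** Agreement at c spreads over a length h with L h <= 1/2, because every bound on the difference
    can be halved there; agreement before c passes to c by continuity. *)
Lemma ode_unique (a b : R) z1 z2 : 0 <= a -> ode_on a b z1 -> ode_on a b z2 ->
  z1 a = z2 a -> forall t, seg a b t -> z1 t = z2 t.
Proof.
move=> a0 h1 h2 e12 t /andP[at_ tb].
apply: (@real_induction _ a t (fun t => z1 t = z2 t)) => //.
- move=> c /andP[ac ct] ec.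
  have abc : seg a b c by rewrite /seg /= ac (le_trans (ltW ct)).
  have c0 := le_trans a0 ac.
  have [Oz1 d1] := h1 c abc; have [Oz2 d2] := h2 c abc.
  have [d [L [d0 L0 bO lip]]] := v_lip c0 Oz1.
  have [r1 r10 H1] := deriv_cont d1 d0; have [r2 r20 H2] := deriv_cont d2 d0.
  have L20 : 0 < 2 * L + 1 by rewrite ltr_wpDl ?mulr_ge0.
  pose h := Num.min (Num.min d (Num.min r1 r2) / 2) ((2 * L + 1)^-1).
  have h0 : 0 < h by rewrite !lt_min ?divr_gt0 ?invr_gt0 // !lt_min d0 r10.
  have [hd hr1 hr2] : [/\ h <= d / 2, h <= r1 / 2 & h <= r2 / 2].
    have : h <= Num.min d (Num.min r1 r2) / 2 by rewrite ge_min lexx.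
    rewrite ler_pdivlMr // !le_min => /andP[q1 /andP[q2 q3]]; split; lra.
  have hL : h * L <= 1 / 2.
    have : h <= (2 * L + 1)^-1 by rewrite ge_min lexx orbT.
    rewrite -(ler_pM2r L20) mulVf ?gt_eqF //; have := ltW h0; nra.
  exists h => // s cs sh st.
  have sub p : seg c s p -> seg a b p.
    move=> /andP[p1 p2]; rewrite /seg /= (le_trans ac) //=.
    by rewrite (le_trans p2) // (le_trans st).
  have near p : seg c s p -> `|p - c| <= h.
    by move=> /andP[p1 p2]; rewrite ger0_norm ?subr_ge0 //; lra.
  have b1 p : seg c s p -> `|z1 p - z1 c| <= d.
    by move=> cp; apply: H1; [exact: sub | have := near p cp; lra].
  have b2 p : seg c s p -> `|z2 p - z1 c| <= d.
    by move=> cp; rewrite ec; apply: H2; [exact: sub | have := near p cp; lra].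
  (* The initial bound 2 d only says that both curves are in the ball of radius d; inserting a bound
     in the Lipschitz estimate returns half of it. *)
  have bound n : forall p, seg c s p -> `|z1 p - z2 p| <= (2 * d) / 2 ^+ n.
    elim: n => [|n IH] p cp.
      have := ler_distD (z1 c) (z1 p) (z2 p); rewrite expr0 divr1.
      have := b1 p cp; have := b2 p cp; rewrite (distrC (z2 p)); lra.
    rewrite halvingS; set D := 2 * d / 2 ^+ n.
    have D0 : 0 <= D by rewrite !mulr_ge0 ?invr_ge0 ?exprn_ge0 // ltW.
    have subp : seg c p `<=` seg c s.
      move: cp => /andP[_ ps] q /andP[q1 q2]; rewrite /seg /= q1.
      exact: le_trans ps.
    have -> : z1 p - z2 p = (z1 p - z2 p) - (z1 c - z2 c).
      by rewrite ec subrr subr0.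
    apply: (@le_trans _ _ (L * D * (p - c))); last first.
      have := near p cp; rewrite ger0_norm ?subr_ge0; last by case/andP: cp.
      have : 0 <= L * D by rewrite mulr_ge0.
      nra.
    apply: (@deriv_bound _ _ _ _ _ (fun t => z1 t - z2 t)
        (fun t => v t (z1 t) - v t (z2 t))).
    + by case/andP: cp.
    + move=> q cq; have abq := sub _ (subp _ cq).
      have subq : seg c p `<=` seg a b by move=> x /subp; exact: sub.
      apply: (deriv_on_sub subq).
      by apply: deriv_onB; [case: (h1 q abq) | case: (h2 q abq)].
    + move=> q cq; have cq' := subp _ cq.
      apply: le_trans (lip _ _ _ _ _ _ _) _.
      * by case/andP: cq => q1 _; exact: le_trans q1.
      * have := near q cq'; lra.
      * exact: b1.
      * exact: b2.
      * by apply: ler_wpM2l => //; exact: IH.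
  apply/eqP; rewrite -subr_eq0 -normr_le0.
  by apply: (@le0_halving _ _ (2 * d)) => n; apply: bound; rewrite /seg /= cs lexx.
- move=> c /andP[ac ct] ec.
  have abc : seg a b c by rewrite /seg /= (ltW ac) (le_trans ct).
  have [_ /deriv_cont d1] := h1 c abc; have [_ /deriv_cont d2] := h2 c abc.
  apply/eqP; rewrite -subr_eq0 -normr_le0.
  apply/ler_addgt0Pr => e e0; rewrite add0r.
  have e20 : 0 < e / 2 by rewrite divr_gt0.
  have [r1 r10 H1] := d1 _ e20; have [r2 r20 H2] := d2 _ e20.
  pose r := Num.min r1 r2; pose s := Num.max a (c - r / 2).
  have r0 : 0 < r by rewrite lt_min r10.
  have rr : r <= r1 /\ r <= r2 by rewrite !ge_min !lexx orbT.
  have [as_ sc rs] : [/\ a <= s, s < c & c - r / 2 <= s].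
    rewrite le_max lexx gt_max ac /= ltrBlDr -ltrBlDl subrr divr_gt0 //.
    by rewrite le_max lexx orbT.
  have abs : seg a b s by rewrite /seg /= as_ (le_trans (ltW sc)) // (le_trans ct).
  have sr : `|s - c| < r by rewrite distrC gtr0_norm ?subr_gt0 //; lra.
  have := H1 s abs; have := H2 s abs; rewrite ec ?as_ //.
  have := ler_distD (z2 s) (z1 c) (z2 c); rewrite (distrC (z1 c) (z2 s)).
  case: rr => rr1 rr2 h q1 q2.
  have : `|z2 s - z2 c| <= e / 2 by apply: q1; exact: lt_le_trans rr2.
  have : `|z2 s - z1 c| <= e / 2 by apply: q2; exact: lt_le_trans rr1.
  lra.
Qed.

Lemma ode_glue a b c z1 z2 : a <= c -> c <= b -> z1 c = z2 c ->
  ode_on a c z1 -> ode_on c b z2 ->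
  ode_on a b (fun t => if t <= c then z1 t else z2 t).
Proof.
move=> ac cb e12 h1 h2 t /andP[at_ tb]; split.
  case: (leP t c) => tc; first by case: (h1 t) => //; rewrite /seg /= at_.
  by case: (h2 t) => //; rewrite /seg /= tb ltW.
apply: deriv_on_glue => //; last by rewrite /seg /= at_.
- by move=> act; case: leP (h1 t act) => [_ []//|]; case/andP: act; lra.
- move=> cbt; have [_] := h2 t cbt; case: leP => // tc.
  have -> : t = c by case/andP: cbt => ct _; apply/le_anti/andP.
  by rewrite e12.
Qed.

(** The supremum of the ends of all solutions is [tmax]. Were [tmax] = b finite and y in the domain
    a limit of z at b, [closing] would turn z completed by y into a solution on [a, b], and a local
    solution from y would lead beyond the supremum. *)
Theorem ode_maximal (a : R) y0 : 0 <= a -> Om y0 ->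
  exists2 tmax : \bar R, (a%:E < tmax)%E & exists z : R -> E,
  [/\ z a = y0, forall b, (b%:E < tmax)%E -> ode_on a b z &
      forall b, tmax = b%:E -> ~ exists2 y, Om y & forall e : R, 0 < e ->
        exists2 r : R, 0 < r & forall t, a <= t < b -> b - t < r ->
          `|z t - y| <= e].
Proof.
move=> a0 y0Om.
pose S := [set b | a <= b /\ exists2 z, z a = y0 & ode_on a b z].
pose tmax := ereal_sup [set b%:E | b in S].
have leS b : S b -> (b%:E <= tmax)%E by move=> Sb; apply: ereal_sup_ubound; exists b.
have [h h0 hz0] := ode_local a0 y0Om.
have aah : a <= a + h by rewrite lerDl ltW.
have atmax : (a%:E < tmax)%E.
  apply: (@lt_le_trans _ _ (a + h)%:E); first by rewrite lte_fin ltrDl.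
  by apply: leS; split.
exists tmax => //.
have /choice[sol hsol] : forall b, exists z, S b -> z a = y0 /\ ode_on a b z.
  move=> b; have [[_ [z za hz]]|nb] := pselect (S b); first by exists z.
  by exists (fun=> 0).
have S_down (b c : R) : S b -> a <= c -> c <= b -> S c.
  by move=> [ab [z za hz]] ac cb; split => //; exists z => //; exact: ode_sub hz.
have ltS (b : R) : a <= b -> (b%:E < tmax)%E -> exists2 c, b < c & S c.
  move=> ab /ereal_sup_gt[_ [c Sc <-]]; rewrite lte_fin => bc.
  by exists c.
have ltS' (b : R) : a <= b -> (b%:E < tmax)%E -> S b.
  by move=> ab /(ltS b ab)[c bc Sc]; apply: S_down Sc ab (ltW bc).
(* The value at t is that of a solution chosen on [a, t]; by uniqueness these choices fit
   together. *)
pose z (t : R) := sol t t.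
have zE (b t : R) : S b -> seg a b t -> z t = sol b t.
  move=> Sb /andP[at_ tb]; have St := S_down _ _ Sb at_ tb.
  have [e1 o1] := hsol t St; have [e2 o2] := hsol b Sb.
  apply: (ode_unique a0 o1 (ode_sub tb o2)); first by rewrite e1 e2.
  by rewrite /seg /= at_ lexx.
have Sah : S (a + h) by split.
have Sa : S a by exact: S_down Sah _ aah.
have za : z a = y0 by have [] := hsol a Sa.
have zode b : S b -> ode_on a b z.
  move=> Sb t abt; have [_ o] := hsol b Sb; have [Oz dz] := o t abt.
  rewrite (zE b) //; split => //.
  by apply: eq_deriv_on dz => // s abs; rewrite (zE b).
exists z; split => //.
  move=> b bt t abt; apply: (zode b) => //.
  by apply: ltS' => //; case/andP: abt; exact: le_trans.
move=> b bE [y yOm ylim].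
have ab : a < b by rewrite -lte_fin -bE.
have lt_tmax t : t < b -> (t%:E < tmax)%E by rewrite bE lte_fin.
pose zb t := if t < b then z t else y.
have zbb : zb b = y by rewrite /zb ltxx.
have zbz t : t < b -> zb t = z t by rewrite /zb => ->.
have zb_ode t : a <= t < b -> Om (zb t) /\ deriv_on (seg a b) zb t (v t (zb t)).
  move=> /andP[at_ tb].
  pose q := (t + b) / 2.
  have [tq qb] : t < q /\ q < b by rewrite /q; split; lra.
  have Sq : S q by apply: ltS'; [exact: le_trans (ltW tq) | exact: lt_tmax].
  have [|Oz dz] := zode q Sq t; first by rewrite /seg /= at_ ltW.
  rewrite zbz //; split => //.
  apply: (@deriv_on_local _ _ _ _ _ _ (q - t)); first by rewrite subr_gt0.
  apply: (@eq_deriv_on _ _ _ z).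
  - by split => /=; rewrite ?subrr ?normr0 ?subr_gt0 // /seg /= at_ ltW.
  - by move=> s /= [_ /ltr_normlP[_ s2]]; rewrite zbz //; lra.
  apply: deriv_on_sub dz => s /= [/andP[s1 _] /ltr_normlP[_ s2]].
  by rewrite /seg /= s1; lra.
have zbc t : seg a b t -> Om (zb t) /\ cont_on (seg a b) zb t.
  move=> /andP[at_]; rewrite le_eqVlt => /orP[/eqP->|tb]; last first.
    have [|Oz dz] := zb_ode t; first by rewrite at_.
    by split => //; exact: deriv_cont dz.
  rewrite zbb; split => // e e0; have [r r0 H] := ylim e e0.
  exists r => // s /andP[s1]; rewrite le_eqVlt => /orP[/eqP->|sb] sr.
    by rewrite subrr normr0 ltW.
  rewrite zbb zbz //; apply: H; first by rewrite s1.
  by apply: le_lt_trans sr; rewrite distrC ler_norm.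
have zb_on : ode_on a b zb.
  move=> t abt; split; first by case: (zbc t abt).
  apply: (@closing _ _ a b zb (fun t => v t (zb t))) => //.
  - exact: ltW.
  - by move=> s /zbc[].
  - move=> s abs; apply: field_along_cont => //.
    + by move=> x /andP[/(le_trans a0)].
    + by case: (zbc s abs).
    + by case: (zbc s abs).
  - by move=> s /andP[s1 s2]; case: (zb_ode s) => //; rewrite s2 ltW.
have b0 : 0 <= b by apply: le_trans (ltW ab).
have [h' h'0 [z' z'b z'o]] := ode_local b0 yOm.
have : S (b + h').
  split; first by apply: le_trans (ltW ab) _; rewrite lerDl ltW.
  exists (fun t => if t <= b then zb t else z' t).
    by rewrite (ltW ab) zbz.
  apply: ode_glue zb_on z'o; [exact: ltW | by rewrite lerDl ltW | by rewrite zbb].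
by move=> /leS; rewrite bE lee_fin gerDl leNgt h'0.
Qed.

End ode.

(** * The implicit function theorem *)

Section subspaces.
Context {R : realType}.
Implicit Types X Y : normedModType R.

Definition subspace X (E : set X) :=
  E 0 /\ forall (a : R) x y, E x -> E y -> E (a *: x + y).

Definition norm_closed X (E : set X) :=
  forall x, (forall e : R, 0 < e -> exists2 y, E y & `|x - y| <= e) -> E x.

Definition linear_on X Y (E : set X) (Z : X -> Y) :=
  forall (a : R) x y, E x -> E y -> Z (a *: x + y) = a *: Z x + Z y.

Lemma subspaceD X (E : set X) x y : subspace E -> E x -> E y -> E (x + y).
Proof. by move=> [_ h] Ex Ey; rewrite -[x]scale1r; exact: h. Qed.

Lemma subspaceZ X (E : set X) a x : subspace E -> E x -> E (a *: x).
Proof. by move=> [E0 h] Ex; rewrite -[_ *: _]addr0; exact: h. Qed.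

Lemma subspaceN X (E : set X) x : subspace E -> E x -> E (- x).
Proof. by move=> sE Ex; rewrite -scaleN1r; exact: subspaceZ. Qed.

Lemma subspaceB X (E : set X) x y : subspace E -> E x -> E y -> E (x - y).
Proof. by move=> sE Ex Ey; apply: subspaceD => //; exact: subspaceN. Qed.

Lemma linear_on0 X Y (E : set X) (Z : X -> Y) : E 0 -> linear_on E Z -> Z 0 = 0.
Proof.
move=> E0 lZ; have := lZ 1 0 0 E0 E0; rewrite scaler0 addr0 scale1r => h.
by apply: (addrI (Z 0)); rewrite addr0 -h.
Qed.

Lemma linear_onD X Y (E : set X) (Z : X -> Y) x y : linear_on E Z ->
  E x -> E y -> Z (x + y) = Z x + Z y.
Proof. by move=> lZ Ex Ey; rewrite -[x]scale1r lZ // !scale1r. Qed.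

Lemma linear_onZ X Y (E : set X) (Z : X -> Y) a x : E 0 -> linear_on E Z ->
  E x -> Z (a *: x) = a *: Z x.
Proof.
by move=> E0 lZ Ex; rewrite -[_ *: x]addr0 lZ // (linear_on0 E0 lZ) addr0.
Qed.

Lemma linear_onB X Y (E : set X) (Z : X -> Y) x y : linear_on E Z ->
  E x -> E y -> Z (x - y) = Z x - Z y.
Proof.
by move=> lZ Ex Ey; rewrite addrC -scaleN1r lZ // scaleN1r addrC.
Qed.

(* K bounds the norm of the inverse of Z *)
Definition iso_on X Y (K : R) (E : set X) (F : set Y) (Z : X -> Y) :=
  [/\ linear_on E Z, forall x, E x -> F (Z x),
      forall x, E x -> `|x| <= K * `|Z x|
    & forall y, F y -> exists2 x, E x & Z x = y].

(** Psi minus the linear map Z is e-Lipschitz on a ball of E: strict differentiability at x0 in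
    quantitative form, which is also the shape of the assumption on F_20. *)
Definition close_on X Y (E : set X) (Z Psi : X -> Y) (x0 : X) (r e : R) :=
  forall x y, E x -> E y -> `|x - x0| <= r -> `|y - x0| <= r ->
    `|Psi x - Psi y - Z (x - y)| <= e * `|x - y|.

Lemma close_on_le X Y (E : set X) (Z Psi : X -> Y) x0 r r' e : r' <= r ->
  close_on E Z Psi x0 r e -> close_on E Z Psi x0 r' e.
Proof.
by move=> rr h x y Ex Ey hx hy; apply: h => //; exact: le_trans rr.
Qed.

(** Z is bounded below by 1 / K and Psi deviates from it by an e-Lipschitz map. For K e < 1 this
    controls how a root moves when the equation is perturbed. *)
Lemma inverse_estimate X Y (E : set X) (F : set Y) (Z Psi : X -> Y) x0
    (K r e : R) x y : subspace E -> iso_on K E F Z -> 0 <= K ->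
  close_on E Z Psi x0 r e -> E x -> E y -> `|x - x0| <= r -> `|y - x0| <= r ->
  (1 - K * e) * `|x - y| <= K * `|Psi x - Psi y|.
Proof.
move=> sE [lZ FZ low _] K0 cl Ex Ey hx hy.
have h1 := low _ (subspaceB sE Ex Ey).
have h2 := cl _ _ Ex Ey hx hy.
have : `|Z (x - y)| <= `|Psi x - Psi y| + e * `|x - y|.
  have := ler_distD (Psi x - Psi y) (Z (x - y)) 0.
  by rewrite !subr0 distrC; lra.
move=> /(ler_wpM2l K0); rewrite mulrDr mulrA; lra.
Qed.

Lemma geometric_small (q C e : R) : 0 <= q < 1 -> 0 <= C -> 0 < e ->
  exists N : nat, forall n, (N <= n)%N -> C * q ^+ n <= e.
Proof.
move=> /andP[q0 q1] C0 e0.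
have nq : `|q| < 1 by rewrite ger0_norm.
have C10 : 0 < C + 1 by rewrite ltr_wpDl.
have := cvg_expr nq; move/cvgrPdist_lt/(_ (e / (C + 1))).
rewrite divr_gt0 // => /(_ isT) [N _ H]; exists N => n Nn.
have := H n Nn; rewrite sub0r normrN ger0_norm ?exprn_ge0 //.
rewrite ltr_pdivlMr // mulrDr mulr1 mulrC.
have : 0 <= q ^+ n by rewrite exprn_ge0.
lra.
Qed.

(** Newton's iteration with frozen derivative: x - Z^-1 (Psi x) contracts with factor K e, and the
    smallness of Psi x0 makes the first step at most (1 - K e) r, so that the iterates never leave
    the ball. *)
Lemma implicit_exists X Y (E : set X) (F : set Y) (Z Psi : X -> Y) x0
    (K r e : R) : seq_complete X -> subspace E -> norm_closed E ->
  subspace F -> iso_on K E F Z -> 0 <= K -> 0 <= e -> K * e < 1 -> 0 <= r ->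
  E x0 -> (forall x, E x -> `|x - x0| <= r -> F (Psi x)) ->
  close_on E Z Psi x0 r e -> K * `|Psi x0| <= (1 - K * e) * r ->
  exists x, [/\ E x, `|x - x0| <= r & Psi x = 0].
Proof.
move=> cX sE clE sF isoZ K0 e0 Ke r0 Ex0 FPsi cl small.
have [lZ FZ low surj] := isoZ.
pose q := K * e.
have q0 : 0 <= q by rewrite mulr_ge0.
have q1 : 0 < 1 - q by rewrite subr_gt0.
(* [G] picks a preimage under Z of each point of F; differences of its values are estimated after
   applying Z to them. *)
have /choice[G hG] : forall y, exists x, F y -> E x /\ Z x = y.
  by move=> y; have [/surj[x Ex <-]|ny] := pselect (F y); [exists x | exists 0].
pose T x := x - G (Psi x).
pose u n := iter n T x0.
have in_ball x : E x -> `|x - x0| <= r -> E (G (Psi x)) /\ Z (G (Psi x)) = Psi x.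
  by move=> Ex hx; apply: hG; exact: FPsi.
have T_dist x y : E x -> E y -> `|x - x0| <= r -> `|y - x0| <= r ->
    `|T x - T y| <= q * `|x - y|.
  move=> Ex Ey hx hy; have [Gx Zx] := in_ball x Ex hx; have [Gy Zy] := in_ball y Ey hy.
  have ET : E (T x - T y) by rewrite /T; do 2!apply: subspaceB => //; exact: subspaceB.
  apply: le_trans (low _ ET) _; rewrite /q -mulrA; apply: ler_wpM2l => //.
  have -> : T x - T y = (x - y) - (G (Psi x) - G (Psi y)) by rewrite /T; linear_over R.
  rewrite (linear_onB lZ); [|exact: subspaceB|exact: subspaceB].
  rewrite (linear_onB lZ Gx Gy) Zx Zy distrC.
  exact: cl.
have u0_dist : `|u 1%N - u 0%N| <= (1 - q) * r.
  have [Gx Zx] : E (G (Psi x0)) /\ Z (G (Psi x0)) = Psi x0.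
    by apply: in_ball; rewrite // subrr normr0.
  rewrite /u /= /T addrAC subrr add0r normrN.
  by apply: le_trans (low _ Gx) _; rewrite Zx.
(* The partial sums of the geometric series of steps give the radius (1 - q^n) r, which is what
   makes the induction close. *)
have u_ball n : E (u n) /\ (`|u n - x0| <= (1 - q ^+ n) * r /\
     `|u n.+1 - u n| <= q ^+ n * ((1 - q) * r)).
  elim: n => [|n [En [hn dn]]].
    by rewrite expr0 !subrr normr0 mul0r mul1r.
  have le_r m : (1 - q ^+ m) * r <= r.
    by rewrite mulrBl mul1r gerBl mulr_ge0 // exprn_ge0.
  have hn' : `|u n - x0| <= r by exact: le_trans hn (le_r n).
  have En1 : E (u n.+1).
    rewrite /u /= -/(u n) /T; apply: subspaceB => //.
    by have [] := in_ball _ En hn'.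
  have hn1 : `|u n.+1 - x0| <= (1 - q ^+ n.+1) * r.
    apply: le_trans (ler_distD (u n) _ _) _.
    apply: le_trans (lerD dn hn) _; rewrite exprS.
    by rewrite [X in X <= _](_ : _ = (1 - q * q ^+ n) * r) //; ring.
  split => //; split => //.
  apply: le_trans (T_dist _ _ En1 En (le_trans hn1 (le_r _)) hn') _.
  by rewrite exprS -mulrA; apply: ler_wpM2l.
have uE n : E (u n) by case: (u_ball n).
have ur n : `|u n - x0| <= r.
  have [_ [h _]] := u_ball n; apply: le_trans h _.
  by rewrite mulrBl mul1r gerBl mulr_ge0 // exprn_ge0.
have uD m n : `|u (m + n)%N - u n| <= q ^+ n * r.
  suff : `|u (m + n)%N - u n| <= (1 - q ^+ m) * (q ^+ n * r).
    move/le_trans; apply; rewrite ler_piMl //; first by rewrite mulr_ge0 // exprn_ge0.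
    by rewrite gerBl exprn_ge0.
  elim: m => [|m IH]; first by rewrite add0n !subrr normr0 mul0r.
  apply: le_trans (ler_distD (u (m + n)%N) _ _) _.
  have [_ [_ h]] := u_ball (m + n)%N; rewrite addSn.
  apply: le_trans (lerD h IH) _; rewrite exprD exprS.
  by rewrite [X in X <= _](_ : _ = (1 - q * q ^+ m) * (q ^+ n * r)) //; ring.
have q01 : 0 <= q < 1 by rewrite q0 -subr_gt0.
have [|x hx] := cX u.
  move=> d d0; have [N HN] := geometric_small q01 r0 d0; exists N => m n Nm Nn.
  wlog mn : m n Nm Nn / (n <= m)%N.
    by move=> W; have [/W|/ltnW/W] := leqP n m; [exact | rewrite distrC; exact].
  by rewrite -(subnK mn); apply: le_trans (uD _ _) _; rewrite mulrC; exact: HN.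
have Ex : E x.
  apply: clE => d d0; have [N HN] := hx d d0; exists (u N) => //.
  by rewrite distrC; exact: HN.
have xr : `|x - x0| <= r.
  apply/ler_addgt0Pr => d d0; have [N HN] := hx d d0.
  have := ler_distD (u N) x x0; have := HN N (leqnn N); have := ur N.
  by rewrite (distrC x (u N)); lra.
exists x; split => //.
have Tx : T x = x.
  apply/eqP; rewrite -subr_eq0 -normr_le0; apply/ler_addgt0Pr => d d0; rewrite add0r.
  have d20 : 0 < d / 2 by rewrite divr_gt0.
  have [N HN] := hx _ d20.
  have h1 := HN N (leqnn N); have h2 := HN N.+1 (leqnSn N).
  have := T_dist _ _ Ex (uE N) xr (ur N); rewrite -/(u N.+1).
  have := ler_distD (u N.+1) (T x) x; rewrite distrC in h1.
  rewrite -[T (u N)]/(u N.+1).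
  have : q * `|x - u N| <= `|x - u N| by rewrite ler_piMl // ltW // -subr_gt0.
  lra.
have [GE ZG] := in_ball x Ex xr.
have G0 : G (Psi x) = 0.
  by apply/eqP; rewrite -oppr_eq0; apply/eqP; apply: (addrI x); rewrite addr0.
by rewrite -ZG G0; apply: (linear_on0 _ lZ); case: sE.
Qed.

(** Differentiating Psi s (z s) = 0 suggests Z w = - a. Only the curve s -> Psi s (z t) with frozen
    second argument is differentiated; strict closeness to Z, uniform for s near t, handles the
    motion of z. *)
Lemma implicit_deriv X Y (E : set X) (F : set Y) (Z : X -> Y)
    (Psi : R -> X -> Y) (J : set R) (t : R) (z : R -> X) (a : Y) (K r : R) :
  subspace E -> subspace F -> iso_on K E F Z -> 0 <= K -> 0 < r -> J t ->
  (forall s, J s -> E (z s) /\ Psi s (z s) = 0) -> cont_on J z t ->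
  (forall e : R, 0 < e -> exists d : R, [/\ 0 < d, d <= r &
     forall s, J s -> `|s - t| < d -> close_on E Z (Psi s) (z t) d e]) ->
  F a -> deriv_on J (fun s => Psi s (z t)) t a ->
  exists w, [/\ E w, Z w = - a & deriv_on J z t w].
Proof.
move=> sE sF isoZ K0 r0 Jt zE zc cl Fa da.
have [lZ FZ low surj] := isoZ.
have [w Ew Zw] := surj _ (subspaceN sF Fa).
exists w; split => // e e0.
have [Et Psit] := zE t Jt.
have K10 : 0 < K + 1 by rewrite ltr_wpDl.
(* |z s - z t| <= 2 K |Psi s (z t)| near t *)
have [C C0 [d1 d10 H1]] : exists2 C : R, 0 < C & exists2 d : R, 0 < d &
    forall s, J s -> `|s - t| < d -> `|z s - z t| <= C * `|s - t|.
  (* With this e the product K e is at most 1/2; K + 1 is used since K may be 0. *)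
  have [|d [d0 dr Hd]] := cl ((2 * (K + 1))^-1); first by rewrite invr_gt0 mulr_gt0.
  have [p p0 Hp] := zc _ d0.
  have [p' p'0 Hp'] := deriv_lip da.
  exists (2 * (K + 1) * (`|a| + 1)); first by rewrite !mulr_gt0 // ltr_wpDl.
  exists (Num.min (Num.min p p') d); first by rewrite !lt_min p0 p'0.
  move=> s Js; rewrite !lt_min => /andP[/andP[sp sp'] sd].
  have [Es Psis] := zE s Js.
  have h1 : `|z s - z t| <= d by exact: Hp.
  have h2 : `|z t - z t| <= d by rewrite subrr normr0 ltW.
  have := inverse_estimate sE isoZ K0 (Hd s Js sd) Es Et h1 h2.
  rewrite Psis sub0r normrN.
  have := Hp' s Js sp'; rewrite Psit subr0 => h3 h4.
  have Ke : K * (2 * (K + 1))^-1 <= 1 / 2.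
    by rewrite ler_pdivrMr ?mulr_gt0 //; lra.
  have h5 : (1 / 2) * `|z s - z t| <= (1 - K * (2 * (K + 1))^-1) * `|z s - z t|.
    by rewrite ler_wpM2r //; lra.
  have h6 : K * `|Psi s (z t)| <= (K + 1) * ((`|a| + 1) * `|s - t|).
    by apply: ler_pM => //; lra.
  lra.
(* One half of the error is the deviation of Psi s from Z, measured against the bound C |s - t| on
   the motion of z; the other half is the remainder of s -> Psi s (z t). The factor K + 1 pays for
   inverting Z. *)
have [|d2 [d20 d2r H2]] := cl (e / (2 * (K + 1) * C)).
  by rewrite divr_gt0 // !mulr_gt0.
have [|p p0 Hp] := da (e / (2 * (K + 1))); first by rewrite divr_gt0 // mulr_gt0.
have [p' p'0 Hp'] := zc _ d20.
exists (Num.min (Num.min d1 d2) (Num.min p p')); first by rewrite !lt_min d10 d20 p0.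
move=> s Js; rewrite !lt_min => /andP[/andP[s1 s2] /andP[s3 s4]].
have [Es Psis] := zE s Js.
have Ez : E (z s - z t) by exact: subspaceB.
have Ew' : E (z s - z t - (s - t) *: w).
  by apply: subspaceB => //; exact: subspaceZ.
apply: le_trans (low _ Ew') _.
have -> : Z (z s - z t - (s - t) *: w) =
    - (Psi s (z s) - Psi s (z t) - Z (z s - z t)) -
      (Psi s (z t) - Psi t (z t) - (s - t) *: a).
  rewrite (linear_onB lZ) //; last exact: subspaceZ.
  rewrite (linear_onZ _ _ lZ) //; last by case: sE.
  by rewrite Zw Psis Psit; linear_over R.
have h1 : `|Psi s (z s) - Psi s (z t) - Z (z s - z t)| <=
    e / (2 * (K + 1)) * `|s - t|.
  have : `|Psi s (z s) - Psi s (z t) - Z (z s - z t)| <=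
      e / (2 * (K + 1) * C) * `|z s - z t|.
    by apply: H2 => //; [exact: Hp' | rewrite subrr normr0 ltW].
  move/le_trans; apply.
  have := H1 s Js s1; rewrite -(ler_pM2l (x := e / (2 * (K + 1) * C))); last first.
    by rewrite divr_gt0 // !mulr_gt0.
  move/le_trans; apply; rewrite mulrA.
  by rewrite [_ / _ * C](_ : _ = e / (2 * (K + 1))) //; field; rewrite !gt_eqF.
have h2 := Hp s Js s3.
apply: le_trans (ler_wpM2l K0 (ler_normB _ _)) _; rewrite normrN.
apply: le_trans (ler_wpM2l K0 (lerD h1 h2)) _.
rewrite -mulrDl mulrA ler_wpM2r //.
rewrite (_ : e / (2 * (K + 1)) + e / (2 * (K + 1)) = e / (K + 1)); last first.
  by field; rewrite gt_eqF.
rewrite mulrCA ler_piMr ?(ltW e0) // ler_pdivrMr // mul1r.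
by rewrite lerDl.
Qed.

End subspaces.

Fixpoint all_prop (T : Type) (P : T -> Prop) (s : seq T) : Prop :=
  match s with [::] => True | x :: s' => P x /\ all_prop P s' end.

Lemma all_prop_cat (T : Type) (P : T -> Prop) s1 s2 :
  all_prop P s1 -> all_prop P s2 -> all_prop P (s1 ++ s2).
Proof. by elim: s1 => //= x s IH [Px /IH h] /h. Qed.

Lemma all_prop_sub (T : Type) (P Q : T -> Prop) s :
  (forall x, P x -> Q x) -> all_prop P s -> all_prop Q s.
Proof. by move=> PQ; elim: s => //= x s IH [/PQ ? /IH]. Qed.

(** * Multilinear maps along curves *)

Section multilinear.
Context {R : realType} {W Y : normedModType R}.
Variable V : set W.
Hypothesis sV : subspace V.
Implicit Types (J : set R) (N : seq W -> Y) (c : R -> W) (cs : seq (R -> W)).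

(** A map on lists, constrained only on lists of length n with entries in V: the format of the
    derivatives in [class_C]. *)
Definition multilinear n N :=
  (forall us vs (a : R) v w, (size us + size vs).+1 = n ->
     (forall z, z \in us ++ v :: w :: vs -> V z) ->
     N (us ++ (a *: v + w) :: vs) = a *: N (us ++ v :: vs) + N (us ++ w :: vs)) /\
  exists2 L : R, 0 <= L & forall vs, size vs = n ->
    (forall z, z \in vs -> V z) -> `|N vs| <= L * \prod_(v <- vs) `|v|.

Definition values cs (t : R) : seq W := [seq c t | c <- cs].

Lemma size_values cs t : size (values cs t) = size cs.
Proof. by rewrite size_map. Qed.

Lemma values_in cs t : all_prop (fun c => V (c t)) cs ->
  forall z, z \in values cs t -> V z.
Proof.
elim: cs => //= c cs IH [Vc /IH h] z; rewrite inE => /orP[/eqP->//|]; exact: h.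
Qed.

Lemma multilinear_cons n N v : V v -> multilinear n.+1 N ->
  multilinear n (fun l => N (v :: l)).
Proof.
move=> Vv [lin [L L0 bnd]]; split.
  move=> us vs a w w' sz h; apply: (lin (v :: us)); first by rewrite /= -sz.
  by move=> z; rewrite /= inE => /orP[/eqP->//|]; exact: h.
exists (L * `|v|) => [|vs sz h]; first exact: mulr_ge0.
have := bnd (v :: vs); rewrite big_cons mulrA; apply; first by rewrite /= sz.
by move=> z; rewrite inE => /orP[/eqP->//|]; exact: h.
Qed.

Lemma multilinear_head n N a v w vs : multilinear n.+1 N -> size vs = n ->
  V v -> V w -> (forall z, z \in vs -> V z) ->
  N ((a *: v + w) :: vs) = a *: N (v :: vs) + N (w :: vs).
Proof.
move=> [lin _] sz Vv Vw h; apply: (lin [::]); first by rewrite /= sz.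
by move=> z; rewrite /= !inE => /orP[/eqP->//|/orP[/eqP->//|]]; exact: h.
Qed.

Lemma multilinear_linear n N vs : multilinear n.+1 N -> size vs = n ->
  (forall z, z \in vs -> V z) -> linear_on V (fun v => N (v :: vs)).
Proof. by move=> mN sz h a v w Vv Vw; exact: (multilinear_head _ mN). Qed.

Lemma prod_values_bounded J cs t : all_prop (fun c => cont_on J c t) cs ->
  exists2 B : R, 0 < B & exists2 r : R, 0 < r & forall s, J s -> `|s - t| < r ->
    \prod_(v <- values cs s) `|v| <= B.
Proof.
elim: cs => [_|c cs IH /= [/cont_on_bounded[r r0 H] /IH[B B0 [r' r'0 H']]]].
  by exists 1 => //; exists 1 => // s _ _; rewrite big_nil.
exists ((`|c t| + 1) * B); first by rewrite mulr_gt0 // ltr_wpDl.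
exists (Num.min r r'); first by rewrite lt_min r0.
move=> s Js; rewrite lt_min => /andP[sr sr']; rewrite big_cons.
by apply: ler_pM => //; [exact: prodr_ge0 | exact: H | exact: H'].
Qed.

(** The first argument is split as (c s - c t) + c t. The term with the small head tends to 0
    because the other arguments are bounded near t; the term with frozen head is continuous by
    induction. *)
Lemma multilinear_cont J N cs t : J t -> multilinear (size cs) N ->
  all_prop (fun c => (forall s, J s -> V (c s)) /\ cont_on J c t) cs ->
  cont_on J (fun s => N (values cs s)) t.
Proof.
move=> Jt; elim: cs N => [|c cs IH] N mN /=; first by move=> _; exact: cont_on_cst.
move=> [[Vc cc] hcs].
have Vcs s : J s -> forall z, z \in values cs s -> V z.
  by move=> Js; apply: values_in; apply: all_prop_sub hcs => d [h _]; exact: h.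
have split_head s : J s ->
    N (c s :: values cs s) = N ((c s - c t) :: values cs s) + N (c t :: values cs s).
  move=> Js; rewrite -{1}(subrK (c t) (c s)) -[c s - c t]scale1r.
  rewrite (multilinear_head _ mN) ?size_values //; first by rewrite !scale1r.
  - by apply: subspaceB => //; exact: Vc.
  - exact: Vc.
  - exact: Vcs.
apply: (@eq_cont_on _ _ _ (fun s => N ((c s - c t) :: values cs s) +
    N (c t :: values cs s))) => //.
  by move=> s Js; rewrite -split_head.
apply: cont_onD; last first.
  exact: (IH _ (multilinear_cons (Vc t Jt) mN) hcs).
have [_ [L L0 bnd]] := mN.
have [|B B0 [r r0 HB]] := @prod_values_bounded J cs t.
  by apply: all_prop_sub hcs => d [].
have head0 : N ((c t - c t) :: values cs t) = 0.
  rewrite subrr; apply: (linear_on0 (E := V) (Z := fun v => N (v :: values cs t))).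
    by case: sV.
  by apply: multilinear_linear mN _ _; rewrite ?size_values //; exact: Vcs.
move=> e e0; have LB : 0 < (L + 1) * B by rewrite mulr_gt0 // ltr_wpDl.
have [|r' r'0 H] := cc (e / ((L + 1) * B)); first by rewrite divr_gt0.
exists (Num.min r r'); first by rewrite lt_min r0.
move=> s Js; rewrite lt_min => /andP[sr sr']; rewrite head0 subr0.
apply: le_trans (bnd _ _ _) _; first by rewrite /= size_values.
  move=> z; rewrite inE => /orP[/eqP->|]; last exact: Vcs.
  by apply: subspaceB => //; exact: Vc.
rewrite big_cons.
have h1 := H s Js sr'; have h2 := HB s Js sr.
apply: (@le_trans _ _ ((L + 1) * (e / ((L + 1) * B) * B))).
  apply: ler_pM => //; [|by lra|].
    by rewrite mulr_ge0 //; exact: prodr_ge0.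
  by apply: ler_pM => //; exact: prodr_ge0.
rewrite [X in X <= _](_ : _ = e) //; field.
by rewrite !gt_eqF // ltr_wpDl.
Qed.

(** Since the head vanishes at t, the product rule keeps only the term differentiating it, and
    continuity of the other arguments is enough. *)
Lemma multilinear_head_deriv J N cs t d w : J t -> multilinear (size cs).+1 N ->
  (forall s, J s -> V (d s)) -> d t = 0 -> V w -> deriv_on J d t w ->
  all_prop (fun c => (forall s, J s -> V (c s)) /\ cont_on J c t) cs ->
  deriv_on J (fun s => N (d s :: values cs s)) t (N (w :: values cs t)).
Proof.
move=> Jt mN Vd d0 Vw dd hcs.
have Vcs s : J s -> forall z, z \in values cs s -> V z.
  by move=> Js; apply: values_in; apply: all_prop_sub hcs => c [h _]; exact: h.
have [_ [L L0 bnd]] := mN.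
have [|B B0 [r r0 HB]] := @prod_values_bounded J cs t.
  by apply: all_prop_sub hcs => c [].
have head0 : N (d t :: values cs t) = 0.
  rewrite d0; apply: (linear_on0 (E := V) (Z := fun v => N (v :: values cs t))).
    by case: sV.
  by apply: multilinear_linear mN _ _; rewrite ?size_values //; exact: Vcs.
have wc : cont_on J (fun s => N (w :: values cs s)) t.
  exact: (multilinear_cont Jt (multilinear_cons Vw mN) hcs).
move=> e e0; have LB : 0 < 2 * ((L + 1) * B) by rewrite !mulr_gt0 // ltr_wpDl.
have [|r' r'0 H] := dd (e / (2 * ((L + 1) * B))); first by rewrite divr_gt0.
have [|q q0 Hq] := wc (e / 2); first by rewrite divr_gt0.
exists (Num.min (Num.min r r') q); first by rewrite !lt_min r0 r'0.
move=> s Js; rewrite !lt_min => /andP[/andP[sr sr'] sq]; rewrite head0 subr0.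
have Vdw : V (d s - (s - t) *: w).
  by apply: subspaceB => //; [exact: Vd | exact: subspaceZ].
have -> : N (d s :: values cs s) =
    (s - t) *: N (w :: values cs s) + N (d s - (s - t) *: w :: values cs s).
  rewrite -(multilinear_head _ mN) ?size_values //; last exact: Vcs.
  by rewrite addrC subrK.
have -> : (s - t) *: N (w :: values cs s) + N (d s - (s - t) *: w :: values cs s) -
    (s - t) *: N (w :: values cs t) =
  (s - t) *: (N (w :: values cs s) - N (w :: values cs t)) +
    N (d s - (s - t) *: w :: values cs s) by linear_over R.
have h1 : `|(s - t) *: (N (w :: values cs s) - N (w :: values cs t))| <=
    e / 2 * `|s - t|.
  by rewrite normrZ mulrC ler_wpM2r //; exact: Hq.
have h2 : `|N (d s - (s - t) *: w :: values cs s)| <= e / 2 * `|s - t|.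
  apply: le_trans (bnd _ _ _) _; first by rewrite /= size_values.
    by move=> z; rewrite inE => /orP[/eqP->//|]; exact: Vcs.
  rewrite big_cons; have := H s Js sr'; rewrite d0 subr0 => h3.
  have h4 := HB s Js sr.
  apply: (@le_trans _ _ ((L + 1) * (e / (2 * ((L + 1) * B)) * `|s - t| * B))).
    apply: ler_pM => //; [|by lra|].
      by rewrite mulr_ge0 //; exact: prodr_ge0.
    by apply: ler_pM => //; exact: prodr_ge0.
  rewrite [X in X <= _](_ : _ = e / 2 * `|s - t|) //; field.
  by rewrite !gt_eqF // ltr_wpDl.
apply: le_trans (ler_normD _ _) _; lra.
Qed.

(* the pairs in ps are curves with their derivatives *)
Fixpoint leibniz N (ps : seq ((R -> W) * (R -> W))) (t : R) : Y :=
  match ps with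
  | [::] => 0
  | p :: qs => N (p.2 t :: values [seq q.1 | q <- qs] t) +
               leibniz (fun l => N (p.1 t :: l)) qs t
  end.

Definition dcurve J (p : (R -> W) * (R -> W)) := forall t, J t ->
  [/\ V (p.1 t), V (p.2 t) & deriv_on J p.1 t (p.2 t)].

Lemma dcurve_cont J ps t : J t -> all_prop (dcurve J) ps ->
  all_prop (fun c => (forall s, J s -> V (c s)) /\ cont_on J c t)
    [seq p.1 | p <- ps].
Proof.
move=> Jt; elim: ps => //= p ps IH [hp /IH h]; split => //; split.
  by move=> s /hp[].
by have [_ _ /deriv_cont] := hp t Jt.
Qed.

Lemma multilinear_deriv J N ps t : J t -> multilinear (size ps) N ->
  all_prop (dcurve J) ps ->
  deriv_on J (fun s => N (values [seq p.1 | p <- ps] s)) t (leibniz N ps t).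
Proof.
move=> Jt; elim: ps N => [|p ps IH] N mN /=; first by move=> _; exact: deriv_on_cst.
move=> [hp hps]; have hcs := dcurve_cont Jt hps.
set cs := [seq p.1 | p <- ps].
have [Vp Vp' dp] := hp t Jt.
have Vps s : J s -> V (p.1 s) by move=> /hp[].
have Vcs s : J s -> forall z, z \in values cs s -> V z.
  by move=> Js; apply: values_in; apply: all_prop_sub hcs => c [h _]; exact: h.
have szcs : size cs = size ps by rewrite size_map.
apply: (@eq_deriv_on _ _ _ (fun s => N ((p.1 s - p.1 t) :: values cs s) +
    N (p.1 t :: values cs s))) => //.
  move=> s Js; rewrite -[in RHS](subrK (p.1 t) (p.1 s)) -[in RHS](scale1r (p.1 s - _)).
  rewrite (multilinear_head _ mN) ?size_values ?szcs //.
  - by rewrite !scale1r.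
  - by apply: subspaceB => //; exact: Vps.
  - exact: Vcs.
apply: deriv_onD; last exact: (IH _ (multilinear_cons Vp mN) hps).
apply: (multilinear_head_deriv (d := fun s => p.1 s - p.1 t)) => //.
- by rewrite szcs.
- by move=> s Js; apply: subspaceB => //; exact: Vps.
- by rewrite subrr.
- by rewrite -[p.2 t]subr0; apply: deriv_onB => //; exact: deriv_on_cst.
Qed.

End multilinear.

(** * Curves of class C^n with values in a subspace *)

Section smooth_curves.
Context {R : realType}.
Implicit Types E : normedModType R.

(** The derivatives too are required to lie in V, so that they can be inserted in maps that are
    multilinear on V only. *)
Fixpoint smooth_curve E (n : nat) (V : set E) (J : set R) (c : R -> E) : Prop :=
  (forall t, J t -> V (c t)) /\
  match n with
  | 0 => forall t, J t -> cont_on J c t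
  | m.+1 => exists2 c' : R -> E, forall t, J t -> deriv_on J c t (c' t)
                               & smooth_curve m V J c'
  end.

Lemma smooth_curve_in E n (V : set E) J c : smooth_curve n V J c ->
  forall t, J t -> V (c t).
Proof. by case: n => [[]|n []]. Qed.

Lemma smooth_curve_cont E n (V : set E) J c : smooth_curve n V J c ->
  forall t, J t -> cont_on J c t.
Proof.
by case: n => [[]//|n [_ [c' dc _]]] t Jt; exact: deriv_cont (dc t Jt).
Qed.

Lemma smooth_curve_deriv E n (V : set E) J c : smooth_curve n.+1 V J c ->
  exists2 c' : R -> E, forall t, J t -> deriv_on J c t (c' t)
                     & smooth_curve n V J c'.
Proof. by case. Qed.

Lemma smooth_curveS E n (V : set E) J c : smooth_curve n.+1 V J c ->
  smooth_curve n V J c.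
Proof.
elim: n c => [c [Vc [c' dc _]]|n IH c [Vc [c' dc sc']]].
  by split => // t Jt; exact: deriv_cont (dc t Jt).
by split => //; exists c' => //; exact: IH.
Qed.

Lemma smooth_curve_le E n m (V : set E) J c : (m <= n)%N ->
  smooth_curve n V J c -> smooth_curve m V J c.
Proof.
move=> mn; rewrite -(subnK mn); elim: (n - m)%N => [//|i IH].
by rewrite addSn => /smooth_curveS.
Qed.

Lemma smooth_curve_sub E n (V V' : set E) J c : V `<=` V' ->
  smooth_curve n V J c -> smooth_curve n V' J c.
Proof.
move=> VV; elim: n c => [c [Vc cc]|n IH c [Vc [c' dc /IH sc']]].
  by split => // t /Vc/VV.
by split => [t /Vc/VV//|]; exists c'.
Qed.

Lemma smooth_curve_ext E n (V : set E) J c d : (forall t, J t -> c t = d t) ->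
  smooth_curve n V J c -> smooth_curve n V J d.
Proof.
case: n => [|n] cd [Vc h]; split; try by move=> t Jt; rewrite -cd //; exact: Vc.
  by move=> t Jt; apply: eq_cont_on (h t Jt).
case: h => c' dc sc'; exists c' => // t Jt.
by apply: eq_deriv_on (dc t Jt).
Qed.

Lemma smooth_curve_cst E n (V : set E) J x : subspace V -> V x ->
  smooth_curve n V J (fun=> x).
Proof.
move=> sV; elim: n x => [x Vx|n IH x Vx]; first by split => // t _; exact: cont_on_cst.
split => //; exists (fun=> 0); first by move=> t _; exact: deriv_on_cst.
by apply: IH; case: sV.
Qed.

Lemma smooth_curveD E n (V : set E) J c d : subspace V ->
  smooth_curve n V J c -> smooth_curve n V J d ->
  smooth_curve n V J (fun t => c t + d t).
Proof.
move=> sV; elim: n c d => [c d [Vc cc] [Vd cd]|n IH c d [Vc [c' dc sc]] [Vd [d' dd sd]]].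
  split => t Jt; first by apply: subspaceD => //; [exact: Vc | exact: Vd].
  by apply: cont_onD; [exact: cc | exact: cd].
split; first by move=> t Jt; apply: subspaceD => //; [exact: Vc | exact: Vd].
exists (fun t => c' t + d' t); last exact: IH.
by move=> t Jt; apply: deriv_onD; [exact: dc | exact: dd].
Qed.

Lemma smooth_curveN E n (V : set E) J c : subspace V ->
  smooth_curve n V J c -> smooth_curve n V J (fun t => - c t).
Proof.
move=> sV; elim: n c => [c [Vc cc]|n IH c [Vc [c' dc sc]]].
  split => t Jt; first by apply: subspaceN => //; exact: Vc.
  by apply: cont_onN; exact: cc.
split; first by move=> t Jt; apply: subspaceN => //; exact: Vc.
exists (fun t => - c' t); last exact: IH.
by move=> t Jt; apply: deriv_onN; exact: dc.
Qed.

Lemma smooth_curve_sum E n (V : set E) J (I : Type) (r : seq I) (P : pred I)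
    (c : I -> R -> E) : subspace V ->
  (forall i, P i -> smooth_curve n V J (c i)) ->
  smooth_curve n V J (fun t => \sum_(i <- r | P i) c i t).
Proof.
move=> sV h; elim: r => [|i r IH].
  apply: (@smooth_curve_ext _ _ _ _ (fun=> 0)); first by move=> t _; rewrite big_nil.
  by apply: smooth_curve_cst => //; case: sV.
case Pi : (P i).
  apply: (@smooth_curve_ext _ _ _ _ (fun t => c i t + \sum_(j <- r | P j) c j t)).
    by move=> t _; rewrite big_cons Pi.
  by apply: smooth_curveD => //; exact: h.
by apply: smooth_curve_ext IH => t _; rewrite big_cons Pi.
Qed.

Definition bounded_linear_on E E' (V : set E) (T : E -> E') :=
  linear_on V T /\ exists2 L : R, 0 <= L & forall x, V x -> `|T x| <= L * `|x|.

Lemma bounded_linear_cont E E' (V : set E) (T : E -> E') J c t : subspace V ->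
  bounded_linear_on V T -> J t -> (forall s, J s -> V (c s)) -> cont_on J c t ->
  cont_on J (fun s => T (c s)) t.
Proof.
move=> sV [lT [L L0 bT]] Jt Vc cc e e0.
have L10 : 0 < L + 1 by rewrite ltr_wpDl.
have [|r r0 H] := cc (e / (L + 1)); first by rewrite divr_gt0.
exists r => // s Js st; rewrite -(linear_onB lT); [|exact: Vc|exact: Vc].
apply: le_trans (bT _ _) _; first by apply: subspaceB => //; exact: Vc.
have := H s Js st; rewrite ler_pdivlMr //.
have := normr_ge0 (c s - c t); nra.
Qed.

Lemma bounded_linear_deriv E E' (V : set E) (T : E -> E') J c t d : subspace V ->
  bounded_linear_on V T -> J t -> (forall s, J s -> V (c s)) -> V d ->
  deriv_on J c t d -> deriv_on J (fun s => T (c s)) t (T d).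
Proof.
move=> sV [lT [L L0 bT]] Jt Vc Vd dc e e0.
have L10 : 0 < L + 1 by rewrite ltr_wpDl.
have [|r r0 H] := dc (e / (L + 1)); first by rewrite divr_gt0.
exists r => // s Js st.
have Vcc : V (c s - c t) by apply: subspaceB => //; exact: Vc.
have Vd' : V ((s - t) *: d) by exact: subspaceZ.
rewrite -(linear_onZ _ _ lT) //; last by case: sV.
rewrite -(linear_onB lT (Vc s Js) (Vc t Jt)) -(linear_onB lT Vcc Vd').
apply: le_trans (bT _ _) _; first exact: subspaceB.
have h := H s Js st.
apply: le_trans (ler_wpM2l L0 h) _; rewrite mulrA ler_wpM2r //.
by rewrite mulrCA ler_piMr ?(ltW e0) // ler_pdivrMr // mul1r lerDl.
Qed.

Lemma smooth_curve_linear E E' n (V : set E) (V' : set E') (T : E -> E') J c :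
  subspace V -> bounded_linear_on V T -> (forall x, V x -> V' (T x)) ->
  smooth_curve n V J c -> smooth_curve n V' J (fun t => T (c t)).
Proof.
move=> sV bT TV; elim: n c => [c [Vc cc]|n IH c [Vc [c' dc sc]]].
  split => t Jt; first by apply: TV; exact: Vc.
  exact: (bounded_linear_cont sV bT Jt Vc (cc t Jt)).
split; first by move=> t Jt; apply: TV; exact: Vc.
exists (fun t => T (c' t)); last exact: IH.
move=> t Jt; apply: (bounded_linear_deriv sV bT Jt Vc _ (dc t Jt)).
exact: (smooth_curve_in sc).
Qed.

End smooth_curves.

(** * Maps of class C^m along curves *)

Section smooth_maps.
Context {R : realType} {W Y : normedModType R}.
Variables (m : nat) (U V : set W) (Dg : W -> seq W -> Y).
Hypothesis sV : subspace V.

(* Dg p [:: v1; ..; vj] is the j-th derivative at p of a map of class C^m *)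
Definition smooth_map := [/\
  forall p, U p -> forall j, (j <= m)%N -> multilinear V j (Dg p),
  forall p, U p -> forall j, (j < m)%N -> forall e : R, 0 < e ->
    exists2 d : R, 0 < d & forall p', U p' -> `|p' - p| < d ->
      forall vs, size vs = j -> (forall z, z \in vs -> V z) ->
      `|Dg p' vs - Dg p vs - Dg p ((p' - p) :: vs)| <=
        e * `|p' - p| * \prod_(v <- vs) `|v|
  & forall p, U p -> forall j, (j <= m)%N -> forall e : R, 0 < e ->
    exists2 d : R, 0 < d & forall p', U p' -> `|p' - p| < d ->
      forall vs, size vs = j -> (forall z, z \in vs -> V z) ->
      `|Dg p' vs - Dg p vs| <= e * \prod_(v <- vs) `|v| ].

Hypothesis sm : smooth_map.
Hypothesis UV : U `<=` V.

Lemma smooth_map_cont J (ga : R -> W) (cs : seq (R -> W)) t : J t ->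
  (forall s, J s -> U (ga s)) -> cont_on J ga t -> (size cs <= m)%N ->
  all_prop (fun c => (forall s, J s -> V (c s)) /\ cont_on J c t) cs ->
  cont_on J (fun s => Dg (ga s) (values cs s)) t.
Proof.
move=> Jt Uga gac szm hcs; have [mul _ cont] := sm.
have h2 := multilinear_cont sV Jt (mul _ (Uga t Jt) _ szm) hcs.
have [|B B0 [q q0 HB]] := @prod_values_bounded _ _ J cs t.
  by apply: all_prop_sub hcs => c [].
move=> e e0; have e20 : 0 < e / 2 by rewrite divr_gt0.
have eB0 : 0 < e / (2 * B) by rewrite divr_gt0 // mulr_gt0.
have [d d0 Hd] := cont _ (Uga t Jt) _ szm _ eB0.
have [r r0 Hr] := gac (d / 2) ltac:(by rewrite divr_gt0).
have [r' r'0 Hr'] := h2 _ e20.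
exists (Num.min (Num.min r r') q); first by rewrite !lt_min r0 r'0.
move=> s Js; rewrite !lt_min => /andP[/andP[sr sr'] sq].
apply: le_trans (ler_distD (Dg (ga t) (values cs s)) _ _) _.
have h3 := Hr' s Js sr'.
have : `|Dg (ga s) (values cs s) - Dg (ga t) (values cs s)| <= e / 2.
  apply: le_trans (Hd _ (Uga s Js) _ _ _ _) _.
  - by apply: le_lt_trans (Hr s Js sr) _; rewrite ltr_pdivrMr //; lra.
  - by rewrite size_values.
  - by apply: values_in; apply: all_prop_sub hcs => c [h _]; exact: h.
  apply: le_trans (ler_wpM2l (ltW eB0) (HB s Js sq)) _.
  by rewrite [X in X <= _](_ : _ = e / 2) //; field; rewrite gt_eqF.
lra.
Qed.

(** The value at [ga s] is split into the Frechet remainder, of order o(|s - t|) because the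
    arguments stay bounded; the next derivative at [ga s - ga t], whose head vanishes at t; and the
    multilinear map frozen at [ga t], to which the product rule applies. *)
Lemma smooth_map_deriv J (ga : R -> W) ga' ps t : J t ->
  (forall s, J s -> U (ga s)) -> V ga' -> deriv_on J ga t ga' ->
  (size ps < m)%N -> all_prop (dcurve V J) ps ->
  deriv_on J (fun s => Dg (ga s) (values [seq p.1 | p <- ps] s)) t
    (Dg (ga t) (ga' :: values [seq p.1 | p <- ps] t) + leibniz (Dg (ga t)) ps t).
Proof.
move=> Jt Uga Vga' dga szm hps; have [mul dif _] := sm.
set cs := [seq p.1 | p <- ps].
have szcs : size cs = size ps by rewrite size_map.
have hcs := dcurve_cont Jt hps.
have Vcs s : J s -> forall z, z \in values cs s -> V z.
  by move=> Js; apply: values_in; apply: all_prop_sub hcs => c [h _]; exact: h.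
have Ut := Uga t Jt.
have h2 := multilinear_deriv sV Jt (mul _ Ut _ (ltnW szm)) hps.
have h1 : deriv_on J (fun s => Dg (ga t) ((ga s - ga t) :: values cs s)) t
    (Dg (ga t) (ga' :: values cs t)).
  apply: (multilinear_head_deriv sV (d := fun s => ga s - ga t)) => //.
  - by apply: mul => //; rewrite szcs.
  - by move=> s Js; apply: subspaceB => //; apply: UV; exact: Uga.
  - by rewrite subrr.
  - by rewrite -[ga']subr0; apply: deriv_onB => //; exact: deriv_on_cst.
have [|B B0 [q q0 HB]] := @prod_values_bounded _ _ J cs t.
  by apply: all_prop_sub hcs => c [].
have [p p0 Hp] := deriv_lip dga.
set C := `|ga'| + 1 in Hp; have C0 : 0 < C by rewrite ltr_wpDl.
have h0 : deriv_on J (fun s => Dg (ga s) (values cs s) - Dg (ga t) (values cs s) -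
    Dg (ga t) ((ga s - ga t) :: values cs s)) t 0.
  have head0 : Dg (ga t) ((ga t - ga t) :: values cs t) = 0.
    rewrite subrr; apply: (linear_on0 (E := V)
      (Z := fun v => Dg (ga t) (v :: values cs t))); first by case: sV.
    apply: (multilinear_linear (mul _ Ut _ szm)); first by rewrite size_values.
    exact: Vcs.
  move=> e e0; have eB0 : 0 < e / (C * B) by rewrite divr_gt0 // mulr_gt0.
  have [d d0 Hd] := dif _ Ut _ szm _ eB0.
  have [r r0 Hr] := deriv_cont dga (e := d / 2) ltac:(by rewrite divr_gt0).
  exists (Num.min (Num.min r p) q); first by rewrite !lt_min r0 p0.
  move=> s Js; rewrite !lt_min => /andP[/andP[sr sp] sq].
  rewrite head0 subrr !subr0 scaler0 subr0.
  apply: le_trans (Hd _ (Uga s Js) _ _ _ _) _.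
  - by apply: le_lt_trans (Hr s Js sr) _; rewrite ltr_pdivrMr //; lra.
  - by rewrite size_values.
  - exact: Vcs.
  apply: (@le_trans _ _ (e / (C * B) * (C * `|s - t|) * B)).
    apply: ler_pM => //.
    + by rewrite mulr_ge0 // ltW.
    + exact: prodr_ge0.
    + by apply: ler_wpM2l; [exact: ltW | exact: Hp].
    + exact: HB.
  by rewrite [X in X <= _](_ : _ = e * `|s - t|) //; field; rewrite !gt_eqF.
have := deriv_onD (deriv_onD h0 h1) h2; rewrite add0r.
by apply: eq_deriv_on => // s Js /=; rewrite -/cs; linear_over R.
Qed.

(** [pre] holds the curves that the recursion of [leibniz] has already moved in front, so that each
    summand is [Dg (ga t)] applied to a full list of curves. *)
Lemma smooth_leibniz n J (ga : R -> W) (pre : seq (R -> W)) ps :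
  (forall cs, size cs = (size pre + size ps)%N ->
     all_prop (smooth_curve n V J) cs ->
     smooth_curve n setT J (fun t => Dg (ga t) (values cs t))) ->
  all_prop (smooth_curve n V J) pre ->
  all_prop (fun p => smooth_curve n V J p.1 /\ smooth_curve n V J p.2) ps ->
  smooth_curve n setT J
    (fun t => leibniz (fun l => Dg (ga t) (values pre t ++ l)) ps t).
Proof.
elim: ps pre => [|p ps IH] pre H hpre /=.
  by move=> _; exact: smooth_curve_cst.
move=> [[h1 h2] hps]; apply: smooth_curveD => //.
  have : smooth_curve n setT J
      (fun t => Dg (ga t) (values (pre ++ p.2 :: [seq q.1 | q <- ps]) t)).
    apply: H; first by rewrite size_cat /= size_map.
    apply: all_prop_cat => //=; split => //.
    by elim: (ps) hps => //= q qs IHq [[? _] /IHq].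
  by apply: smooth_curve_ext => t _; rewrite /values map_cat.
have : smooth_curve n setT J (fun t =>
    leibniz (fun l => Dg (ga t) (values (rcons pre p.1) t ++ l)) ps t).
  apply: IH => //.
    by move=> cs; rewrite size_rcons addSnnS; exact: H.
  by rewrite -cats1; apply: all_prop_cat.
apply: smooth_curve_ext => t _.
by congr (leibniz _ _ _); apply/funext => l; rewrite /values map_rcons cat_rcons.
Qed.

(** One differentiation either adds the argument [ga'] or replaces an argument by its derivative.
    The number of arguments plus the remaining order never exceeds m, which replaces an explicit
    formula for higher derivatives of a composite. *)
Lemma smooth_map_curve n J (ga : R -> W) cs :
  (forall t, J t -> U (ga t)) -> smooth_curve n V J ga ->
  (size cs + n <= m)%N -> all_prop (smooth_curve n V J) cs ->
  smooth_curve n setT J (fun t => Dg (ga t) (values cs t)).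
Proof.
move=> Uga; elim: n cs => [|n IH] cs sga szm hcs.
  split => // t Jt; apply: smooth_map_cont => //.
  - by case: sga => _; exact.
  - by rewrite addn0 in szm.
  - by apply: all_prop_sub hcs => c [Vc cc]; split => //; exact: cc.
have [_ [ga' dga sga']] := sga.
have [ps [pE hps dps]] : exists ps, [/\ cs = [seq p.1 | p <- ps],
    all_prop (fun p => smooth_curve n V J p.1 /\ smooth_curve n V J p.2) ps &
    all_prop (dcurve V J) ps].
  elim: {IH szm} cs hcs => [_|c cs IH /= [sc /IH[ps [-> hps dps]]]].
    by exists [::].
  have scn := smooth_curveS sc; have [Vc [c' dc sc']] := sc.
  exists ((c, c') :: ps); split => //=; split => // t Jt; split => /=.
  - exact: Vc.
  - exact: smooth_curve_in sc' t Jt.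
  - exact: dc.
have szps : size cs = size ps by rewrite pE size_map.
split => //.
exists (fun t => Dg (ga t) (ga' t :: values cs t) + leibniz (Dg (ga t)) ps t).
  move=> t Jt; rewrite pE; apply: smooth_map_deriv => //.
  - exact: smooth_curve_in sga' t Jt.
  - exact: dga.
  - by rewrite -szps; apply: leq_trans szm; rewrite addnS ltnS leq_addr.
apply: smooth_curveD => //.
  apply: (IH (ga' :: cs)) => //; [exact: smooth_curveS|by rewrite /= addSnnS|].
  by split => //; apply: all_prop_sub hcs => c; exact: smooth_curveS.
apply: (@smooth_leibniz n J ga [::]) => // cs' szcs' hcs'; apply: IH => //.
  exact: smooth_curveS.
by rewrite szcs' add0n -szps; apply: leq_trans szm; rewrite addnS.
Qed.

End smooth_maps.

Section half_line.
Context {R : realType}.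

Definition half_line : set R := [set t | 0 <= t].

Lemma half_line_acc (t : R) : half_line t -> forall r : R, 0 < r ->
  exists s, [/\ half_line s, s != t & `|s - t| < r].
Proof.
move=> t0 r r0; exists (t + r / 2); split.
- by rewrite /half_line /= addr_ge0 // divr_ge0 // ltW.
- by rewrite -subr_eq0 addrAC subrr add0r gt_eqF // divr_gt0.
- by rewrite addrAC subrr add0r gtr0_norm ?divr_gt0 //; lra.
Qed.

(** The difference quotients lie in the closed subspace F; in this way a differentiated equation
    inherits the target space of the original one. *)
Lemma deriv_in (E : normedModType R) (F : set E) J (g : R -> E) t d :
  subspace F -> norm_closed F -> J t ->
  (forall r, 0 < r -> exists s, [/\ J s, s != t & `|s - t| < r]) ->
  (forall s, J s -> F (g s)) -> deriv_on J g t d -> F d.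
Proof.
move=> sF clF Jt acc Fg dg; apply: clF => e e0.
have [r r0 H] := dg e e0; have [s [Js st sr]] := acc r r0.
exists ((s - t)^-1 *: (g s - g t)).
  by apply: subspaceZ => //; apply: subspaceB => //; exact: Fg.
have st0 : s - t != 0 by rewrite subr_eq0.
have -> : d - (s - t)^-1 *: (g s - g t) =
    - ((s - t)^-1 *: (g s - g t - (s - t) *: d)).
  by rewrite [in RHS]scalerBr scalerA mulVf // scale1r opprB.
rewrite normrN normrZ normfV mulrC ler_pdivrMr ?normr_gt0 //.
exact: H.
Qed.

End half_line.

(** * Smoothness of implicitly defined curves *)

Section smooth_implicit.
Context {R : realType} {X Y : normedModType R}.
Local Notation W := (R^o * X)%type.
Local Notation J := (@half_line R).

Lemma pair_norm (a : R) (x : X) : `|(a, x) : W| = Num.max `|a| `|x|.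
Proof. by []. Qed.

Lemma pair_norm_lt (a r : R) (x : X) : `|a| < r -> `|x| < r -> `|(a, x) : W| < r.
Proof. by move=> ha hx; rewrite pair_norm gt_max ha. Qed.

Lemma pair0_norm (x : X) : `|(0, x) : W| = `|x|.
Proof. by rewrite pair_norm normr0; apply/max_idPr. Qed.

Lemma bounded_linear_pair0 (V : set X) :
  bounded_linear_on V (fun x => (0, x) : W).
Proof.
split; last by exists 1 => // x _; rewrite pair0_norm mul1r.
move=> a x y _ _; apply/pair_equal_spec; split => //=.
by rewrite addr0 /GRing.scale /= mulr0.
Qed.

Lemma deriv_on_pair (J' : set R) (c : R -> X) t d : deriv_on J' c t d ->
  deriv_on J' (fun s => (s, c s) : W) t (1, d).
Proof.
move=> dc e e0; have [r r0 H] := dc e e0; exists r => // s Js st.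
have -> : (s, c s) - (t, c t) - (s - t) *: (1, d) = (0, c s - c t - (s - t) *: d) :> W.
  apply/pair_equal_spec; split => //=.
  by rewrite /GRing.scale /= mulr1 subrr.
by rewrite pair0_norm; exact: H.
Qed.

Lemma cont_on_pair (J' : set R) (c : R -> X) t : cont_on J' c t ->
  cont_on J' (fun s => (s, c s) : W) t.
Proof.
move=> cc e e0; have [r r0 H] := cc e e0; exists (Num.min r e).
  by rewrite lt_min r0.
move=> s Js; rewrite lt_min => /andP[sr se].
have -> : (s, c s) - (t, c t) = (s - t, c s - c t) :> W by [].
by rewrite pair_norm ge_max (ltW se) H.
Qed.

Variables (m : nat) (U V : set X) (Dg : W -> seq W -> Y).
Let TU : set W := [set p | 0 <= p.1 /\ U p.2].
Let VW : set W := [set p | V p.2].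
Hypotheses (m0 : (0 < m)%N) (sV : subspace V) (UV : U `<=` V).
Hypothesis sm : smooth_map m TU VW Dg.

Let sVW : subspace VW.
Proof.
case: sV => V0 h; split => // a [p1 p2] [q1 q2]; exact: h.
Qed.

Let TUVW : TU `<=` VW. Proof. by move=> p [_ /UV]. Qed.

Lemma smooth_graph n (c : R -> X) : smooth_curve n V J c ->
  smooth_curve n VW J (fun t => (t, c t) : W).
Proof.
case: n => [[Vc cc]|n [Vc [c' dc sc']]].
  by split => // t Jt; apply: cont_on_pair; exact: cc.
split => //; exists (fun t => (1, c' t) : W).
  by move=> t Jt; apply: deriv_on_pair; exact: dc.
have sub : V `<=` [set x | V x] by [].
apply: (@smooth_curve_ext _ _ _ _ _ (fun t => ((1, 0) : W) + (0, c' t))).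
  by move=> t _; apply/pair_equal_spec; rewrite /= addr0 add0r.
apply: smooth_curveD => //; first by apply: smooth_curve_cst => //; case: sV.
apply: (smooth_curve_linear (V' := VW) sV (bounded_linear_pair0 V)) sc'.
by move=> x Vx.
Qed.

Lemma smooth_pair0 n (E : set X) (c : R -> X) : E `<=` V -> subspace E ->
  smooth_curve n E J c -> smooth_curve n VW J (fun t => (0, c t) : W).
Proof.
move=> EV sE; apply: (smooth_curve_linear sE (bounded_linear_pair0 E)).
by move=> x /EV.
Qed.

Section invertible.
Variables (E : set X) (F : set Y) (b : X -> Y).
Hypotheses (sE : subspace E) (EV : E `<=` V) (sF : subspace F).
Hypotheses (clF : norm_closed F) (lb : linear_on E b).

Let La (p : W) (x : X) := Dg p [:: (0, x)] - b x.

Lemma derivative_linear p : TU p -> linear_on E (La p).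
Proof.
move=> TUp; have [mul _ _] := sm; have mp := mul _ TUp _ m0.
have l1 := multilinear_linear mp (vs := [::]) erefl ltac:(by []).
move=> a x y Ex Ey; rewrite /La lb //.
have [lp _] := bounded_linear_pair0 E.
have -> : Dg p [:: (0, a *: x + y)] = a *: Dg p [:: (0, x)] + Dg p [:: (0, y)].
  by rewrite (lp a x y Ex Ey); apply: l1; exact: EV.
by linear_over R.
Qed.

Lemma derivative_close p (e : R) : TU p -> 0 < e -> exists2 d : R, 0 < d &
  forall p' x, TU p' -> `|p' - p| < d -> E x -> `|La p' x - La p x| <= e * `|x|.
Proof.
move=> TUp e0; have [_ _ cont] := sm; have [d d0 H] := cont p TUp 1%N m0 e e0.
exists d => // p' x TUp' hp Ex.
have -> : La p' x - La p x = Dg p' [:: (0, x)] - Dg p [:: (0, x)].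
  by rewrite /La; linear_over R.
have := H p' TUp' hp [:: (0, x)] erefl; rewrite big_seq1 pair0_norm; apply.
by move=> z; rewrite inE => /eqP->; exact: EV.
Qed.

Variable q : R -> X.
Hypothesis Uq : forall t, J t -> U (q t).
Let ga (t : R) : W := (t, q t).
Hypothesis inv : forall t, J t -> exists2 K : R, 0 <= K & iso_on K E F (La (ga t)).

Let TUga t : J t -> TU (ga t). Proof. by move=> Jt; split => //; exact: Uq. Qed.

(** Continuity of z is an instance of [inverse_estimate]. Differentiating, z' solves an equation
    with the same operator and the right-hand side k' - D^2 g [ga', z], to which the induction
    applies; z of order n thus uses derivatives of order n + 1, whence n < m. *)
Lemma smooth_inverse n (z : R -> X) (k : R -> Y) : (n < m)%N ->
  smooth_curve n V J q -> smooth_curve n setT J k ->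
  (forall t, J t -> E (z t) /\ La (ga t) (z t) = k t) -> smooth_curve n E J z.
Proof.
move=> + sq; have sga := smooth_graph sq.
have gac t : J t -> cont_on J ga t by exact: smooth_curve_cont sga t.
have strong t (e : R) (z0 : X) (k0 : R -> Y) : J t -> 0 < e ->
    exists2 d : R, 0 < d & forall s, J s -> `|s - t| < d -> forall r,
      close_on E (La (ga t)) (fun x => La (ga s) x - k0 s) z0 r e.
  move=> Jt e0; have [d d0 Hd] := derivative_close (TUga Jt) e0.
  have [r r0 Hr] := gac t Jt (d / 2) ltac:(by rewrite divr_gt0).
  exists r => // s Js st rr x y Ex Ey _ _.
  have Exy : E (x - y) by exact: subspaceB.
  have -> : La (ga s) x - k0 s - (La (ga s) y - k0 s) - La (ga t) (x - y) =
      La (ga s) (x - y) - La (ga t) (x - y).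
    by rewrite (linear_onB (derivative_linear (TUga Js)) Ex Ey); linear_over R.
  apply: Hd => //; first exact: TUga.
  by apply: le_lt_trans (Hr s Js st) _; rewrite ltr_pdivrMr //; lra.
have sFk (z0 : X) (k0 : R -> Y) : E z0 -> (forall s, J s -> F (k0 s)) ->
    forall s, J s -> F (La (ga s) z0 - k0 s).
  move=> Ez0 Fk s Js; apply: subspaceB => //; last exact: Fk.
  by have [K _ [_ FZ _ _]] := inv Js; exact: FZ.
have bl0 x : V x -> forall J' : set R, all_prop (fun c : R -> W =>
    (forall s : R, J' s -> VW (c s)) /\ forall t, cont_on J' c t) [:: fun=> (0, x)].
  by move=> Vx J'; split => //; split => // t; exact: cont_on_cst.
have contk (z0 : X) (k0 : R -> Y) t : J t -> E z0 -> cont_on J k0 t ->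
    cont_on J (fun s => La (ga s) z0 - k0 s) t.
  move=> Jt Ez0 ck; apply: cont_onB => //; apply: cont_onB; last exact: cont_on_cst.
  apply: (smooth_map_cont sVW sm (cs := [:: fun=> (0, z0)])) => //; first exact: gac.
  by apply: all_prop_sub (bl0 z0 (EV Ez0) J) => c [h1 h2]; split => //; exact: h2.
have zcont z0 k0 t : J t -> cont_on J k0 t ->
    (forall t, J t -> E (z0 t) /\ La (ga t) (z0 t) = k0 t) -> cont_on J z0 t.
  move=> Jt ck hz e e0; have [K K0 iso] := inv Jt.
  have K10 : 0 < K + 1 by rewrite ltr_wpDl.
  have [|d d0 Hd] := strong t (2 * (K + 1))^-1 (z0 t) k0 Jt.
    by rewrite invr_gt0 mulr_gt0.
  have [Et Lt] := hz t Jt.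
  have [|r r0 Hr] := contk (z0 t) k0 t Jt Et ck (e / (2 * (K + 1))).
    by rewrite divr_gt0 // mulr_gt0.
  exists (Num.min d r); first by rewrite lt_min d0.
  move=> s Js; rewrite lt_min => /andP[sd sr].
  have [Es Ls] := hz s Js.
  have := inverse_estimate sE iso K0 (Hd s Js sd `|z0 s - z0 t|) Es Et (lexx _).
  rewrite subrr normr0 => /(_ (normr_ge0 _)).
  rewrite Ls subrr sub0r normrN.
  have := Hr s Js sr; rewrite Lt subrr subr0 => h1.
  have Ke : K * (2 * (K + 1))^-1 <= 1 / 2.
    by rewrite ler_pdivrMr ?mulr_gt0 //; lra.
  have h5 : (1 / 2) * `|z0 s - z0 t| <= (1 - K * (2 * (K + 1))^-1) * `|z0 s - z0 t|.
    by rewrite ler_wpM2r //; lra.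
  have h6 : K * `|La (ga s) (z0 t) - k0 s| <= (K + 1) * (e / (2 * (K + 1))).
    by apply: ler_pM => //; lra.
  have h7 : (K + 1) * (e / (2 * (K + 1))) = e / 2 by field; rewrite gt_eqF.
  lra.
have Fz (z0 : R -> X) (k0 : R -> Y) :
    (forall t, J t -> E (z0 t) /\ La (ga t) (z0 t) = k0 t) -> forall t, J t -> F (k0 t).
  by move=> hz t Jt; have [Et <-] := hz t Jt; have [K _ [_ FZ _ _]] := inv Jt; exact: FZ.
elim: n z k sq sga => [|n IH] z k sq sga nm sk hz.
  split; first by move=> t /hz[].
  by move=> t Jt; apply: (zcont z k) => //; case: sk => _; exact.
have sz := IH z k (smooth_curveS sq) (smooth_curveS sga) (ltnW nm) (smooth_curveS sk) hz.
have [_ [ga' dga sga']] := sga; have [_ [k' dk sk']] := sk.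
have dPsi t : J t -> deriv_on J (fun s => La (ga s) (z t) - k s) t
    (Dg (ga t) [:: ga' t; (0, z t)] - k' t).
  move=> Jt; apply: deriv_onB; last exact: dk.
  have Vz : V (z t) by apply: EV; case: (hz t Jt).
  have V0 : V 0 by case: sV.
  have m1 : (1 < m)%N by apply: leq_ltn_trans nm.
  have hps : all_prop (dcurve VW J) [:: (fun=> (0, z t) : W, fun=> 0 : W)].
    by split => // s Js; split => //; exact: deriv_on_cst.
  have := smooth_map_deriv sVW sm TUVW
    (ps := [:: (fun=> (0, z t) : W, fun=> 0 : W)]) Jt TUga
    (smooth_curve_in sga' Jt) (dga t Jt) m1 hps; rewrite /=.
  have [mul _ _] := sm; have mp := mul _ (TUga Jt) _ m0.
  have l1 := multilinear_linear mp (vs := [::]) erefl ltac:(by []).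
  rewrite (linear_on0 _ l1) // !addr0 => h.
  rewrite -[X in deriv_on _ _ _ X]subr0.
  by apply: deriv_onB; [exact: h | exact: deriv_on_cst].
have Fa t : J t -> F (Dg (ga t) [:: ga' t; (0, z t)] - k' t).
  move=> Jt; apply: (deriv_in sF clF Jt (half_line_acc Jt) _ (dPsi t Jt)).
  by apply: sFk; [case: (hz t Jt) | exact: Fz hz].
have /choice[w hw] : forall t, exists w, J t ->
    [/\ E w, La (ga t) w = - (Dg (ga t) [:: ga' t; (0, z t)] - k' t) &
        deriv_on J z t w].
  move=> t; have [Jt|nJt] := pselect (J t); last by exists 0.
  have [K K0 iso] := inv Jt.
  have [|||w hw] := implicit_deriv sE sF iso K0 ltr01 Jt
    (Psi := fun s x => La (ga s) x - k s) (z := z) _ _ _ (Fa t Jt) (dPsi t Jt).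
  - by move=> s Js; have [Es ->] := hz s Js; rewrite subrr.
  - by apply: smooth_curve_cont sz t Jt.
  - move=> e e0; have [d d0 Hd] := strong t e (z t) k Jt e0.
    exists (Num.min d 1); split; first by rewrite lt_min d0 ltr01.
      by rewrite ge_min lexx orbT.
    by move=> s Js; rewrite lt_min => /andP[sd _]; exact: Hd.
  by exists w.
split; first by move=> t /hz[].
exists w; first by move=> t /hw[].
apply: (IH w (fun t => - (Dg (ga t) [:: ga' t; (0, z t)] - k' t))).
- exact: smooth_curveS.
- exact: smooth_curveS.
- exact: ltnW.
- apply: smooth_curveN => //; apply: smooth_curveD; [by [] | | exact: smooth_curveN].
  apply: (smooth_map_curve sVW sm TUVW (cs := [:: ga'; fun t => (0, z t)])) => //.
  + exact: smooth_curveS.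
  + by split => //; split => //; exact: smooth_pair0 EV sE sz.
- by move=> t /hw[].
Qed.

End invertible.

Section implicit_curve.
Hypothesis cX : seq_complete X.
Variables (E Mx : set X) (F : set Y) (b : X -> Y) (c x : R -> X) (h : R -> Y).
Hypotheses (sE : subspace E) (clE : norm_closed E) (EV : E `<=` V).
Hypotheses (sF : subspace F) (clF : norm_closed F) (bb : bounded_linear_on E b).
Hypothesis ME : Mx `<=` E.
Hypothesis Mopen : forall y, Mx y -> exists2 r : R, 0 < r &
  forall y', E y' -> `|y' - y| <= r -> Mx y'.
Hypothesis UM : forall t y, J t -> Mx y -> U (c t + y).
Let Psi (t : R) (y : X) := Dg (t, c t + y) [::] - b y - h t.
Hypothesis FPsi : forall t y, J t -> Mx y -> F (Psi t y).
Hypothesis xM : forall t, J t -> Mx (x t).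
Hypothesis x0 : forall t, J t -> Psi t (x t) = 0.
Hypothesis xu : forall t y, J t -> Mx y -> Psi t y = 0 -> y = x t.
Hypothesis inv : forall t, J t -> exists2 K : R, 0 <= K &
  iso_on K E F (fun y => Dg (t, c t + x t) [:: (0, y)] - b y).

Let lb : linear_on E b := bb.1.
Let xE t : J t -> E (x t). Proof. by move=> /xM/ME. Qed.

(** Continuity of the derivative becomes strict differentiability, uniformly for times near t, by
    the mean value inequality along the segment from y2 to y1 at each fixed time s; the linear term
    b cancels. *)
Let strong t (e : R) : J t -> cont_on J c t -> 0 < e -> exists d : R,
  [/\ 0 < d, forall y, E y -> `|y - x t| <= d -> Mx y &
     forall s, J s -> `|s - t| < d ->
       close_on E (fun y => Dg (t, c t + x t) [:: (0, y)] - b y) (Psi s) (x t) d e].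
Proof.
move=> Jt ct e0; have [r r0 Hr] := Mopen (xM Jt).
have TUt : TU (t, c t + x t) by split => //; apply: UM => //; exact: xM.
have [d d0 Hd] := derivative_close b EV TUt e0.
have [r' r'0 Hr'] := ct (d / 4) ltac:(by rewrite divr_gt0).
(* The motions of c and of y take d / 4 each, so the point remains within the radius d on which the
   derivative is close to its value at t. *)
pose d' := Num.min (Num.min r r') (d / 4).
have d'0 : 0 < d' by rewrite !lt_min r0 r'0 divr_gt0.
have [d'r d'r' d'd] : [/\ d' <= r, d' <= r' & d' <= d / 4].
  by have := lexx d'; rewrite {2}/d' !le_min => /andP[/andP[-> ->] ->].
have ballM y : E y -> `|y - x t| <= d' -> Mx y.
  by move=> Ey hy; apply: Hr => //; exact: le_trans d'r.
exists d'; split => // s Js st y1 y2 E1 E2 h1 h2.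
pose D := y1 - y2.
have ED : E D by exact: subspaceB.
pose y (a : R) := y2 + a *: D.
have yball a : seg 0 1 a -> `|y a - x t| <= d'.
  move=> /andP[a0 a1].
  have -> : y a - x t = a *: (y1 - x t) + (1 - a) *: (y2 - x t).
    by rewrite /y /D; linear_over R.
  apply: le_trans (ler_normD _ _) _; rewrite !normrZ !ger0_norm ?subr_ge0 //.
  have := ler_wpM2l a0 h1; have a1' : 0 <= 1 - a by rewrite subr_ge0.
  have := ler_wpM2l a1' h2; lra.
have yM a : seg 0 1 a -> Mx (y a).
  move=> a01; apply: ballM; last exact: yball.
  by apply: subspaceD => //; exact: subspaceZ.
pose gl (a : R) : W := (s, c s + y a).
have glU a : seg 0 1 a -> TU (gl a).
  by move=> a01; split => //; apply: UM => //; exact: yM.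
pose L0 := Dg (t, c t + x t) [:: (0, D)].
have dphi a : seg 0 1 a -> deriv_on (seg 0 1) (fun a => Dg (gl a) [::] - (0 + (a - 0) *: L0)) a
    (Dg (gl a) [:: (0, D)] - L0).
  move=> a01; apply: deriv_onB; last exact: deriv_on_affine.
  have := smooth_map_deriv sVW sm TUVW (ps := [::]) (ga := gl) (ga' := (0, D)) a01.
  rewrite /= addr0; apply => //; first exact: EV.
  apply: (@eq_deriv_on _ _ _ (fun a => ((s, c s + y2) : W) + (a - 0) *: ((0, D) : W))) => //.
    move=> q _; apply/pair_equal_spec; split => /=.
      by rewrite /GRing.scale /= mulr0 addr0.
    by rewrite /y subr0 addrA.
  exact: deriv_on_affine.
have := deriv_bound (C := e * `|D|) ler01 dphi.
rewrite !subr0 mulr1 !add0r scale1r scale0r subr0 => H.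
have -> : Psi s y1 - Psi s y2 - (Dg (t, c t + x t) [:: (0, y1 - y2)] - b (y1 - y2)) =
   Dg (gl 1) [::] - L0 - Dg (gl 0) [::].
  rewrite /Psi /gl /y scale1r scale0r addr0 /D (addrC y2) subrK -/L0.
  by rewrite (linear_onB lb E1 E2); linear_over R.
apply: H => a a01.
have := Hd (gl a) D (glU a a01) _ ED.
have -> : Dg (gl a) [:: (0, D)] - b D - (Dg (t, c t + x t) [:: (0, D)] - b D) =
  Dg (gl a) [:: (0, D)] - L0 by rewrite /L0; linear_over R.
apply.
have -> : gl a - (t, c t + x t) = (s - t, c s + y a - (c t + x t)) :> W by [].
apply: pair_norm_lt; first lra.
have -> : c s + y a - (c t + x t) = (c s - c t) + (y a - x t) by linear_over R.
apply: le_lt_trans (ler_normD _ _) _.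
have := yball a a01; have : `|c s - c t| <= d / 4 by apply: Hr' => //; lra.
lra.
Qed.

Let frozen_cont t y : J t -> Mx y -> cont_on J c t -> cont_on J h t ->
  cont_on J (fun s => Psi s y) t.
Proof.
move=> Jt My cc ch; apply: cont_onB => //; apply: cont_onB; last exact: cont_on_cst.
apply: (smooth_map_cont sVW sm (cs := [::]) (ga := fun s => (s, c s + y))) => //.
  by move=> s Js; split => //; exact: UM.
by apply: cont_on_pair; apply: cont_onD => //; exact: cont_on_cst.
Qed.

(** [implicit_exists] at time s, started at x t, produces a root within e of x t; by uniqueness in
    [Mx] it is x s. *)
Lemma implicit_curve_cont t : J t -> cont_on J c t -> cont_on J h t ->
  cont_on J x t.
Proof.
move=> Jt cc ch e e0; have [K K0 iso] := inv Jt.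
have K10 : 0 < K + 1 by rewrite ltr_wpDl.
have eta0 : 0 < (2 * (K + 1))^-1 by rewrite invr_gt0 mulr_gt0.
have [d [d0 ballM Hd]] := strong Jt cc eta0.
pose r := Num.min d e.
have r0 : 0 < r by rewrite lt_min d0.
have [rd re] : r <= d /\ r <= e by rewrite !ge_min !lexx orbT.
have Ke : K * (2 * (K + 1))^-1 <= 1 / 2.
  by rewrite ler_pdivrMr ?mulr_gt0 //; lra.
have [|q q0 Hq] := frozen_cont Jt (xM Jt) cc ch (e := r / (2 * (K + 1))).
  by rewrite divr_gt0 // mulr_gt0.
exists (Num.min d q); first by rewrite lt_min d0.
move=> s Js; rewrite lt_min => /andP[sd sq].
have small : K * `|Psi s (x t)| <= (1 - K * (2 * (K + 1))^-1) * r.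
  have := Hq s Js sq; rewrite x0 // subr0 => h1.
  apply: (@le_trans _ _ ((K + 1) * (r / (2 * (K + 1))))).
    by apply: ler_pM => //; lra.
  rewrite [X in X <= _](_ : _ = 1 / 2 * r); last by field; rewrite gt_eqF.
  by apply: ler_wpM2r; [exact: ltW | lra].
have [||y [Ey hy y0]] := implicit_exists cX sE clE sF iso K0 (ltW eta0) _ (ltW r0)
  (xE Jt) _ (close_on_le rd (Hd s Js sd)) small.
- lra.
- by move=> y Ey hy; apply: FPsi => //; apply: ballM => //; exact: le_trans rd.
have My : Mx y by apply: ballM => //; exact: le_trans rd.
by rewrite -(xu Js My y0); exact: le_trans re.
Qed.

(** [implicit_deriv] yields a derivative w of x solving a linear equation whose coefficients and
    right-hand side depend on x itself. If x is known to be C^n these are C^n, so w is C^n by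
    [smooth_inverse] and x is C^{n+1}. *)
Theorem implicit_curve_smooth n : (n <= m)%N ->
  smooth_curve n V J c -> smooth_curve n setT J h -> smooth_curve n E J x.
Proof.
elim: n => [_ [Vc cc] [_ ch]|n IH nm sc sh].
  split => // t Jt; apply: implicit_curve_cont => //; [exact: cc | exact: ch].
have sx := IH (ltnW nm) (smooth_curveS sc) (smooth_curveS sh).
have [Vc [c' dc sc']] := sc; have [_ [h' dh sh']] := sh.
pose q t := c t + x t.
have Uq t : J t -> U (q t) by move=> Jt; apply: UM => //; exact: xM.
have sq : smooth_curve n V J q.
  by apply: smooth_curveD => //; [exact: smooth_curveS | exact: smooth_curve_sub sx].
(* The total derivative of the equation reads Dg [(1, c')] + Dg [(0, w)] - b w - h' = 0; everything
   without w is collected in k. *)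
pose k t := h' t - Dg (t, q t) [:: (1, c' t)].
have dPsi t : J t -> deriv_on J (fun s => Psi s (x t)) t (- k t).
  move=> Jt.
  have -> : - k t = Dg (t, q t) [:: (1, c' t)] - 0 - h' t by rewrite /k; linear_over R.
  apply: deriv_onB; last exact: dh.
  apply: deriv_onB; last exact: deriv_on_cst.
  have := smooth_map_deriv sVW sm TUVW (ps := [::])
    (ga := fun s => (s, c s + x t)) (ga' := (1, c' t)) Jt.
  rewrite /= addr0; apply => //.
  - by move=> s Js; split => //; apply: UM => //; exact: xM.
  - exact: smooth_curve_in sc' t Jt.
  - apply: deriv_on_pair; rewrite -[c' t]addr0.
    by apply: deriv_onD; [exact: dc | exact: deriv_on_cst].
have Fk t : J t -> F (- k t).
  move=> Jt; apply: (deriv_in sF clF Jt (half_line_acc Jt) _ (dPsi t Jt)).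
  by move=> s Js; apply: FPsi => //; exact: xM.
have /choice[w hw] : forall t, exists w, J t ->
    [/\ E w, Dg (t, q t) [:: (0, w)] - b w = k t & deriv_on J x t w].
  move=> t; have [Jt|nJt] := pselect (J t); last by exists 0.
  have [K K0 iso] := inv Jt.
  have cc : cont_on J c t := deriv_cont (dc t Jt).
  have [|||w [Ew Zw dw]] := implicit_deriv sE sF iso K0 ltr01 Jt
    (Psi := Psi) (z := x) _ _ _ (Fk t Jt) (dPsi t Jt).
  - by move=> s Js; split; [exact: xE | exact: x0].
  - exact: smooth_curve_cont sx t Jt.
  - move=> e e0; have [d [d0 _ Hd]] := strong Jt cc e0.
    exists (Num.min d 1); split; first by rewrite lt_min d0 ltr01.
      by rewrite ge_min lexx orbT.
    move=> s Js; rewrite lt_min => /andP[sd _].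
    by apply: close_on_le (Hd s Js sd); rewrite ge_min lexx.
  by exists w; rewrite Zw opprK.
split => //; exists w; first by move=> t /hw[].
apply: (smooth_inverse sE EV sF clF lb Uq inv nm sq (k := k)).
  apply: smooth_curveD => //; apply: smooth_curveN => //.
  apply: (smooth_map_curve sVW sm TUVW (cs := [:: fun t => (1, c' t)])) => //.
  - by move=> t Jt; split => //; exact: Uq.
  - exact: smooth_graph.
  - split => //.
    apply: (@smooth_curve_ext _ _ _ _ _ (fun t => ((1, 0) : W) + (0, c' t))).
      by move=> t _; apply/pair_equal_spec; rewrite /= addr0 add0r.
    apply: smooth_curveD => //; first by apply: smooth_curve_cst => //; case: sV.
    exact: (smooth_pair0 (E := V)).
by move=> t /hw[].
Qed.

End implicit_curve.
End smooth_implicit.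

(** * The closed graph theorem *)

Section closed_graph.
Context {R : realType} {P Q : normedModType R}.
Variables (S : set P) (T : P -> Q).
Hypotheses (cP : seq_complete P) (cQ : seq_complete Q).
Hypotheses (sS : subspace S) (clS : norm_closed S) (lT : linear_on S T).
Hypothesis closed_graph : forall x y, S x ->
  (forall e : R, 0 < e -> exists x', [/\ S x', `|x - x'| <= e & `|y - T x'| <= e]) ->
  y = T x.

Let C (n : nat) : set P := [set x | S x /\ `|T x| <= n%:R].

(** Baire's argument for the sets where |T x| <= n. If none were dense in a ball, shrinking balls
    avoiding one of these sets after another would have a common point l of S belonging to none of
    them. *)
Let baire : exists n x0 (r : R), [/\ S x0, 0 < r & forall x, S x ->
  `|x - x0| <= r -> forall e : R, 0 < e -> exists2 x', C n x' & `|x - x'| <= e].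
Proof.
apply: contrapT => nbaire.
have step n (u : P * R) : exists u' : P * R, S u.1 -> 0 < u.2 ->
    [/\ S u'.1, 0 < u'.2, `|u'.1 - u.1| <= u.2 / 2, u'.2 <= u.2 / 2
      & forall x', C n x' -> u'.2 < `|u'.1 - x'|].
  case: u => x0 r /=; have [[Sx0 r0]|h] := pselect (S x0 /\ 0 < r); last first.
    by exists (0, 0) => Sx0 r0; case: h.
  have [x [Sx hx [e e0 He]]] : exists x, [/\ S x, `|x - x0| <= r / 2 &
      exists2 e : R, 0 < e & forall x', C n x' -> e < `|x - x'|].
    apply: contrapT => nx; apply: nbaire; exists n, x0, (r / 2).
    split; [by []|exact: divr_gt0|] => x Sx hx e e0; apply: contrapT => ne.
    apply: nx; exists x; split => //; exists e => // x' Cx'.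
    by rewrite ltNge; apply/negP => h; apply: ne; exists x'.
  exists (x, Num.min e (r / 2)) => _ _ /=; split => //.
  - by rewrite lt_min e0 divr_gt0.
  - by rewrite ge_min lexx orbT.
  - by move=> x' /He; apply: le_lt_trans; rewrite ge_min lexx.
have /choice[nx hnx] : forall n, exists g : P * R -> P * R, forall u,
    S u.1 -> 0 < u.2 -> [/\ S (g u).1, 0 < (g u).2, `|(g u).1 - u.1| <= u.2 / 2,
      (g u).2 <= u.2 / 2 & forall x', C n x' -> (g u).2 < `|(g u).1 - x'|].
  by move=> n; have /choice[g hg] := step n; exists g.
pose u := fix u n := match n with 0 => (0 : P, 1 : R) | m.+1 => nx m (u m) end.
have u_ok n : S (u n).1 /\ 0 < (u n).2.
  elim: n => [|n [h1 h2]] /=; first by case: sS.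
  by have [] := hnx n _ h1 h2.
have uS n := hnx n _ (u_ok n).1 (u_ok n).2.
have r_small n : (u n).2 <= 1 / 2 ^+ n.
  elim: n => [|n IH]; first by rewrite expr0 divr1.
  by rewrite halvingS; have [_ _ _ h _] := uS n; rewrite -[u n.+1]/(nx n (u n)); lra.
have dist n k : `|(u (k + n)%N).1 - (u n).1| <= (u n).2 - (u (k + n)%N).2.
  elim: k => [|k IH]; first by rewrite add0n !subrr normr0.
  have [_ _ h1 h2 _] := uS (k + n)%N; rewrite addSn.
  rewrite -[u (k + n).+1]/(nx (k + n)%N (u (k + n)%N)).
  have := ler_distD (u (k + n)%N).1 (nx (k + n)%N (u (k + n)%N)).1 (u n).1; lra.
have [|l hl] := @halving_limit _ _ (fun n => (u n).1) (1 / 2) cP.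
  move=> n; have [_ _ h _ _] := uS n; rewrite -[u n.+1]/(nx n (u n)).
  by have := r_small n; rewrite (_ : 1 / 2 / _ = 1 / 2 ^+ n / 2); [lra | ring].
have near n : `|(u n).1 - l| <= (u n).2.
  apply/ler_addgt0Pr => e e0; have [m hm] := small_halving (2 * (1 / 2) : R) e0.
  have h1 := hl (m + n)%N; have h2 := dist n m; have [_ h3] := u_ok (m + n)%N.
  have := ler_distD (u (m + n)%N).1 (u n).1 l.
  rewrite (distrC (u n).1 (u (m + n)%N).1).
  have : 2 * (1 / 2) / 2 ^+ (m + n) <= 2 * (1 / 2) / 2 ^+ m :> R.
    by apply: ler_halving; [lra | exact: leq_addr].
  lra.
have Sl : S l.
  apply: clS => e e0; have [m hm] := small_halving (2 * (1 / 2) : R) e0.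
  by exists (u m).1; [case: (u_ok m) | rewrite distrC; have := hl m; lra].
(* An n above |T l| contradicts that the ball chosen after stage n avoids [C n]. *)
pose n := (Num.truncn `|T l|).+1.
have [_ _ _ _ /(_ l)] := uS n; rewrite -[nx n (u n)]/(u n.+1) => h.
have := near n.+1; rewrite leNgt h //; split => //.
exact: ltW (truncnS_gt _).
Qed.

(** The two centres x0 + a y and x0 are approximated by points of the dense [C n]; the difference of
    these points, divided by a, approximates y up to half its norm, and T is bounded by 2 n / a on
    it. *)
Let approximable : exists2 K : R, 0 <= K & forall y, S y ->
  exists v, [/\ S v, `|y - v| <= `|y| / 2 & `|T v| <= K * `|y|].
Proof.
have [n [x0 [r [Sx0 r0 H]]]] := baire.
exists (2 * n%:R / r); first by rewrite divr_ge0 ?mulr_ge0 // ltW.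
move=> y Sy; have [->|y0] := eqVneq y 0.
  have S0 : S 0 by case: sS.
  by exists 0; rewrite (linear_on0 S0 lT) subrr !normr0 mul0r mulr0.
have ny0 : 0 < `|y| by rewrite normr_gt0.
(* This scaling places x0 + a y on the boundary of the ball; the tolerance a |y| / 4 on each of the
   two points adds up to half of a |y|. *)
pose a := r / `|y|.
have a0 : 0 < a by rewrite divr_gt0.
have e0 : 0 < a * (`|y| / 4) by rewrite mulr_gt0 // divr_gt0.
have Say : S (x0 + a *: y) by apply: subspaceD => //; exact: subspaceZ.
have [|x1 [S1 T1] h1] := H _ Say _ _ e0.
  rewrite addrAC subrr add0r normrZ gtr0_norm // /a -mulrA mulVf ?mulr1 //.
  by rewrite gt_eqF.
have [|x2 [S2 T2] h2] := H _ Sx0 _ _ e0; first by rewrite subrr normr0 ltW.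
have S12 : S (x1 - x2) by exact: subspaceB.
exists (a^-1 *: (x1 - x2)); split; first exact: subspaceZ.
- have -> : y - a^-1 *: (x1 - x2) =
      a^-1 *: ((x0 + a *: y - x1) - (x0 - x2)).
    rewrite -{1}(scale1r y) -(mulVf (lt0r_neq0 a0)).
    by linear_over R.
  rewrite normrZ gtr0_norm ?invr_gt0 // mulrC ler_pdivrMr //.
  apply: le_trans (ler_normB _ _) _.
  by have := lerD h1 h2; rewrite [X in _ <= X -> _](_ : _ = `|y| / 2 * a) //; field.
- rewrite (linear_onZ _ _ lT) //; last by case: sS.
  rewrite (linear_onB lT) // normrZ gtr0_norm ?invr_gt0 //.
  rewrite mulrC ler_pdivrMr // /a.
  rewrite [X in _ <= X](_ : _ = n%:R + n%:R); last first.
    by field; rewrite !gt_eqF.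
  by apply: le_trans (ler_normB _ _) _; exact: lerD.
Qed.

(** Approximating the remainder again and again halves it each time. The images of the partial sums
    converge with total length 2 K |y|, and closedness of the graph identifies their limit with T
    y. *)
Theorem closed_graph_bounded :
  exists2 L : R, 0 <= L & forall x, S x -> `|T x| <= L * `|x|.
Proof.
have [K K0 H] := approximable.
have S0 : S 0 by case: sS.
exists (2 * K); first exact: mulr_ge0.
move=> y Sy.
have /choice[v hv] : forall w, exists v, S w ->
    [/\ S v, `|w - v| <= `|w| / 2 & `|T v| <= K * `|w|].
  move=> w; have [/H[v hv]|nw] := pselect (S w); first by exists v.
  by exists 0.
pose w n := iter n (fun w => w - v w) y.
have wS n : S (w n).
  elim: n => [//|n IH] /=; have [Sv _ _] := hv _ IH; exact: subspaceB.
have w_small n : `|w n| <= `|y| / 2 ^+ n.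
  elim: n => [|n IH]; first by rewrite expr0 divr1.
  by rewrite halvingS /=; have [_ h _] := hv _ (wS n); lra.
have SyT n : S (y - w n) by exact: subspaceB.
have [|z hz] := @halving_limit _ _ (fun n => T (y - w n)) (K * `|y|) cQ.
  move=> n; have [Sv _ h] := hv _ (wS n).
  rewrite -(linear_onB lT) //.
  have -> : y - w n.+1 - (y - w n) = v (w n) by rewrite /=; linear_over R.
  apply: le_trans h _; rewrite -mulrA; apply: ler_wpM2l => //.
have zE : z = T y.
  apply: closed_graph => // e e0.
  have [n1 h1] := small_halving `|y| e0.
  have [n2 h2] := small_halving (2 * (K * `|y|)) e0.
  exists (y - w (maxn n1 n2)); split => //.
    rewrite opprB addrC subrK; apply: le_trans (w_small _) _.
    by apply: le_trans h1; apply: ler_halving => //; exact: leq_maxl.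
  rewrite distrC; apply: le_trans (hz _) _; apply: le_trans h2.
  by apply: ler_halving; [rewrite !mulr_ge0 | exact: leq_maxr].
by have := hz 0%N; rewrite /= subrr (linear_on0 S0 lT) sub0r normrN expr0 divr1 zE mulrA.
Qed.

End closed_graph.

(** * Neighbourhoods, closedness and completeness in terms of real norms *)

Section topology.
Context {R : realType} {k : scalars}.
Local Notation K := (scalar_field R k).

Lemma nbhs_nrm (X : normedModType K) (x : X) (U : set X) :
  nbhs x U <-> exists2 r : R, 0 < r & forall y, nrm (y - x) < r -> U y.
Proof.
split.
  move=> /nbhs_normP[e /= e0 H]; exists (to_real k e).
    by rewrite -(ltr_of_real k) of_real0 ge0_to_real // ltW.
  move=> y hy; apply: H; rewrite /ball_ /= distrC nrmE.
  by rewrite -(ge0_to_real (ltW e0)) ltr_of_real.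
move=> [r r0 H]; apply/nbhs_normP; exists (of_real k r).
  by rewrite /= -(of_real0 k) ltr_of_real.
by move=> y; rewrite /ball_ /= distrC nrmE ltr_of_real; exact: H.
Qed.

Lemma closed_nrm (X : normedModType K) (F : set X) : closed F ->
  norm_closed (F : set (realify X)).
Proof.
move=> clF x H; apply: clF => U /nbhs_nrm[r r0 HU].
have [|y Fy hy] := H (r / 2); first by rewrite divr_gt0.
exists y; split => //; apply: HU.
have : `|(x : realify X) - y| < r by apply: le_lt_trans hy _; rewrite ltr_pdivrMr //; lra.
by rewrite distrC.
Qed.

Lemma closed_op_nrm (X Y : normedModType K) (T : linop X Y) x y : closed_op T ->
  (forall e : R, 0 < e -> exists x', [/\ dom T x', nrm (x - x') <= e &
     nrm (y - T x') <= e]) -> dom T x /\ y = T x.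
Proof.
move=> clT H; apply: (clT (x, y)) => U [/= [U1 U2] [/nbhs_nrm[r1 r10 H1] /nbhs_nrm[r2 r20 H2]] UU].
have [|x' [dx' h1 h2]] := H (Num.min r1 r2 / 2).
  by rewrite divr_gt0 // lt_min r10.
have lt12 : Num.min r1 r2 / 2 < r1 /\ Num.min r1 r2 / 2 < r2.
  have : 0 < Num.min r1 r2 by rewrite lt_min r10.
  have : Num.min r1 r2 <= r1 by rewrite ge_min lexx.
  have : Num.min r1 r2 <= r2 by rewrite ge_min lexx orbT.
  by split; lra.
exists (x', T x'); split => //; apply: UU; split => /=.
  apply: H1; change (`|(x' : realify X) - x| < r1); rewrite distrC.
  by apply: le_lt_trans h1 _; case: lt12.
apply: H2; change (`|(T x' : realify Y) - y| < r2); rewrite distrC.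
by apply: le_lt_trans h2 _; case: lt12.
Qed.

Lemma realify_complete (X : completeNormedModType K) : seq_complete (realify X).
Proof.
move=> u cu.
pose v : nat -> X := u.
have : cvg (v @ \oo).
  apply/cauchy_cvgP/cauchy_exP => e e0.
  have r0 : 0 < to_real k e by rewrite -(ltr_of_real k) of_real0 ge0_to_real // ltW.
  have [|N HN] := cu (to_real k e / 2); first by rewrite divr_gt0.
  exists (u N : X); exists N => // n /= Nn; rewrite -ball_normE /ball_ /= nrmE.
  rewrite -(ge0_to_real (ltW e0)) ltr_of_real.
  apply: (@le_lt_trans _ _ (to_real k e / 2)); first exact: HN.
  by rewrite ltr_pdivrMr //; lra.
move=> /cvg_ex[l hl]; exists l => e e0.
have [N _ HN] : \forall n \near \oo, nrm ((u n : X) - l) < e.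
  by apply: (hl [set y | nrm (y - l) < e]); apply/nbhs_nrm; exists e.
by exists N => n Nn; apply: ltW; exact: HN.
Qed.

End topology.

(** A real mu acts componentwise on pairs, so over real scalars the first component of the
    complexified preimage of (y, 0) is a real preimage of y. *)
Lemma pencil_onto (R : realType) (k : scalars)
    (X Y : normedModType (scalar_field R k)) (D : set X) (A B : X -> Y) p :
  regular_pencil D A B p -> exists2 r : R, 0 < r & forall mu : R, 0 < mu < r ->
    forall y, exists x, D x /\ A x + of_real k mu *: B x = y.
Proof.
case: k X Y D A B => X Y D A B [_ [G [r [r0 inv _]]]]; exists r => // mu /andP[mu0 mur] y.
  have [|_ GD GT _] := inv (real_complex R mu).
    by rewrite normc_def /= expr0n addr0 sqrtr_sqr gtr0_norm // mu0.
  have [D1 _] := GD (y, 0).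
  exists (G (real_complex R mu) (y, 0)).1; split => //.
  by have := congr1 fst (GT (y, 0)); rewrite /= scale0r subr0.
have [|_ GD GT _] := inv (real_complex R mu).
  by rewrite normc_def /= expr0n addr0 sqrtr_sqr gtr0_norm // mu0.
by exists (G (real_complex R mu) y); split; [exact: GD | exact: GT].
Qed.

(** * Linear operators with a domain *)

Section linops.
Context {R : realType} {k : scalars}.
Local Notation K := (scalar_field R k).
Context {X Y : normedModType K}.
Variable T : linop X Y.

Lemma linop0 : T 0 = 0.
Proof.
have := app_linear 1 (dom0 T) (dom0 T); rewrite !scale1r addr0 => h.
by apply: (addrI (T 0)); rewrite addr0 -h.
Qed.

Lemma domZ a x : dom T x -> dom T (a *: x).
Proof. by move=> dx; rewrite -[_ *: _]addr0; apply: dom_comb => //; exact: dom0. Qed.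

Lemma domD x y : dom T x -> dom T y -> dom T (x + y).
Proof. by move=> dx dy; rewrite -[x]scale1r; exact: dom_comb. Qed.

Lemma linopZ a x : dom T x -> T (a *: x) = a *: T x.
Proof.
move=> dx; rewrite -[_ *: _]addr0 (app_linear a dx (dom0 T)).
by rewrite linop0 addr0.
Qed.

Lemma linopD x y : dom T x -> dom T y -> T (x + y) = T x + T y.
Proof. by move=> dx dy; rewrite -[x]scale1r (app_linear 1 dx dy) !scale1r. Qed.

Lemma domN x : dom T x -> dom T (- x).
Proof. by move=> dx; rewrite -scaleN1r; exact: domZ. Qed.

Lemma linopN x : dom T x -> T (- x) = - T x.
Proof. by move=> dx; rewrite -scaleN1r linopZ // scaleN1r. Qed.

Lemma linopB x y : dom T x -> dom T y -> T (x - y) = T x - T y.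
Proof. by move=> dx dy; rewrite linopD ?linopN //; exact: domN. Qed.

Lemma dom_sum I (r : seq I) (P : pred I) (v : I -> X) :
  (forall i, P i -> dom T (v i)) -> dom T (\sum_(i <- r | P i) v i).
Proof. by move=> h; apply: big_ind => //; [exact: dom0 | exact: domD]. Qed.

Lemma linop_sum I (r : seq I) (P : pred I) (v : I -> X) :
  (forall i, P i -> dom T (v i)) ->
  T (\sum_(i <- r | P i) v i) = \sum_(i <- r | P i) T (v i).
Proof.
move=> h; elim: r => [|i r IH]; first by rewrite !big_nil linop0.
rewrite !big_cons; case: ifP => // Pi; rewrite linopD ?IH //; first exact: h.
exact: dom_sum.
Qed.

Lemma adjP q : adj_dom T q -> is_adjoint T q (adj T q).
Proof. by move=> [r hr]; exact: (xgetPex (fun=> 0) (ex_intro _ r hr)). Qed.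

End linops.

Section bounded_linear.
Context {R : realType} {k : scalars}.
Local Notation K := (scalar_field R k).
Implicit Types X Y : normedModType K.

Lemma nrm_functional X (q : X -> K) : functional q ->
  exists2 L : R, 0 <= L & forall x, nrm (q x) <= L * nrm x.
Proof.
move=> [_ [L HL]]; exists `|L| => // x; apply: le_trans (HL x) _.
by apply: ler_wpM2r (ler_norm _); exact: (normr_ge0 (x : realify X)).
Qed.

Lemma bounded_linear_rank1 X Y (q : X -> K) (v : Y) : functional q ->
  @bounded_linear_on R (realify X) (realify Y) setT (fun x => q x *: v).
Proof.
move=> fq; have [L L0 HL] := nrm_functional fq; have [lq _] := fq; split.
  move=> a x y _ _; rewrite lq scalerDl.
  by rewrite -[_ *: v in LHS]scalerA.
exists (L * nrm v) => [|x _]; first by rewrite mulr_ge0 //; exact: (normr_ge0 (v : realify Y)).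
change (nrm (q x *: v) <= L * nrm v * nrm x); rewrite nrm_scale mulrAC.
by apply: ler_wpM2r; [exact: (normr_ge0 (v : realify Y)) | exact: HL].
Qed.

Lemma bounded_linear_sum (E F : normedModType R) (I : Type) (r : seq I)
    (P : pred I) (V : set E) (T : I -> E -> F) :
  (forall i, P i -> bounded_linear_on V (T i)) ->
  bounded_linear_on V (fun x => \sum_(i <- r | P i) T i x).
Proof.
move=> h; elim: r => [|i r [IH [L L0 HL]]].
  split; first by move=> a x y _ _; rewrite !big_nil scaler0 addr0.
  by exists 0 => // x _; rewrite big_nil normr0 mul0r.
case Pi : (P i); last first.
  split; first by move=> a x y Vx Vy; rewrite !big_cons Pi; exact: IH.
  by exists L => // x Vx; rewrite big_cons Pi; exact: HL.
have [li [M M0 HM]] := h i Pi; split.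
  by move=> a x y Vx Vy; rewrite !big_cons Pi li // IH // scalerDr addrACA.
exists (M + L); first exact: addr_ge0.
move=> x Vx; rewrite big_cons Pi mulrDl; apply: le_trans (ler_normD _ _) _.
by apply: lerD; [exact: HM | exact: HL].
Qed.

End bounded_linear.

(** * Algebra of the root vectors *)

Section functionals.
Context {R : realType} {k : scalars}.
Local Notation K := (scalar_field R k).
Context {X : normedModType K}.
Variable q : X -> K.
Hypothesis fq : functional q.

Lemma functional0 : q 0 = 0.
Proof.
have [lq _] := fq; have := lq 1 0 0; rewrite scale1r mul1r addr0 => h.
by apply: (addrI (q 0)); rewrite addr0 -h.
Qed.

Lemma functionalZ a x : q (a *: x) = a * q x.
Proof. by have [lq _] := fq; rewrite -[_ *: _]addr0 lq functional0 addr0. Qed.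

Lemma functionalD x y : q (x + y) = q x + q y.
Proof. by have [lq _] := fq; rewrite -[x]scale1r lq mul1r scale1r. Qed.

Lemma functional_sum I (r : seq I) (P : pred I) (v : I -> X) :
  q (\sum_(i <- r | P i) v i) = \sum_(i <- r | P i) q (v i).
Proof.
by apply: (big_morph q functionalD functional0).
Qed.

End functionals.

Lemma sum_pick (V : nmodType) (c : bool) (a b j0 : nat) (v : V) :
  \sum_(a <= j < b) (if c && (j0 == j) then v else 0) =
  if c && (a <= j0 < b)%N then v else 0.
Proof.
case: c => /=; last by rewrite big1.
case: ifP => h.
  rewrite (bigD1_seq j0) ?mem_index_iota ?iota_uniq //= eqxx.
  by rewrite big1 ?addr0 // => i; rewrite eq_sym => /negbTE->.
rewrite big_nat big1 // => i hi; case: eqP => // ij.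
by rewrite ij hi in h.
Qed.

Section root_system.
Context {R : realType} {k : scalars}.
Local Notation K := (scalar_field R k).
Context {X Y : normedModType K}.
Variable S : root_data X Y.
Local Notation A := (opA S).
Local Notation B := (opB S).
Local Notation nu := (idx S).
Local Notation n := (kdim S).
Local Notation phi := (@phi _ _ _ _ S).
Local Notation qf := (@qf _ _ _ _ S).
Implicit Types i : 'I_n.
Hypothesis hbasis : root_basis S.
Hypotheses (hroot : root_vectors S) (hdual : dual_root_vectors S).

(** The functional B^* q_i^j, which by biorthogonality is the coordinate along phi_i^j. *)
Definition coord (i : 'I_n) (j : nat) : X -> K := adj B (qf i j).

Lemma D_domA x : D S x -> dom A x. Proof. by case. Qed.
Lemma D_domB x : D S x -> dom B x. Proof. by case. Qed.

Lemma D0 : D S 0. Proof. by split; exact: dom0. Qed.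

Lemma D_comb a x y : D S x -> D S y -> D S (a *: x + y).
Proof. by move=> [h1 h2] [h3 h4]; split; exact: dom_comb. Qed.

Lemma DZ a x : D S x -> D S (a *: x).
Proof. by move=> Dx; rewrite -[_ *: _]addr0; apply: D_comb => //; exact: D0. Qed.

Lemma DD x y : D S x -> D S y -> D S (x + y).
Proof. by move=> Dx Dy; rewrite -[x]scale1r; exact: D_comb. Qed.

Lemma DN x : D S x -> D S (- x).
Proof. by move=> Dx; rewrite -scaleN1r; exact: DZ. Qed.

Lemma D_sum I (r : seq I) (P : pred I) (v : I -> X) :
  (forall j, P j -> D S (v j)) -> D S (\sum_(j <- r | P j) v j).
Proof. by move=> h; apply: big_ind => //; [exact: D0 | exact: DD]. Qed.

Lemma coord_functional i j : (1 <= j <= mult i)%N -> functional (coord i j).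
Proof. by move=> hj; have [/(_ i j hj)[_ /adjP[]]] := hdual. Qed.

Lemma dual_functional i j : (1 <= j <= mult i)%N -> functional (qf i j).
Proof. by move=> hj; have [/(_ i j hj)[_ /adjP[]]] := hdual. Qed.

Lemma dual_B i j x : (1 <= j <= mult i)%N -> dom B x -> qf i j (B x) = coord i j x.
Proof. by move=> hj; have [/(_ i j hj)[_ /adjP[_ _ H]] _ _ _] := hdual; exact: H. Qed.

(** The relations A^* q_i^j = - B^* q_i^{j+1} and A^* q_i^{m_i} = 0 make A shift coordinates along
    each chain; every identity between A and the projectors rests on this. *)
Lemma dual_A i j x : (1 <= j <= mult i)%N -> dom A x ->
  qf i j (A x) = if (j < mult i)%N then - coord i j.+1 x else 0.
Proof.
move=> hj dx; have [/(_ i j hj)[/adjP[_ _ H] _] top low _] := hdual.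
rewrite H //; case: ifP => jm.
  by rewrite low //; case/andP: hj => ->.
have -> : j = mult i.
  by apply/eqP; rewrite eqn_leq; case/andP: hj => _ -> /=; rewrite leqNgt jm.
by rewrite top.
Qed.

Lemma phi_D i j : (1 <= j <= mult i)%N -> D S (phi i j).
Proof. by have [_ _ H _] := hroot; exact: H. Qed.

Lemma coord_phi i i' j l : (1 <= j <= mult i)%N -> (1 <= l <= mult i')%N ->
  coord i' l (phi i j) = ((i == i') && (j == l))%:R.
Proof.
move=> hj hl; rewrite -dual_B //; last exact/D_domB/phi_D.
by have [_ _ _ H] := hdual; exact: H.
Qed.

Lemma phiS_D i (s : 'I_(mult i)) : D S (phi i s.+1).
Proof. by apply: phi_D; exact: ltn_ord. Qed.

Lemma mult_le i : (1 <= mult i <= nu)%N. Proof. by have [H] := hroot. Qed.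

(** All projectors are sums over a set of root vectors. The set is described by a predicate on pairs
    (i, s) with s counted from 0, the vector being [phi i s.+1]; composition of projectors becomes
    conjunction of predicates. *)
Definition rsum (V : nmodType) (p : 'I_n -> nat -> bool) (g : 'I_n -> nat -> V) :=
  \sum_i \sum_(s < mult i | p i s) g i s.

Definition PR p (x : X) := rsum p (fun i s => coord i s.+1 x *: phi i s.+1).
Definition QR p (y : Y) := rsum p (fun i s => qf i s.+1 y *: B (phi i s.+1)).

(** The five predicates give P_{2s} ([level]), P_{2s}^{(s+1)} ([top]), P_{2/\,s} ([wedge]), P_2
    ([every]) and P_{2Sigma} ([upper]), and likewise the projectors on Y. *)
Definition level s (i : 'I_n) (s' : nat) := s' == s.
Definition top s (i : 'I_n) (s' : nat) := (s' == s) && (mult i == s.+1).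
Definition wedge s (i : 'I_n) (s' : nat) := (s' == s) && (mult i != s.+1).
Definition every (i : 'I_n) (s' : nat) := true.
Definition upper (i : 'I_n) (s' : nat) := (0 < s')%N.

Section rsums.
Variable V : zmodType.
Implicit Types (p : 'I_n -> nat -> bool) (g : 'I_n -> nat -> V).

Lemma rsumE p g : rsum p g = \sum_i \sum_(s < mult i) if p i s then g i s else 0.
Proof. by apply: eq_bigr => i _; rewrite big_mkcond. Qed.

Lemma eq_rsum p q g h :
  (forall i s, (s < mult i)%N -> (if p i s then g i s else 0) =
     (if q i s then h i s else 0)) -> rsum p g = rsum q h.
Proof.
by move=> H; rewrite !rsumE; apply: eq_bigr => i _; apply: eq_bigr => s _; exact: H.
Qed.

Lemma rsum_big I (r : seq I) (P : pred I) (p : I -> 'I_n -> nat -> bool) q g :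
  (forall i s, (s < mult i)%N ->
     \sum_(j <- r | P j) (if p j i s then g i s else 0) =
     if q i s then g i s else 0) ->
  \sum_(j <- r | P j) rsum (p j) g = rsum q g.
Proof.
move=> H; rewrite rsumE; under eq_bigr do rewrite rsumE.
rewrite exchange_big; apply: eq_bigr => i _.
by rewrite exchange_big; apply: eq_bigr => s _; exact: H.
Qed.

Lemma rsumB p q q' g :
  (forall i s, (s < mult i)%N -> (if p i s then g i s else 0) -
     (if q i s then g i s else 0) = if q' i s then g i s else 0) ->
  rsum p g - rsum q g = rsum q' g.
Proof.
move=> H; rewrite !rsumE -sumrB; apply: eq_bigr => i _.
by rewrite -sumrB; apply: eq_bigr => s _; exact: H.
Qed.

Lemma rsum_level s j g : (s < j)%N ->
  \sum_(i < n | mult i == j) g i s = rsum (fun i s' => (s' == s) && (mult i == j)) g.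
Proof.
move=> sj; rewrite big_mkcond /=; apply: eq_bigr => i _; case: eqP => [mj|_].
  rewrite mj in sj |- *; under eq_bigl do rewrite andbT.
  by rewrite (big_pred1 (Ordinal sj)).
by rewrite big_pred0 // => s'; rewrite andbF.
Qed.

Lemma rsum_levels s g :
  \sum_(s.+1 <= j < nu.+1) \sum_(i < n | mult i == j) g i s = rsum (level s) g.
Proof.
transitivity (\sum_(s.+1 <= j < nu.+1)
    rsum (fun i s' => (s' == s) && (mult i == j)) g).
  by rewrite !big_nat; apply: eq_bigr => j /andP[sj _]; rewrite rsum_level.
apply: rsum_big => i s' s'm; rewrite sum_pick /level.
have /andP[_ mnu] := mult_le i.
by case: (s' =P s) => // <-; rewrite s'm ltnS mnu.
Qed.

End rsums.

Lemma P2topE s : P2sj S s s.+1 = PR (top s).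
Proof.
by apply/funext => x; apply: (rsum_level (fun i s => coord i s.+1 x *: phi i s.+1)).
Qed.

Lemma Q2topE s : Q2sj S s s.+1 = QR (top s).
Proof.
by apply/funext => y; apply: (rsum_level (fun i s => qf i s.+1 y *: B (phi i s.+1))).
Qed.

Lemma P2sE s : P2s S s = PR (level s).
Proof.
by apply/funext => x; exact: (rsum_levels s (fun i s => coord i s.+1 x *: phi i s.+1)).
Qed.

Lemma Q2sE s : Q2s S s = QR (level s).
Proof.
by apply/funext => y; exact: (rsum_levels s (fun i s => qf i s.+1 y *: B (phi i s.+1))).
Qed.

Lemma P2E : P2 S = PR every.
Proof.
apply/funext => x; rewrite /P2; under eq_bigr do rewrite P2sE.
apply: rsum_big => i s sm; rewrite (sum_pick true).
by have /andP[_ mnu] := mult_le i; rewrite /= (leq_trans sm mnu).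
Qed.

Lemma Q2E : Q2 S = QR every.
Proof.
apply/funext => x; rewrite /Q2; under eq_bigr do rewrite Q2sE.
apply: rsum_big => i s sm; rewrite (sum_pick true).
by have /andP[_ mnu] := mult_le i; rewrite /= (leq_trans sm mnu).
Qed.

Lemma P2SigE : P2Sig S = PR upper.
Proof.
apply/funext => x; rewrite /P2Sig; under eq_bigr do rewrite P2sE.
apply: rsum_big => i s sm; rewrite (sum_pick true).
by have /andP[_ mnu] := mult_le i; rewrite /= (leq_trans sm mnu) andbT.
Qed.

Lemma P2wE s : P2w S s = PR (wedge s).
Proof.
apply/funext => x; rewrite /P2w P2sE P2topE; apply: rsumB => i s' _.
by rewrite /level /top /wedge; case: eqP; case: eqP; rewrite /= ?subrr ?subr0.
Qed.

Lemma Q2SigE s : Q2Sig S s = QR (wedge s).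
Proof.
apply/funext => x; rewrite /Q2Sig Q2sE Q2topE; apply: rsumB => i s' _.
by rewrite /level /top /wedge; case: eqP; case: eqP; rewrite /= ?subrr ?subr0.
Qed.

Lemma rsum_delta p (a : 'I_n -> nat -> K) i s : (s < mult i)%N ->
  rsum p (fun i' s' => a i' s' * ((i' == i) && (s' == s))%:R) =
  if p i s then a i s else 0.
Proof.
move=> sm; rewrite rsumE (bigD1 i) //= [X in _ + X]big1 => [|i' /negbTE ii']; last first.
  by apply: big1 => s' _; rewrite ii' /= mulr0 if_same.
rewrite addr0 (bigD1 (Ordinal sm)) //= !eqxx mulr1 big1 ?addr0 // => s' ss'.
by rewrite -val_eqE /= in ss'; rewrite (negbTE ss') mulr0 if_same.
Qed.

Lemma coord_sum p (a : 'I_n -> nat -> K) i s : (s < mult i)%N ->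
  coord i s.+1 (rsum p (fun i s => a i s *: phi i s.+1)) =
  if p i s then a i s else 0.
Proof.
move=> sm; have f := @coord_functional i s.+1 sm.
rewrite -(rsum_delta p a sm) /rsum (functional_sum f); apply: eq_bigr => i' _.
rewrite (functional_sum f); apply: eq_bigr => s' _.
by rewrite (functionalZ f) (@coord_phi i' i s'.+1 s.+1 (ltn_ord s') sm) eqSS.
Qed.

Lemma dual_sum p (a : 'I_n -> nat -> K) i s : (s < mult i)%N ->
  qf i s.+1 (rsum p (fun i s => a i s *: B (phi i s.+1))) =
  if p i s then a i s else 0.
Proof.
move=> sm; have f := @dual_functional i s.+1 sm.
rewrite -(rsum_delta p a sm) /rsum (functional_sum f); apply: eq_bigr => i' _.
rewrite (functional_sum f); apply: eq_bigr => s' _.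
rewrite (functionalZ f) dual_B //; last exact/D_domB/phiS_D.
by rewrite (@coord_phi i' i s'.+1 s.+1 (ltn_ord s') sm) eqSS.
Qed.

Lemma coord_PR p x i s : (s < mult i)%N ->
  coord i s.+1 (PR p x) = if p i s then coord i s.+1 x else 0.
Proof. by move=> sm; rewrite /PR (coord_sum _ (fun i s => coord i s.+1 x)). Qed.

Lemma dual_QR p y i s : (s < mult i)%N ->
  qf i s.+1 (QR p y) = if p i s then qf i s.+1 y else 0.
Proof. by move=> sm; rewrite /QR (dual_sum _ (fun i s => qf i s.+1 y)). Qed.

(** Only the selected coordinates enter a projection; identities between projectors thus reduce to
    identities between predicates. *)
Lemma eq_PR p x p' x' : (forall i s, (s < mult i)%N ->
    (if p i s then coord i s.+1 x else 0) = (if p' i s then coord i s.+1 x' else 0)) ->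
  PR p x = PR p' x'.
Proof.
move=> H; apply: eq_rsum => i s sm; have := H i s sm.
case: (p i s); first by case: (p' i s) => ->; rewrite ?scale0r.
by case: (p' i s) => [<-|_]; rewrite ?scale0r.
Qed.

Lemma eq_QR p y p' y' : (forall i s, (s < mult i)%N ->
    (if p i s then qf i s.+1 y else 0) = (if p' i s then qf i s.+1 y' else 0)) ->
  QR p y = QR p' y'.
Proof.
move=> H; apply: eq_rsum => i s sm; have := H i s sm.
case: (p i s); first by case: (p' i s) => ->; rewrite ?scale0r.
by case: (p' i s) => [<-|_]; rewrite ?scale0r.
Qed.

Lemma PR_comp p q x : PR p (PR q x) = PR (fun i s => p i s && q i s) x.
Proof.
apply: eq_PR => i s sm; rewrite coord_PR //.
by case: (p i s) => /=; case: (q i s).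
Qed.

Lemma QR_comp p q y : QR p (QR q y) = QR (fun i s => p i s && q i s) y.
Proof.
apply: eq_QR => i s sm; rewrite dual_QR //.
by case: (p i s) => /=; case: (q i s).
Qed.

Lemma PR_false p x : (forall i s, (s < mult i)%N -> p i s = false) -> PR p x = 0.
Proof.
by move=> H; rewrite /PR rsumE big1 // => i _; rewrite big1 // => s _; rewrite H.
Qed.

Lemma QR_false p y : (forall i s, (s < mult i)%N -> p i s = false) -> QR p y = 0.
Proof.
by move=> H; rewrite /QR rsumE big1 // => i _; rewrite big1 // => s _; rewrite H.
Qed.

Lemma PR_coord0 p x : (forall i s, (s < mult i)%N -> coord i s.+1 x = 0) -> PR p x = 0.
Proof.
by move=> H; rewrite /PR /rsum big1 // => i _; rewrite big1 // => s _; rewrite H // scale0r.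
Qed.

Lemma PR_D p x : D S (PR p x).
Proof. by apply: D_sum => i _; apply: D_sum => s _; apply: DZ; exact: phiS_D. Qed.

Lemma B_PR p x : dom B x -> B (PR p x) = QR p (B x).
Proof.
move=> Dx; rewrite /PR /rsum linop_sum; last first.
  by move=> i _; apply: dom_sum => s _; apply: domZ; exact/D_domB/phiS_D.
apply: eq_bigr => i _; rewrite linop_sum; last first.
  by move=> s _; apply: domZ; exact/D_domB/phiS_D.
apply: eq_bigr => s _; rewrite linopZ; last exact/D_domB/phiS_D.
by rewrite (@dual_B i s.+1 x (ltn_ord s) Dx).
Qed.

Lemma A_phi1 i : A (phi i 1) = 0. Proof. by have [/(_ i)[]] := hbasis. Qed.

Lemma A_PR p x : A (PR p x) = rsum (fun i s => p i s && (0 < s)%N)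
  (fun i s => - coord i s.+1 x *: B (phi i s)).
Proof.
rewrite /PR /rsum linop_sum; last first.
  by move=> i _; apply: dom_sum => s _; apply: domZ; exact/D_domA/phiS_D.
apply: eq_bigr => i _; rewrite linop_sum; last first.
  by move=> s _; apply: domZ; exact/D_domA/phiS_D.
rewrite big_mkcondr /=; apply: eq_bigr => s _.
rewrite linopZ; last exact/D_domA/phiS_D.
have [_ _ _ H] := hroot; case: ifP => s0.
  have -> : A (phi i s.+1) = - B (phi i s) by apply: (H i s.+1); rewrite ltnS s0 ltn_ord.
  by rewrite scalerN scaleNr.
have -> : nat_of_ord s = 0%N by case: (nat_of_ord s) s0.
by rewrite A_phi1 scaler0.
Qed.

(** Applying q_i^{s+1} to A x reads minus the coordinate s + 2, and A phi_i^{s+2} = - B phi_i^{s+1}: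
    the signs cancel and the index set is shifted up by one level. *)
Lemma QR_A p x : dom A x -> QR p (A x) = A (PR (fun i s => (0 < s)%N && p i s.-1) x).
Proof.
move=> dx; rewrite A_PR /QR !rsumE; apply: eq_bigr => i _.
have /andP[m0 _] := mult_le i; case mE : (mult i) m0 => [//|m'] _.
(* On the left the last term of each chain vanishes, A^* q_i^{m_i} being 0; on the right the first
   one does, A killing level 0. The remaining terms match after the shift. *)
rewrite big_ord_recr [RHS]big_ord_recl /= add0r.
rewrite dual_A ?mE //; last by rewrite leqnn.
rewrite ltnn scale0r if_same addr0; apply: eq_bigr => s _.
rewrite /bump /= add1n /= andbT; case: (p i s) => //.
have sm := ltn_ord s; rewrite (@dual_A i s.+1) //; last by rewrite mE; exact: (leqW sm).
by rewrite mE ltnS sm.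
Qed.

Lemma A_PR_level0 x : A (PR (level 0) x) = 0.
Proof.
rewrite A_PR /rsum big1 // => i _; rewrite big_pred0 // => s.
by rewrite /level; case: eqP => [->|].
Qed.

Lemma proj_imageP p x : (PR p @` D S) x <-> PR p x = x.
Proof.
split => [[z Dz <-]|h]; last by exists x => //; rewrite -h; exact: PR_D.
by rewrite PR_comp; apply: eq_PR => i s _; case: (p i s).
Qed.

Lemma proj_rangeP p y : range (QR p) y <-> QR p y = y.
Proof.
split => [[z _ <-]|h]; last by exists y.
by rewrite QR_comp; apply: eq_QR => i s _; case: (p i s).
Qed.

Lemma PR_every0 x : PR every x = 0 <-> forall i s, (s < mult i)%N -> coord i s.+1 x = 0.
Proof.
split; last exact: PR_coord0.
move=> h i s sm; have := coord_PR every x sm; rewrite h /= => <-.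
by rewrite (functional0 (@coord_functional i s.+1 sm)).
Qed.

Lemma QR_every0 y : QR every y = 0 <->
  forall i s, (s < mult i)%N -> qf i s.+1 y = 0.
Proof.
split => [h i s sm|H].
  have := dual_QR every y sm; rewrite h /= => <-.
  by rewrite (functional0 (@dual_functional i s.+1 sm)).
by rewrite /QR /rsum big1 // => i _; rewrite big1 // => s _; rewrite H // scale0r.
Qed.

Lemma D1P x : D1 S x <-> D S x /\ PR every x = 0.
Proof.
split => [[z Dz <-]|[Dx h]]; last by exists x => //; rewrite /P1 P2E h subr0.
rewrite /P1 P2E; split; first by apply: DD => //; apply: DN; exact: PR_D.
apply/PR_every0 => i s sm; have f := @coord_functional i s.+1 sm.
by rewrite -scaleN1r (functionalD f) (functionalZ f) coord_PR //= mulN1r subrr.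
Qed.

Lemma Y1P y : Y1 S y <-> QR every y = 0.
Proof.
split => [[z _ <-]|h]; last by exists y => //; rewrite /Q1 Q2E h subr0.
rewrite /Q1 Q2E; apply/QR_every0 => i s sm; have f := @dual_functional i s.+1 sm.
by rewrite -scaleN1r (functionalD f) (functionalZ f) dual_QR //= mulN1r subrr.
Qed.

Lemma tildeA_D1 x : D1 S x -> tildeA S x = A x.
Proof.
move=> /D1P[_ /PR_every0 h]; rewrite /tildeA big1 ?addr0 // => i _.
by have /andP[m0 _] := mult_le i; rewrite -/(coord i 1 x) (h i 0%N m0) scale0r.
Qed.

(** The coordinates of [tildeA x] along a chain are those of x moved cyclically by one place, up to
    sign, since the additional term feeds the first coordinate into the end of the chain. If the
    former all vanish, so do the latter. *)
Lemma tildeA_Y1 x : D S x -> Y1 S (tildeA S x) -> D1 S x.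
Proof.
move=> Dx /Y1P/QR_every0 h; apply/D1P; split => //; apply/PR_every0.
have key i s : (s < mult i)%N -> qf i s.+1 (tildeA S x) =
    if (s.+1 < mult i)%N then - coord i s.+2 x else coord i 1 x.
  move=> sm; have f := @dual_functional i s.+1 sm.
  rewrite /tildeA (functionalD f) dual_A //; last exact: D_domA.
  rewrite (functional_sum f) (bigD1 i) //= big1 => [|i' /negbTE ii'].
    have /andP[m0 _] := mult_le i.
    rewrite (functionalZ f) dual_B //; last by apply/D_domB/phi_D; rewrite m0 leqnn.
    rewrite coord_phi ?m0 ?leqnn // eqxx addr0 /=.
    case: (ltngtP s.+1 (mult i)) => [h1|h1|h1].
    - by rewrite mulr0 addr0.
    - by move: sm; rewrite leqNgt h1.
    - by rewrite mulr1 add0r.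
  have /andP[m0 _] := mult_le i'.
  rewrite (functionalZ f) dual_B //; last by apply/D_domB/phi_D; rewrite m0 leqnn.
  by rewrite coord_phi ?m0 ?leqnn // ii' mulr0.
move=> i s sm; have /andP[m0 _] := mult_le i.
case: s sm => [_|s sm].
  have pm : ((mult i).-1 < mult i)%N by rewrite prednK.
  by have := key i _ pm; rewrite h // prednK // ltnn => <-.
by have := key i s (ltnW sm); rewrite h ?(ltnW sm) // sm => /eqP; rewrite eq_sym oppr_eq0 => /eqP.
Qed.

Lemma M1P (MY : set Y) x : MY `<=` Y1 S -> M1 S MY x <-> D1 S x /\ MY (A x).
Proof.
move=> MYY; split => [[Dx Mx]|[D1x Mx]].
  have D1x : D1 S x by apply: tildeA_Y1 => //; exact: MYY.
  by split => //; rewrite -tildeA_D1.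
by split; [case/D1P: D1x | rewrite /preimage /= tildeA_D1].
Qed.

(** An element of the kernel is a combination of the phi_i^1, whose coefficients are its first
    coordinates; these vanish on D_1. *)
Lemma A_inj_D1 x : D1 S x -> A x = 0 -> x = 0.
Proof.
move=> /D1P[Dx h] Ax; have [_ _ /(_ x Dx Ax)[c xE]] := hbasis.
have ci i : c i = 0.
  have /andP[m0 _] := mult_le i.
  have f := @coord_functional i 1 m0.
  have /PR_every0/(_ i 0%N m0) := h; rewrite xE (functional_sum f) (bigD1 i) //=.
  rewrite (functionalZ f) coord_phi // !eqxx mulr1 big1 ?addr0 // => i' /negbTE ii'.
  have /andP[m0' _] := mult_le i'.
  by rewrite (functionalZ f) coord_phi // ii' mulr0.
by rewrite xE big1 // => i _; rewrite ci scale0r.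
Qed.

Lemma A_D1_Y1 x : D1 S x -> Y1 S (A x).
Proof.
move=> /D1P[Dx /PR_every0 h]; apply/Y1P/QR_every0 => i s sm.
rewrite dual_A //; last exact: D_domA.
by case: ifP => // sm'; rewrite h // oppr0.
Qed.

(** Subtracting P_2 x does not change A x: the shift turns A P_2 x into Q_2 A x, which is 0 on
    Y_1. *)
Lemma range_A_Y1 x : D S x -> Y1 S (A x) -> exists2 x1, D1 S x1 & A x1 = A x.
Proof.
move=> Dx /Y1P h; have dP := D_domA (PR_D every x).
exists (x - PR every x).
  apply/D1P; split; first by apply: DD => //; apply: DN; exact: PR_D.
  apply/PR_every0 => i s sm; have f := @coord_functional i s.+1 sm.
  by rewrite -scaleN1r (functionalD f) (functionalZ f) coord_PR //= mulN1r subrr.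
rewrite linopB //; last exact: D_domA.
suff -> : A (PR every x) = 0 by rewrite subr0.
have -> : A (PR every x) = A (PR (fun i s => (0 < s)%N && every i s.-1) x).
  by rewrite !A_PR; apply: eq_rsum => i s _; rewrite /every andbT; case: (0 < s)%N.
by rewrite -QR_A //; exact: D_domA.
Qed.

Lemma D1_comb a x y : D1 S x -> D1 S y -> D1 S (a *: x + y).
Proof.
move=> /D1P[Dx /PR_every0 hx] /D1P[Dy /PR_every0 hy]; apply/D1P; split.
  exact: D_comb.
apply/PR_every0 => i s sm; have f := @coord_functional i s.+1 sm.
by rewrite (functionalD f) (functionalZ f) hx // hy // mulr0 addr0.
Qed.

Lemma D1_0 : D1 S 0.
Proof.
apply/D1P; split; first exact: D0.
by apply/PR_every0 => i s sm; rewrite (functional0 (@coord_functional i s.+1 sm)).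
Qed.

(* the coordinates of x solve a triangular homogeneous system *)
Lemma pencil_D1 (mu : K) x : mu != 0 -> D S x -> Y1 S (A x + mu *: B x) -> D1 S x.
Proof.
move=> mu0 Dx /Y1P/QR_every0 h; apply/D1P; split => //; apply/PR_every0.
have key i s : (s < mult i)%N ->
    (if (s.+1 < mult i)%N then - coord i s.+2 x else 0) + mu * coord i s.+1 x = 0.
  move=> sm; have f := @dual_functional i s.+1 sm.
  have := h i s sm; rewrite (functionalD f) (functionalZ f).
  by rewrite dual_A ?dual_B //; [exact: D_domB | exact: D_domA].
(* d bounds the distance from s to the end of the chain, where the system has only the diagonal
   term. *)
move=> i; suff H d s : (s < mult i)%N -> (mult i - s <= d)%N -> coord i s.+1 x = 0.
  by move=> s sm; exact: (H _ s sm (leqnn _)).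
elim: d s => [|d IH] s sm; first by rewrite leqn0 subn_eq0 leqNgt sm.
move=> le_d; have := key i s sm.
suff -> : (if (s.+1 < mult i)%N then - coord i s.+2 x else 0) = 0.
  by rewrite add0r => /eqP; rewrite mulf_eq0 (negbTE mu0) => /eqP.
case: ifP => // sm'; rewrite IH ?oppr0 //.
by rewrite subnS -ltnS prednK // subn_gt0.
Qed.

End root_system.

(** * Kernels and fixed points of bounded operators *)

Section bounded_sets.
Context {R : realType}.
Implicit Types E F : normedModType R.

Lemma eq_bounded_linear_on E F (V : set E) (T T' : E -> F) :
  (forall x, T x = T' x) -> bounded_linear_on V T -> bounded_linear_on V T'.
Proof. by move=> /funext->. Qed.

Lemma bounded_linearB E F (T T' : E -> F) : bounded_linear_on setT T ->
  bounded_linear_on setT T' -> bounded_linear_on setT (fun x => T x - T' x).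
Proof.
move=> [lT [L L0 HL]] [lT' [L' L'0 HL']]; split.
  by move=> a x y _ _; rewrite lT // lT' // scalerBr opprD addrACA.
exists (L + L'); first exact: addr_ge0.
move=> x _; apply: le_trans (ler_normB _ _) _.
by rewrite mulrDl; apply: lerD; [exact: HL | exact: HL'].
Qed.

Lemma bounded_linear_id E : bounded_linear_on setT (fun x : E => x).
Proof. by split => //; exists 1 => // x _; rewrite mul1r. Qed.

Lemma bounded_linear_comp E F (G : normedModType R) (V : set E) (T : E -> F)
    (T' : F -> G) : bounded_linear_on V T -> bounded_linear_on setT T' ->
  bounded_linear_on V (fun x => T' (T x)).
Proof.
move=> [lT [L L0 HL]] [lT' [L' L'0 HL']]; split.
  by move=> a x y Vx Vy; rewrite lT // lT'.
exists (L' * L); first exact: mulr_ge0.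
move=> x Vx; apply: le_trans (HL' _ _) _ => //.
by rewrite -mulrA; apply: ler_wpM2l => //; exact: HL.
Qed.

Lemma kernel_closed E F (T : E -> F) : bounded_linear_on setT T ->
  norm_closed [set x | T x = 0].
Proof.
move=> [lT [L L0 HL]] x H /=; apply/eqP; rewrite -normr_le0.
apply/ler_addgt0Pr => e e0; rewrite add0r.
have L10 : 0 < L + 1 by rewrite ltr_wpDl.
have [|y Ty hy] := H (e / (L + 1)); first by rewrite divr_gt0.
have -> : T x = T (x - y) by rewrite (linear_onB lT) // Ty subr0.
apply: le_trans (HL _ _) _ => //; move: hy; rewrite ler_pdivlMr //.
have := normr_ge0 (x - y); nra.
Qed.

Lemma fixed_subspace E (T : E -> E) : bounded_linear_on setT T ->
  subspace [set x | T x = x].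
Proof.
move=> [lT _]; split; first exact: linear_on0 lT.
by move=> a x y /= hx hy; rewrite lT // hx hy.
Qed.

Lemma fixed_closed E (T : E -> E) : bounded_linear_on setT T ->
  norm_closed [set x | T x = x].
Proof.
move=> bT x H; apply/subr0_eq.
apply: (kernel_closed (bounded_linearB bT (bounded_linear_id E))) => e e0.
have [y Ty hy] := H e e0; exists y => //=.
by rewrite Ty subrr.
Qed.

End bounded_sets.

Section root_system_bounded.
Context {R : realType} {k : scalars}.
Local Notation K := (scalar_field R k).
Context {X Y : normedModType K}.
Variable S : root_data X Y.
Local Notation A := (opA S).
Local Notation B := (opB S).
Local Notation phi := (@phi _ _ _ _ S).
Hypotheses (hroot : root_vectors S) (hdual : dual_root_vectors S).

Lemma PR_bounded p :
  @bounded_linear_on R (realify X) (realify X) setT (PR (S := S) p).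
Proof.
apply: bounded_linear_sum => i _; apply: bounded_linear_sum => s _.
by apply: bounded_linear_rank1; apply: (coord_functional hdual); exact: ltn_ord.
Qed.

Lemma QR_bounded p :
  @bounded_linear_on R (realify Y) (realify Y) setT (QR (S := S) p).
Proof.
apply: bounded_linear_sum => i _; apply: bounded_linear_sum => s _.
by apply: bounded_linear_rank1; apply: (dual_functional hdual); exact: ltn_ord.
Qed.

(** T may be unbounded, but T composed with a finite-rank projector is a finite sum of bounded
    functionals times fixed vectors. *)
Lemma linop_PR_bounded (T : linop X Y) p : D S `<=` dom T ->
  @bounded_linear_on R (realify X) (realify Y) setT (fun x => T (PR (S := S) p x)).
Proof.
move=> DT.
have dphi i (s : 'I_(mult i)) : dom T (phi i s.+1) by apply: DT; exact: phiS_D.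
apply: (@eq_bounded_linear_on R (realify X) (realify Y) setT
  (fun x => rsum p (fun i s => coord i s.+1 x *: T (phi i s.+1)))).
  move=> x; rewrite /PR /rsum linop_sum; last first.
    by move=> i _; apply: dom_sum => s _; apply: domZ.
  apply: eq_bigr => i _; rewrite linop_sum; last by move=> s _; apply: domZ.
  by apply: eq_bigr => s _; rewrite linopZ.
apply: bounded_linear_sum => i _; apply: bounded_linear_sum => s _.
by apply: bounded_linear_rank1; apply: (coord_functional hdual); exact: ltn_ord.
Qed.

Lemma A_PR_bounded p :
  @bounded_linear_on R (realify X) (realify Y) setT (fun x => A (PR (S := S) p x)).
Proof. by apply: linop_PR_bounded => x []. Qed.

Lemma B_PR_bounded p :
  @bounded_linear_on R (realify X) (realify Y) setT (fun x => B (PR (S := S) p x)).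
Proof. by apply: linop_PR_bounded => x []. Qed.

Lemma Q1_bounded : @bounded_linear_on R (realify Y) (realify Y) setT (Q1 S).
Proof.
apply: (@eq_bounded_linear_on R (realify Y) (realify Y) setT (fun y => y - QR (S := S) (every (S := S)) y)).
  by move=> y; rewrite /Q1 Q2E.
by apply: bounded_linearB; [exact: bounded_linear_id | exact: QR_bounded].
Qed.

End root_system_bounded.

(** * The inverse of A between D_1 and Y_1 *)

Section A_isomorphism.
Context {R : realType} {k : scalars}.
Local Notation K := (scalar_field R k).
Context {X Y : completeNormedModType K}.
Variable S : root_data X Y.
Local Notation A := (opA S).
Local Notation B := (opB S).
Local Notation XR := (realify X).
Local Notation YR := (realify Y).
Hypotheses (hAclosed : closed_op A) (hBclosed : closed_op B).
Hypothesis hArange : closed [set A x | x in dom A].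
Hypotheses (hAB : dom A `<=` dom B).
Hypothesis hpencil : regular_pencil (D S) A B (idx S).
Hypotheses (hbasis : root_basis S).
Hypotheses (hroot : root_vectors S) (hdual : dual_root_vectors S).

Let every := every (S := S).
Let AD1 : set YR := [set y | exists2 x, D1 S x & A x = y].

Let D1_dom x : D1 S x -> dom A x.
Proof. by move=> /(D1P hroot hdual)[[]]. Qed.

Let D1_inj x y : D1 S x -> D1 S y -> A x = A y -> x = y.
Proof.
move=> Dx Dy e; apply/subr0_eq/(A_inj_D1 hbasis hroot hdual).
  by rewrite addrC -scaleN1r; exact: (D1_comb hroot hdual).
by rewrite linopB ?e ?subrr //; exact: D1_dom.
Qed.

Let AD1_subspace : subspace AD1.
Proof.
split; first by exists 0; [exact: (D1_0 hroot hdual) | exact: linop0].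
move=> a y y' [x Dx <-] [x' Dx' <-]; exists (of_real k a *: x + x').
  exact: (D1_comb hroot hdual).
by rewrite app_linear //; exact: D1_dom.
Qed.

(** A limit y is some A x by closedness of the range, and Q_2 y = 0 in the limit; since [dom A] is
    contained in [dom B], x is in D and can be replaced by an element of D_1. *)
Let AD1_closed : norm_closed AD1.
Proof.
move=> y H.
have [x dx Ax] : [set A x | x in dom A] y.
  apply: (closed_nrm hArange) => e e0.
  have [y' [x Dx <-] hy] := H e e0; exists (A x) => //.
  by exists x => //; exact: D1_dom.
have Yy : Y1 S y.
  apply/(Y1P hroot hdual).
  apply: (kernel_closed (QR_bounded hdual every)) => e e0.
  have [y' [x' Dx' <-] hy] := H e e0; exists (A x') => //.
  exact/(Y1P hroot hdual)/(A_D1_Y1 hroot hdual).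
have DSx : D S x by split => //; exact: hAB.
rewrite -Ax in Yy *; have [x1 Dx1 Ax1] := range_A_Y1 hbasis hroot hdual DSx Yy.
by exists x1.
Qed.

Let inverse_exists : exists T0 : YR -> XR, forall y, AD1 y -> D1 S (T0 y) /\ A (T0 y) = y.
Proof.
have /choice[T0 hT0] : forall y : YR, exists x : XR, AD1 y -> D1 S x /\ A x = y.
  move=> y; have [[x Dx <-]|ny] := pselect (AD1 y); last by exists 0.
  by exists x.
by exists T0.
Qed.

(** Boundedness comes before surjectivity. On the image of D_1 the inverse T0 and B T0 have closed
    graphs, and the bound on B T0 is what makes mu B x small when A x + mu B x = y, so that y is a
    limit of points A x. *)
Theorem A_inverse_exists : exists G : YR -> XR,
  [/\ bounded_linear_on setT G,
      bounded_linear_on setT (fun y => B (G y) : YR),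
      forall y, D1 S (G y), forall y, A (G y) = Q1 S y
    & forall x, D1 S x -> G (A x) = x].
Proof.
have [T0 hT0] := inverse_exists.
have TD y : AD1 y -> D1 S (T0 y) by move=> /hT0[].
have AT y : AD1 y -> A (T0 y) = y by move=> /hT0[].
have lT0 : linear_on AD1 T0.
  move=> a y y' Sy Sy'; have Syy := AD1_subspace.2 a y y' Sy Sy'.
  apply: D1_inj; first exact: TD.
    by apply: (D1_comb hroot hdual); exact: TD.
  rewrite AT // [RHS](app_linear (of_real k a)); [|exact/D1_dom/TD|exact/D1_dom/TD].
  by rewrite !AT.
have cX := @realify_complete R k X; have cY := @realify_complete R k Y.
have [L1 L10 HL1] : exists2 L : R, 0 <= L & forall y, AD1 y -> `|T0 y| <= L * `|y|.
  apply: closed_graph_bounded => // y x Sy H.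
  have [dx yE] : dom A x /\ y = A x.
    apply: closed_op_nrm hAclosed _ => e e0; have [y' [Sy' h1 h2]] := H e e0.
    by exists (T0 y'); split; [exact/D1_dom/TD | exact: h2 | rewrite AT].
  apply: D1_inj; [|exact: TD|by rewrite AT].
  apply/(D1P hroot hdual); split; first by split => //; exact: hAB.
  apply: (kernel_closed (PR_bounded hdual every)) => e e0.
  have [y' [Sy' h1 h2]] := H e e0; exists (T0 y') => //.
  by have [] := (D1P hroot hdual _).1 (TD y' Sy').
have domB_T y : AD1 y -> dom B (T0 y) by move=> Sy; apply: hAB; exact/D1_dom/TD.
have lBT : linear_on AD1 (fun y => B (T0 y) : YR).
  move=> a y y' Sy Sy'; rewrite lT0 //.
  by apply: (app_linear (of_real k a)); exact: domB_T.
have [L2 L20 HL2] : exists2 L : R, 0 <= L &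
    forall y, AD1 y -> `|B (T0 y) : YR| <= L * `|y|.
  apply: (closed_graph_bounded (T := fun y => B (T0 y) : YR)) => // y z Sy H.
  suff [] : dom B (T0 y) /\ z = B (T0 y) by [].
  apply: closed_op_nrm hBclosed _ => e e0.
  have L110 : 0 < L1 + 1 by rewrite ltr_wpDl.
  pose e' := Num.min e (e / (L1 + 1)).
  have e'0 : 0 < e' by rewrite lt_min e0 divr_gt0.
  have [y' [Sy' h1 h2]] := H e' e'0; exists (T0 y'); split; first exact: domB_T.
    change (`|T0 y - T0 y'| <= e); rewrite -(linear_onB lT0) //.
    apply: le_trans (HL1 _ _) _; first exact: subspaceB.
    have : `|y - y'| <= e / (L1 + 1) by apply: le_trans h1 _; rewrite ge_min lexx orbT.
    rewrite ler_pdivlMr //; have := normr_ge0 (y - y'); nra.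
  by apply: le_trans h2 _; rewrite ge_min lexx.
have onto y : Y1 S y -> AD1 y.
  move=> Yy; apply: AD1_closed => e e0.
  have [r r0 Hr] := pencil_onto hpencil.
  have L210 : 0 < L2 + 1 by rewrite ltr_wpDl.
  have q0 : 0 < 2 * L2 * `|y : YR| + 1 by rewrite ltr_wpDl ?mulr_ge0.
  (* The second bound gives mu L2 <= 1/2 and thereby |A x| <= 2 |y|; the third then gives mu |B x|
     <= 2 mu L2 |y| <= e. *)
  pose mu := Num.min (Num.min (r / 2) (2 * (L2 + 1))^-1) (e / (2 * L2 * `|y : YR| + 1)).
  have mu0 : 0 < mu by rewrite !lt_min !divr_gt0 // invr_gt0 mulr_gt0.
  have [mur muL mue] : [/\ mu <= r / 2, mu <= (2 * (L2 + 1))^-1 &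
      mu <= e / (2 * L2 * `|y : YR| + 1)].
    by have := lexx mu; rewrite {2}/mu !le_min => /andP[/andP[-> ->] ->].
  have [|x [Dx xy]] := Hr mu _ y; first by rewrite mu0 /=; lra.
  have mun0 : of_real k mu != 0.
    by rewrite -normr_gt0 norm_of_real -(of_real0 k) ltr_of_real normr_gt0 gt_eqF.
  have D1x : D1 S x by apply: (pencil_D1 hroot hdual mun0 Dx); rewrite xy.
  have SAx : AD1 (A x) by exists x.
  have xE : T0 (A x) = x by apply: D1_inj => //; [exact: TD | exact: AT].
  exists (A x) => //.
  have -> : (y : YR) - A x = mu *: (B x : YR).
    by rewrite -xy addrAC subrr add0r.
  rewrite normrZ gtr0_norm //.
  have h1 : `|B x : YR| <= L2 * `|A x : YR| by rewrite -{1}xE; exact: HL2.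
  have h2 : `|A x : YR| <= `|y : YR| + mu * `|B x : YR|.
    have -> : A x = (y : YR) - mu *: (B x : YR) by rewrite -xy addrK.
    by apply: le_trans (ler_normB _ _) _; rewrite normrZ gtr0_norm.
  have muL2 : mu * L2 <= 1 / 2.
    have : mu * (2 * (L2 + 1)) <= 1 by rewrite -ler_pdivlMr ?mulr_gt0 // mul1r.
    lra.
  have h3 : mu * `|B x : YR| <= mu * L2 * `|A x : YR|.
    by rewrite -mulrA; apply: ler_wpM2l => //; exact: ltW.
  have h4 : mu * L2 * `|A x : YR| <= 1 / 2 * `|A x : YR| by exact: ler_wpM2r.
  have h5 : `|A x : YR| <= 2 * `|y : YR| by lra.
  have h6 : mu * L2 * `|A x : YR| <= mu * L2 * (2 * `|y : YR|).
    by apply: ler_wpM2l => //; rewrite mulr_ge0 // ltW.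
  move: mue; rewrite ler_pdivlMr //; lra.
have Q1Y y : AD1 (Q1 S y) by apply: onto; exists y.
have bQ1 := Q1_bounded hroot hdual.
(* Composition with Q_1 extends the inverse to all of Y, so that the reduced equation can be posed
   on an open set of Y. *)
exists (fun y => T0 (Q1 S y)); split.
- have [lQ [LQ LQ0 HQ]] := bQ1; split.
    by move=> a y y' _ _; rewrite lQ // lT0.
  exists (L1 * LQ); first exact: mulr_ge0.
  move=> y _; apply: le_trans (HL1 _ (Q1Y y)) _; rewrite -mulrA.
  by apply: ler_wpM2l => //; exact: HQ.
- have [lQ [LQ LQ0 HQ]] := bQ1; split.
    by move=> a y y' _ _; rewrite lQ // lBT.
  exists (L2 * LQ); first exact: mulr_ge0.
  move=> y _; apply: le_trans (HL2 _ (Q1Y y)) _; rewrite -mulrA.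
  by apply: ler_wpM2l => //; exact: HQ.
- by move=> y; exact: TD.
- by move=> y; exact: AT.
- move=> x Dx; apply: D1_inj => //; first exact: TD.
  rewrite AT // /Q1 Q2E //.
  by have /(Y1P hroot hdual)-> := A_D1_Y1 hroot hdual Dx; rewrite subr0.
Qed.

End A_isomorphism.

(** * From the differentiability classes of the statement to smooth maps *)

Section class_C_smooth.
Context {R : realType} {k : scalars}.
Local Notation K := (scalar_field R k).
Context {X Y : normedModType K}.
Local Notation XR := (realify X).
Local Notation YR := (realify Y).
Local Notation W := (R^o * XR)%type.

Lemma txnrm_le (v : W) : txnrm (v : R * X) <= 2 * `|v|.
Proof.
case: v => a x; rewrite /txnrm /= pair_norm; set r := Num.max _ _.
have : `|a| <= r by rewrite le_max lexx.
have : nrm (x : X) <= r by rewrite le_max lexx orbT.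
lra.
Qed.

Lemma txnrm_ge0 (v : W) : 0 <= txnrm (v : R * X).
Proof. by case: v => a x; rewrite /txnrm addr_ge0 //; exact: (normr_ge0 (x : XR)). Qed.

Lemma prod_txnrm_le (vs : seq W) :
  \prod_(v <- (vs : seq (R * X))) txnrm v <= 2 ^+ size vs * \prod_(v <- vs) `|v|.
Proof.
elim: vs => [|v vs IH]; first by rewrite !big_nil mulr1.
rewrite !big_cons exprS mulrACA; apply: ler_pM => //.
- exact: txnrm_ge0.
- by apply: prodr_ge0 => i _; exact: txnrm_ge0.
- exact: txnrm_le.
Qed.

(** The norm |t| + |x| of [class_C] is at most twice the maximum norm of the product, so estimates
    for j-linear maps change by a factor of at most 2^j. *)
Lemma class_C_smooth_map m (U V : set X) (g : R -> X -> Y) : subspace (V : set XR) ->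
  U `<=` V -> class_C m U V g -> exists Dg : W -> seq W -> YR,
  smooth_map m [set p : W | 0 <= p.1 /\ U p.2] [set p : W | V p.2] Dg /\
  forall p : W, 0 <= p.1 -> U p.2 -> Dg p [::] = g p.1 p.2.
Proof.
move=> sV UV [Dg [H0 H1 H2 H3]]; exists Dg; split; last by move=> p p1 p2; exact: H0.
have mul p : 0 <= p.1 /\ U p.2 -> forall j, (j <= m)%N ->
    @multilinear R W YR [set p : W | V p.2] j (Dg p).
  move=> TUp j jm; have [lin [L HL]] := H1 p TUp j jm; split; first exact: lin.
  exists (`|L| * 2 ^+ j); first by rewrite mulr_ge0 // exprn_ge0.
  move=> vs sz Vvs; apply: (@le_trans _ _ (L * \prod_(v <- (vs : seq (R * X))) txnrm v)).
    by apply: HL; split => //; exact: Vvs.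
  apply: (@le_trans _ _ (`|L| * \prod_(v <- (vs : seq (R * X))) txnrm v)).
    by apply: ler_wpM2r (ler_norm _); apply: prodr_ge0 => v _; exact: txnrm_ge0.
  rewrite -mulrA -sz; apply: ler_wpM2l => //; exact: prod_txnrm_le.
have dif p : 0 <= p.1 /\ U p.2 -> forall j, (j < m)%N -> forall e : R, 0 < e ->
    exists2 d : R, 0 < d & forall p' : W, 0 <= p'.1 /\ U p'.2 ->
      `|p' - p : W| < d ->
      forall vs : seq W, size vs = j -> (forall z, z \in vs -> V z.2) ->
      `|Dg p' vs - Dg p vs - Dg p ((p' - p : W) :: vs) : YR| <=
        e * `|p' - p : W| * \prod_(v <- vs) `|v|.
  move=> TUp j jm e e0.
  have q0 : 0 < 2 * 2 ^+ j :> R by rewrite mulr_gt0 // exprn_gt0.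
  have [|d d0 Hd] := H2 p TUp j jm (e / (2 * 2 ^+ j)); first by rewrite divr_gt0.
  exists (d / 2); first by rewrite divr_gt0.
  move=> p' TUp' pd vs sz Vvs.
  have txd := txnrm_le (p' - p : W).
  apply: le_trans (Hd p' TUp' _ vs _) _; first by apply: le_lt_trans txd _; lra.
    by split => //; exact: Vvs.
  have -> : e * `|p' - p : W| * \prod_(v <- vs) `|v| =
     e / (2 * 2 ^+ j) * (2 * `|p' - p : W|) * (2 ^+ size vs * \prod_(v <- vs) `|v|).
    by rewrite sz; field; rewrite gt_eqF // exprn_gt0.
  apply: ler_pM.
  - by rewrite mulr_ge0 ?txnrm_ge0 // divr_ge0 // ltW.
  - by apply: prodr_ge0 => v _; exact: txnrm_ge0.
  - by apply: ler_wpM2l => //; rewrite divr_ge0 // ltW.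
  - exact: prod_txnrm_le.
split => //= p TUp j jm e e0.
have [jlt|jge] := ltnP j m; last first.
  have -> : j = m by apply/eqP; rewrite eqn_leq jm.
  have q0 : 0 < 2 ^+ m :> R by rewrite exprn_gt0.
  have [|d d0 Hd] := H3 p TUp (e / 2 ^+ m); first by rewrite divr_gt0.
  exists (d / 2); first by rewrite divr_gt0.
  move=> p' TUp' pd vs sz Vvs; have txd := txnrm_le (p' - p : W).
  apply: le_trans (Hd p' TUp' _ vs _) _; first by apply: le_lt_trans txd _; lra.
    by split => //; exact: Vvs.
  have -> : e * \prod_(v <- vs) `|v| = e / 2 ^+ m * (2 ^+ size vs * \prod_(v <- vs) `|v|).
    by rewrite sz; field; rewrite gt_eqF.
  by apply: ler_wpM2l; [rewrite divr_ge0 // ltW | exact: prod_txnrm_le].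
(* Below the top order, continuity follows from differentiability: the remainder with e = 1 and the
   bound L of the next derivative add up to the factor L + 1. *)
have [d d0 Hd] := dif p TUp j jlt 1 ltr01.
have [_ [L L0 HL]] := mul p TUp _ jlt.
have L10 : 0 < L + 1 by rewrite ltr_wpDl.
exists (Num.min d (e / (L + 1))); first by rewrite lt_min d0 divr_gt0.
move=> p' TUp'; rewrite lt_min ltr_pdivlMr // => /andP[pd pe] vs sz Vvs.
have h1 := Hd p' TUp' pd vs sz Vvs.
have h2 : `|Dg p ((p' - p : W) :: vs) : YR| <= L * (`|p' - p : W| * \prod_(v <- vs) `|v|).
  have := HL ((p' - p : W) :: vs); rewrite big_cons; apply; first by rewrite /= sz.
  move=> z; rewrite inE => /orP[/eqP->|]; last exact: Vvs.
  case: TUp TUp' => _ /UV Vp [_ /UV Vp'].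
  by apply: (@subspaceB R XR V p'.2 p.2).
have := ler_normD (Dg p' vs - Dg p vs - Dg p ((p' - p : W) :: vs) : YR)
  (Dg p ((p' - p : W) :: vs)).
rewrite subrK => h3; apply: le_trans h3 _.
apply: (@le_trans _ _ (`|p' - p : W| * (L + 1) * \prod_(v <- vs) `|v|)); first lra.
by apply: ler_wpM2r; [exact: prodr_ge0 | exact: ltW].
Qed.

(** Uniqueness of the partial derivative in the directions of E: both linear maps approximate the
    same increment of g along a v, and their difference is divided by a. *)
Lemma has_dx_smooth_map m (U V E : set X) (g : R -> X -> Y) t x (T : X -> Y)
    (Dg : W -> seq W -> YR) : (0 < m)%N -> subspace (V : set XR) ->
  subspace (E : set XR) -> E `<=` V ->
  smooth_map m [set p : W | 0 <= p.1 /\ U p.2] [set p : W | V p.2] Dg ->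
  (forall p : W, 0 <= p.1 -> U p.2 -> Dg p [::] = g p.1 p.2) ->
  0 <= t -> U x ->
  (exists2 r : R, 0 < r & forall v, E v -> `|v : XR| <= r -> U (x + v)) ->
  has_dx U V g t x T -> forall v, E v -> T v = Dg (t, x) [:: (0, v)].
Proof.
move=> m0 sV sE EV [mul dif _] Dg0 t0 Ux [r r0 Hr] [lT _ HT] v Ev.
have TUp : 0 <= (t, x).1 /\ U (t, x).2 by [].
have lD := multilinear_linear (mul (t, x) TUp 1%N m0) (vs := [::]) erefl ltac:(by []).
have Vv := EV v Ev; have V0 : V 0 by case: sV.
have lTR : @linear_on R XR YR V T by exact: lT.
apply/subr0_eq/eqP; rewrite -(normr_le0 (T v - Dg (t, x) [:: (0, v)] : YR)).
apply/ler_addgt0Pr => e e0; rewrite add0r.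
have v10 : 0 < `|v : XR| + 1 by rewrite ltr_wpDl.
pose e' := e / 2 / (`|v : XR| + 1).
have e'0 : 0 < e' by rewrite !divr_gt0.
have [d1 d10 Hd1] := HT e' e'0.
have [d2 d20 Hd2] := dif (t, x) TUp 0%N m0 e' e'0.
(* The step a v is shorter than both radii of differentiability and keeps x + a v in U; 1 is added
   since v may be 0. *)
pose a := Num.min (Num.min d1 d2) r / (2 * (`|v : XR| + 1)).
have min0 : 0 < Num.min (Num.min d1 d2) r by rewrite !lt_min d10 d20.
have a0 : 0 < a by rewrite divr_gt0 // mulr_gt0.
have av : a * `|v : XR| < Num.min (Num.min d1 d2) r.
  rewrite /a mulrAC ltr_pdivrMr ?mulr_gt0 //.
  have := normr_ge0 (v : XR); nra.
have {}av : [/\ a * `|v : XR| < d1, a * `|v : XR| < d2 & a * `|v : XR| < r].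
  by move: av; rewrite !lt_min => /andP[/andP[-> ->] ->].
case: av => av1 av2 avr.
have Eav : E (a *: (v : XR)) by exact: subspaceZ.
have nav : `|a *: (v : XR)| = a * `|v : XR| by rewrite normrZ gtr0_norm.
have Uav : U (x + a *: (v : XR)) by apply: Hr => //; rewrite nav ltW.
have h1 : `|g t (x + a *: (v : XR)) - g t x - T (a *: (v : XR)) : YR| <= e' * (a * `|v : XR|).
  have dxE : (x + a *: (v : XR) - x : XR) = a *: (v : XR) by rewrite addrAC subrr add0r.
  have := Hd1 _ Uav; rewrite [X in nrm X < _ -> _](_ : _ = a *: (v : XR)); last exact: dxE.
  rewrite dxE -nav; apply; rewrite -nav in av1; exact: av1.
have h2 : `|g t (x + a *: (v : XR)) - g t x - Dg (t, x) [:: (0, a *: (v : XR))] : YR| <= e' * (a * `|v : XR|).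
  have dpE : (t, x + a *: (v : XR)) - (t, x) = (0, a *: (v : XR)) :> W.
    apply/pair_equal_spec; split => /=; first by rewrite subrr.
    by rewrite addrAC subrr add0r.
  have TUa : 0 <= (t, x + a *: (v : XR)).1 /\ U (t, x + a *: (v : XR)).2 by [].
  have := Hd2 (t, x + a *: (v : XR)) TUa; rewrite dpE pair0_norm nav.
  move=> /(_ av2 [::] erefl); rewrite big_nil mulr1.
  by rewrite (Dg0 (t, x + a *: (v : XR)) t0 Uav) (Dg0 (t, x) t0 Ux) => H; exact: H.
have TE : T (a *: (v : XR)) = a *: (T v : YR) by exact: (linear_onZ a V0 lTR Vv).
have DE : Dg (t, x) [:: (0, a *: (v : XR))] = a *: Dg (t, x) [:: (0, v)].
  have pE : (0, a *: (v : XR)) = a *: ((0, v) : W).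
    by apply/pair_equal_spec; split; rewrite // /GRing.scale /= mulr0.
  rewrite pE; exact: (@linear_onZ R W YR [set p : W | V p.2] (fun v => Dg (t, x) [:: v]) a (0, v) V0 lD Vv).
have h3 : `|a *: (T v - Dg (t, x) [:: (0, v)] : YR)| <= 2 * (e' * (a * `|v : XR|)).
  have -> : a *: (T v - Dg (t, x) [:: (0, v)] : YR) =
    (g t (x + a *: (v : XR)) - g t x - Dg (t, x) [:: (0, a *: (v : XR))] : YR) -
    (g t (x + a *: (v : XR)) - g t x - T (a *: (v : XR)) : YR).
    have id0 (P T1 D1 : YR) : a *: (T1 - D1) = P - a *: D1 - (P - a *: T1).
      by linear_over R.
    by rewrite TE DE; exact: id0.
  apply: le_trans (ler_normB _ _) _; lra.
move: h3; rewrite normrZ gtr0_norm // => h3.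
rewrite -(ler_pM2l a0); apply: le_trans h3 _.
rewrite (_ : 2 * (e' * (a * `|v : XR|)) = a * (2 * e' * `|v : XR|)); last by ring.
rewrite ler_pM2l // /e'.
rewrite (_ : 2 * (e / 2 / (`|v : XR| + 1)) * `|v : XR| = e * (`|v : XR| / (`|v : XR| + 1))); last first.
  by field; rewrite gt_eqF.
by rewrite ler_piMr ?(ltW e0) // ler_pdivrMr // mul1r lerDl.
Qed.

End class_C_smooth.

(** * One algebraic equation solved along a curve *)

Section stage.
Context {R : realType} {k : scalars}.
Local Notation K := (scalar_field R k).
Context {X Y : completeNormedModType K}.
Variable S : root_data X Y.
Local Notation A := (opA S).
Local Notation B := (opB S).
Local Notation XR := (realify X).
Local Notation YR := (realify Y).
Local Notation J := (@half_line R).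
Hypotheses (hroot : root_vectors S) (hdual : dual_root_vectors S).
Variable f : R -> X -> Y.

Definition Pfix p : set X := [set x | PR (S := S) p x = x].
Definition Qfix p : set Y := [set y | QR (S := S) p y = y].

Lemma Pfix_subspace p : subspace (Pfix p : set XR).
Proof. exact: fixed_subspace (PR_bounded hdual p). Qed.

Lemma Pfix_closed p : norm_closed (Pfix p : set XR).
Proof. exact: fixed_closed (PR_bounded hdual p). Qed.

Lemma Qfix_subspace p : subspace (Qfix p : set YR).
Proof. exact: fixed_subspace (QR_bounded hdual p). Qed.

Lemma Qfix_closed p : norm_closed (Qfix p : set YR).
Proof. exact: fixed_closed (QR_bounded hdual p). Qed.

Lemma Pfix_D p x : Pfix p x -> D S x.
Proof. by move=> <-; exact: PR_D. Qed.

Lemma Qfix_QR p y : Qfix p (QR (S := S) p y).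
Proof.
rewrite /Qfix /= (QR_comp hroot hdual); apply: (eq_QR) => i s _.
by case: (p i s).
Qed.

Lemma Qfix_B p x : Pfix p x -> Qfix p (B x).
Proof.
move=> Px; rewrite /Qfix /= -(B_PR hroot hdual); last exact: (D_domB (Pfix_D Px)).
by rewrite Px.
Qed.

Lemma bounded_linear_on_Pfix p (T : X -> Y) :
  @bounded_linear_on R XR YR setT (fun x => T (PR (S := S) p x)) ->
  @bounded_linear_on R XR YR (Pfix p) T.
Proof.
move=> [lT [L L0 HL]]; split; last first.
  by exists L => // x Px; have := HL x I; rewrite Px.
move=> a x y Px Py; have Pxy := (Pfix_subspace p).2 a x y Px Py.
by have := lT a x y I I; rewrite Pxy Px Py.
Qed.

Lemma B_bounded_Pfix p : @bounded_linear_on R XR YR (Pfix p) B.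
Proof. exact/bounded_linear_on_Pfix/B_PR_bounded. Qed.

Lemma A_bounded_Pfix p : @bounded_linear_on R XR YR (Pfix p) A.
Proof. exact/bounded_linear_on_Pfix/A_PR_bounded. Qed.

Lemma rel_open_ball p (Mx : set X) x : rel_open (Pfix p) Mx -> Mx x ->
  exists2 r : R, 0 < r & forall y, Pfix p y -> `|(y : XR) - x| <= r -> Mx y.
Proof.
move=> [U oU ->] [Ux Px]; have [r r0 H] := (nbhs_nrm x U).1 (open_nbhs_nbhs (conj oU Ux)).
exists (r / 2); first by rewrite divr_gt0.
move=> y Py hy; split => //; apply: H.
by apply: le_lt_trans (hy : nrm (y - x) <= r / 2) _; rewrite ltr_pdivrMr //; lra.
Qed.

Lemma rel_open_sub p (Mx : set X) : rel_open (Pfix p) Mx -> Mx `<=` Pfix p.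
Proof. by move=> [U _ ->] x []. Qed.

(** c carries the components found before, h the image under A of their derivatives. The map is
    differentiable on the larger space V containing c, while the equation is solved for y in the
    range of a single projector. *)
Theorem stage_smooth p m r (U V Mx : set X) (c x : R -> XR) (h : R -> YR) :
  (0 < m)%N -> (r <= m)%N -> subspace (V : set XR) -> U `<=` V ->
  class_C m U V (fun t x => QR (S := S) p (f t x)) ->
  Pfix p `<=` V -> rel_open (Pfix p) Mx ->
  smooth_curve r (V : set XR) J c -> smooth_curve r setT J h ->
  (forall t, J t -> Qfix p (h t)) ->
  (forall t y, J t -> Mx y -> U (c t + y)) ->
  let Psi t y := QR (S := S) p (f t (c t + y)) - B y - h t in
  (forall t, J t -> Mx (x t) /\ Psi t (x t) = 0) ->
  (forall t y, J t -> Mx y -> Psi t y = 0 -> y = x t) ->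
  (forall t, J t -> invertible_dx S f U V (QR (S := S) p) (PR (S := S) p)
     (Pfix p) (Qfix p) t (c t + x t)) ->
  smooth_curve r (Pfix p : set XR) J x.
Proof.
move=> m0 rm sV UV cC PV oM sc sh Fh UM Psi hx xu inv.
have [Dg [sm Dg0]] := class_C_smooth_map sV UV cC.
have MP := rel_open_sub oM.
have PsiE t y : J t -> Mx y -> Dg (t, c t + y) [::] - B y - h t = Psi t y.
  by move=> Jt My; rewrite Dg0 //; exact: UM.
apply: (@implicit_curve_smooth _ XR YR m U V Dg m0 sV UV sm
  (@realify_complete R k X) (Pfix p) Mx (Qfix p) B c x h
  (Pfix_subspace p) (@Pfix_closed p) PV (Qfix_subspace p) (@Qfix_closed p)
  (B_bounded_Pfix p) MP) => //.
- by move=> y My; exact: rel_open_ball.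
- move=> t y Jt My; rewrite PsiE //; apply: (subspaceB (Qfix_subspace p)); last exact: Fh.
  by apply: (subspaceB (Qfix_subspace p)); [exact: Qfix_QR | exact/Qfix_B/MP].
- by move=> t /hx[].
- by move=> t Jt; have [Mt Pt] := hx t Jt; rewrite PsiE.
- by move=> t y Jt My; rewrite PsiE //; exact: xu.
move=> t Jt; have [T [dxT [G [h1 h2 h3 h4 [L HL]]]]] := inv t Jt.
have [Mt _] := hx t Jt.
have TE : forall v, Pfix p v -> T v = Dg (t, c t + x t) [:: (0, v)].
  apply: (has_dx_smooth_map m0 sV (Pfix_subspace p) PV sm Dg0 Jt _ _ dxT).
    exact: UM.
  have [q q0 Hq] := rel_open_ball oM Mt; exists q => // v Pv hv.
  rewrite -addrA; apply: UM => //; apply: Hq.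
    by apply: (subspaceD (Pfix_subspace p)) => //; exact: MP.
  by rewrite [X in `|X|](_ : _ = (v : XR)) // addrAC subrr add0r.
(* On the ranges P v = v and Q B v = B v, so the operator assumed invertible is the derivative of
   the equation. *)
have LaE v : Pfix p v -> T (PR (S := S) p v) - QR (S := S) p (B (PR (S := S) p v)) =
    Dg (t, c t + x t) [:: (0, v)] - B v.
  by move=> Pv; rewrite Pv TE // [X in _ - X](Qfix_B Pv).
have TUt : [set p : R^o * XR | 0 <= p.1 /\ U p.2] (t, c t + x t).
  by split => //; exact: UM.
exists `|L| => //; split.
- exact: (derivative_linear m0 sm PV (B_bounded_Pfix p).1 TUt).
- by move=> v Pv; rewrite -LaE //; exact: h1.
- move=> v Pv; have := HL _ (h1 v Pv); rewrite h3 // LaE // => H.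
  by apply: le_trans H _; apply: ler_wpM2r (ler_norm _); exact: (normr_ge0 (_ : YR)).
- move=> y Fy; exists (G y); first exact: h2.
  by rewrite -LaE; [exact: h4 | exact: h2].
Qed.

End stage.

(** Distinguishes the sum of two sets of vectors from the sum of measures of the same name. *)
Notation msum := Defs.msum.

(** * Sums of subspaces *)

Section direct_sums.

Lemma eq_sum_nat (V : nmodType) a b (u v : nat -> V) :
  (forall j, (a <= j < b)%N -> u j = v j) ->
  \sum_(a <= j < b) u j = \sum_(a <= j < b) v j.
Proof. by move=> h; rewrite !big_nat; apply: eq_bigr. Qed.

Lemma dsum1 (V : zmodType) a (M : nat -> set V) : dsum a a.+1 M = M a.
Proof.
apply/seteqP; split => x; last first.
  move=> Mx; exists (fun=> x); last by rewrite big_nat1.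
  by move=> j hj; have -> : j = a by lia.
by move=> [u Mu ->]; rewrite big_nat1; apply: Mu; rewrite leqnn ltnSn.
Qed.

Lemma dsum_mem (V : zmodType) a b (M : nat -> set V) u :
  (forall j, (a <= j < b)%N -> M j (u j)) -> dsum a b M (\sum_(a <= j < b) u j).
Proof. by move=> h; exists u. Qed.

Lemma dsum_sub (V : zmodType) a b (M N : nat -> set V) :
  (forall j, (a <= j < b)%N -> M j `<=` N j) -> dsum a b M `<=` dsum a b N.
Proof. by move=> h x [u Mu ->]; exists u => // j hj; exact/(h j hj)/Mu. Qed.

Lemma msum_sub (V : zmodType) (E F E' F' : set V) : E `<=` E' -> F `<=` F' ->
  msum E F `<=` msum E' F'.
Proof. by move=> EE FF x [y /EE Ey [z /FF Fz <-]]; exists y => //; exists z. Qed.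

Context {R : realType}.
Implicit Types X : normedModType R.

Lemma dsum_subspace X a b (M : nat -> set X) :
  (forall j, (a <= j < b)%N -> subspace (M j)) -> subspace (dsum a b M).
Proof.
move=> h; split.
  exists (fun=> 0); last by rewrite big1.
  by move=> j /h[].
move=> c x y [u Mu ->] [v Mv ->]; exists (fun j => c *: u j + v j).
  by move=> j hj; apply: (h j hj).2; [exact: Mu | exact: Mv].
by rewrite scaler_sumr -big_split.
Qed.

Lemma msum_subspace X (E F : set X) : subspace E -> subspace F ->
  subspace (msum E F).
Proof.
move=> sE sF; split.
  by exists 0; [case: sE | exists 0; [case: sF | rewrite addr0]].
move=> c x y [x1 Ex1 [x2 Fx2 <-]] [y1 Ey1 [y2 Fy2 <-]].
exists (c *: x1 + y1); first exact: sE.2.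
exists (c *: x2 + y2); first exact: sF.2.
by rewrite scalerDr addrACA.
Qed.

Lemma sub_dsum X a b (M : nat -> set X) s :
  (forall j, (a <= j < b)%N -> subspace (M j)) -> (a <= s < b)%N ->
  M s `<=` dsum a b M.
Proof.
move=> h hs x Mx; exists (fun j => if j == s then x else 0).
  by move=> j hj; case: eqP => [->//|_]; case: (h j hj).
rewrite (bigD1_seq s) ?mem_index_iota ?iota_uniq //= eqxx big1 ?addr0 //.
by move=> i /negbTE->.
Qed.

Lemma sub_msuml X (E F : set X) : subspace F -> E `<=` msum E F.
Proof. by move=> [F0 _] x Ex; exists x => //; exists 0; rewrite ?addr0. Qed.

Lemma sub_msumr X (E F : set X) : subspace E -> F `<=` msum E F.
Proof. by move=> [E0 _] x Fx; exists 0 => //; exists x; rewrite ?add0r. Qed.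

Lemma smooth_curve_sum_nat X n (V : set X) J a b (c : nat -> R -> X) : subspace V ->
  (forall j, (a <= j < b)%N -> smooth_curve n V J (c j)) ->
  smooth_curve n V J (fun t => \sum_(a <= j < b) c j t).
Proof.
move=> sV h; apply: (@smooth_curve_ext _ _ _ _ _
   (fun t => \sum_(a <= j < b | (a <= j < b)%N) c j t)).
  by move=> t _; rewrite -big_nat.
exact: smooth_curve_sum.
Qed.

End direct_sums.

(** * Images of the projectors as sets of fixed points *)

Section projection_images.
Context {R : realType} {k : scalars}.
Local Notation K := (scalar_field R k).
Context {X Y : normedModType K}.
Variable S : root_data X Y.
Hypotheses (hroot : root_vectors S) (hdual : dual_root_vectors S).
Local Notation top := (top (S := S)).
Local Notation wedge := (wedge (S := S)).
Local Notation level := (level (S := S)).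
Local Notation upper := (upper (S := S)).
Local Notation PR := (PR (S := S)).
Local Notation QR := (QR (S := S)).

Lemma D2E s : D2 S s = [set x | PR (top s) x = x].
Proof. by rewrite /D2 P2topE; apply/seteqP; split => x; rewrite proj_imageP. Qed.

Lemma DwE s : Dw S s = [set x | PR (wedge s) x = x].
Proof. by rewrite /Dw P2wE //; apply/seteqP; split => x; rewrite proj_imageP. Qed.

Lemma D2sE s : D2s S s = [set x | PR (level s) x = x].
Proof. by rewrite /D2s P2sE //; apply/seteqP; split => x; rewrite proj_imageP. Qed.

Lemma D2SigE : D2Sig S = [set x | PR upper x = x].
Proof. by rewrite /D2Sig P2SigE //; apply/seteqP; split => x; rewrite proj_imageP. Qed.

Lemma Y2E s : Y2 S s = [set y | QR (top s) y = y].
Proof. by rewrite /Y2 Q2topE; apply/seteqP; split => y; rewrite proj_rangeP. Qed.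

Lemma Y2SigE s : Y2Sig S s = [set y | QR (wedge s) y = y].
Proof. by rewrite /Y2Sig Q2SigE //; apply/seteqP; split => y; rewrite proj_rangeP. Qed.

Lemma Y2sE s : Y2s S s = [set y | QR (level s) y = y].
Proof. by rewrite /Y2s Q2sE //; apply/seteqP; split => y; rewrite proj_rangeP. Qed.

(** No chain is longer than nu, so one that reaches the level nu - 1 ends there; at the last level
    there is no [wedge] part. *)
Lemma top_last i s : (s < mult i)%N -> level (idx S).-1 i s = top (idx S).-1 i s.
Proof.
have /andP[_ mnu] := mult_le hroot i.
by rewrite /level /top; case: eqP => //= -> h; lia.
Qed.

Lemma Q2s_last : Q2s S (idx S).-1 = Q2sj S (idx S).-1 (idx S).-1.+1.
Proof.
rewrite Q2sE // Q2topE; apply/funext => y; apply: (eq_QR) => i s sm.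
by rewrite top_last.
Qed.

Lemma P2s_last : P2s S (idx S).-1 = P2sj S (idx S).-1 (idx S).-1.+1.
Proof.
rewrite P2sE // P2topE; apply/funext => y; apply: (eq_PR) => i s sm.
by rewrite top_last.
Qed.

Lemma D2s_last : D2s S (idx S).-1 = D2 S (idx S).-1.
Proof. by rewrite /D2s P2s_last. Qed.

Lemma Y2s_last : Y2s S (idx S).-1 = Y2 S (idx S).-1.
Proof. by rewrite /Y2s Q2s_last. Qed.

Lemma wedge_last i s j : ((idx S).-1 <= j)%N -> (s < mult i)%N -> wedge j i s = false.
Proof.
have /andP[_ mnu] := mult_le hroot i.
by rewrite /wedge; case: eqP => //= -> hj h; apply/negbTE; lia.
Qed.

Lemma Dw_last j x : ((idx S).-1 <= j)%N -> Dw S j x <-> x = 0.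
Proof.
move=> hj; rewrite DwE /= PR_false; last by move=> i s; exact: wedge_last.
by split => ->.
Qed.

End projection_images.

(** * Components determined by the algebraic equations *)

Section algebraic_components.
Context {R : realType} {k : scalars}.
Local Notation K := (scalar_field R k).
Context {X Y : completeNormedModType K}.
Variable S : root_data X Y.
Local Notation A := (opA S).
Local Notation B := (opB S).
Local Notation nu := (idx S).
Local Notation XR := (realify X).
Local Notation YR := (realify Y).
Local Notation J := (@half_line R).
Local Notation top := (top (S := S)).
Local Notation wedge := (wedge (S := S)).
Local Notation PR := (PR (S := S)).
Local Notation QR := (QR (S := S)).
Local Notation Pfix := (Pfix (S := S)).
Local Notation Qfix := (Qfix (S := S)).
Hypothesis hbasis : root_basis S.
Hypotheses (hroot : root_vectors S) (hdual : dual_root_vectors S).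
Variables (f : R -> X -> Y) (MY : set Y) (M20 : set X) (M2 Mw : nat -> set X).
Hypothesis hopen : open_sets S MY M20 M2 Mw.
Hypothesis hsmooth : smoothness S f M2 Mw.
Hypotheses (h1a : cond1a S f M2) (h1b : cond1b S f M2).
Hypotheses (h1c : cond1c S f M2 Mw) (h1d : cond1d S f M2 Mw).
Hypotheses (h2a : cond2a S f M2) (h2b : cond2b S f M2).
Hypotheses (h2c : cond2c S f M2 Mw) (h2d : cond2d S f M2 Mw).

Lemma D2_Pfix s : D2 S s = Pfix (top s). Proof. exact: D2E. Qed.
Lemma Dw_Pfix s : Dw S s = Pfix (wedge s). Proof. exact: DwE. Qed.
Lemma Y2_Qfix s : Y2 S s = Qfix (top s). Proof. exact: Y2E. Qed.
Lemma Y2Sig_Qfix s : Y2Sig S s = Qfix (wedge s). Proof. exact: Y2SigE. Qed.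

Lemma M2_open s : (1 <= s < nu)%N -> rel_open (Pfix (top s)) (M2 s).
Proof. by rewrite -D2_Pfix; have [_ _ H _] := hopen; exact: H. Qed.

Lemma Mw_open s : (1 <= s < nu.-1)%N -> rel_open (Pfix (wedge s)) (Mw s).
Proof. by rewrite -Dw_Pfix; have [_ _ _ H] := hopen; exact: H. Qed.

Lemma M2_sub s : (1 <= s < nu)%N -> M2 s `<=` Pfix (top s).
Proof. by move=> /M2_open; exact: rel_open_sub. Qed.

Lemma Mw_sub s : (1 <= s < nu.-1)%N -> Mw s `<=` Pfix (wedge s).
Proof. by move=> /Mw_open; exact: rel_open_sub. Qed.

Lemma F2_local s t (u v : nat -> X) : (s < nu)%N ->
  (forall j, (s <= j < nu)%N -> u j = v j) -> F2 S f s t u = F2 S f s t v.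
Proof.
move=> sn h; rewrite /F2 (eq_sum_nat h) h //.
by rewrite leqnn.
Qed.

Lemma F2Sig_local s t (u v w z : nat -> X) d dw : (s < nu.-1)%N ->
  (forall j, (1 <= j < nu)%N -> u j = v j) ->
  (forall j, (s <= j < nu.-1)%N -> w j = z j) ->
  F2Sig S f s t u w d dw = F2Sig S f s t v z d dw.
Proof.
move=> sn h h'; rewrite /F2Sig (eq_sum_nat h) (eq_sum_nat h') h' //.
by rewrite leqnn.
Qed.

Lemma F2_last t u : (0 < nu)%N -> F2 S f nu.-1 t u = F2last S f t (u nu.-1).
Proof.
move=> n0; rewrite /F2 /F2last (Q2s_last hroot).
by rewrite -[in X in index_iota _ X](prednK n0) big_nat1.
Qed.

Lemma F2Sig_lastE t u w d : (3 <= nu)%N ->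
  F2Sig S f (nu - 2) t u w d 0 = F2Sig_last S f t u (w (nu - 2)%N) d.
Proof.
move=> n3; rewrite /F2Sig /F2Sig_last addr0.
have -> : nu.-1 = (nu - 2).+1 by lia.
by rewrite big_nat1.
Qed.

(** Merges 1.a, the case s = nu - 1 where P_{2s} is already the top part, with 1.b, so that all
    levels are treated alike. *)
Lemma root_top s t u : (1 <= s < nu)%N -> 0 <= t -> in_M2 S M2 s.+1 u ->
  exists x, [/\ M2 s x, F2 S f s t [eta u with s |-> x] = 0 &
    forall x', M2 s x' -> F2 S f s t [eta u with s |-> x'] = 0 -> x' = x].
Proof.
move=> /andP[s1 sn] t0 Mu; have [sl|sl] := eqVneq s nu.-1.
  have [|x [[Mx Fx] ux]] := h1a _ t0; first by lia.
  have n0 : (0 < nu)%N by lia.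
  have FE y : F2 S f s t [eta u with s |-> y] = F2last S f t y.
    by rewrite sl F2_last //= eqxx.
  exists x; split; first by rewrite sl.
    by rewrite FE.
  by move=> x' Mx'; rewrite FE => Fx'; apply/esym/ux; rewrite -sl.
have [|x [[Mx Fx] ux]] := h1b (s := s) _ t0 Mu; first by lia.
by exists x; split => // x' Mx' Fx'; apply/esym/ux.
Qed.

(** Merges 1.c and 1.d: for s = nu - 2 the argument [dw] lies in the zero space, and the two
    functions coincide. *)
Lemma root_wedge s t u w d dw : (1 <= s < nu.-1)%N -> 0 <= t ->
  in_M2 S M2 1 u -> in_Mw S Mw s.+1 w -> D2 S s.+1 d -> Dw S s.+1 dw ->
  exists x, [/\ Mw s x, F2Sig S f s t u [eta w with s |-> x] d dw = 0 &
    forall x', Mw s x' -> F2Sig S f s t u [eta w with s |-> x'] d dw = 0 -> x' = x].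
Proof.
move=> /andP[s1 sn] t0 Mu Mw' Dd Ddw; have [sl|sl] := eqVneq s (nu - 2)%N.
  have n3 : (3 <= nu)%N by lia.
  have hj : (nu.-1 <= s.+1)%N by lia.
  have dw0 := (Dw_last hroot hdual dw hj).1 Ddw.
  have [|x [[Mx Fx] ux]] := h1c n3 t0 Mu (d := d).
    by rewrite D2s_last //; move: Dd; have -> : s.+1 = nu.-1 by lia.
  have FE y : F2Sig S f s t u [eta w with s |-> y] d dw = F2Sig_last S f t u y d.
    by rewrite sl dw0 F2Sig_lastE //= eqxx.
  exists x; split; first by rewrite sl.
    by rewrite FE.
  by move=> x' Mx'; rewrite FE => Fx'; apply/esym/ux; rewrite -sl.
have [|x [[Mx Fx] ux]] := h1d (s := s) _ t0 Mu Mw' Dd Ddw; first by lia.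
by exists x; split => // x' Mx' Fx'; apply/esym/ux.
Qed.

(** The last level has one order more, since the equation at level nu - 2 needs its derivative to be
    of class C^{nu-2}. *)
Let order_top s := if s == nu.-1 then nu.-1 else (nu - 2)%N.

Lemma class_top s : (1 <= s < nu)%N ->
  class_C (order_top s) (dsum s nu M2) (dsum s nu (fun j => Pfix (top j)))
    (fun t x => QR (top s) (f t x)).
Proof.
have [H1 _ H3] := hsmooth; move=> /andP[s1 sn].
have -> : (fun j => Pfix (top j)) = D2 S by apply/funext => j; rewrite D2_Pfix.
rewrite -Q2topE /order_top; case: eqP => [sl|sl]; last by apply: H1; lia.
have nE : nu = s.+1 by lia.
have := H3 ltac:(lia); rewrite Q2s_last // -sl.
by rewrite [in X in dsum _ X M2]nE [in X in dsum _ X (D2 S)]nE !dsum1.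
Qed.

Lemma inv_top s t u : (1 <= s < nu)%N -> 0 <= t -> in_M2 S M2 s u ->
  F2 S f s t u = 0 ->
  invertible_dx S f (dsum s nu M2) (dsum s nu (fun j => Pfix (top j)))
    (QR (top s)) (PR (top s)) (Pfix (top s)) (Qfix (top s)) t (\sum_(s <= j < nu) u j).
Proof.
move=> /andP[s1 sn] t0 Mu Fu.
have -> : (fun j => Pfix (top j)) = D2 S by apply/funext => j; rewrite D2_Pfix.
rewrite -Q2topE -P2topE -D2_Pfix -Y2_Qfix.
have [sl|sl] := eqVneq s nu.-1; last by apply: h2b => //; lia.
have nE : nu = s.+1 by lia.
rewrite [in X in dsum _ X M2]nE [in X in dsum _ X (D2 S)]nE !dsum1.
rewrite [in X in index_iota _ X]nE big_nat1.
have := h2a ltac:(lia) t0 (x := u s).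
rewrite Q2s_last // P2s_last // D2s_last // Y2s_last // -sl; apply.
  by apply: Mu; rewrite leqnn.
by rewrite -Fu {2}sl F2_last ?sl //; lia.
Qed.

Lemma class_wedge s : (1 <= s < nu.-1)%N ->
  class_C s (msum (dsum 1 nu M2) (dsum s nu.-1 Mw))
    (msum (dsum 1 nu (fun j => Pfix (top j))) (dsum s nu.-1 (fun j => Pfix (wedge j))))
    (fun t x => QR (wedge s) (f t x)).
Proof.
have [_ H2 _] := hsmooth; move=> /andP[s1 sn].
have -> : (fun j => Pfix (top j)) = D2 S by apply/funext => j; rewrite D2_Pfix.
have -> : (fun j => Pfix (wedge j)) = Dw S by apply/funext => j; rewrite Dw_Pfix.
by rewrite -Q2SigE //; apply: H2; lia.
Qed.

Lemma inv_wedge s t u w d dw : (1 <= s < nu.-1)%N -> 0 <= t ->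
  in_M2 S M2 1 u -> in_Mw S Mw s w -> D2 S s.+1 d -> Dw S s.+1 dw ->
  F2Sig S f s t u w d dw = 0 ->
  invertible_dx S f (msum (dsum 1 nu M2) (dsum s nu.-1 Mw))
    (msum (dsum 1 nu (fun j => Pfix (top j))) (dsum s nu.-1 (fun j => Pfix (wedge j))))
    (QR (wedge s)) (PR (wedge s)) (Pfix (wedge s)) (Qfix (wedge s)) t
    (\sum_(1 <= j < nu) u j + \sum_(s <= j < nu.-1) w j).
Proof.
move=> /andP[s1 sn] t0 Mu Mw' Dd Ddw Fw.
have -> : (fun j => Pfix (top j)) = D2 S by apply/funext => j; rewrite D2_Pfix.
have -> : (fun j => Pfix (wedge j)) = Dw S by apply/funext => j; rewrite Dw_Pfix.
rewrite -Q2SigE // -P2wE // -Dw_Pfix -Y2Sig_Qfix.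
have [sl|sl] := eqVneq s (nu - 2)%N; last by apply: h2d Fw => //; lia.
have n3 : (3 <= nu)%N by lia.
have hj : (nu.-1 <= s.+1)%N by lia.
have dw0 := (Dw_last hroot hdual dw hj).1 Ddw.
have nE : nu.-1 = s.+1 by lia.
rewrite nE !dsum1 big_nat1.
have := h2c n3 t0 Mu (x := w s) (d := d); rewrite -sl; apply.
- by apply: Mw'; rewrite leqnn.
- by rewrite D2s_last // nE.
- by rewrite -Fw dw0 {2}sl F2Sig_lastE // -sl.
Qed.

Let tops_subspace a b : subspace (dsum a b (fun j => Pfix (top j)) : set XR).
Proof. by apply: dsum_subspace => j _; exact: Pfix_subspace. Qed.

Let wedges_subspace a b : subspace (dsum a b (fun j => Pfix (wedge j)) : set XR).
Proof. by apply: dsum_subspace => j _; exact: Pfix_subspace. Qed.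

Let u_spec (u : nat -> R -> XR) s := [/\
  forall t, J t -> M2 s (u s t), forall t, J t -> F2 S f s t (u^~ t) = 0
  & smooth_curve (order_top s) (Pfix (top s) : set XR) J (u s)].

(** The unique roots at level s define a curve, smooth by [stage_smooth] with the sum of the higher
    components as c and with h = 0: no derivative enters the equations for the top parts. *)
Let u_step s (u : nat -> R -> XR) : (1 <= s < nu)%N ->
  (forall j, (s < j < nu)%N -> u_spec u j) ->
  exists u', forall j, (s <= j < nu)%N -> u_spec u' j.
Proof.
move=> s1n hu; have /andP[s1 sn] := s1n.
have Mu t : J t -> in_M2 S M2 s.+1 (u^~ t) by move=> Jt j hj; have [H _ _] := hu j hj; exact: H.
have /choice[x hx] : forall t, exists x : XR, J t ->
    [/\ M2 s x, F2 S f s t [eta (u^~ t) with s |-> x] = 0 &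
      forall x', M2 s x' -> F2 S f s t [eta (u^~ t) with s |-> x'] = 0 -> x' = x].
  move=> t; have [Jt|nJt] := pselect (J t); last by exists 0.
  by have [x hx] := root_top s1n Jt (Mu t Jt); exists x.
pose u' j := if j == s then x else u j.
have u's : u' s = x by rewrite /u' eqxx.
have u'j j : (s < j)%N -> u' j = u j by move=> sj; rewrite /u' gtn_eqF.
have u'E t y : (fun j => if j == s then y else u j t) = [eta (u^~ t) with s |-> y] by [].
have u't t : (u'^~ t) = [eta (u^~ t) with s |-> x t].
  by apply/funext => j; rewrite /u' /=; case: eqP.
pose c t := \sum_(s.+1 <= j < nu) u j t.
have FE t y : F2 S f s t [eta (u^~ t) with s |-> y] =
    QR (top s) (f t (c t + y)) - B y - 0.
  rewrite /F2 Q2topE big_ltn //= eqxx subr0 [y + _]addrC; congr (QR _ (f _ (_ + _)) - _).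
  by apply: eq_sum_nat => j /andP[sj _] /=; rewrite gtn_eqF.
have MP j : (s <= j < nu)%N -> M2 j `<=` Pfix (top j).
  by move=> hj; apply: M2_sub; lia.
have xs : smooth_curve (order_top s) (Pfix (top s) : set XR) J x.
  apply: (@stage_smooth _ _ _ _ S hroot hdual f (top s) (order_top s) (order_top s)
    (dsum s nu M2) (dsum s nu (fun j => Pfix (top j))) (M2 s) c x (fun=> 0)) => //.
  - by rewrite /order_top; case: eqP; lia.
  - exact: dsum_sub.
  - exact: class_top.
  - apply: (sub_dsum (M := fun j => Pfix (top j) : set XR)).
      by move=> j _; exact: Pfix_subspace.
    by rewrite leqnn.
  - exact: M2_open.
  - apply: smooth_curve_sum_nat => // j hj; have [_ _ sj] := hu j hj.
    apply: (smooth_curve_sub (V := Pfix (top j) : set XR)).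
      apply: (sub_dsum (M := fun j => Pfix (top j) : set XR)); last lia.
      by move=> i _; exact: Pfix_subspace.
    by apply: smooth_curve_le sj; rewrite /order_top; do 2!case: eqP; lia.
  - exact: smooth_curve_cst.
  - by move=> t _; case: (Qfix_subspace hdual (top s)).
  - move=> t y Jt My; rewrite addrC; exists [eta (u^~ t) with s |-> y].
      move=> j hj /=; case: eqP => [->//|/eqP js]; apply: Mu => //; lia.
    rewrite big_ltn //= eqxx; congr (_ + _).
    by apply: eq_sum_nat => j /andP[sj _] /=; rewrite gtn_eqF.
  - by move=> t Jt; have [Mx Fx _] := hx t Jt; split => //; rewrite -FE.
  - by move=> t y Jt My; have [_ _ ux] := hx t Jt; rewrite -FE => /(ux _ My).
  - move=> t Jt; have [Mx Fx _] := hx t Jt.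
    have -> : c t + x t = \sum_(s <= j < nu) [eta (u^~ t) with s |-> x t] j.
      rewrite addrC big_ltn //= eqxx; congr (_ + _).
      by apply: eq_sum_nat => j /andP[sj _] /=; rewrite gtn_eqF.
    apply: inv_top => // j hj /=; case: eqP => [->//|/eqP js]; apply: Mu => //; lia.
exists u' => j hj; have [->|js] := eqVneq j s.
  split; rewrite ?u's //; first by move=> t /hx[].
  by move=> t Jt; rewrite u't; have [] := hx t Jt.
have sj : (s < j < nu)%N by lia.
have [H1 H2 H3] := hu j sj; split; rewrite ?u'j //; try lia.
move=> t Jt; rewrite -(H2 t Jt); apply: F2_local; first lia.
by move=> i hi; rewrite u'j //; lia.
Qed.

Let u_exists : exists u, forall s, (1 <= s < nu)%N -> u_spec u s.
Proof.
(* d counts the levels already treated, starting from nu - 1. *)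
suff H d : (d < nu)%N -> exists u, forall s, (nu - d <= s < nu)%N -> u_spec u s.
  have [n0|n0] := posnP nu; first by exists (fun _ _ => 0) => s; rewrite n0; lia.
  have [|u hu] := H nu.-1; first lia.
  by exists u => s hs; apply: hu; lia.
elim: d => [_|d IH dn]; first by exists (fun _ _ => 0) => s; lia.
have [|u hu] := IH; first lia.
have [||u' hu'] := @u_step (nu - d.+1) u; first lia.
  by move=> j hj; apply: hu; lia.
by exists u'.
Qed.

Lemma top_curves_exist : exists u ud : nat -> R -> XR, forall s, (1 <= s < nu)%N ->
  [/\ forall t, J t -> M2 s (u s t), forall t, J t -> F2 S f s t (u^~ t) = 0,
      smooth_curve (nu - 2) (Pfix (top s) : set XR) J (u s),
      forall t, J t -> deriv_on J (u s) t (ud s t)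
    & smooth_curve s.-1 (Pfix (top s) : set XR) J (ud s)].
Proof.
have [u hu] := u_exists.
have /choice[ud hud] : forall s, exists v : R -> XR, (1 <= s < nu)%N ->
    (forall t, J t -> deriv_on J (u s) t (v t)) /\
    smooth_curve s.-1 (Pfix (top s) : set XR) J v.
  move=> s; have [hs|hs] := boolP ((1 <= s < nu)%N); last by exists (fun=> 0).
  have [_ _] := hu s hs.
  have -> : order_top s = (order_top s).-1.+1 by rewrite /order_top; case: eqP; lia.
  move=> /smooth_curve_deriv[v dv sv]; exists v => _; split => //.
  (* For s = nu - 1 the derivative has order exactly nu - 2 = s - 1; below, nu - 3 >= s - 1. This is
     the order that the equation at level s - 1 can use. *)
  by apply: smooth_curve_le sv; rewrite /order_top; case: eqP; lia.
exists u, ud => s hs; have [H1 H2 H3] := hu s hs; have [H4 H5] := hud s hs; split => //.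
by apply: smooth_curve_le H3; rewrite /order_top; case: eqP; lia.
Qed.

Section wedges.
Variables u ud : nat -> R -> XR.
Hypothesis hu : forall s, (1 <= s < nu)%N ->
  [/\ forall t, J t -> M2 s (u s t), forall t, J t -> F2 S f s t (u^~ t) = 0,
      smooth_curve (nu - 2) (Pfix (top s) : set XR) J (u s),
      forall t, J t -> deriv_on J (u s) t (ud s t)
    & smooth_curve s.-1 (Pfix (top s) : set XR) J (ud s)].

Definition wedge_spec (w wd : nat -> R -> XR) s := [/\
  forall t, J t -> Mw s (w s t),
  forall t, J t -> F2Sig S f s t (u^~ t) (w^~ t) (ud s.+1 t) (wd s.+1 t) = 0,
  smooth_curve s (Pfix (wedge s) : set XR) J (w s),
  forall t, J t -> deriv_on J (w s) t (wd s t)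
  & smooth_curve s.-1 (Pfix (wedge s) : set XR) J (wd s)].

Lemma QR_A_fix p q x : PR q x = x ->
  (forall i s, (s < mult i)%N -> q i s -> (0 < s)%N && p i s.-1) -> QR p (A x) = A x.
Proof.
move=> qx h; rewrite (QR_A hbasis hroot hdual); last first.
  by rewrite -qx; apply: D_domA; exact: PR_D.
congr (A _); rewrite -{1}qx (PR_comp hroot hdual) -[RHS]qx; apply: eq_PR => i s sm.
by case qis : (q i s); rewrite ?andbF // andbT h.
Qed.

(** A lowers the level by one, and a chain that reaches the level s + 1 is longer than s + 1; its
    vectors therefore land in the [wedge] part of level s. *)
Lemma A_next_wedge s d dw : Pfix (top s.+1) d -> Pfix (wedge s.+1) dw ->
  Qfix (wedge s) (A (d + dw)).
Proof.
move=> hd hdw; rewrite linopD; [|exact: (D_domA (Pfix_D hroot hd))|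
  exact: (D_domA (Pfix_D hroot hdw))].
apply: (subspaceD (Qfix_subspace hdual (wedge s))).
  apply: (QR_A_fix hd) => i s' _ /andP[/eqP-> /eqP ms]; rewrite /wedge /= eqxx /=.
  by rewrite ms; lia.
apply: (QR_A_fix hdw) => i s' sm /andP[/eqP s'E ms]; rewrite /wedge s'E /= eqxx /=.
by apply/eqP; lia.
Qed.

(** The condition on [wd nu.-1] stands for the absent [wedge] component of the last level, whose
    derivative the equation at level nu - 2 refers to. *)
Let w_step s (w wd : nat -> R -> XR) : (1 <= s < nu.-1)%N ->
  (forall j, (s < j < nu.-1)%N -> wedge_spec w wd j) ->
  (forall t, wd nu.-1 t = 0) ->
  exists w' wd', (forall j, (s <= j < nu.-1)%N -> wedge_spec w' wd' j) /\
    (forall t, wd' nu.-1 t = 0).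
Proof.
move=> s1n hw wdl; have /andP[s1 sn] := s1n.
have sn' : (1 <= s.+1 < nu)%N by lia.
have Mu t : J t -> in_M2 S M2 1 (u^~ t) by move=> Jt j hj; have [H _ _ _ _] := hu hj; exact: H.
have Mw' t : J t -> in_Mw S Mw s.+1 (w^~ t).
  by move=> Jt j hj; have [H _ _ _ _] := hw j hj; exact: H.
have sud : smooth_curve s (Pfix (top s.+1) : set XR) J (ud s.+1).
  by have [_ _ _ _] := hu sn'.
have swd : smooth_curve s (Pfix (wedge s.+1) : set XR) J (wd s.+1).
  have [sl|sl] := eqVneq s.+1 nu.-1; last by have [|_ _ _ _] := hw s.+1; first lia.
  apply: (@smooth_curve_ext _ _ _ _ _ (fun=> 0)); first by move=> t _; rewrite sl wdl.
  by apply: smooth_curve_cst; [exact: Pfix_subspace | case: (Pfix_subspace hdual (wedge s.+1))].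
have Dd t : J t -> D2 S s.+1 (ud s.+1 t).
  by move=> Jt; rewrite D2_Pfix; exact: smooth_curve_in sud t Jt.
have Ddw t : J t -> Dw S s.+1 (wd s.+1 t).
  by move=> Jt; rewrite Dw_Pfix; exact: smooth_curve_in swd t Jt.
have /choice[x hx] : forall t, exists x : XR, J t ->
    [/\ Mw s x, F2Sig S f s t (u^~ t) [eta (w^~ t) with s |-> x] (ud s.+1 t) (wd s.+1 t) = 0 &
      forall x', Mw s x' -> F2Sig S f s t (u^~ t) [eta (w^~ t) with s |-> x']
        (ud s.+1 t) (wd s.+1 t) = 0 -> x' = x].
  move=> t; have [Jt|nJt] := pselect (J t); last by exists 0.
  by have [x hx] := root_wedge s1n Jt (Mu t Jt) (Mw' t Jt) (Dd t Jt) (Ddw t Jt); exists x.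
pose w' j := if j == s then x else w j.
have w's : w' s = x by rewrite /w' eqxx.
have w'j j : (s < j)%N -> w' j = w j by move=> sj; rewrite /w' gtn_eqF.
have w't t : (w'^~ t) = [eta (w^~ t) with s |-> x t].
  by apply/funext => j; rewrite /w' /=; case: eqP.
pose c t := \sum_(1 <= j < nu) u j t + \sum_(s.+1 <= j < nu.-1) w j t.
pose h t := A (ud s.+1 t + wd s.+1 t).
have sumE t y : c t + y =
    \sum_(1 <= j < nu) u j t + \sum_(s <= j < nu.-1) [eta (w^~ t) with s |-> y] j.
  rewrite /c -addrA; congr (_ + _); rewrite addrC [RHS]big_ltn //= eqxx; congr (_ + _).
  by apply: eq_sum_nat => j /andP[sj _] /=; rewrite gtn_eqF.
have FE t y : F2Sig S f s t (u^~ t) [eta (w^~ t) with s |-> y] (ud s.+1 t) (wd s.+1 t) =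
    QR (wedge s) (f t (c t + y)) - B y - h t.
  by rewrite /F2Sig Q2SigE // sumE /= eqxx.
pose V := msum (dsum 1 nu (fun j => Pfix (top j)))
  (dsum s nu.-1 (fun j => Pfix (wedge j))) : set XR.
have sV : subspace V by exact: msum_subspace.
have xs : smooth_curve s (Pfix (wedge s) : set XR) J x.
  apply: (@stage_smooth _ _ _ _ S hroot hdual f (wedge s) s s
    (msum (dsum 1 nu M2) (dsum s nu.-1 Mw)) V (Mw s) c x h) => //.
  - apply: msum_sub; apply: dsum_sub => j hj; first exact: M2_sub.
    by apply: Mw_sub; lia.
  - exact: class_wedge.
  - apply: subset_trans (sub_msumr (tops_subspace 1 nu)).
    apply: (sub_dsum (M := fun j => Pfix (wedge j) : set XR)); last lia.
    by move=> i _; exact: Pfix_subspace.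
  - exact: Mw_open.
  - apply: smooth_curveD => //.
      apply: smooth_curve_sum_nat => // j hj; have [_ _ sj _ _] := hu hj.
      apply: (smooth_curve_sub (V := Pfix (top j) : set XR)).
        apply: subset_trans (sub_msuml (wedges_subspace s nu.-1)).
        apply: (sub_dsum (M := fun j => Pfix (top j) : set XR)); last lia.
        by move=> i _; exact: Pfix_subspace.
      by apply: smooth_curve_le sj; lia.
    apply: smooth_curve_sum_nat => // j hj; have [_ _ sj _ _] := hw j hj.
    apply: (smooth_curve_sub (V := Pfix (wedge j) : set XR)).
      apply: subset_trans (sub_msumr (tops_subspace 1 nu)).
      apply: (sub_dsum (M := fun j => Pfix (wedge j) : set XR)); last lia.
      by move=> i _; exact: Pfix_subspace.
    by apply: smooth_curve_le sj; lia.
  - apply: (@smooth_curve_ext _ _ _ _ _ (fun t => (A (ud s.+1 t) + A (wd s.+1 t) : YR))).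
      move=> t Jt; rewrite /h linopD //; apply: D_domA; apply: (Pfix_D hroot).
        exact: smooth_curve_in sud t Jt.
      exact: smooth_curve_in swd t Jt.
    apply: smooth_curveD => //.
      exact: (smooth_curve_linear (Pfix_subspace hdual _) (A_bounded_Pfix hroot hdual _)) sud.
    exact: (smooth_curve_linear (Pfix_subspace hdual _) (A_bounded_Pfix hroot hdual _)) swd.
  - move=> t Jt; apply: A_next_wedge.
      exact: smooth_curve_in sud t Jt.
    exact: smooth_curve_in swd t Jt.
  - move=> t y Jt My; rewrite sumE.
    exists (\sum_(1 <= j < nu) u j t); first by apply: dsum_mem => j hj; exact: (Mu t Jt).
    exists (\sum_(s <= j < nu.-1) [eta (w^~ t) with s |-> y] j) => //.
    apply: dsum_mem => j hj /=; case: eqP => [->//|/eqP js]; apply: Mw' => //; lia.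
  - by move=> t Jt; have [Mx Fx _] := hx t Jt; split => //; rewrite -FE.
  - by move=> t y Jt My; have [_ _ ux] := hx t Jt; rewrite -FE => /(ux _ My).
  - move=> t Jt; have [Mx Fx _] := hx t Jt; rewrite sumE.
    apply: inv_wedge (Dd t Jt) (Ddw t Jt) Fx => //; first exact: Mu.
    by move=> j hj /=; case: eqP => [->//|/eqP js]; apply: Mw' => //; lia.
have [x' dx sx'] : exists2 x' : R -> XR, forall t, J t -> deriv_on J x t (x' t) &
    smooth_curve s.-1 (Pfix (wedge s) : set XR) J x'.
  by apply: smooth_curve_deriv; rewrite prednK.
exists w', (fun j => if j == s then x' else wd j); split; last first.
  by move=> t; rewrite ifN ?wdl //; lia.
move=> j hj; have [->|js] := eqVneq j s.
  split; rewrite ?w's ?eqxx //; first by move=> t /hx[].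
  by move=> t Jt; rewrite w't ifN; [have [] := hx t Jt | lia].
have sj : (s < j < nu.-1)%N by lia.
have [H1 H2 H3 H4 H5] := hw j sj; split; rewrite ?w'j ?ifN //; try lia.
move=> t Jt; rewrite -(H2 t Jt).
by apply: F2Sig_local => //; [lia | move=> i hi; rewrite w'j //; lia].
Qed.

Lemma wedge_curves_exist : exists w wd : nat -> R -> XR,
  (forall s, (1 <= s < nu.-1)%N -> wedge_spec w wd s) /\ (forall t, wd nu.-1 t = 0).
Proof.
suff H d : (d < nu.-1)%N -> exists w wd, (forall s, (nu.-1 - d <= s < nu.-1)%N ->
    wedge_spec w wd s) /\ (forall t, wd nu.-1 t = 0).
  have [n0|n0] := posnP nu.-1.
    by exists (fun _ _ => 0), (fun _ _ => 0); split => // s; rewrite n0; lia.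
  have [|w [wd [hw wdl]]] := H nu.-2; first lia.
  by exists w, wd; split => // s hs; apply: hw; lia.
elim: d => [_|d IH dn].
  by exists (fun _ _ => 0), (fun _ _ => 0); split => // s; lia.
have [|w [wd [hw wdl]]] := IH; first lia.
have [|||w' [wd' hw']] := @w_step (nu.-1 - d.+1) w wd => //; first lia.
  by move=> j hj; apply: hw; lia.
by exists w', wd'.
Qed.

End wedges.
End algebraic_components.

(** * Operator norm, continuity and Lipschitz conditions in terms of real norms *)

Section interface.
Context {R : realType} {k : scalars}.
Local Notation K := (scalar_field R k).
Implicit Types X Y : normedModType K.

Lemma opnorm_ge0 X Y (E : set X) (T : X -> Y) : 0 <= opnorm E T.
Proof.
rewrite /opnorm; set L := [set _ | _].
have [L0|/set0P/negP/negPn/eqP->] := pselect (L !=set0); last by rewrite inf0.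
by apply: lb_le_inf => // l [].
Qed.

Lemma opnorm_le X Y (E : set X) (T : X -> Y) x : bounded_on E T -> E x ->
  nrm (T x) <= opnorm E T * nrm x.
Proof.
move=> [L HL] Ex; rewrite /opnorm; set LL := [set _ | _].
have LL0 : LL `|L|.
  split => // y Ey; apply: le_trans (HL y Ey) _.
  by apply: ler_wpM2r (ler_norm _); exact: (normr_ge0 (y : realify X)).
have [x0|x0] := eqVneq (nrm x) 0.
  by have [_ /(_ x Ex)] := LL0; rewrite x0 !mulr0.
have x1 : 0 < nrm x by rewrite lt_neqAle eq_sym x0; exact: (normr_ge0 (x : realify X)).
rewrite -ler_pdivrMr //; apply: lb_le_inf; first by exists `|L|.
by move=> l [_ Hl]; rewrite ler_pdivrMr //; exact: Hl.
Qed.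

Lemma within_cont_nrm X Y (D : set X) (f : R -> X -> Y) :
  {within [set p : R * X | 0 <= p.1 /\ D p.2],
    continuous (fun p : R * X => f p.1 p.2)} ->
  forall (t0 : R) x0, 0 <= t0 -> D x0 -> forall e : R, 0 < e ->
  exists2 d : R, 0 < d & forall (t : R) x, 0 <= t -> D x -> `|t - t0| < d ->
    nrm (x - x0) < d -> nrm (f t x - f t0 x0) <= e.
Proof.
move=> /subspace_continuousP H t0 x0 t00 Dx0 e e0.
have := H (t0, x0) (conj t00 Dx0) [set y | nrm (y - f t0 x0) < e].
have /[swap]/[apply] : nbhs (f t0 x0) [set y | nrm (y - f t0 x0) < e].
  by apply/nbhs_nrm; exists e.
move=> [/= [U1 U2] [/= /nbhs_normP[d1 /= d10 H1] /nbhs_nrm[d2 d20 H2]] UU].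
exists (Num.min d1 d2); first by rewrite lt_min d10.
move=> t x t1 Dx; rewrite !lt_min => /andP[td1 td2] /andP[xd1 xd2].
apply: ltW; apply: (UU (t, x)) => //; split => /=; last exact: H2.
by apply: H1; rewrite /ball_ /= distrC.
Qed.

Lemma loc_lipschitz_nrm X Y (M : set X) (P : X -> X) (g : R -> X -> Y) :
  loc_lipschitz M P g -> forall (t0 : R) x0, 0 <= t0 -> M x0 ->
  exists d L : R, [/\ 0 < d, 0 <= L & forall (t : R) x y, 0 <= t -> `|t - t0| < d ->
    M x -> nrm (x - x0) < d -> M y -> nrm (y - x0) < d -> P x = P y ->
    nrm (g t x - g t y) <= L * nrm (x - y)].
Proof.
move=> H t0 x0 t00 Mx0; have [I [V [L [oI oV L0 HL]]]] := H t0 x0 t00 Mx0.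
have /nbhs_normP[d1 /= d10 H1] := open_nbhs_nbhs oI.
have /nbhs_nrm[d2 d20 H2] := open_nbhs_nbhs oV.
exists (Num.min d1 d2), L; split => //; first by rewrite lt_min d10.
move=> t x y t1; rewrite !lt_min => /andP[td1 td2] Mx /andP[xd1 xd2] My /andP[yd1 yd2] Pxy.
apply: HL => //; [|exact: H2|exact: H2].
by apply: H1; rewrite /ball_ /= distrC.
Qed.

End interface.

(** * The component x_20 and the field of the reduced equation *)

Section x20_component.
Context {R : realType} {k : scalars}.
Local Notation K := (scalar_field R k).
Context {X Y : completeNormedModType K}.
Variable S : root_data X Y.
Local Notation A := (opA S).
Local Notation B := (opB S).
Local Notation XR := (realify X).
Local Notation YR := (realify Y).
Local Notation J := (@half_line R).
Local Notation top := (top (S := S)).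
Local Notation wedge := (wedge (S := S)).
Local Notation level := (level (S := S)).
Local Notation upper := (upper (S := S)).
Local Notation PR := (PR (S := S)).
Local Notation QR := (QR (S := S)).
Local Notation Pfix := (Pfix (S := S)).
Local Notation Qfix := (Qfix (S := S)).
Hypotheses (hroot : root_vectors S) (hdual : dual_root_vectors S).
Variables (f : R -> X -> Y) (MY : set Y) (M20 : set X) (M2 Mw : nat -> set X).
Hypothesis hfcont : {within [set p : R * X | 0 <= p.1 /\ D S p.2],
                 continuous (fun p : R * X => f p.1 p.2)}.
Hypothesis hopen : open_sets S MY M20 M2 Mw.
Hypothesis h1e : cond1e S f MY M20 M2 Mw.
Hypothesis h2e_lip : cond2e_lipschitz S f MY M20 M2 Mw.
Hypothesis h2e : cond2e_F20 S f MY M20 M2 Mw.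
Variable G : YR -> XR.
Hypotheses (bG : bounded_linear_on setT G)
  (bBG : bounded_linear_on setT (fun y => B (G y) : YR))
  (GD : forall y, D1 S (G y)) (AG : forall y, A (G y) = Q1 S y).
Variables xs d1 dw1 : R -> XR.
Hypotheses (xsM : forall t, J t -> M2Sig S M2 Mw (xs t))
  (xsP : forall t, J t -> Pfix upper (xs t))
  (d1P : forall t, J t -> Pfix (top 1) (d1 t))
  (dw1P : forall t, J t -> Pfix (wedge 1) (dw1 t))
  (xs_cont : forall t, J t -> cont_on J xs t)
  (d1_cont : forall t, J t -> cont_on J d1 t)
  (dw1_cont : forall t, J t -> cont_on J dw1 t).

Let M20_open : rel_open (Pfix (level 0)) M20.
Proof. by have [_ H _ _] := hopen; move: H; rewrite D2sE. Qed.

Let M20_sub : M20 `<=` Pfix (level 0).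
Proof. exact: rel_open_sub M20_open. Qed.

Let MY_sub : MY `<=` Y1 S.
Proof. by have [[U _ ->] _ _ _] := hopen => y []. Qed.

Lemma M1_D1 x : M1 S MY x -> D1 S x.
Proof. by move=> /(M1P hroot hdual _ MY_sub)[]. Qed.

Lemma D1_D x : D1 S x -> D S x. Proof. by move=> /(D1P hroot hdual)[]. Qed.

Lemma PR_D1 p x : D1 S x -> PR p x = 0.
Proof.
by move=> /(D1P hroot hdual)[_ /(PR_every0 hroot hdual) h]; apply: PR_coord0.
Qed.

(** [MY] is open only relative to Y_1; its preimage under the bounded projector Q_1 is open in Y. *)
Let Om : set YR := [set y | MY (Q1 S y)].

Lemma M1_G y : Om y -> M1 S MY (G y).
Proof. by move=> Oy; apply/(M1P hroot hdual _ MY_sub); rewrite AG. Qed.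

Lemma Om_open y : Om y -> exists2 r : R, 0 < r & forall y', `|y' - y| <= r -> Om y'.
Proof.
move=> Oy; have [[U oU UE] _ _ _] := hopen.
have Uy : U (Q1 S y) by move: Oy; rewrite /Om /= UE => -[].
have [r r0 H] := (nbhs_nrm (Q1 S y) U).1 (open_nbhs_nbhs (conj oU Uy)).
have [lQ [L L0 HL]] := Q1_bounded hroot hdual.
have L10 : 0 < L + 1 by rewrite ltr_wpDl.
exists (r / 2 / (L + 1)); first by rewrite !divr_gt0.
move=> y'; rewrite ler_pdivlMr // => hy; rewrite /Om /= UE; split; last by exists y'.
apply: H; change (`|Q1 S y' - Q1 S y : YR| < r).
rewrite -(linear_onB lQ) //; apply: le_lt_trans (HL _ I) _.
have := normr_ge0 (y' - y); nra.
Qed.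

Let Phi t x1 x20 := F20 S f t x1 x20 (xs t) (d1 t) (dw1 t).

Lemma x20_exists : exists Xi : R -> X -> XR, forall t x1, J t -> M1 S MY x1 ->
  [/\ M20 (Xi t x1), F20 S f t x1 (Xi t x1) (xs t) (d1 t) (dw1 t) = 0
    & forall x, M20 x -> F20 S f t x1 x (xs t) (d1 t) (dw1 t) = 0 -> x = Xi t x1].
Proof.
have /choice[Xi hXi] : forall p : R * X, exists x : XR, J p.1 -> M1 S MY p.2 ->
    [/\ M20 x, Phi p.1 p.2 x = 0 & forall x', M20 x' -> Phi p.1 p.2 x' = 0 -> x' = x].
  move=> [t x1] /=; have [[Jt Mx1]|h] := pselect (J t /\ M1 S MY x1); last first.
    by exists 0 => Jt Mx1; case: h.
  have [||x [[Mx Fx] ux]] := h1e Jt Mx1 (xsM Jt) (d := d1 t) (dw := dw1 t).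
  - by rewrite D2E //; exact: d1P.
  - by rewrite DwE //; exact: dw1P.
  by exists x => _ _; split => // x' Mx' Fx'; apply/esym/ux.
by exists (fun t x => Xi (t, x)) => t x1 Jt Mx1; exact: (hXi (t, x1)).
Qed.

Let QRb := QR_bounded hdual (level 0).

Let h1 t : YR := QR (level 0) (A (d1 t + dw1 t)).

Let h1_cont t : J t -> cont_on J h1 t.
Proof.
move=> Jt.
apply: (@eq_cont_on _ _ _ (fun t => QR (level 0) (A (d1 t)) + QR (level 0) (A (dw1 t)) : YR)) => //.
  move=> s Js; rewrite /h1 linopD; last first.
  - exact: (D_domA (Pfix_D hroot (dw1P Js))).
  - exact: (D_domA (Pfix_D hroot (d1P Js))).
  by rewrite (linear_onD QRb.1).
have bA p : bounded_linear_on (Pfix p : set XR) (fun x : XR => QR (level 0) (A x) : YR).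
  exact: (bounded_linear_comp (A_bounded_Pfix hroot hdual p) QRb).
apply: cont_onD.
  exact: (bounded_linear_cont (Pfix_subspace hdual _) (bA _) Jt d1P (d1_cont Jt)).
exact: (bounded_linear_cont (Pfix_subspace hdual _) (bA _) Jt dw1P (dw1_cont Jt)).
Qed.

Let PhiE t x1 x20 : Phi t x1 x20 =
  (QR (level 0) (f t (x1 + x20 + xs t)) : YR) - (B x20 : YR) - h1 t.
Proof. by rewrite /Phi /F20 Q2sE. Qed.

Let Phi_Qfix t x1 x20 : Pfix (level 0) x20 -> Qfix (level 0) (Phi t x1 x20).
Proof.
move=> hx; rewrite PhiE; have sQ := Qfix_subspace hdual (level 0).
apply: (subspaceB sQ); last exact: Qfix_QR.
by apply: (subspaceB sQ); [exact: Qfix_QR | exact: Qfix_B].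
Qed.

Let f_cont := within_cont_nrm hfcont.

Let sum_D t x1 x20 : J t -> D1 S x1 -> Pfix (level 0) x20 -> D S (x1 + x20 + xs t).
Proof.
move=> Jt Dx1 Px; apply: DD; last exact: Pfix_D (xsP Jt).
by apply: DD; [exact: D1_D | exact: Pfix_D Px].
Qed.

Let sum_M t x1 x20 : J t -> M1 S MY x1 -> M20 x20 -> M S MY M20 M2 Mw (x1 + x20 + xs t).
Proof.
move=> Jt Mx1 Mx20; exists (x1 + x20); last by exists (xs t) => //; exact: xsM.
by exists x1 => //; exists x20.
Qed.

Let near_sum (t t0 : R) (x1 y1 x20 y20 : XR) (d : R) : 0 < d ->
  `|x1 - y1| < d / 3 -> `|x20 - y20| < d / 3 -> `|xs t - xs t0| < d / 3 ->
  nrm (x1 + x20 + xs t - (y1 + y20 + xs t0) : X) < d.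
Proof.
move=> d0 a1 a2 a3; change (`|x1 + x20 + xs t - (y1 + y20 + xs t0)| < d).
have -> : x1 + x20 + xs t - (y1 + y20 + xs t0) =
  (x1 - y1) + (x20 - y20) + (xs t - xs t0) by linear_over R.
apply: le_lt_trans (ler_normD _ _) _.
by have := ler_normD (x1 - y1) (x20 - y20); lra.
Qed.

Let Phi_cont t0 y1 y20 : J t0 -> D1 S y1 -> Pfix (level 0) y20 -> forall e : R, 0 < e ->
  exists2 d : R, 0 < d & forall t (x1 : XR), J t -> `|t - t0| < d -> D1 S x1 ->
    `|x1 - y1| < d -> `|Phi t x1 y20 - Phi t0 y1 y20 : YR| <= e.
Proof.
move=> J0 D10 P20 e e0; have [lQ [L L0 HL]] := QRb.
have L10 : 0 < L + 1 by rewrite ltr_wpDl.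
have e'0 : 0 < e / 2 / (L + 1) by rewrite !divr_gt0.
have [d d0 Hd] := f_cont J0 (sum_D J0 D10 P20) e'0.
have d30 : 0 < d / 6 by rewrite divr_gt0.
have [r r0 Hr] := xs_cont J0 d30.
have e20 : 0 < e / 2 by rewrite divr_gt0.
have [q q0 Hq] := h1_cont J0 e20.
exists (Num.min (Num.min (d / 6) r) q); first by rewrite !lt_min d30 r0.
move=> t x1 Jt; rewrite !lt_min => /andP[/andP[td tr] tq] Dx1 /andP[/andP[xd _] _].
rewrite !PhiE.
have -> : (QR (level 0) (f t (x1 + y20 + xs t)) : YR) - (B y20 : YR) - h1 t -
    ((QR (level 0) (f t0 (y1 + y20 + xs t0)) : YR) - (B y20 : YR) - h1 t0) =
  ((QR (level 0) (f t (x1 + y20 + xs t)) : YR) - (QR (level 0) (f t0 (y1 + y20 + xs t0)) : YR)) -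
   (h1 t - h1 t0) by linear_over R.
apply: le_trans (ler_normB _ _) _.
have a1 : `|h1 t - h1 t0| <= e / 2 by exact: Hq.
have a2 : `|(f t (x1 + y20 + xs t) : YR) - f t0 (y1 + y20 + xs t0)| <= e / 2 / (L + 1).
  apply: Hd => //; first exact: sum_D.
    by lra.
  apply: near_sum => //; [lra | by rewrite subrr normr0 divr_gt0 |].
  by have := Hr t Jt tr; lra.
have a3 : `|(QR (level 0) (f t (x1 + y20 + xs t)) : YR) - (QR (level 0) (f t0 (y1 + y20 + xs t0)) : YR)| <= e / 2.
  rewrite -(linear_onB lQ) //; apply: le_trans (HL _ I) _.
  move: a2; rewrite ler_pdivlMr //.
  have := normr_ge0 ((f t (x1 + y20 + xs t) : YR) - f t0 (y1 + y20 + xs t0)); nra.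
lra.
Qed.

(** The assumption on F_20 in the form of [close_on], along the known curves: radii are taken so
    small that kappa is below the inverse of the norm of Z^-1, then time is restricted until [xs],
    [d1] and [dw1] stay within these radii. *)
Let near_close t0 y1 y20 : J t0 -> M1 S MY y1 -> M20 y20 -> Phi t0 y1 y20 = 0 ->
  exists (Kc e r d : R) (Z : XR -> YR), [/\ [/\ 0 <= Kc, 0 <= e, Kc * e < 1, 0 < r & 0 < d],
    iso_on Kc (Pfix (level 0) : set XR) (Qfix (level 0) : set YR) Z,
    forall z : XR, Pfix (level 0) z -> `|z - y20| <= r -> M20 z &
    forall t (x1 : XR), J t -> `|t - t0| < d -> D1 S x1 -> `|x1 - y1| < d ->
      close_on (Pfix (level 0) : set XR) Z (Phi t x1) y20 r e].
Proof.
move=> J0 My1 My20 Phi0.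
have [||de0 [ep0 [Z [Zi [ka [l [[de00 ep00] [lZ bZ] iZ cl [lim ll]]]]]]]] :=
  h2e J0 My1 My20 (xsM J0) (e := d1 t0) (ew := dw1 t0) _ _ Phi0.
- by rewrite D2E //; exact: d1P.
- by rewrite DwE //; exact: dw1P.
rewrite D2sE // Y2sE // in iZ ll lZ bZ.
set Kc := opnorm _ Zi in ll.
have Kc0 : 0 <= Kc by exact: opnorm_ge0.
(* The gap between the limit l and the inverse of the norm of Z^-1 is the admissible deviation of
   kappa from l. *)
have [|rho rho0 Hrho] := lim (Kc^-1 - l); first by rewrite subr_gt0.
have [de deP de_rho] : exists2 de : 'I_5 -> R,
    forall i, 0 < de i <= de0 i & forall i, 0 < de i < rho.
  exists (fun i => Num.min (de0 i) (rho / 2)) => i.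
    by rewrite lt_min de00 divr_gt0 //= ge_min lexx.
  rewrite lt_min de00 divr_gt0 //=; apply: (@le_lt_trans _ _ (rho / 2)); last lra.
  by rewrite ge_min lexx orbT.
pose ep := Num.min ep0 (rho / 2).
have epP : 0 < ep <= ep0 by rewrite lt_min ep00 divr_gt0 //= ge_min lexx.
have ep_rho : 0 < ep < rho.
  case/andP: epP => -> _ /=; apply: (@le_lt_trans _ _ (rho / 2)); last lra.
  by rewrite ge_min lexx orbT.
have ka_lt : ka de ep < Kc^-1.
  have := Hrho de ep de_rho ep_rho; rewrite ltr_norml => /andP[_]; lra.
(* kappa may be negative, whereas a contraction constant has to be nonnegative. *)
pose e := Num.max (ka de ep) 0.
have e0 : 0 <= e by rewrite le_max lexx orbT.
have Ke : Kc * e < 1.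
  have [->|Kc1] := eqVneq Kc 0; first by rewrite mul0r.
  have Kc2 : 0 < Kc by rewrite lt_neqAle eq_sym Kc1.
  by rewrite mulrC -ltr_pdivlMr // mul1r gt_max ka_lt invr_gt0.
have [r r0 Hr] := rel_open_ball M20_open My20.
have [ep1 _] := andP epP; have [ep2 _] := andP ep_rho.
pose r' := Num.min r (ep / 2).
have r'0 : 0 < r' by rewrite lt_min r0 divr_gt0.
have de1 i : 0 < de i by case/andP: (deP i).
have [q1 q10 Hq1] := xs_cont J0 (e := de 2 / 2) ltac:(by rewrite divr_gt0).
have [q2 q20 Hq2] := d1_cont J0 (e := de 3 / 2) ltac:(by rewrite divr_gt0).
have [q3 q30 Hq3] := dw1_cont J0 (e := de 4 / 2) ltac:(by rewrite divr_gt0).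
pose d := Num.min (Num.min (de 0) (de 1)) (Num.min q1 (Num.min q2 q3)).
have d0 : 0 < d by rewrite !lt_min !de1 q10 q20.
exists Kc, e, r', d, Z; split=> //.
- have [i1 i2 i3 i4 i5] := iZ; split => //.
  + by move=> a x y Px Py; exact: lZ.
  + move=> x Px; have := opnorm_le i5 (i1 x Px); rewrite i3 //; exact.
  + by move=> y Qy; exists (Zi y); [exact: i2 | exact: i4].
- by move=> z Pz zr; apply: Hr => //; apply: le_trans zr _; rewrite ge_min lexx.
move=> t x1 Jt; rewrite !lt_min => /andP[/andP[t1 t2] /andP[t3 /andP[t4 t5]]].
move=> Dx1 /andP[/andP[y2 y3] _] a b Pa Pb ha hb.
have inU : in_Udelta S de t0 y1 (xs t0) (d1 t0) (dw1 t0) t x1 (xs t) (d1 t) (dw1 t).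
  split; split => //.
  - by rewrite D2SigE //; exact: xsP.
  - by apply: le_lt_trans (Hq1 t Jt t3) _; have := de1 2; lra.
  - by rewrite D2E //; exact: d1P.
  - by apply: le_lt_trans (Hq2 t Jt t4) _; have := de1 3; lra.
  - by rewrite DwE //; exact: dw1P.
  - by apply: le_lt_trans (Hq3 t Jt t5) _; have := de1 4; lra.
have lt_ep (z : XR) : `|z - y20| <= r' -> nrm (z - y20 : X) < ep.
  move=> h; apply: (@le_lt_trans _ _ (ep / 2)); last lra.
  by apply: le_trans (h : nrm (z - y20 : X) <= r') _; rewrite ge_min lexx orbT.
have := cl de ep deP epP t x1 (xs t) (d1 t) (dw1 t) inU a b.
rewrite D2sE // => /(_ Pa (lt_ep a ha) Pb (lt_ep b hb)) h.
apply: le_trans (h : `|(_ : YR)| <= ka de ep * `|(a - b : XR)|) _.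
by apply: ler_wpM2r => //; rewrite le_max lexx.
Qed.

Variable Xi : R -> X -> XR.
Hypothesis hXi : forall t x1, J t -> M1 S MY x1 ->
  [/\ M20 (Xi t x1), F20 S f t x1 (Xi t x1) (xs t) (d1 t) (dw1 t) = 0
    & forall x, M20 x -> F20 S f t x1 x (xs t) (d1 t) (dw1 t) = 0 -> x = Xi t x1].

(** At a nearby (t, x1) a root is found within e of the old one by [implicit_exists], and uniqueness
    in [M20] identifies it with [Xi t x1]. *)
Lemma x20_cont t0 (y1 : XR) : J t0 -> M1 S MY y1 -> forall e : R, 0 < e ->
  exists2 d : R, 0 < d & forall t (x1 : XR), J t -> `|t - t0| < d -> M1 S MY x1 ->
    `|x1 - y1| < d -> `|Xi t x1 - Xi t0 y1| <= e.
Proof.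
move=> J0 My1 e e0; have [M0 Phi0 _] := hXi J0 My1.
have [Kc [eta [r [d [Z [[Kc0 eta0 Ke r0 d0] iso ballM cl]]]]]] := near_close J0 My1 M0 Phi0.
pose q := Num.min r e.
have q0 : 0 < q by rewrite lt_min r0.
have [qr qe] : q <= r /\ q <= e by rewrite !ge_min !lexx orbT.
have K10 : 0 < Kc + 1 by rewrite ltr_wpDl.
have Ke1 : 0 < 1 - Kc * eta by rewrite subr_gt0.
have c0 : 0 < (1 - Kc * eta) * q / (Kc + 1) by rewrite divr_gt0 // mulr_gt0.
have [p p0 Hp] := Phi_cont J0 (M1_D1 My1) (M20_sub M0) c0.
exists (Num.min d p); first by rewrite lt_min d0.
move=> t x1 Jt; rewrite !lt_min => /andP[td tp] Mx1 /andP[xd xp].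
have small : Kc * `|Phi t x1 (Xi t0 y1) : YR| <= (1 - Kc * eta) * q.
  have := Hp t x1 Jt tp (M1_D1 Mx1) xp; rewrite [Phi t0 _ _]Phi0 subr0.
  rewrite ler_pdivlMr //; have := normr_ge0 (Phi t x1 (Xi t0 y1) : YR); nra.
have [|x [Px hx x0]] := implicit_exists (@realify_complete R k X)
  (Pfix_subspace hdual (level 0)) (@Pfix_closed _ _ _ _ _ hdual (level 0))
  (Qfix_subspace hdual (level 0)) iso Kc0 eta0 Ke (ltW q0) (M20_sub M0) _
  (close_on_le qr (cl t x1 Jt td (M1_D1 Mx1) xd)) small.
- by move=> x Px _; exact: Phi_Qfix.
have Mx : M20 x by apply: ballM => //; exact: le_trans qr.
have [_ _ ux] := hXi Jt Mx1.
by rewrite -(ux x Mx x0); exact: le_trans qe.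
Qed.

(** The Lipschitz conditions concern pairs with equal x_{2Sigma}; at a common time this holds for
    any two states, because P_{2Sigma} annihilates D_1 and D_20. *)
Let sigma_eq t x1 x20 x1' x20' : D1 S x1 -> D1 S x1' -> Pfix (level 0) x20 ->
  Pfix (level 0) x20' -> P2Sig S (x1 + x20 + xs t) = P2Sig S (x1' + x20' + xs t).
Proof.
move=> D11 D11' P0 P0'; rewrite P2SigE //.
have z x : Pfix (level 0) x -> PR upper x = 0.
  move=> <-; rewrite PR_comp //; apply: PR_false => i s _.
  by rewrite /upper /level; case: s.
have lP := (PR_bounded hdual upper).1.
have e x y : D1 S x -> Pfix (level 0) y -> PR upper (x + y + xs t) = PR upper (xs t).
  move=> Dx Py; rewrite (@linear_onD _ XR XR setT _ (x + y) (xs t) lP) //.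
  by rewrite (@linear_onD _ XR XR setT _ x y lP) // PR_D1 // z // !add0r.
by rewrite !e.
Qed.

(** [inverse_estimate] bounds the distance of two roots by a multiple of the residual of the second
    root in the first equation, and the Lipschitz condition on Q_20 f bounds this residual by L |x1
    - x1'|. *)
Lemma x20_lip t0 (y1 : XR) : J t0 -> M1 S MY y1 -> exists d L : R, [/\ 0 < d, 0 <= L &
  forall t (x1 x1' : XR), J t -> `|t - t0| < d -> M1 S MY x1 -> `|x1 - y1| < d ->
    M1 S MY x1' -> `|x1' - y1| < d -> `|Xi t x1 - Xi t x1'| <= L * `|x1 - x1'|].
Proof.
move=> J0 My1; have [M0 Phi0 _] := hXi J0 My1.
have [Kc [eta [r [d [Z [[Kc0 eta0 Ke r0 d0] iso ballM cl]]]]]] := near_close J0 My1 M0 Phi0.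
have [d2 [L [d20 L0 HL]]] := loc_lipschitz_nrm h2e_lip.2 J0 (sum_M J0 My1 M0).
have d60 : 0 < d2 / 6 by rewrite divr_gt0.
have [d3 d30 H3] := xs_cont J0 d60.
have m0 : 0 < Num.min r (d2 / 6) by rewrite lt_min r0.
have [d4 d40 H4] := x20_cont J0 My1 m0.
have Ke1 : 0 < 1 - Kc * eta by rewrite subr_gt0.
exists (Num.min (Num.min d (d2 / 6)) (Num.min d3 d4)), (Kc * L / (1 - Kc * eta)).
split; first by rewrite !lt_min d0 d60 d30.
  by rewrite divr_ge0 ?mulr_ge0 // ltW.
move=> t x x' Jt; rewrite !lt_min => /andP[/andP[t1 t2] /andP[t3 t4]] Mx.
move=> /andP[/andP[x1 x2] /andP[x3 x4]] Mx' /andP[/andP[x1' x2'] /andP[x3' x4']].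
have [Ma Phia _] := hXi Jt Mx; have [Mb Phib _] := hXi Jt Mx'.
have ha := H4 t x Jt t4 Mx x4; have hb := H4 t x' Jt t4 Mx' x4'.
have [mr md] : Num.min r (d2 / 6) <= r /\ Num.min r (d2 / 6) <= d2 / 6.
  by rewrite !ge_min !lexx orbT.
have := inverse_estimate (Pfix_subspace hdual (level 0)) iso Kc0
  (cl t x Jt t1 (M1_D1 Mx) x1) (M20_sub Ma) (M20_sub Mb) (le_trans ha mr) (le_trans hb mr).
move=> h; rewrite mulrAC ler_pdivlMr // mulrC; apply: le_trans h _.
rewrite -mulrA; apply: ler_wpM2l => //.
(* Both roots give 0, so the first term may be exchanged; the remaining difference compares
   arguments differing only in x_1, and the terms with B and A cancel. *)
have -> : (Phi t x (Xi t x) : YR) - Phi t x (Xi t x') =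
    (Phi t x' (Xi t x') : YR) - Phi t x (Xi t x').
  by rewrite [Phi t x (Xi t x)]Phia [Phi t x' (Xi t x')]Phib.
rewrite !PhiE.
have -> : (QR (level 0) (f t (x' + Xi t x' + xs t)) : YR) - (B (Xi t x') : YR) - h1 t -
    ((QR (level 0) (f t (x + Xi t x' + xs t)) : YR) - (B (Xi t x') : YR) - h1 t) =
  (QR (level 0) (f t (x' + Xi t x' + xs t)) : YR) - (QR (level 0) (f t (x + Xi t x' + xs t)) : YR).
  have id0 (a a' b h : YR) : a - b - h - (a' - b - h) = a - a' by linear_over R.
  exact: id0.
have -> : `|x - x'| = nrm (x' + Xi t x' + xs t - (x + Xi t x' + xs t) : X).
  rewrite distrC; change (`|x' - x| = `|x' + Xi t x' + xs t - (x + Xi t x' + xs t)|).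
  by congr (`|_|); linear_over R.
have hx3 := H3 t Jt t3.
have := HL t (x' + Xi t x' + xs t) (x + Xi t x' + xs t) Jt; rewrite Q2sE //; apply.
- lra.
- exact: sum_M.
- by apply: near_sum => //; lra.
- exact: sum_M.
- by apply: near_sum => //; lra.
- apply: sigma_eq; [exact: M1_D1 | exact: M1_D1 | exact: M20_sub | exact: M20_sub].
Qed.

(** The argument y plays the role of A x_1: all components of the solution at time t are recovered
    from it. *)
Definition state t (y : YR) : XR := G y + Xi t (G y) + xs t.
Definition field t (y : YR) : YR := Q1 S (f t (state t y)) - B (G y).

Lemma state_M t y : J t -> Om y -> M S MY M20 M2 Mw (state t y).
Proof.
by move=> Jt Oy; apply: sum_M => //; [exact: M1_G | case: (hXi Jt (M1_G Oy))].
Qed.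

Lemma state_cont t0 y0 : J t0 -> Om y0 -> forall e : R, 0 < e ->
  exists2 d : R, 0 < d & forall t y, J t -> `|t - t0| < d -> Om y ->
    `|y - y0| < d -> `|state t y - state t0 y0| < e.
Proof.
move=> J0 Oy0 e e0; have e30 : 0 < e / 4 by rewrite divr_gt0.
have [lG [L L0 HL]] := bG; have L10 : 0 < L + 1 by rewrite ltr_wpDl.
have [d d0 Hd] := x20_cont J0 (M1_G Oy0) e30.
have [r r0 Hr] := xs_cont J0 e30.
pose q := Num.min (e / 4) d / (L + 1).
have m0 : 0 < Num.min (e / 4) d by rewrite lt_min e30.
have q0 : 0 < q by rewrite divr_gt0.
exists (Num.min (Num.min d r) q); first by rewrite !lt_min d0 r0.
move=> t y Jt; rewrite !lt_min => /andP[/andP[td tr] _] Oy /andP[_].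
rewrite ltr_pdivlMr // => yq.
have : `|G y - G y0| < Num.min (e / 4) d.
  rewrite -(linear_onB lG) //; apply: le_lt_trans (HL _ I) _.
  by apply: le_lt_trans yq; have := normr_ge0 (y - y0); nra.
rewrite lt_min => /andP[g1 g2].
have := Hd t (G y) Jt td (M1_G Oy) g2; have := Hr t Jt tr => a1 a2.
by apply: near_sum => //; lra.
Qed.

Lemma field_cont (t0 : R) y0 : 0 <= t0 -> Om y0 -> forall e : R, 0 < e ->
  exists2 d : R, 0 < d & forall (t : R) y, 0 <= t -> `|t - t0| <= d ->
    `|y - y0| <= d -> `|field t y - field t0 y0| <= e.
Proof.
move=> J0 Oy0 e e0; have e20 : 0 < e / 2 by rewrite divr_gt0.
have [lB [LB LB0 HB]] := bBG; have LB10 : 0 < LB + 1 by rewrite ltr_wpDl.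
have [lQ [LQ LQ0 HQ]] := Q1_bounded hroot hdual; have LQ10 : 0 < LQ + 1 by rewrite ltr_wpDl.
have DM t y : J t -> Om y -> D S (state t y).
  move=> Jt Oy; apply: sum_D => //; apply: M20_sub.
  by case: (hXi Jt (M1_G Oy)).
have c0 : 0 < e / 2 / (LQ + 1) by rewrite divr_gt0.
have [d d0 Hd] := f_cont J0 (DM t0 y0 J0 Oy0) c0.
have [q q0 Hq] := state_cont J0 Oy0 d0.
have [r r0 Hr] := Om_open Oy0.
pose p := Num.min (Num.min (d / 2) (q / 2)) (Num.min r (e / 2 / (LB + 1))).
have p0 : 0 < p by rewrite !lt_min r0 !divr_gt0.
have [pd pq pr pe] : [/\ p <= d / 2, p <= q / 2, p <= r & p <= e / 2 / (LB + 1)].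
  by have := lexx p; rewrite {2}/p !le_min => /andP[/andP[-> ->] /andP[-> ->]].
exists p => // t y Jt tp yp.
have Oy : Om y by apply: Hr; exact: le_trans pr.
have a1 : `|(f t (state t y) : YR) - f t0 (state t0 y0)| <= e / 2 / (LQ + 1).
  apply: Hd => //; [exact: DM | lra |].
  by apply: Hq => //; lra.
have a2 : `|(Q1 S (f t (state t y)) : YR) - Q1 S (f t0 (state t0 y0))| <= e / 2.
  rewrite -(linear_onB lQ) //; apply: le_trans (HQ _ I) _.
  move: a1; rewrite ler_pdivlMr //.
  have := normr_ge0 ((f t (state t y) : YR) - f t0 (state t0 y0)); nra.
have a3 : `|(B (G y) : YR) - B (G y0)| <= e / 2.
  rewrite -(linear_onB lB) //; apply: le_trans (HB _ I) _.
  have : `|y - y0| <= e / 2 / (LB + 1) by exact: le_trans pe.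
  by rewrite ler_pdivlMr //; have := normr_ge0 (y - y0); nra.
have -> : field t y - field t0 y0 = ((Q1 S (f t (state t y)) : YR) -
   Q1 S (f t0 (state t0 y0))) - ((B (G y) : YR) - B (G y0)).
  have id0 (q1 q2 b1 b2 : YR) : q1 - b1 - (q2 - b2) = q1 - q2 - (b1 - b2).
    by linear_over R.
  exact: id0.
apply: le_trans (ler_normB _ _) _; lra.
Qed.

(** The state is Lipschitz in y with constant (1 + L) LG, from the bound LG on G and the Lipschitz
    constant L of x_20; Q_1 f and B G then contribute L2 (1 + L) LG and LB. *)
Lemma field_lip (t0 : R) y0 : 0 <= t0 -> Om y0 -> exists d L : R,
  [/\ 0 < d, 0 <= L, forall y, `|y - y0| <= d -> Om y &
      forall (t : R) y1 y2, 0 <= t -> `|t - t0| <= d ->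
        `|y1 - y0| <= d -> `|y2 - y0| <= d ->
        `|field t y1 - field t y2| <= L * `|y1 - y2|].
Proof.
move=> J0 Oy0; have [lB [LB LB0 HB]] := bBG.
have [lG [LG LG0 HG]] := bG; have LG10 : 0 < LG + 1 by rewrite ltr_wpDl.
have [d [L [d0 L0 HL]]] := x20_lip J0 (M1_G Oy0).
have [d2 [L2 [d20 L20 HL2]]] := loc_lipschitz_nrm h2e_lip.1 J0 (state_M J0 Oy0).
have [q q0 Hq] := state_cont J0 Oy0 d20.
have [r r0 Hr] := Om_open Oy0.
pose p := Num.min (Num.min (d / 2) (q / 2)) (Num.min (Num.min r (d2 / 2)) (d / 2 / (LG + 1))).
have p0 : 0 < p by rewrite !lt_min r0 !divr_gt0.
have [pd pq pr pd2 pG] : [/\ p <= d / 2, p <= q / 2, p <= r, p <= d2 / 2 & p <= d / 2 / (LG + 1)].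
  by have := lexx p; rewrite {2}/p !le_min => /andP[/andP[-> ->] /andP[/andP[-> ->] ->]].
exists p, (L2 * ((1 + L) * LG) + LB); split => //.
- by rewrite addr_ge0 // !mulr_ge0 // addr_ge0.
- by move=> y yp; apply: Hr; exact: le_trans pr.
move=> t y1 y2 Jt tp y1p y2p.
have Oy1 : Om y1 by apply: Hr; exact: le_trans pr.
have Oy2 : Om y2 by apply: Hr; exact: le_trans pr.
have Gnear y : `|y - y0| <= p -> `|G y - G y0| < d.
  move=> yp; rewrite -(linear_onB lG) //; apply: le_lt_trans (HG _ I) _.
  have : `|y - y0| <= d / 2 / (LG + 1) by exact: le_trans pG.
  by rewrite ler_pdivlMr //; have := normr_ge0 (y - y0); nra.
have GL : `|G y1 - G y2| <= LG * `|y1 - y2|.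
  by rewrite -(linear_onB lG) //; exact: HG.
have XL : `|Xi t (G y1) - Xi t (G y2)| <= L * `|G y1 - G y2|.
  apply: HL => //; try exact: M1_G; try exact: Gnear; lra.
have sL : `|state t y1 - state t y2| <= (1 + L) * LG * `|y1 - y2|.
  have -> : state t y1 - state t y2 = (G y1 - G y2) + (Xi t (G y1) - Xi t (G y2)).
    by rewrite /state; linear_over R.
  apply: le_trans (ler_normD _ _) _.
  have : L * `|G y1 - G y2| <= L * (LG * `|y1 - y2|) by exact: ler_wpM2l.
  lra.
have [m1 _ _] := hXi Jt (M1_G Oy1); have [m2 _ _] := hXi Jt (M1_G Oy2).
have fL : `|(Q1 S (f t (state t y1)) : YR) - Q1 S (f t (state t y2))| <=
    L2 * `|state t y1 - state t y2|.
  apply: (HL2 t (state t y1) (state t y2)) => //.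
  - lra.
  - exact: state_M.
  - by apply: Hq => //; lra.
  - exact: state_M.
  - by apply: Hq => //; lra.
  - by apply: sigma_eq => //; exact: M20_sub.
have BL : `|(B (G y1) : YR) - B (G y2)| <= LB * `|y1 - y2|.
  by rewrite -(linear_onB lB) //; exact: HB.
have -> : field t y1 - field t y2 = ((Q1 S (f t (state t y1)) : YR) -
   Q1 S (f t (state t y2))) - ((B (G y1) : YR) - B (G y2)).
  have id0 (q1 q2 b1 b2 : YR) : q1 - b1 - (q2 - b2) = q1 - q2 - (b1 - b2).
    by linear_over R.
  exact: id0.
apply: le_trans (ler_normB _ _) _.
have : L2 * `|state t y1 - state t y2| <= L2 * ((1 + L) * LG * `|y1 - y2|) by exact: ler_wpM2l.
lra.
Qed.

End x20_component.

(** * Continuity and time derivatives of the statement in terms of estimates *)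

Section time_derivatives.
Context {R : realType} {k : scalars}.
Local Notation K := (scalar_field R k).
Context {X : normedModType K}.
Local Notation XR := (realify X).

Lemma within_contP (J : set R) (g : R -> X) : {within J, continuous g} <->
  forall t, J t -> @cont_on R XR J g t.
Proof.
split=> [/subspace_continuousP H t Jt e e0|H].
  have := H t Jt [set y | nrm (y - g t) < e].
  have /[swap]/[apply] : nbhs (g t) [set y | nrm (y - g t) < e].
    by apply/nbhs_nrm; exists e.
  move=> /nbhs_normP[r /= r0 Hr]; exists r => // s Js st; apply: ltW.
  by apply: Hr => //; rewrite /ball_ /= distrC.
apply/subspace_continuousP => t Jt U /nbhs_nrm[e e0 He].
have e20 : 0 < e / 2 by rewrite divr_gt0.
have [r r0 Hr] := H t Jt _ e20; apply/nbhs_normP; exists r => //= s.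
rewrite /ball_ /= distrC => st Js; apply: He.
by apply: le_lt_trans (Hr s Js st) _; lra.
Qed.

(** Multiplying the difference quotient by |s - t| turns its limit into the remainder estimate; the
    excluded point s = t is trivial in the latter. *)
Lemma has_tderivP (J : set R) (g : R -> X) t d : has_tderiv J g t d <->
  @deriv_on R XR J g t d.
Proof.
have scale_quot (s : R) : s != t -> nrm (g s - g t - of_real k (s - t) *: d) =
    `|s - t| * nrm (of_real k (s - t)^-1 *: (g (t + (s - t)) - g t) - d).
  move=> st; rewrite -nrm_of_real scalerBr scalerA -of_realM divff ?subr_eq0 //.
  by rewrite of_real1 scale1r [t + _]addrC subrK.
split=> [H e e0|H U /nbhs_nrm[e e0 He]].
  have := H [set y | nrm (y - d) < e].
  have /[swap]/[apply] : nbhs d [set y | nrm (y - d) < e] by apply/nbhs_nrm; exists e.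
  move=> /nbhs_normP[r /= r0 Hr]; exists r => // s Js st.
  have [->|sn] := eqVneq s t; first by rewrite !subrr scale0r subr0 !normr0 mulr0.
  change (nrm (g s - g t - of_real k (s - t) *: d) <= e * `|s - t|).
  rewrite scale_quot // mulrC; apply: ler_wpM2r => //; apply: ltW; apply: Hr.
  - by rewrite /ball_ /= sub0r normrN.
  - by rewrite subr_eq0.
  - by rewrite /= [t + _]addrC subrK.
have e20 : 0 < e / 2 by rewrite divr_gt0.
have [r r0 Hr] := H _ e20; apply/nbhs_normP; exists r => //= h.
rewrite /ball_ /= sub0r normrN => hr h0 Jh; apply: He.
have := Hr (t + h) Jh; rewrite [t + h - t]addrAC subrr add0r => /(_ hr).
have hn : t + h != t by rewrite -subr_eq0 addrAC subrr add0r.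
have := scale_quot (t + h) hn; rewrite [t + h - t]addrAC subrr add0r => hq.
move=> hle; have {hle} : nrm (g (t + h) - g t - of_real k h *: d) <= e / 2 * `|h| by exact: hle.
rewrite hq mulrC ler_pM2r ?normr_gt0 // => hle; apply: le_lt_trans hle _; lra.
Qed.

End time_derivatives.

(** * Components of vectors and projections of the equation *)

Section components.
Context {R : realType} {k : scalars}.
Local Notation K := (scalar_field R k).
Context {X Y : completeNormedModType K}.
Variable S : root_data X Y.
Local Notation A := (opA S).
Local Notation B := (opB S).
Local Notation nu := (idx S).
Local Notation XR := (realify X).
Local Notation YR := (realify Y).
Local Notation top := (top (S := S)).
Local Notation wedge := (wedge (S := S)).
Local Notation level := (level (S := S)).
Local Notation every := (every (S := S)).
Local Notation PR := (PR (S := S)).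
Local Notation QR := (QR (S := S)).
Local Notation Pfix := (Pfix (S := S)).
Local Notation Qfix := (Qfix (S := S)).
Implicit Types p q : 'I_(kdim S) -> nat -> bool.
Hypotheses (hroot : root_vectors S) (hdual : dual_root_vectors S).

Lemma PR_add p x y : PR p (x + y) = PR p x + PR p y.
Proof. exact: (linear_onD (x := x : XR) (PR_bounded hdual p).1). Qed.

Lemma QR_add p x y : QR p (x + y) = QR p x + QR p y.
Proof. exact: (linear_onD (x := x : YR) (QR_bounded hdual p).1). Qed.

Lemma QR_sub p x y : QR p (x - y) = QR p x - QR p y.
Proof. exact: (linear_onB (x := x : YR) (QR_bounded hdual p).1). Qed.

Lemma PR_zero p : PR p 0 = 0.
Proof. by apply: (addrI (PR p 0)); rewrite -PR_add !addr0. Qed.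

Lemma QR_zero p : QR p 0 = 0.
Proof. by apply: (addrI (QR p 0)); rewrite -QR_add !addr0. Qed.

Lemma PR_sum p I (r : seq I) (P : pred I) (v : I -> X) :
  PR p (\sum_(i <- r | P i) v i) = \sum_(i <- r | P i) PR p (v i).
Proof. exact: (big_morph _ (PR_add p) (PR_zero p)). Qed.

Lemma QR_sum p I (r : seq I) (P : pred I) (v : I -> Y) :
  QR p (\sum_(i <- r | P i) v i) = \sum_(i <- r | P i) QR p (v i).
Proof. exact: (big_morph _ (QR_add p) (QR_zero p)). Qed.

Lemma PR_disjoint p q x : (forall i s, p i s -> q i s = false) -> Pfix q x -> PR p x = 0.
Proof.
move=> pq <-; rewrite (PR_comp hroot hdual); apply: PR_false => i s _.
by case ps : (p i s); rewrite // pq.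
Qed.

Lemma QR_disjoint p q y : (forall i s, p i s -> q i s = false) -> Qfix q y -> QR p y = 0.
Proof.
move=> pq <-; rewrite (QR_comp hroot hdual); apply: QR_false => i s _.
by case ps : (p i s); rewrite // pq.
Qed.

Lemma Pfix_le p q : (forall i s, (s < mult i)%N -> p i s -> q i s) -> Pfix p `<=` Pfix q.
Proof.
move=> pq x; rewrite /Pfix /= => <-; rewrite (PR_comp hroot hdual).
by apply: eq_PR => i s /pq; case: (p i s) => [->|_]; rewrite ?andbF.
Qed.

Lemma sum_nat_pick (V : nmodType) a b s (v : nat -> V) : (a <= s < b)%N ->
  (forall j, (a <= j < b)%N -> j != s -> v j = 0) -> \sum_(a <= j < b) v j = v s.
Proof.
move=> hs h; rewrite (bigD1_seq s) ?mem_index_iota ?iota_uniq //=.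
by rewrite big_nat_cond big1 ?addr0 // => j /andP[]; exact: h.
Qed.

Lemma sum_nat_eq0 (V : nmodType) a b (v : nat -> V) :
  (forall j, (a <= j < b)%N -> v j = 0) -> \sum_(a <= j < b) v j = 0.
Proof. by move=> h; rewrite big_nat_cond big1 // => j /andP[/h]. Qed.

Lemma PR_level s x : PR (level s) x = PR (top s) x + PR (wedge s) x.
Proof. by rewrite -P2sE // -P2topE -P2wE // /P2w addrC subrK. Qed.

Lemma component_decomp x : (0 < nu)%N ->
  x = P1 S x + PR (level 0) x +
    (\sum_(1 <= j < nu) PR (top j) x + \sum_(1 <= j < nu.-1) PR (wedge j) x).
Proof.
move=> n0; rewrite -addrA; set y := (X in _ + X); suff <- : P2 S x = y by rewrite subrK.
rewrite /P2 big_ltn // P2sE //; congr (_ + _).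
rewrite (eq_sum_nat (v := fun j => PR (top j) x + PR (wedge j) x)); last first.
  by move=> j _; rewrite P2sE // PR_level.
rewrite big_split /=; congr (_ + _).
have [n1|n1] := eqVneq nu 1%N; first by rewrite n1 !big_geq.
(* The [wedge] part of the last level is 0, which is why the second sum ends one index earlier. *)
rewrite -{1}(prednK n0) big_nat_recr /=; last lia.
by rewrite (PR_false (p := wedge nu.-1)) ?addr0 // => i s; exact: wedge_last.
Qed.

Section sums.
Variables (x1 x20 : X) (u w : nat -> X).
Hypotheses (hx1 : D1 S x1) (hx20 : Pfix (level 0) x20).
Hypothesis hu : forall j, (1 <= j < nu)%N -> Pfix (top j) (u j).
Hypothesis hw : forall j, (1 <= j < nu.-1)%N -> Pfix (wedge j) (w j).
Let x := x1 + x20 + (\sum_(1 <= j < nu) u j + \sum_(1 <= j < nu.-1) w j).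

Let PRx p : PR p x = PR p x20 +
  (\sum_(1 <= j < nu) PR p (u j) + \sum_(1 <= j < nu.-1) PR p (w j)).
Proof. by rewrite /x !PR_add !PR_sum (PR_D1 hroot hdual) // add0r. Qed.

Lemma PR_top_sum s : (1 <= s < nu)%N -> PR (top s) x = u s.
Proof.
move=> hs; rewrite PRx (PR_disjoint _ hx20); last first.
  by rewrite /top /level => i s' /andP[/eqP-> _]; apply/eqP; lia.
rewrite (sum_nat_pick hs) => [|j hj js]; last first.
  apply: (PR_disjoint _ (hu hj)) => i s'; rewrite /top => /andP[/eqP-> _].
  by rewrite eq_sym (negbTE js).
rewrite sum_nat_eq0 => [|j hj].
  by rewrite add0r addr0; exact: hu.
apply: (PR_disjoint _ (hw hj)) => i s'; rewrite /top /wedge => /andP[/eqP-> /eqP->].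
by case: eqP => //= ->; rewrite eqxx.
Qed.

Lemma PR_wedge_sum s : (1 <= s < nu.-1)%N -> PR (wedge s) x = w s.
Proof.
move=> hs; rewrite PRx (PR_disjoint _ hx20); last first.
  by rewrite /wedge /level => i s' /andP[/eqP-> _]; apply/eqP; lia.
rewrite [X in _ + (_ + X)](sum_nat_pick hs) => [|j hj js]; last first.
  apply: (PR_disjoint _ (hw hj)) => i s'; rewrite /wedge => /andP[/eqP-> _].
  by rewrite eq_sym (negbTE js).
rewrite sum_nat_eq0 => [|j hj].
  by rewrite !add0r; exact: hw.
apply: (PR_disjoint _ (hu hj)) => i s'; rewrite /top /wedge => /andP[/eqP-> ms].
by case: eqP => //= <-; exact: negbTE.
Qed.

Lemma PR_level0_sum : PR (level 0) x = x20.
Proof.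
rewrite PRx hx20 !sum_nat_eq0 ?addr0 // => j hj.
  apply: (PR_disjoint _ (hw hj)) => i s'; rewrite /wedge /level => /eqP->.
  by case: j hj.
apply: (PR_disjoint _ (hu hj)) => i s'; rewrite /top /level => /eqP->.
by case: j hj.
Qed.

Lemma P1_sum : (0 < nu)%N -> P1 S x = x1.
Proof.
move=> n0; have := component_decomp x n0; rewrite PR_level0_sum.
rewrite (eq_sum_nat (v := u)); last by move=> j hj; exact: PR_top_sum.
rewrite (eq_sum_nat (u := fun j => PR (wedge j) x) (v := w)); last by move=> j hj; exact: PR_wedge_sum.
by rewrite {1}/x => /addIr/addIr.
Qed.

End sums.

(** A place (i, s) in a chain is at level 0, at the end of its chain or in the [wedge] part; each
    dual functional is therefore covered by one of the projections. *)
Lemma Y_eq0 y : Q1 S y = 0 -> QR (level 0) y = 0 ->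
  (forall s, (1 <= s < nu)%N -> QR (top s) y = 0) ->
  (forall s, (1 <= s < nu.-1)%N -> QR (wedge s) y = 0) -> y = 0.
Proof.
move=> h1 h0 ht hw; move: h1; rewrite /Q1 Q2E //.
have -> : QR every y = 0.
  apply/(QR_every0 hroot hdual) => i s sm.
  have qE p : p i s -> QR p y = 0 -> qf i s.+1 y = 0.
    move=> ps q0; have := dual_sum hroot hdual p (fun i s => qf i s.+1 y) sm.
    by rewrite ps => <-; rewrite -[rsum _ _]/(QR p y) q0; exact/functional0/(dual_functional hdual).
  have /andP[_ mn] := mult_le hroot i.
  have [s0|s0] := posnP s; first by apply: (qE (level 0)); rewrite // /level s0.
  have [ms|ms] := eqVneq (mult i) s.+1.
    by apply: (qE (top s)); [rewrite /top eqxx ms eqxx | apply: ht; lia].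
  by apply: (qE (wedge s)); [rewrite /wedge eqxx ms | apply: hw; lia].
by rewrite subr0.
Qed.

Lemma QR_Q1 p y : QR p (Q1 S y) = 0.
Proof.
rewrite /Q1 Q2E // QR_sub (QR_comp hroot hdual); apply/eqP; rewrite subr_eq0; apply/eqP.
by apply: eq_QR => i s _; rewrite andbT.
Qed.

Lemma Q1_idem y : Q1 S (Q1 S y) = Q1 S y.
Proof. by rewrite {1}/Q1 Q2E // QR_Q1 subr0. Qed.

Lemma Q1_B x : dom B x -> Q1 S (B x) = B (P1 S x).
Proof.
move=> dx; rewrite /Q1 /P1 Q2E // P2E // linopB //; last exact/D_domB/PR_D.
by rewrite B_PR.
Qed.

Hypothesis hbasis : root_basis S.

Lemma Q1_A x : dom A x -> Q1 S (A x) = A (P1 S x).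
Proof.
move=> dx; rewrite /Q1 /P1 Q2E // P2E // linopB //; last exact/D_domA/PR_D.
congr (_ - _); rewrite (QR_A hbasis hroot hdual) // !(A_PR hbasis hroot).
by congr (rsum _ _); apply/funext => i; apply/funext => s; case: (0 < s)%N.
Qed.

(** The shifted index set would ask for the level s + 1 in chains of length s + 1, and is empty;
    projecting on a top part removes the derivative from the equation. *)
Lemma QR_top_A s x : dom A x -> QR (top s) (A x) = 0.
Proof.
move=> dx; rewrite (QR_A hbasis hroot hdual) // PR_false ?linop0 // => i s' sm.
by rewrite /top; apply/negP => /and3P[? /eqP ? /eqP ?]; lia.
Qed.

(** After the shift the condition that the chain does not end at level s is automatic, so the whole
    level s + 1 survives. *)
Lemma QR_wedge_A s x : dom A x -> QR (wedge s) (A x) = A (PR (level s.+1) x).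
Proof.
move=> dx; rewrite (QR_A hbasis hroot hdual) //; congr (A _); apply: eq_PR => i s' sm.
rewrite /wedge /level; have -> // : [&& (0 < s')%N, s'.-1 == s & mult i != s.+1] = (s' == s.+1).
by apply/and3P/eqP => [[]|]; [move=> ? /eqP ? _; lia | move=> h; split; lia].
Qed.

Lemma QR_level0_A x : dom A x -> QR (level 0) (A x) = A (PR (level 1) x).
Proof.
move=> dx; rewrite (QR_A hbasis hroot hdual) //; congr (A _); apply: eq_PR => i s' sm.
rewrite /level; have -> // : ((0 < s')%N && (s'.-1 == 0%N)) = (s' == 1%N).
by case: s' sm => [|[]].
Qed.

Section structure.
Variable f : R -> X -> Y.
Hypothesis hf : has_structure S f.

(** A projection without level 0 removes the first two terms of the structure formula; a top or
    [wedge] projection then selects a single summand, the index sets being disjoint. *)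
Let QR_f p (t : R) x : 0 <= t -> D S x ->
  (forall i s, p i s -> level 0 i s = false) ->
  QR p (f t x) =
    \sum_(1 <= s < nu.-1) QR p (QR (wedge s)
      (f t (\sum_(1 <= j < nu) PR (top j) x + \sum_(s <= j < nu.-1) PR (wedge j) x))) +
    \sum_(1 <= s < nu) QR p (QR (top s) (f t (\sum_(s <= j < nu) PR (top j) x))).
Proof.
move=> t0 Dx p0; rewrite [f t x in LHS]hf // Q2sE //; do 3!rewrite QR_add.
rewrite QR_Q1 add0r (QR_disjoint p0); last exact: Qfix_QR.
rewrite add0r; do 2!rewrite QR_sum; congr (_ + _); apply: eq_sum_nat => s hs.
  rewrite Q2SigE //; congr (QR _ (QR _ (f _ (_ + _)))).
    by apply: eq_bigr => j _; rewrite P2topE.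
  by apply: eq_bigr => j _; rewrite P2wE.
rewrite Q2topE; congr (QR _ (QR _ (f _ _))).
by apply: eq_bigr => j _; rewrite P2topE.
Qed.

Lemma QR_top_f s (t : R) x : (1 <= s < nu)%N -> 0 <= t -> D S x ->
  QR (top s) (f t x) = QR (top s) (f t (\sum_(s <= j < nu) PR (top j) x)).
Proof.
move=> hs t0 Dx; rewrite QR_f //; last first.
  by move=> i s'; rewrite /top /level => /andP[/eqP-> _]; apply/eqP; lia.
rewrite [X in X + _]sum_nat_eq0 ?add0r => [|j hj]; last first.
  apply: (QR_disjoint (q := wedge j)); last exact: Qfix_QR.
  move=> i s'; rewrite /top /wedge => /andP[/eqP-> /eqP->].
  by case: eqP => //= ->; rewrite eqxx.
rewrite (sum_nat_pick hs); first exact: Qfix_QR.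
move=> j hj js; apply: (QR_disjoint (q := top j)); last exact: Qfix_QR.
by move=> i s'; rewrite /top => /andP[/eqP-> _]; rewrite eq_sym (negbTE js).
Qed.

Lemma QR_wedge_f s (t : R) x : (1 <= s < nu.-1)%N -> 0 <= t -> D S x ->
  QR (wedge s) (f t x) = QR (wedge s)
    (f t (\sum_(1 <= j < nu) PR (top j) x + \sum_(s <= j < nu.-1) PR (wedge j) x)).
Proof.
move=> hs t0 Dx; rewrite QR_f //; last first.
  by move=> i s'; rewrite /wedge /level => /andP[/eqP-> _]; apply/eqP; lia.
rewrite [X in _ + X]sum_nat_eq0 ?addr0 => [|j hj]; last first.
  apply: (QR_disjoint (q := top j)); last exact: Qfix_QR.
  move=> i s'; rewrite /top /wedge => /andP[/eqP-> ms].
  by case: eqP => //= <-; exact: negbTE.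
rewrite (sum_nat_pick hs); first exact: Qfix_QR.
move=> j hj js; apply: (QR_disjoint (q := wedge j)); last exact: Qfix_QR.
by move=> i s'; rewrite /wedge => /andP[/eqP-> _]; rewrite eq_sym (negbTE js).
Qed.

End structure.
End components.

(** * Trajectories of the equation *)

Section curve_sums.
Context {R : realType} {E : normedModType R}.
Implicit Types (J : set R) (v : nat -> R -> E).

Lemma deriv_on_sum J v (vd : nat -> E) a b t :
  (forall j, (a <= j < b)%N -> deriv_on J (v j) t (vd j)) ->
  deriv_on J (fun s => \sum_(a <= j < b) v j s) t (\sum_(a <= j < b) vd j).
Proof.
elim: b => [|b IH] h.
  by rewrite big_geq // => e e0; exists 1 => // s _ _; rewrite !big_geq // subrr
    scaler0 subr0 normr0 mulr_ge0 // ltW.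
have [ab|ba] := leqP a b; last first.
  rewrite big_geq // => e e0; exists 1 => // s _ _; rewrite !big_geq // subrr.
  by rewrite scaler0 subr0 normr0 mulr_ge0 // ltW.
have -> : (fun s => \sum_(a <= j < b.+1) v j s) =
    (fun s => \sum_(a <= j < b) v j s + v b s).
  by apply/funext => s; rewrite big_nat_recr.
rewrite big_nat_recr //=; apply: deriv_onD; last by apply: h; lia.
by apply: IH => j hj; apply: h; lia.
Qed.

Lemma cont_on_sum J v a b t :
  (forall j, (a <= j < b)%N -> cont_on J (v j) t) ->
  cont_on J (fun s => \sum_(a <= j < b) v j s) t.
Proof.
elim: b => [|b IH] h.
  by move=> e e0; exists 1 => // s _ _; rewrite !big_geq // subrr normr0 ltW.
have [ab|ba] := leqP a b; last first.
  by move=> e e0; exists 1 => // s _ _; rewrite !big_geq // subrr normr0 ltW.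
have -> : (fun s => \sum_(a <= j < b.+1) v j s) =
    (fun s => \sum_(a <= j < b) v j s + v b s).
  by apply/funext => s; rewrite big_nat_recr.
apply: cont_onD; last by apply: h; lia.
by apply: IH => j hj; apply: h; lia.
Qed.

End curve_sums.

Section chains.
Context {R : realType} {k : scalars}.
Local Notation K := (scalar_field R k).
Context {X Y : completeNormedModType K}.
Variable S : root_data X Y.
Local Notation A := (opA S).
Local Notation B := (opB S).
Local Notation nu := (idx S).
Local Notation XR := (realify X).
Local Notation YR := (realify Y).
Local Notation J := (@half_line R).
Local Notation top := (top (S := S)).
Local Notation wedge := (wedge (S := S)).
Local Notation level := (level (S := S)).
Local Notation upper := (upper (S := S)).
Local Notation PR := (PR (S := S)).
Local Notation QR := (QR (S := S)).
Local Notation Pfix := (Pfix (S := S)).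
Variables (f : R -> X -> Y) (MY : set Y) (M20 : set X) (M2 Mw : nat -> set X).

(* u j and w j are the components x_{2j}^{(j+1)} and x_{2/\,j} of every
   solution, with derivatives ud j and wd j; they vanish when j is out of range *)
Record chain_curves (u w ud wd : nat -> R -> XR) : Prop := ChainCurves {
  chain_top_in : forall s t, (1 <= s)%N -> J t -> Pfix (top s) (u s t);
  chain_wedge_in : forall s t, (1 <= s)%N -> J t -> Pfix (wedge s) (w s t);
  chain_top_M2 : forall t, J t -> in_M2 S M2 1 (u^~ t);
  chain_wedge_Mw : forall t, J t -> in_Mw S Mw 1 (w^~ t);
  chain_top_eq : forall s t, (1 <= s < nu)%N -> J t -> F2 S f s t (u^~ t) = 0;
  chain_wedge_eq : forall s t, (1 <= s < nu.-1)%N -> J t ->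
    F2Sig S f s t (u^~ t) (w^~ t) (ud s.+1 t) (wd s.+1 t) = 0;
  chain_top_deriv : forall s t, (1 <= s)%N -> J t -> deriv_on J (u s) t (ud s t);
  chain_wedge_deriv : forall s t, (1 <= s)%N -> J t -> deriv_on J (w s) t (wd s t);
  chain_dtop_in : forall s t, (1 <= s)%N -> J t -> Pfix (top s) (ud s t);
  chain_dwedge_in : forall s t, (1 <= s)%N -> J t -> Pfix (wedge s) (wd s t);
  chain_dtop_cont : forall s t, (1 <= s)%N -> J t -> cont_on J (ud s) t;
  chain_dwedge_cont : forall s t, (1 <= s)%N -> J t -> cont_on J (wd s) t }.

Hypotheses (hbasis : root_basis S).
Hypotheses (hroot : root_vectors S) (hdual : dual_root_vectors S).
Hypothesis hopen : open_sets S MY M20 M2 Mw.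
Hypotheses (h1a : cond1a S f M2) (h1b : cond1b S f M2).
Hypotheses (h1c : cond1c S f M2 Mw) (h1d : cond1d S f M2 Mw).

Lemma chain_curves_exist : smoothness S f M2 Mw -> cond2a S f M2 -> cond2b S f M2 ->
  cond2c S f M2 Mw -> cond2d S f M2 Mw -> exists u w ud wd, chain_curves u w ud wd.
Proof.
move=> hsmooth h2a h2b h2c h2d.
have [u [ud hu]] := top_curves_exist hroot hdual hopen hsmooth h1a h1b h2a h2b.
have [w [wd [hw wd0]]] :=
  wedge_curves_exist hbasis hroot hdual hopen hsmooth h1c h1d h2c h2d hu.
(* Outside their range the curves are set to 0, so that formulas involving the level above the last
   one need no case distinction. *)
pose cut n (v : nat -> R -> XR) j := if (j < n)%N then v j else (fun=> 0).
have cutE n v j : (j < n)%N -> cut n v j = v j by rewrite /cut => ->.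
have P0 p : Pfix p 0 by case: (Pfix_subspace hdual p).
have wspec := @hw.
exists (cut nu u), (cut nu.-1 w), (cut nu ud), (cut nu.-1 wd); split.
- move=> s t s1 Jt; rewrite /cut; case: ifP => // sn.
  have hs : (1 <= s < nu)%N by rewrite s1.
  by apply: (M2_sub hroot hdual hopen hs); have [H _ _ _ _] := hu s hs; exact: H.
- move=> s t s1 Jt; rewrite /cut; case: ifP => // sn.
  have hs : (1 <= s < nu.-1)%N by rewrite s1.
  by apply: (Mw_sub hroot hdual hopen hs); have [H _ _ _ _] := hw s hs; exact: H.
- move=> t Jt s hs; rewrite cutE; last by case/andP: hs.
  by have [H _ _ _ _] := hu s hs; exact: H.
- move=> t Jt s hs; rewrite cutE; last by case/andP: hs.
  by have [H _ _ _ _] := hw s hs; exact: H.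
- move=> s t hs Jt; have [_ H _ _ _] := hu s hs; rewrite -(H t Jt).
  by apply: F2_local => [|j hj]; [lia | rewrite cutE //; lia].
- move=> s t hs Jt; have [_ H _ _ _] := hw s hs; rewrite -(H t Jt).
  rewrite cutE; last lia.
  have -> : cut nu.-1 wd s.+1 t = wd s.+1 t.
    rewrite /cut; case: ltnP => // h; have -> : s.+1 = nu.-1 by lia.
    by rewrite wd0.
  by apply: F2Sig_local => [|j hj|j hj]; [lia | rewrite cutE //; lia | rewrite cutE //; lia].
- move=> s t s1 Jt; rewrite /cut; case: ifP => sn; last exact: deriv_on_cst.
  by have [|_ _ _ H _] := hu s; [rewrite s1 | exact: H].
- move=> s t s1 Jt; rewrite /cut; case: ifP => sn; last exact: deriv_on_cst.
  by have [|_ _ _ H _] := hw s; [rewrite s1 | exact: H].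
- move=> s t s1 Jt; rewrite /cut; case: ifP => // sn.
  by have [|_ _ _ _ H] := hu s; [rewrite s1 | exact: smooth_curve_in H t Jt].
- move=> s t s1 Jt; rewrite /cut; case: ifP => // sn.
  by have [|_ _ _ _ H] := hw s; [rewrite s1 | exact: smooth_curve_in H t Jt].
- move=> s t s1 Jt; rewrite /cut; case: ifP => sn; last exact: cont_on_cst.
  have [|_ _ _ _ H] := hu s; first by rewrite s1.
  by have [_ h] := smooth_curve_le (leq0n _) H; exact: h.
- move=> s t s1 Jt; rewrite /cut; case: ifP => sn; last exact: cont_on_cst.
  have [|_ _ _ _ H] := hw s; first by rewrite s1.
  by have [_ h] := smooth_curve_le (leq0n _) H; exact: h.
Qed.

Lemma M_components x : M S MY M20 M2 Mw x ->
  [/\ M1 S MY (P1 S x), M20 (PR (level 0) x), in_M2 S M2 1 (fun j => PR (top j) x)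
    & in_Mw S Mw 1 (fun j => PR (wedge j) x)].
Proof.
move=> [_ [x1 Mx1 [x20 Mx20 <-]] [_ [_ [u Mu ->] [_ [w Mw' ->] <-]] <-]].
have D1x : D1 S x1 by exact: (M1_D1 hroot hdual hopen).
have P20 : Pfix (level 0) x20.
  have [_ H _ _] := hopen; rewrite D2sE // in H; exact: (rel_open_sub H).
have Pu j : (1 <= j < nu)%N -> Pfix (top j) (u j).
  by move=> hj; apply: (M2_sub hroot hdual hopen hj); exact: Mu.
have Pw j : (1 <= j < nu.-1)%N -> Pfix (wedge j) (w j).
  by move=> hj; apply: (Mw_sub hroot hdual hopen hj); exact: Mw'.
have n0 : (0 < nu)%N by have [_ [i <-] _ _] := hroot; have [/(_ i)/andP[]] := hroot.
split.
- by rewrite P1_sum.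
- by rewrite PR_level0_sum.
- by move=> j hj; rewrite PR_top_sum //; exact: Mu.
- by move=> j hj; rewrite PR_wedge_sum //; exact: Mw'.
Qed.

Variables u w ud wd : nat -> R -> XR.
Hypothesis hc : chain_curves u w ud wd.

Definition chain_sum (v z : nat -> R -> XR) t : XR :=
  \sum_(1 <= j < nu) v j t + \sum_(1 <= j < nu.-1) z j t.
Local Notation xs := (chain_sum u w).
Local Notation xd := (chain_sum ud wd).

Let Pfix_sum (v z : nat -> R -> XR) t : J t ->
  (forall s t, (1 <= s)%N -> J t -> Pfix (top s) (v s t)) ->
  (forall s t, (1 <= s)%N -> J t -> Pfix (wedge s) (z s t)) ->
  Pfix upper (chain_sum v z t).
Proof.
move=> Jt hv hz; have sP := Pfix_subspace hdual upper.
have sum0 a b (y : nat -> XR) : (forall j, (a <= j < b)%N -> Pfix upper (y j)) ->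
    Pfix upper (\sum_(a <= j < b) y j).
  move=> h; rewrite big_nat; apply: (big_ind (Pfix upper)) => //; first by case: sP.
  by move=> x y' hx hy; exact: (subspaceD sP).
apply: (subspaceD sP); apply: sum0 => j /andP[j1 _].
  apply: Pfix_le (hv j t j1 Jt) => // i s _; rewrite /top /upper => /andP[/eqP-> _].
  exact: j1.
apply: Pfix_le (hz j t j1 Jt) => // i s _; rewrite /wedge /upper => /andP[/eqP-> _].
exact: j1.
Qed.

Lemma chain_sum_upper t : J t -> Pfix upper (xs t).
Proof.
by move=> Jt; apply: Pfix_sum => //; [exact: chain_top_in hc | exact: chain_wedge_in hc].
Qed.

Lemma chain_dsum_upper t : J t -> Pfix upper (xd t).
Proof.
by move=> Jt; apply: Pfix_sum => //; [exact: chain_dtop_in hc | exact: chain_dwedge_in hc].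
Qed.

Lemma chain_sum_M2Sig t : J t -> M2Sig S M2 Mw (xs t).
Proof.
move=> Jt; exists (\sum_(1 <= j < nu) u j t).
  by apply: dsum_mem => j; exact: (chain_top_M2 hc Jt).
exists (\sum_(1 <= j < nu.-1) w j t) => //.
by apply: dsum_mem => j; exact: (chain_wedge_Mw hc Jt).
Qed.

Lemma chain_sum_deriv t : J t -> deriv_on J xs t (xd t).
Proof.
move=> Jt; apply: deriv_onD; apply: deriv_on_sum => j /andP[j1 _].
  exact: (chain_top_deriv hc).
exact: (chain_wedge_deriv hc).
Qed.

Lemma chain_dsum_cont t : J t -> cont_on J xd t.
Proof.
move=> Jt; apply: cont_onD; apply: cont_on_sum => j /andP[j1 _].
  exact: (chain_dtop_cont hc).
exact: (chain_dwedge_cont hc).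
Qed.

Let top0 s x : (nu <= s)%N -> PR (top s) x = 0.
Proof.
move=> ns; apply: PR_false => i s' sm; have /andP[_ mn] := mult_le hroot i.
by rewrite /top; apply/negP => /andP[/eqP e _]; lia.
Qed.

Let wedge0 s x : (nu.-1 <= s)%N -> PR (wedge s) x = 0.
Proof. by move=> ns; apply: PR_false => i s'; exact: wedge_last. Qed.

Lemma PR_level_chain_dsum s t : J t -> PR (level s.+1) (xd t) = ud s.+1 t + wd s.+1 t.
Proof.
move=> Jt; have D0 := D1_0 hroot hdual.
have P0 : Pfix (level 0) 0 by case: (Pfix_subspace hdual (level 0)).
have hu j : (1 <= j < nu)%N -> Pfix (top j) (ud j t).
  by move=> /andP[j1 _]; exact: (chain_dtop_in hc).
have hw j : (1 <= j < nu.-1)%N -> Pfix (wedge j) (wd j t).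
  by move=> /andP[j1 _]; exact: (chain_dwedge_in hc).
(* [xd t] is read as a full decomposition with vanishing D_1 and level-0 parts, to which the
   projection formulas apply. *)
have xdE : xd t = 0 + 0 + (\sum_(1 <= j < nu) ud j t + \sum_(1 <= j < nu.-1) wd j t).
  by rewrite !add0r.
rewrite PR_level // xdE; congr (_ + _).
  have [sn|ns] := ltnP s.+1 nu; first by rewrite (PR_top_sum hroot hdual D0 P0 hu hw).
  by rewrite top0 // -(chain_dtop_in hc (ltn0Sn s) Jt) top0.
have [sn|ns] := ltnP s.+1 nu.-1; first by rewrite (PR_wedge_sum hroot hdual D0 P0 hu hw).
by rewrite wedge0 // -(chain_dwedge_in hc (ltn0Sn s) Jt) wedge0.
Qed.

Section trajectory.
Hypothesis hfstruct : has_structure S f.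
Variables (I : set R) (y : R -> X).
Hypotheses (IJ : I `<=` J) (Iacc : forall t, I t -> forall r : R, 0 < r ->
  exists s, [/\ I s, s != t & `|s - t| < r]).
Hypothesis yM : forall t, I t -> M S MY M20 M2 Mw (y t).
Hypothesis yd : forall t, I t ->
  deriv_on I (fun s => A (y s) : YR) t (f t (y t) - B (y t)).

Let M_D x : M S MY M20 M2 Mw x -> D S x.
Proof.
move=> Mx; have n0 : (0 < nu)%N by have [_ [i <-] _ _] := hroot; have [/(_ i)/andP[]] := hroot.
have [M1x _ _ _] := M_components Mx.
rewrite (component_decomp hroot x n0); apply: DD.
  apply: DD; last exact: PR_D.
  exact/(D1_D hroot hdual)/(M1_D1 hroot hdual hopen).
by apply: DD; apply: D_sum => j _; exact: PR_D.
Qed.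

Lemma M_sub_D : M S MY M20 M2 Mw `<=` D S. Proof. exact: M_D. Qed.

(** The derivative of Q A y is computed twice, from the equation and from a known curve c;
    uniqueness of derivatives turns the projected equation into an algebraic one. *)
Let proj p t (c : R -> YR) d : I t -> (forall s, I s -> QR p (A (y s)) = c s) ->
  deriv_on I c t d -> QR p (f t (y t)) - QR p (B (y t)) = d.
Proof.
move=> It ce dc; have bQ := QR_bounded hdual p; rewrite -QR_sub //.
apply: (deriv_on_unique (Iacc It)) dc.
apply: (@eq_deriv_on _ _ _ (fun s => QR p (A (y s)) : YR) c t _ It ce).
by apply: (bounded_linear_deriv _ bQ It _ _ (yd It)); [split | done | done].
Qed.

(** Descending induction on the level: the projected equation has no derivative and involves only
    top components of level s and above, so that the component of y solves the equation defining u
    s, whose root in [M2 s] is unique. *)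
Lemma trajectory_top s t : (1 <= s)%N -> I t -> PR (top s) (y t) = u s t.
Proof.
have [n hn] := ubnP (nu - s); elim: n s t hn => // n IH s t hn s1 It.
have Jt := IJ It; have [sn|ns] := ltnP s nu; last first.
  by rewrite top0 // -(chain_top_in hc s1 Jt) top0.
have hs : (1 <= s < nu)%N by rewrite s1.
have [M1y M20y M2y Mwy] := M_components (yM It).
have Dy := M_D (yM It).
have above j : (s < j)%N -> PR (top j) (y t) = u j t.
  by move=> sj; apply: IH => //; lia.
have Mu : in_M2 S M2 s.+1 (u^~ t).
  by move=> j hj; apply: (chain_top_M2 hc Jt); lia.
have [x [Mx Fx ux]] := root_top hroot h1a h1b hs Jt Mu.
have -> : u s t = x.
  apply: ux; first exact: (chain_top_M2 hc Jt).
  rewrite -(chain_top_eq hc hs Jt); apply: F2_local => // j _ /=.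
  by case: eqP => // ->.
apply: ux; first exact: M2y.
have E0 := proj It (fun s' Is' => QR_top_A hroot hdual hbasis s (D_domA (M_D (yM Is'))))
  (deriv_on_cst I (0 : YR) t).
rewrite /F2 /= eqxx Q2topE (B_PR hroot hdual _ (D_domB Dy)).
rewrite -[RHS]E0 (QR_top_f hroot hdual hfstruct hs Jt Dy); congr (QR _ (f _ _) - _).
apply: eq_sum_nat => j /andP[sj _] /=; case: eqP => [->//|/eqP js].
by rewrite above //; lia.
Qed.

(** y itself is only known to be continuous; its level s is differentiable once identified with the
    curves u s + w s. *)
Let wedge_deriv s t : (1 <= s)%N -> I t ->
  (forall t, I t -> PR (wedge s) (y t) = w s t) ->
  deriv_on I (fun t => A (PR (level s) (y t)) : YR) t (A (ud s t + wd s t)).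
Proof.
move=> s1 It hw; have Jt := IJ It.
have domu p v : Pfix p v -> dom A v by move=> /(Pfix_D hroot)/D_domA.
apply: (@eq_deriv_on _ _ _ (fun t => (A (u s t) : YR) + A (w s t))) => //.
  move=> t' It'; rewrite PR_level // trajectory_top // hw // linopD //.
    exact: domu (chain_top_in hc s1 (IJ It')).
  exact: domu (chain_wedge_in hc s1 (IJ It')).
rewrite linopD; [|exact: domu (chain_dtop_in hc s1 Jt)|exact: domu (chain_dwedge_in hc s1 Jt)].
apply: deriv_onD.
  apply: (bounded_linear_deriv (Pfix_subspace hdual _) (A_bounded_Pfix hroot hdual (top s)) It).
  - by move=> t' /IJ; exact: (chain_top_in hc s1).
  - exact: (chain_dtop_in hc s1).
  - exact: (deriv_on_sub IJ (chain_top_deriv hc s1 Jt)).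
apply: (bounded_linear_deriv (Pfix_subspace hdual _) (A_bounded_Pfix hroot hdual (wedge s)) It).
- by move=> t' /IJ; exact: (chain_wedge_in hc s1).
- exact: (chain_dwedge_in hc s1).
- exact: (deriv_on_sub IJ (chain_wedge_deriv hc s1 Jt)).
Qed.

(** Descending induction again: the derivative in the projected equation is that of level s + 1,
    known from the previous step, and uniqueness of the root in [Mw s] concludes. *)
Lemma trajectory_wedge s t : (1 <= s)%N -> I t -> PR (wedge s) (y t) = w s t.
Proof.
have [n hn] := ubnP (nu.-1 - s); elim: n s t hn => // n IH s t hn s1 It.
have Jt := IJ It; have [sn|ns] := ltnP s nu.-1; last first.
  by rewrite wedge0 // -(chain_wedge_in hc s1 Jt) wedge0.
have hs : (1 <= s < nu.-1)%N by rewrite s1.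
have [M1y M20y M2y Mwy] := M_components (yM It).
have Dy := M_D (yM It).
have above j : (s < j)%N -> PR (wedge j) (y t) = w j t.
  by move=> sj; apply: IH => //; lia.
have Mu := chain_top_M2 hc Jt.
have Mw' : in_Mw S Mw s.+1 (w^~ t).
  by move=> j hj; apply: (chain_wedge_Mw hc Jt); lia.
have Dd : D2 S s.+1 (ud s.+1 t) by rewrite D2E //; exact: (chain_dtop_in hc).
have Ddw : Dw S s.+1 (wd s.+1 t) by rewrite DwE //; exact: (chain_dwedge_in hc).
have [x [Mx Fx ux]] := root_wedge hroot hdual h1c h1d hs Jt Mu Mw' Dd Ddw.
have -> : w s t = x.
  apply: ux; first exact: (chain_wedge_Mw hc Jt).
  rewrite -(chain_wedge_eq hc hs Jt); apply: F2Sig_local => // j _ /=.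
  by case: eqP => // ->.
apply: ux; first exact: Mwy.
have E0 := proj It (fun s' Is' => QR_wedge_A hroot hdual hbasis s (D_domA (M_D (yM Is'))))
  (wedge_deriv (ltn0Sn s) It (fun t' It' => IH s.+1 t' ltac:(lia) isT It')).
rewrite /F2Sig /= eqxx Q2SigE // -[RHS](subrr (A (ud s.+1 t + wd s.+1 t))) -{2}E0.
rewrite (B_PR hroot hdual _ (D_domB Dy)); congr (_ - _ - _).
rewrite (QR_wedge_f hroot hdual hfstruct hs Jt Dy); congr (QR _ (f _ (_ + _))).
  by apply: eq_sum_nat => j /andP[j1 _]; rewrite trajectory_top.
apply: eq_sum_nat => j /andP[sj _] /=; case: eqP => [->//|/eqP js].
by rewrite above //; lia.
Qed.

Variables (Xi : R -> X -> XR) (G : YR -> XR).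
Hypothesis hXi : forall t x1, J t -> M1 S MY x1 ->
  [/\ M20 (Xi t x1), F20 S f t x1 (Xi t x1) (xs t) (ud 1 t) (wd 1 t) = 0
    & forall x, M20 x -> F20 S f t x1 x (xs t) (ud 1 t) (wd 1 t) = 0 -> x = Xi t x1].
Hypothesis GA : forall x, D1 S x -> G (A x) = x.

(** At level 0 the equation contains only the known derivative of level 1, so that x_20 is the
    unique root of F_20 = 0, and G recovers x_1 from A x_1. *)
Lemma trajectory_state t : I t -> y t = state G xs Xi t (A (P1 S (y t))).
Proof.
move=> It; have Jt := IJ It.
have n0 : (0 < nu)%N by have [_ [i <-] _ _] := hroot; have [/(_ i)/andP[]] := hroot.
have [M1y M20y M2y Mwy] := M_components (yM It).
have Dy := M_D (yM It).
have yE : y t = P1 S (y t) + PR (level 0) (y t) + xs t.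
  rewrite {1}(component_decomp hroot (y t) n0); congr (_ + (_ + _)).
    by apply: eq_sum_nat => j /andP[j1 _]; exact: trajectory_top.
  by apply: eq_sum_nat => j /andP[j1 _]; exact: trajectory_wedge.
have [_ _ ux] := hXi Jt M1y.
rewrite /state GA; last exact: (M1_D1 hroot hdual hopen).
rewrite {1}yE; congr (_ + _ + _); apply: ux => //.
have E0 := proj It (fun s' Is' => QR_level0_A hroot hdual hbasis (D_domA (M_D (yM Is'))))
  (wedge_deriv (leqnn 1) It (fun t' It' => trajectory_wedge (leqnn 1) It')).
have QA : QR (level 0) (A (ud 1 t + wd 1 t)) = A (ud 1 t + wd 1 t).
  by rewrite -E0 -QR_sub //; exact: Qfix_QR.
rewrite /F20 Q2sE // QA.
by rewrite -yE -E0 (B_PR hroot hdual _ (D_domB Dy)) subrr.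
Qed.

Lemma trajectory_Om t : I t -> MY (Q1 S (A (P1 S (y t)))).
Proof.
move=> It; have [M1y _ _ _] := M_components (yM It).
have D1y := M1_D1 hroot hdual hopen M1y.
rewrite -(Q1_A hroot hdual hbasis) ?Q1_idem //; last exact: D_domA (M_D (yM It)).
rewrite (Q1_A hroot hdual hbasis); last exact: D_domA (M_D (yM It)).
have MYs : MY `<=` Y1 S by have [[U _ ->] _ _ _] := hopen => z [].
by have [] := (M1P hroot hdual _ MYs).1 M1y.
Qed.

Lemma trajectory_deriv t : I t ->
  deriv_on I (fun s => A (P1 S (y s)) : YR) t (field S f G xs Xi t (A (P1 S (y t)))).
Proof.
move=> It; have Jt := IJ It; have Dy := M_D (yM It).
have [M1y _ _ _] := M_components (yM It).
have D1y := M1_D1 hroot hdual hopen M1y.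
rewrite /field -trajectory_state // GA // -(Q1_B hroot hdual (D_domB Dy)).
have bQ := Q1_bounded hroot hdual.
rewrite -(linear_onB bQ.1) //.
apply: (@eq_deriv_on _ _ _ (fun s => Q1 S (A (y s)) : YR)) => //.
  by move=> s Is; rewrite (Q1_A hroot hdual hbasis) //; exact: D_domA (M_D (yM Is)).
by apply: (bounded_linear_deriv _ bQ It _ _ (yd It)).
Qed.

End trajectory.
End chains.

(** * Half-open intervals and limits at an open left end *)

Section half_open_intervals.
Context {R : realType} {E : normedModType R}.
Implicit Types (z w : R -> E) (T : \bar R).

Lemma half_open_next (a : R) T t : half_open a T t ->
  exists2 b, t < b & half_open a T b.
Proof.
move=> [at_]; case: T => [T| |] // tT.
  exists ((t + T) / 2); first by move: tT; rewrite lte_fin; lra.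
  by move: tT; split; rewrite ?lte_fin /=; move: tT; rewrite lte_fin; lra.
exists (t + 1); first by lra.
by split; rewrite ?ltry //; lra.
Qed.

Lemma deriv_half_open (a : R) T z d t : half_open a T t ->
  (forall b, half_open a T b -> seg a b t -> deriv_on (seg a b) z t d) ->
  deriv_on (half_open a T) z t d.
Proof.
move=> Jt H; have [b tb Jb] := half_open_next Jt.
apply: (@deriv_on_local _ _ _ _ _ _ (b - t)); first by rewrite subr_gt0.
have at_ : a <= t by case: Jt.
apply: deriv_on_sub (H b Jb _); last by rewrite /seg /= at_ ltW.
move=> s [[as_ _]] /=; rewrite ltr_norml => /andP[_ sb]; rewrite /seg /= as_ /=; lra.
Qed.

(** A backward Gronwall estimate: at a maximum point c of |z| one has |z c| <= |z b| + (C + L |z c|)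
    (b - a), and L (b - a) <= 1/2 absorbs the last term. *)
Lemma growth_bound (a b C L : R) z w : a <= b -> 0 <= L -> L * (b - a) <= 1 / 2 ->
  (forall t, seg a b t -> deriv_on (seg a b) z t (w t)) ->
  (forall t, seg a b t -> `|w t| <= C + L * `|z t|) ->
  forall t, seg a b t -> `|z t| <= 2 * (`|z b| + C * (b - a)).
Proof.
move=> ab L0 Lab dz wb t abt.
have [|c] := @EVT_max R (fun t => `|z t|) a b ab.
  apply: (@within_contP R RealScalars R^o _ _).2 => s abs e e0.
  have abs' : seg a b s by move: abs; rewrite /= in_itv.
  have [r r0 Hr] := deriv_cont (dz s abs') e0; exists r => // s'; rewrite /= in_itv => abs'' ss'.
  by apply: le_trans (Hr s' abs'' ss'); exact: ler_dist_dist.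
rewrite in_itv /= => /andP[ac cb] cmax.
have {}cmax s : seg a b s -> `|z s| <= `|z c| by move=> abs; apply: cmax; rewrite in_itv.
have sub : seg c b `<=` seg a b.
  by move=> s /andP[s1 s2]; apply/andP; split => //; exact: le_trans s1.
have h1 : `|z b - z c| <= (C + L * `|z c|) * (b - c).
  apply: (@deriv_bound _ _ _ _ _ _ w cb).
    by move=> s cbs; exact: deriv_on_sub sub (dz s (sub s cbs)).
  move=> s cbs; apply: le_trans (wb s (sub s cbs)) _.
  by rewrite lerD2l; apply: ler_wpM2l => //; exact/cmax/sub.
have h2 : 0 <= C + L * `|z c|.
  by apply: le_trans (wb c _); [exact: normr_ge0 | rewrite /seg /= ac].
have h3 : (C + L * `|z c|) * (b - c) <= (C + L * `|z c|) * (b - a).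
  by apply: ler_wpM2l => //; lra.
have h4 : L * (b - a) * `|z c| <= 1 / 2 * `|z c| by exact: ler_wpM2r.
have h5 : `|z c| <= `|z b| + `|z b - z c|.
  by have := ler_normB (z b) (z b - z c); rewrite opprB addrC subrK.
apply: le_trans (cmax t abt) _.
have h6 : (C + L * `|z c|) * (b - a) = C * (b - a) + L * (b - a) * `|z c| by ring.
by rewrite h6 in h3; lra.
Qed.

(** The values at a + (b - a) / 2^n converge geometrically, and the Lipschitz condition carries the
    limit over to all t tending to a. *)
Lemma lipschitz_limit (a b C : R) z : seq_complete E -> a < b -> 0 <= C ->
  (forall s t, a < s <= b -> a < t <= b -> `|z s - z t| <= C * `|s - t|) ->
  exists l, forall t, a < t <= b -> `|z t - l| <= C * (t - a).
Proof.
move=> cE ab C0 lip; pose p n : R := (b - a) / 2 ^+ n.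
have ba0 : 0 < b - a by rewrite subr_gt0.
have p0 n : 0 < p n by rewrite divr_gt0 // exprn_gt0.
have pb n : p n <= b - a.
  by have := @ler_halving R (b - a) 0 n (ltW ba0) (leq0n n); rewrite expr0 divr1.
have ap n : a < a + p n <= b by have := p0 n; have := pb n; lra.
have [|l hl] := @halving_limit R E (fun n => z (a + p n)) (C * (b - a)) cE.
  move=> n; apply: le_trans (lip _ _ (ap _) (ap _)) _.
  have -> : a + p n.+1 - (a + p n) = - (p n / 2).
    by rewrite /p halvingS; field.
  by rewrite normrN gtr0_norm ?divr_gt0 // -mulrA ler_wpM2l //; have := p0 n; rewrite /p; lra.
exists l => t abt; rewrite -subr_le0.
apply: (@le0_halving _ _ (C * (b - a) + 2 * (C * (b - a)))) => n.
have h1 := ler_distD (z (a + p n)) (z t) l.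
have h2 := lip t (a + p n) abt (ap n); have h3 := hl n.
have h4 : `|t - (a + p n)| <= t - a + p n.
  by rewrite ler_norml; have := p0 n; move: abt; lra.
have h5 : C * `|t - (a + p n)| <= C * (t - a + p n) by exact: ler_wpM2l.
have h6 : 2 * (C * (b - a)) / 2 ^+ n = 2 * (C * p n) by rewrite /p; ring.
have h7 : (C * (b - a) + 2 * (C * (b - a))) / 2 ^+ n = C * p n + 2 * (C * p n).
  by rewrite /p; ring.
rewrite h7; rewrite h6 in h3; rewrite mulrDr in h5; lra.
Qed.

End half_open_intervals.

(** * Correspondence between solutions and the reduced equation *)

Section solutions.
Context {R : realType} {k : scalars}.
Local Notation K := (scalar_field R k).
Context {X Y : completeNormedModType K}.
Variable S : root_data X Y.
Local Notation A := (opA S).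
Local Notation B := (opB S).
Local Notation nu := (idx S).
Local Notation XR := (realify X).
Local Notation YR := (realify Y).
Local Notation J := (@half_line R).
Local Notation top := (top (S := S)).
Local Notation wedge := (wedge (S := S)).
Local Notation level := (level (S := S)).
Local Notation every := (every (S := S)).
Local Notation upper := (upper (S := S)).
Local Notation PR := (PR (S := S)).
Local Notation QR := (QR (S := S)).
Local Notation Pfix := (Pfix (S := S)).
Variables (f : R -> X -> Y) (MY : set Y) (M20 : set X) (M2 Mw : nat -> set X).
Hypothesis hbasis : root_basis S.
Hypotheses (hroot : root_vectors S) (hdual : dual_root_vectors S).
Hypothesis hfcont : {within [set p : R * X | 0 <= p.1 /\ D S p.2],
                 continuous (fun p : R * X => f p.1 p.2)}.
Hypothesis hfstruct : has_structure S f.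
Hypothesis hopen : open_sets S MY M20 M2 Mw.
Hypotheses (h1a : cond1a S f M2) (h1b : cond1b S f M2).
Hypotheses (h1c : cond1c S f M2 Mw) (h1d : cond1d S f M2 Mw).
Hypothesis h2e : cond2e_F20 S f MY M20 M2 Mw.
Variables u w ud wd : nat -> R -> XR.
Hypothesis hc : chain_curves S f M2 Mw u w ud wd.
Local Notation xs := (chain_sum S u w).
Local Notation xd := (chain_sum S ud wd).
Variable Xi : R -> X -> XR.
Hypothesis hXi : forall t x1, J t -> M1 S MY x1 ->
  [/\ M20 (Xi t x1), F20 S f t x1 (Xi t x1) (xs t) (ud 1 t) (wd 1 t) = 0
    & forall x, M20 x -> F20 S f t x1 x (xs t) (ud 1 t) (wd 1 t) = 0 -> x = Xi t x1].
Variable G : YR -> XR.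
Hypotheses (bG : bounded_linear_on setT G)
  (bBG : bounded_linear_on setT (fun y => B (G y) : YR))
  (GD : forall y, D1 S (G y)) (AG : forall y, A (G y) = Q1 S y)
  (GA : forall x, D1 S x -> G (A x) = x).

Local Notation MM := (M S MY M20 M2 Mw).
Local Notation st := (state G xs Xi).
Local Notation v := (field S f G xs Xi).
Let Om : set YR := [set y | MY (Q1 S y)].

Let xsM t : J t -> M2Sig S M2 Mw (xs t). Proof. exact: chain_sum_M2Sig hc _. Qed.
Let xsP t : J t -> Pfix upper (xs t). Proof. exact: (chain_sum_upper hroot hdual hc). Qed.
Let d1P t : J t -> Pfix (top 1) (ud 1 t). Proof. exact: (chain_dtop_in hc). Qed.
Let dw1P t : J t -> Pfix (wedge 1) (wd 1 t). Proof. exact: (chain_dwedge_in hc). Qed.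
Let xs_deriv t : J t -> deriv_on J xs t (xd t). Proof. exact: (chain_sum_deriv hc). Qed.
Let xs_cont t : J t -> cont_on J xs t.
Proof. by move=> Jt; exact: deriv_cont (xs_deriv Jt). Qed.
Let d1_cont t : J t -> cont_on J (ud 1) t. Proof. exact: (chain_dtop_cont hc). Qed.
Let dw1_cont t : J t -> cont_on J (wd 1) t. Proof. exact: (chain_dwedge_cont hc). Qed.

Let v_cont := field_cont hroot hdual hfcont hopen h2e bG bBG GD AG
  xsM xsP d1P dw1P xs_cont d1_cont dw1_cont hXi.
Let st_cont := state_cont hroot hdual hfcont hopen h2e bG GD AG
  xsM xsP d1P dw1P xs_cont d1_cont dw1_cont hXi.
Let st_M t y : J t -> Om y -> MM (st t y).
Proof. exact: (state_M hroot hdual hopen GD AG xsM hXi). Qed.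
Let M_D x : MM x -> D S x. Proof. exact: (M_sub_D hroot hdual hopen). Qed.
Let M1G y : Om y -> M1 S MY (G y). Proof. exact: (M1_G hroot hdual hopen GD AG). Qed.
Let n0 : (0 < nu)%N.
Proof. by have [_ [i <-] _ _] := hroot; have [/(_ i)/andP[]] := hroot. Qed.
Let DG y : D S (G y). Proof. exact: (D1_D hroot hdual). Qed.
Let P1G y : P1 S (G y) = G y.
Proof. by rewrite /P1 P2E // (PR_D1 hroot hdual) // subr0. Qed.
Let bQ1 := Q1_bounded hroot hdual.
Let Q1B y z : Q1 S (y - z) = Q1 S y - Q1 S z.
Proof. exact: (linear_onB (x := y : YR) bQ1.1). Qed.

Let Q1v t y : Q1 S (v t y) = v t y.
Proof.
by rewrite /field Q1B Q1_idem // (Q1_B hroot hdual (D_domB (DG y))) P1G.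
Qed.

Let XiP t y : J t -> Om y -> Pfix (level 0) (Xi t (G y)).
Proof.
move=> Jt Oy; have [H _ _] := hXi Jt (M1G Oy).
by have [_ o20 _ _] := hopen; rewrite D2sE // in o20; exact: (rel_open_sub o20).
Qed.

Let uP t j : J t -> (1 <= j < nu)%N -> Pfix (top j) (u j t).
Proof. by move=> Jt /andP[j1 _]; exact: (chain_top_in hc). Qed.
Let wP t j : J t -> (1 <= j < nu.-1)%N -> Pfix (wedge j) (w j t).
Proof. by move=> Jt /andP[j1 _]; exact: (chain_wedge_in hc). Qed.

Let xdD t : J t -> dom A (xd t).
Proof. by move=> Jt; exact: D_domA (Pfix_D hroot (chain_dsum_upper hroot hdual hc Jt)). Qed.

Lemma P1_state t y : J t -> Om y -> P1 S (st t y) = G y.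
Proof.
move=> Jt Oy; apply: (P1_sum hroot hdual (GD y) (XiP Jt Oy)) => // j hj; [exact: uP | exact: wP].
Qed.

(** By [Y_eq0] it suffices to compare projections: Q_1 gives the definition of the field, level 0
    the equation F_20 = 0, the top and [wedge] parts the equations of the curves u and w. *)
Lemma state_solves t y : J t -> Om y ->
  f t (st t y) - B (st t y) = v t y + A (xd t).
Proof.
move=> Jt Oy; have Dx := M_D (st_M Jt Oy).
have PT := PR_top_sum hroot hdual (GD y) (XiP Jt Oy) (fun j => uP Jt (j := j)) (fun j => wP Jt (j := j)).
have PW := PR_wedge_sum hroot hdual (GD y) (XiP Jt Oy) (fun j => uP Jt (j := j)) (fun j => wP Jt (j := j)).
have PL := PR_level0_sum hroot hdual (GD y) (XiP Jt Oy) (fun j => uP Jt (j := j)) (fun j => wP Jt (j := j)).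
have QRe p : QR p (f t (st t y) - B (st t y) - (v t y + A (xd t))) =
    QR p (f t (st t y)) - B (PR p (st t y)) - QR p (A (xd t)).
  rewrite !QR_sub // QR_add // -(Q1v t y) QR_Q1 // add0r.
  by rewrite (B_PR hroot hdual _ (D_domB Dx)).
apply: subr0_eq; apply: (Y_eq0 hroot hdual).
- have P1xd : P1 S (xd t) = 0.
    have P0 : Pfix (level 0) 0 by case: (Pfix_subspace hdual (level 0)).
    rewrite (_ : xd t = 0 + 0 + xd t); last by rewrite !add0r.
    apply: (P1_sum hroot hdual (D1_0 hroot hdual) P0) => //.
      by move=> j /andP[j1 _]; exact: (chain_dtop_in hc).
    by move=> j /andP[j1 _]; exact: (chain_dwedge_in hc).
  rewrite !Q1B (linear_onD (x := v t y : YR) bQ1.1) // Q1v (Q1_B hroot hdual (D_domB Dx)).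
  rewrite P1_state // (Q1_A hroot hdual hbasis (xdD Jt)) P1xd linop0 addr0.
  by rewrite /field subrr.
- rewrite QRe PL.
  have [_ <- _] := hXi Jt (M1G Oy); rewrite /F20 Q2sE // (QR_level0_A hroot hdual hbasis (xdD Jt)).
  rewrite (PR_level_chain_dsum hroot hdual hc 0 Jt) -(PR_level_chain_dsum hroot hdual hc 0 Jt).
  by rewrite -(QR_level0_A hroot hdual hbasis (xdD Jt)) (Qfix_QR hroot hdual).
- move=> s hs; rewrite QRe (QR_top_A hroot hdual hbasis _ (xdD Jt)) subr0 PT //.
  rewrite (QR_top_f hroot hdual hfstruct hs Jt Dx) -(chain_top_eq hc hs Jt) /F2 Q2topE.
  congr (QR _ (f _ _) - _); apply: eq_sum_nat => j hj; rewrite PT //; lia.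
- move=> s hs; rewrite QRe (QR_wedge_A hroot hdual hbasis _ (xdD Jt)) PW //.
  rewrite (PR_level_chain_dsum hroot hdual hc _ Jt) -(chain_wedge_eq hc hs Jt) /F2Sig Q2SigE //.
  rewrite (QR_wedge_f hroot hdual hfstruct hs Jt Dx).
  congr (QR _ (f _ (_ + _)) - _ - _); apply: eq_sum_nat => j hj; first by rewrite PT.
  by rewrite PW //; lia.
Qed.

(** A annihilates x_20, the one component that is not differentiable; hence A x is as smooth as z
    and the curves u, w. *)
Lemma A_state t y : J t -> Om y -> A (st t y) = Q1 S y + A (xs t).
Proof.
move=> Jt Oy; have dA p x : Pfix p x -> dom A x by move=> /(Pfix_D hroot)/D_domA.
have dG := D_domA (DG y); have dX := dA _ _ (XiP Jt Oy).
rewrite /state linopD; [|exact: domD|exact: dA (xsP Jt)].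
rewrite linopD //.
by rewrite AG -(XiP Jt Oy) (A_PR_level0 hbasis hroot) addr0.
Qed.

(** The field takes values in Y_1, so z - Q_1 z has zero derivative and remains 0. *)
Lemma ode_Q1 (a b : R) (z : R -> YR) : 0 <= a -> Q1 S (z a) = z a -> ode_on Om v a b z ->
  forall t, seg a b t -> Q1 S (z t) = z t.
Proof.
move=> a0 za hz t abt; have /andP[at_ tb] := abt.
have sub : seg a t `<=` seg a b.
  by move=> s /andP[s1 s2]; apply/andP; split => //; exact: le_trans tb.
have bT := bounded_linearB (bounded_linear_id YR) bQ1.
have dz s : seg a t s -> deriv_on (seg a t) (fun s => z s - Q1 S (z s) : YR) s 0.
  move=> hs; have [_ dz] := hz s (sub s hs).
  have := bounded_linear_deriv (V := setT) _ bT hs (fun _ _ => I) I (deriv_on_sub sub dz).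
  by rewrite Q1v subrr; apply; split.
have := deriv0_cst at_ (fun s hs => deriv_cont (dz s hs)).
rewrite za subrr => H; apply/esym/subr0_eq/H => s /andP[s1 s2].
by apply: dz; rewrite /seg /= !ltW.
Qed.

Lemma tdom_half_open (t0 : R) T t : 0 <= t0 -> half_open t0 T t -> t0 < t ->
  tdom (half_open t0 T) t.
Proof. by move=> t00 Jt t0t; split => // _; exact: le_lt_trans t0t. Qed.

Lemma ode_solution (t0 : R) T (z : R -> YR) : 0 <= t0 -> Q1 S (z t0) = z t0 -> (t0%:E < T)%E ->
  (forall b, (b%:E < T)%E -> ode_on Om v t0 b z) ->
  solution S f (half_open t0 T) (fun t => st t (z t)) /\
  forall t, half_open t0 T t -> [/\ Om (z t), Q1 S (z t) = z t & MM (st t (z t))].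
Proof.
move=> t00 z0 t0T hz; have JJ : half_open t0 T `<=` J by move=> t [/(le_trans t00)].
have ab t : half_open t0 T t -> seg t0 t t by case=> h _; rewrite /seg /= h lexx.
have hOm t : half_open t0 T t -> Om (z t).
  by move=> Jt; have [] := hz t Jt.2 t (ab t Jt).
have hQ t : half_open t0 T t -> Q1 S (z t) = z t.
  by move=> Jt; exact: ode_Q1 t00 z0 (hz t Jt.2) t (ab t Jt).
have hM t : half_open t0 T t -> MM (st t (z t)).
  by move=> Jt; apply: st_M; [exact: JJ | exact: hOm].
have dz t : half_open t0 T t -> deriv_on (half_open t0 T) z t (v t (z t)).
  by move=> Jt; apply: deriv_half_open Jt _ => b Jb hb; have [] := hz b Jb.2 t hb.
have cz t : half_open t0 T t -> cont_on (half_open t0 T) z t.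
  by move=> Jt; exact: deriv_cont (dz t Jt).
have dA t : half_open t0 T t ->
    deriv_on (half_open t0 T) (fun t => A (st t (z t)) : YR) t (v t (z t) + (A (xd t) : YR)).
  move=> Jt; apply: (@eq_deriv_on _ _ _ (fun t => z t + (A (xs t) : YR))) => //.
    by move=> s Js; rewrite A_state ?hQ //; [exact: JJ | exact: hOm].
  apply: deriv_onD; first exact: dz.
  apply: (bounded_linear_deriv (Pfix_subspace hdual _) (A_bounded_Pfix hroot hdual upper) Jt).
  - by move=> s /JJ; exact: xsP.
  - exact: (chain_dsum_upper hroot hdual hc (JJ t Jt)).
  - exact: deriv_on_sub JJ (xs_deriv (JJ t Jt)).
split; last by move=> t Jt; split; [exact: hOm | exact: hQ | exact: hM].
have subT : tdom (half_open t0 T) `<=` half_open t0 T by move=> t [].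
split.
- apply/within_contP => t Jt e e0.
  have [d d0 Hd] := st_cont (JJ t Jt) (hOm t Jt) e0.
  have d20 : 0 < d / 2 by rewrite divr_gt0.
  have [r r0 Hr] := cz t Jt _ d20; exists (Num.min d r); first by rewrite lt_min d0.
  move=> s Js; rewrite lt_min => /andP[sd sr]; apply: ltW; apply: Hd => //.
  + exact: JJ.
  + exact: hOm.
  + by apply: le_lt_trans (Hr s Js sr) _; lra.
- by move=> t Jt; exact: M_D (hM t Jt).
- exists (fun t => v t (z t) + (A (xd t) : YR)).
    by move=> t Jt; apply/has_tderivP; apply: deriv_on_sub subT (dA t (subT t Jt)).
  apply/within_contP => t Jt; apply: (cont_on_sub subT).
  have {}Jt := subT t Jt; apply: cont_onD.
    by apply: (field_along_cont v_cont) => //; [exact: hOm | exact: cz].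
  apply: (bounded_linear_cont (Pfix_subspace hdual _) (A_bounded_Pfix hroot hdual upper) Jt).
    by move=> s /JJ; exact: (chain_dsum_upper hroot hdual hc).
  exact: cont_on_sub JJ (chain_dsum_cont hc (JJ t Jt)).
- move=> t Jt; apply/has_tderivP; rewrite state_solves; [|exact/JJ/subT|exact/hOm/subT].
  exact: deriv_on_sub subT (dA t (subT t Jt)).
Qed.

Section uniqueness.
Variables (t0 : R) (T : \bar R) (x01 : X) (y : R -> X).
Hypotheses (t00 : 0 <= t0) (t0T : (t0%:E < T)%E).
Hypothesis hy : ivp_solution S f MM t0 x01 (half_open t0 T) y.
Let zy t : YR := A (P1 S (y t)).
Let JT := half_open t0 T.
(** t0 is left out, since the equation is not guaranteed there when the interval is the whole of
    R_+. *)
Let It : set R := [set t | t0 < t /\ (t%:E < T)%E].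

Let ItJT : It `<=` JT. Proof. by move=> t [/ltW]. Qed.
Let JTJ : JT `<=` J. Proof. by move=> t [/(le_trans t00)]. Qed.
Let ItJ : It `<=` J. Proof. by move=> t /ItJT/JTJ. Qed.

Let Iacc t : It t -> forall r : R, 0 < r -> exists s, [/\ It s, s != t & `|s - t| < r].
Proof.
move=> [t0t tT] r r0; exists (t - Num.min r (t - t0) / 2).
have m0 : 0 < Num.min r (t - t0) by rewrite lt_min r0 subr_gt0.
have m1 : Num.min r (t - t0) <= r by rewrite ge_min lexx.
have m2 : Num.min r (t - t0) <= t - t0 by rewrite ge_min lexx orbT.
split.
- split; first by lra.
  by apply: lt_trans tT; rewrite lte_fin; lra.
- by rewrite lt_eqF //; lra.
- by rewrite addrAC subrr add0r normrN gtr0_norm ?divr_gt0 //; lra.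
Qed.

Let yM t : It t -> MM (y t). Proof. by move=> /ItJT; have [_ H _] := hy; exact: H. Qed.

Let yd t : It t -> deriv_on It (fun s => A (y s) : YR) t (f t (y t) - B (y t)).
Proof.
move=> Itt; have [[_ _ _ H] _ _] := hy.
have sub : It `<=` tdom JT.
  by move=> s Is; apply: tdom_half_open => //; [exact: ItJT | case: Is].
have {}H := H t (sub t Itt).
by apply: deriv_on_sub sub _; exact/has_tderivP/H.
Qed.

Let zyE t : It t -> y t = st t (zy t).
Proof.
exact: (trajectory_state hbasis hroot hdual hopen h1a h1b h1c h1d hc
  hfstruct ItJ Iacc yM yd hXi GA).
Qed.

Let zyOm t : It t -> Om (zy t).
Proof. exact: (trajectory_Om hbasis hroot hdual hopen yM). Qed.

Let zyd t : It t -> deriv_on It zy t (v t (zy t)).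
Proof.
exact: (trajectory_deriv hbasis hroot hdual hopen h1a h1b h1c h1d hc
  hfstruct ItJ Iacc yM yd hXi GA).
Qed.

Let yMJ t : JT t -> MM (y t). Proof. by have [_ H _] := hy; exact: H. Qed.

Let GzyE t : JT t -> G (zy t) = P1 S (y t).
Proof.
move=> Jt; apply: GA; apply: (M1_D1 hroot hdual hopen).
by have [] := M_components hroot hdual hopen (yMJ Jt).
Qed.

Let JT0 : JT t0. Proof. by split. Qed.

Let y_cont t : JT t -> @cont_on R XR JT y t.
Proof. by have [[H _ _ _] _ _] := hy; exact: (within_contP _ _).1. Qed.

Let P1_cont t : JT t -> @cont_on R XR JT (fun s => P1 S (y s)) t.
Proof.
move=> Jt; have bP : @bounded_linear_on R XR XR setT (P1 S).
  apply: (@eq_bounded_linear_on R XR XR setT (fun x => x - PR every x)).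
    by move=> x; rewrite /P1 P2E.
  by apply: bounded_linearB; [exact: bounded_linear_id | exact: (PR_bounded hdual)].
by apply: (bounded_linear_cont (V := setT) _ bP Jt) (y_cont Jt); split.
Qed.

Let zyseg c b : t0 < c -> JT b -> forall t, seg c b t ->
  deriv_on (seg c b) zy t (v t (zy t)).
Proof.
move=> t0c [_ bT] t /andP[ct tb].
have sub : seg c b `<=` It.
  move=> s /andP[cs sb]; split; first exact: lt_le_trans cs.
  by apply: le_lt_trans bT; rewrite lee_fin.
by apply: (deriv_on_sub sub); apply/zyd/sub; rewrite /seg /= ct.
Qed.

(* near t0 only x is known to be continuous; as |zy'| <= C + L |zy|, zy is
   Lipschitz there, and A being injective on D1 identifies its limit *)
Let zy_limit : exists2 b, It b & exists2 C : R, 0 <= C &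
  forall t, t0 < t <= b -> `|zy t - zy t0| <= C * (t - t0).
Proof.
have f_cont := within_cont_nrm hfcont t00 (M_D (yMJ JT0)).
have [d d0 Hd] := f_cont 1 ltr01.
have d20 : 0 < d / 2 by rewrite divr_gt0.
have [r r0 Hr] := y_cont JT0 d20.
have [lB [LB LB0 HB]] := bBG; have [lQ [LQ LQ0 HQ]] := bQ1.
have [b' t0b' [_ b'T]] := half_open_next JT0.
have c0 : 0 < 1 / (2 * (LB + 1)) :> R by rewrite divr_gt0 // mulr_gt0 // ltr_wpDl.
(* On the length q both t and y t stay where f differs from f t0 (y t0) by at most 1, the interval
   is not left, and LB q <= 1/2 as [growth_bound] demands. *)
pose q := Num.min (Num.min (d / 2) (r / 2)) (Num.min (b' - t0) (1 / (2 * (LB + 1)))).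
have q0 : 0 < q by rewrite !lt_min d20 c0 subr_gt0 t0b' divr_gt0.
have [qd qr qb qL] : [/\ q <= d / 2, q <= r / 2, q <= b' - t0 & q <= 1 / (2 * (LB + 1))].
  by have := lexx q; rewrite {2}/q !le_min => /andP[/andP[-> ->] /andP[-> ->]].
clearbody q; pose b := t0 + q; have Jb : It b.
  split; first by rewrite ltrDl.
  by apply: le_lt_trans b'T; rewrite lee_fin /b; lra.
have btE : b - t0 = q by rewrite /b addrAC subrr add0r.
pose Cf := `|(f t0 (y t0) : YR)| + 1.
have Cf0 : 0 <= Cf by rewrite addr_ge0.
have subI t : t0 < t <= b -> It t.
  move=> /andP[t0t tb]; split => //; apply: le_lt_trans Jb.2.
  by rewrite lee_fin.
have fb t : t0 < t <= b -> `|(f t (y t) : YR)| <= Cf.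
  move=> tb; have Itt := subI t tb; case/andP: tb => t0t tb.
  have tq : `|t - t0| <= q by rewrite gtr0_norm ?subr_gt0 // -btE lerD2r.
  have h : `|(f t (y t) : YR) - f t0 (y t0)| <= 1.
    apply: Hd; [exact: ItJ | exact/M_D/yM | lra |].
    apply: (@le_lt_trans _ _ (d / 2)); last by lra.
    by apply: Hr; [exact: ItJT | lra].
  have := ler_normD ((f t (y t) : YR) - f t0 (y t0)) (f t0 (y t0)).
  by rewrite subrK /Cf; lra.
have vb t : t0 < t <= b -> `|v t (zy t)| <= LQ * Cf + LB * `|zy t|.
  move=> tb; rewrite /field -zyE; last exact: subI.
  apply: le_trans (ler_normB _ _) _; apply: lerD; last exact: HB.
  by apply: le_trans (HQ _ I) _; apply: ler_wpM2l => //; exact: fb.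
have LBq : LB * q <= 1 / 2.
  have LB10 : 0 < 2 * (LB + 1) :> R by rewrite mulr_gt0 // ltr_wpDl.
  move: qL; rewrite ler_pdivlMr // => qL.
  have := ltW q0; nra.
pose Mz := 2 * (`|zy b| + LQ * Cf * q).
have Mz0 : 0 <= Mz by rewrite mulr_ge0 // addr_ge0 // !mulr_ge0 // ltW.
have zb t : t0 < t <= b -> `|zy t| <= Mz.
  move=> /andP[t0t tb].
  apply: (@le_trans _ _ (2 * (`|zy b| + LQ * Cf * (b - t)))).
    apply: (growth_bound tb LB0 (w := fun t => v t (zy t))).
    - apply: le_trans LBq; apply: ler_wpM2l => //; rewrite -btE; lra.
    - exact: zyseg (ItJT Jb).
    - move=> s /andP[ts sb]; apply: vb; rewrite sb andbT; exact: lt_le_trans ts.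
    - by rewrite /seg /= lexx.
  rewrite ler_pM2l // lerD2l; apply: ler_wpM2l; first exact: mulr_ge0.
  by rewrite -btE; lra.
pose C := LQ * Cf + LB * Mz.
have C0 : 0 <= C by rewrite addr_ge0 // mulr_ge0.
have lip s t : t0 < s <= b -> t0 < t <= b -> `|zy s - zy t| <= C * `|s - t|.
  wlog st : s t / t <= s.
    move=> W hs ht; have [ts|/ltW st] := leP t s; first exact: W.
    by rewrite distrC (distrC s); exact: W.
  move=> /andP[t0s sb] /andP[t0t tb]; rewrite (ger0_norm (x := s - t)) ?subr_ge0 //.
  apply: (deriv_bound st (g' := fun t => v t (zy t))).
    apply: zyseg => //; apply: ItJT; apply: subI; by rewrite t0s.
  move=> p /andP[tp ps].
  have pb : t0 < p <= b by rewrite (lt_le_trans t0t) // (le_trans ps).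
  apply: le_trans (vb p pb) _; rewrite lerD2l; apply: ler_wpM2l => //; exact: zb.
have [l hl] := lipschitz_limit (@realify_complete R k Y) Jb.1 C0 lip.
(* l is a limit of points of Y_1, the closed set of fixed points of Q_1. *)
have Ql : Q1 S l = l.
  apply: (fixed_closed bQ1) => e e0; pose t := t0 + Num.min q (e / (C + 1)).
  have C10 : 0 < C + 1 by rewrite ltr_wpDl.
  have m0 : 0 < Num.min q (e / (C + 1)) by rewrite lt_min q0 divr_gt0.
  have tb : t0 < t <= b.
    by rewrite /t /b ltrDl m0 lerD2l ge_min lexx.
  exists (zy t).
    rewrite /= /zy (Q1_A hroot hdual hbasis); last first.
      apply: D_domA; apply: (D1_D hroot hdual); apply: (M1_D1 hroot hdual hopen).
      by have [] := M_components hroot hdual hopen (yM (subI t tb)).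
    rewrite -(GzyE (ItJT (subI t tb))); by rewrite P1G.
  rewrite distrC; apply: le_trans (hl t tb) _.
  rewrite /t addrAC subrr add0r.
  have : Num.min q (e / (C + 1)) <= e / (C + 1) by rewrite ge_min lexx orbT.
  rewrite ler_pdivlMr //; move: m0; nra.
(* G is continuous and G (zy t) = P_1 y t tends to P_1 y t0, since y is continuous at t0. *)
have Gl : G l = P1 S (y t0).
  apply/subr0_eq/eqP; rewrite -(normr_le0 (G l - P1 S (y t0) : XR)).
  apply/ler_addgt0Pr => e e0; rewrite add0r.
  have [lG [LG LG0 HG]] := bG.
  have e20 : 0 < e / 2 by rewrite divr_gt0.
  have [p p0 Hp] := P1_cont JT0 e20.
  have D0 : 0 < LG * C + 1 by rewrite ltr_wpDl // mulr_ge0.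
  pose m := Num.min (Num.min q (p / 2)) (e / 2 / (LG * C + 1)).
  have m0 : 0 < m by rewrite !lt_min q0 !divr_gt0.
  have [mq mp me] : [/\ m <= q, m <= p / 2 & m <= e / 2 / (LG * C + 1)].
    by have := lexx m; rewrite {2}/m !le_min => /andP[/andP[-> ->] ->].
  have tb : t0 < t0 + m <= b by rewrite ltrDl m0 lerD2l.
  have h1 : `|(P1 S (y (t0 + m)) : XR) - P1 S (y t0)| <= e / 2.
    apply: Hp; first exact/ItJT/subI.
    by rewrite addrAC subrr add0r gtr0_norm //; lra.
  have h2 : `|G l - (P1 S (y (t0 + m)) : XR)| <= e / 2.
    rewrite -GzyE; last exact/ItJT/subI.
    rewrite -(linear_onB lG) //; apply: le_trans (HG _ I) _.
    apply: (@le_trans _ _ (LG * (C * m))).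
      apply: ler_wpM2l => //; rewrite distrC; apply: le_trans (hl _ tb) _.
      by rewrite addrAC subrr add0r.
    by move: me; rewrite ler_pdivlMr // mulrA; nra.
  have := ler_distD (P1 S (y (t0 + m)) : XR) (G l) (P1 S (y t0)); lra.
exists b => //; exists C => // t tb.
(* zy t0 = A P_1 y t0 = A G l = Q_1 l = l. *)
by have -> : zy t0 = l; [rewrite /zy -Gl AG | exact: hl].
Qed.

(** To the right of t0 the reduced equation follows from the trajectory lemmas; at t0 continuity
    comes from [zy_limit], and [closing] supplies the derivative. *)
Lemma solution_ode b : JT b -> ode_on Om v t0 b zy.
Proof.
move=> Jb; have [b0 Ib0 [C C0 HC]] := zy_limit.
have t0b : t0 <= b by case: Jb.
have segJ : seg t0 b `<=` J by move=> s /andP[/(le_trans t00)].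
have segI s : seg t0 b s -> t0 < s -> It s.
  by move=> /andP[_ sb] t0s; split => //; apply: le_lt_trans Jb.2; rewrite lee_fin.
have Om0 : Om (zy t0).
  have [M1y _ _ _] := M_components hroot hdual hopen (yMJ JT0).
  have D1y := M1_D1 hroot hdual hopen M1y.
  have MYs : MY `<=` Y1 S by have [[U _ ->] _ _ _] := hopen => z [].
  have [_ MYy] := (M1P hroot hdual _ MYs).1 M1y.
  rewrite /Om /= /zy (Q1_A hroot hdual hbasis); last exact: D_domA (D1_D hroot hdual D1y).
  by rewrite -(GzyE JT0) P1G GzyE.
have OmZ s : seg t0 b s -> Om (zy s).
  move=> hs; have [s0|s0] := eqVneq s t0; first by rewrite s0.
  by apply/zyOm/segI => //; rewrite lt_neqAle eq_sym s0; case/andP: hs.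
have inner s : seg t0 b s -> t0 < s -> deriv_on (seg t0 b) zy s (v s (zy s)).
  move=> hs t0s; have Is := segI s hs t0s.
  apply: (@deriv_on_local _ _ _ _ _ _ (s - t0)); first by rewrite subr_gt0.
  apply: deriv_on_sub (zyd Is) => s' [hs' /=]; rewrite ltr_norml => /andP[h _].
  by apply: segI => //; lra.
have zc s : seg t0 b s -> cont_on (seg t0 b) zy s.
  move=> hs; have [s0|s0] := eqVneq s t0; last first.
    by apply: deriv_cont (inner s hs _); rewrite lt_neqAle eq_sym s0; case/andP: hs.
  rewrite s0 => e e0; have C10 : 0 < C + 1 by rewrite ltr_wpDl.
  exists (Num.min (b0 - t0) (e / (C + 1))).
    by rewrite lt_min subr_gt0 Ib0.1 divr_gt0.
  move=> s' /andP[]; rewrite le_eqVlt => /orP[/eqP<- _ _|t0s' _]; first by rewrite subrr normr0 ltW.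
  rewrite gtr0_norm ?subr_gt0 // lt_min ltr_pdivlMr // => /andP[h1 h2].
  apply: le_trans (HC s' _) _; first by rewrite t0s' /=; lra.
  by have : 0 < s' - t0 by [rewrite subr_gt0|]; nra.
move=> t ht; split; first exact: OmZ.
apply: (closing (w := fun s => v s (zy s)) (@realify_complete R k Y) t0b zc) ht.
  move=> s hs; apply: (field_along_cont v_cont) => //; [exact: OmZ | exact: zc].
by move=> s /andP[t0s sb]; apply: inner => //; rewrite /seg /= !ltW.
Qed.

Lemma solution_state t : It t -> y t = st t (zy t).
Proof. exact: zyE. Qed.

End uniqueness.
End solutions.

(** The maps y -> [state t y] and x -> A P_1 x exchange solutions of the reduced equation and
    solutions with values in M; existence, uniqueness and maximality are carried across. *)
Theorem theorem4p7 (R : realType) (k : scalars)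
    (X Y : completeNormedModType (scalar_field R k)) (S : root_data X Y)
    (* standing assumptions on A and B *)
    (hAclosed : closed_op (opA S)) (hBclosed : closed_op (opB S))
    (hAdense : dense (dom (opA S))) (hBdense : dense (dom (opB S)))
    (hArange : closed [set opA S x | x in dom (opA S)])
    (hD : exists2 x, D S x & x <> 0)
    (hAB : dom (opA S) `<=` dom (opB S))
    (hnu : (0 < idx S)%N)
    (hpencil : regular_pencil (D S) (opA S) (opB S) (idx S))
    (* the fixed systems of root vectors; n = kdim S = dim ker A *)
    (hbasis : root_basis S) (hroot : root_vectors S)
    (hdual : dual_root_vectors S)
    (f : R -> X -> Y)
    (hfcont : {within [set p : R * X | 0 <= p.1 /\ D S p.2],
                 continuous (fun p : R * X => f p.1 p.2)})
    (hfstruct : has_structure S f)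
    (MY : set Y) (M20 : set X) (M2 Mw : nat -> set X)
    (hopen : open_sets S MY M20 M2 Mw)
    (hsmooth : smoothness S f M2 Mw)
    (h1a : cond1a S f M2) (h1b : cond1b S f M2) (h1c : cond1c S f M2 Mw)
    (h1d : cond1d S f M2 Mw) (h1e : cond1e S f MY M20 M2 Mw)
    (h2a : cond2a S f M2) (h2b : cond2b S f M2) (h2c : cond2c S f M2 Mw)
    (h2d : cond2d S f M2 Mw)
    (h2e_lip : cond2e_lipschitz S f MY M20 M2 Mw)
    (h2e : cond2e_F20 S f MY M20 M2 Mw) :
  forall (t0 : R) (x01 : X), 0 <= t0 -> M1 S MY x01 ->
  exists2 tmax : \bar R, (t0%:E < tmax)%E &
  exists x : R -> X,
  [/\ maximal_solution S f (M S MY M20 M2 Mw) (half_open t0 tmax) x,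
      P1 S (x t0) = x01
    & forall (t1 : \bar R) (y : R -> X), (t0%:E < t1)%E ->
        ivp_solution S f (M S MY M20 M2 Mw) t0 x01 (half_open t0 t1) y ->
        forall t, half_open t0 t1 t -> half_open t0 tmax t -> y t = x t].
Proof.
move=> t0 x01 t00 M1x01.
have [u [w [ud [wd hc]]]] := chain_curves_exist hbasis hroot hdual hopen h1a h1b h1c h1d
  hsmooth h2a h2b h2c h2d.
have [G [bG bBG GD AG GA]] := A_inverse_exists hAclosed hBclosed hArange hAB hpencil
  hbasis hroot hdual.
have xsM t : half_line t -> M2Sig S M2 Mw (chain_sum S u w t).
  exact: (chain_sum_M2Sig hc).
have xsP := chain_sum_upper hroot hdual hc.
have d1P t : half_line t -> Pfix (top (S := S) 1) (ud 1 t) by exact: (chain_dtop_in hc).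
have dw1P t : half_line t -> Pfix (wedge (S := S) 1) (wd 1 t) by exact: (chain_dwedge_in hc).
have [Xi hXi] := x20_exists hroot hdual h1e xsM d1P dw1P.
have xs_cont t : half_line t -> cont_on half_line (chain_sum S u w) t.
  by move=> Jt; exact: deriv_cont (chain_sum_deriv hc Jt).
have d1_cont t : half_line t -> cont_on half_line (ud 1) t by exact: (chain_dtop_cont hc).
have dw1_cont t : half_line t -> cont_on half_line (wd 1) t by exact: (chain_dwedge_cont hc).
have v_cont := field_cont hroot hdual hfcont hopen h2e bG bBG GD AG
  xsM xsP d1P dw1P xs_cont d1_cont dw1_cont hXi.
have v_lip := field_lip hroot hdual hfcont hopen h2e_lip h2e bG bBG GD AG
  xsM xsP d1P dw1P xs_cont d1_cont dw1_cont hXi.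
have MYs : MY `<=` Y1 S by have [[U _ ->] _ _ _] := hopen => z [].
have [D1x01 MYx01] := (M1P hroot hdual x01 MYs).1 M1x01.
have P1D1 x : D1 S x -> P1 S x = x.
  by move=> D1x; rewrite /P1 P2E // (PR_D1 hroot hdual) // subr0.
have Q1x01 : Q1 S (opA S x01) = opA S x01.
  by rewrite (Q1_A hroot hdual hbasis (D_domA (D1_D hroot hdual D1x01))) P1D1.
have Om0 : [set y : realify Y | MY (Q1 S y)] (opA S x01) by rewrite /= Q1x01.
have [T t0T [z [z0 hz zmax]]] := ode_maximal (@realify_complete R k Y) v_lip v_cont t00 Om0.
have Qz0 : Q1 S (z t0) = z t0 by rewrite z0.
have [sol solP] := ode_solution hbasis hroot hdual hfcont hfstruct hopen h2e
  hc hXi bG bBG GD AG t00 Qz0 t0T hz.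
set x := fun t => state G (chain_sum S u w) Xi t (z t) in sol.
have x_P1 : P1 S (x t0) = x01.
  have [Oz _ _] := solP t0 (conj (lexx _) t0T).
  by rewrite (P1_state hroot hdual hopen hc hXi GD AG t00 Oz) z0 GA.
exists T => //; exists x; split => //; last first.
  move=> t1 y t0t1 hy.
  have agree t : t0 < t -> half_open t0 t1 t -> half_open t0 T t -> y t = x t.
    move=> t0t Jt1 JT.
    have oy := solution_ode hbasis hroot hdual hfcont hfstruct hopen h1a h1b h1c h1d
      h2e hc hXi bG bBG GD AG GA t00 t0t1 hy Jt1.
    have [_ _ yP] := hy.
    have zE : opA S (P1 S (y t)) = z t.
      apply: (ode_unique v_lip t00 oy (hz t JT.2)); first by rewrite yP z0.
      by rewrite /seg /= lexx andbT ltW.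
    rewrite (solution_state hbasis hroot hdual hfstruct hopen h1a h1b h1c h1d hc hXi GA t00 hy).
      by rewrite zE.
    by split => //; exact: Jt1.2.
  (* The representation of y by [state] holds only after t0; at t0 the two curves agree as limits
     from the right. *)
  move=> t Jt1 JT; have [t0t|] := ltP t0 t; first exact: agree.
  move=> tt0; have {tt0} -> : t = t0 by apply/eqP; rewrite eq_le tt0 Jt1.1.
  have J1 : half_open t0 t1 t0 by split.
  have J2 : half_open t0 T t0 by split.
  have [[yc _ _ _] _ _] := hy; have [xc _ _ _] := sol.
  have yc0 := (within_contP _ _).1 yc t0 J1; have xc0 := (within_contP _ _).1 xc t0 J2.
  apply/subr0_eq/eqP; rewrite -(normr_le0 (y t0 - x t0 : realify X)).
  apply/ler_addgt0Pr => e e0; rewrite add0r; have e20 : 0 < e / 2 by rewrite divr_gt0.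
  have [r r0 Hr] := yc0 _ e20; have [q q0 Hq] := xc0 _ e20.
  have [b1 b10 [_ b1T]] := half_open_next J1; have [b2 b20 [_ b2T]] := half_open_next J2.
  pose m := Num.min (Num.min (r / 2) (q / 2)) (Num.min (b1 - t0) (b2 - t0)).
  have m0 : 0 < m by rewrite !lt_min !subr_gt0 b10 b20 !divr_gt0.
  have [mr mq mb1 mb2] : [/\ m <= r / 2, m <= q / 2, m <= b1 - t0 & m <= b2 - t0].
    by have := lexx m; rewrite {2}/m !le_min => /andP[/andP[-> ->] /andP[-> ->]].
  have J1m : half_open t0 t1 (t0 + m).
    by split; [lra | apply: le_lt_trans b1T; rewrite lee_fin; lra].
  have J2m : half_open t0 T (t0 + m).
    by split; [lra | apply: le_lt_trans b2T; rewrite lee_fin; lra].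
  have nm : `|t0 + m - t0| = m by rewrite addrAC subrr add0r gtr0_norm.
  have := Hr _ J1m; rewrite nm => /(_ ltac:(lra)) h1.
  have := Hq _ J2m; rewrite nm => /(_ ltac:(lra)) h2.
  have tri := ler_distD (x (t0 + m) : realify X) (y t0) (x t0).
  rewrite (distrC (y t0 : realify X) (x (t0 + m))) in tri.
  rewrite agree // in h1; last by rewrite ltrDl.
  lra.
split => //; first by move=> t /solP[].
move=> [J' [y [[iJ' J'0] [JJ' nJJ'] J'bd [ysol yM] yx]]].
(* A proper extension has a time t outside the half-open interval; hence T is a finite b <= t, and b
   belongs to the interval J'. *)
have [t J't nJt] : exists2 t, J' t & ~ half_open t0 T t.
  by apply: contrapT => h; apply: nJJ' => t J't; apply: contrapT => nJt; apply: h; exists t.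
have [s [t0s _] st] := J'bd t J't; have t0t := le_trans t0s st.
have [b TE] : exists b : R, T = b%:E.
  case: {+}T t0T nJt => [b| |] //; first by exists b.
  by move=> _ h; exfalso; apply: h; split => //; exact: ltry.
subst T; move: t0T; rewrite lte_fin => t0b.
have bt : b <= t by rewrite leNgt; apply/negP => h; apply: nJt; split.
have J'b : J' b by apply: (iJ' t0 t) => //; [apply: JJ'; split => //; rewrite ?lexx ?lte_fin | rewrite ltW].
have tdomJ' s' : J' s' -> t0 < s' -> tdom J' s'.
  by move=> h1 h2; split => // _; exact: le_lt_trans h2.
(* A y is differentiable at b, so Q_1 A y is continuous there. Before b it equals z, which thus has
   a limit in the domain of the field, contrary to [zmax]. *)
have [ycont yD [g' hg' _] _] := ysol.
have Acont : @cont_on R (realify Y) (tdom J') (fun t => opA S (y t)) b.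
  by apply: deriv_cont; apply/has_tderivP; exact: (hg' b (tdomJ' b J'b t0b)).
have bQ1 := Q1_bounded hroot hdual.
have Qcont : @cont_on R (realify Y) (tdom J') (fun t => Q1 S (opA S (y t))) b.
  apply: (bounded_linear_cont (V := setT) _ bQ1 _ _ Acont) => //; exact: tdomJ'.
apply: (zmax b erefl); exists (Q1 S (opA S (y b)) : realify Y).
  rewrite /= (Q1_idem hroot hdual) (Q1_A hroot hdual hbasis (D_domA (yD b J'b))).
  have [M1y _ _ _] := M_components hroot hdual hopen (yM b J'b).
  by have [] := (M1P hroot hdual _ MYs).1 M1y.
move=> e e0; have [r r0 Hr] := Qcont e e0; exists (Num.min r (b - t0)).
  by rewrite lt_min r0 subr_gt0.
move=> t' /andP[t0t' t'b]; rewrite lt_min => /andP[h1 h2].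
have JT' : half_open t0 b%:E t' by split => //; rewrite lte_fin.
have [Oz Qz _] := solP t' JT'.
have <- : Q1 S (opA S (y t')) = z t'.
  rewrite (Q1_A hroot hdual hbasis (D_domA (yD t' (JJ' t' JT')))) yx //.
  by rewrite (P1_state hroot hdual hopen hc hXi GD AG _ Oz) ?AG //; exact: le_trans t0t'.
apply: Hr; first by apply: tdomJ'; [exact: JJ' | lra].
by rewrite distrC gtr0_norm ?subr_gt0.
Qed.
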